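(* Let $\{Z_n\}$ be a critical Galton--Watson process with immigration satisfying condition (A) (as described in the context), with $\sigma=\beta/\gamma>1$. Let $\{X_i\}_{i\ge1}$ be i.i.d. real random variables, independent of $\{Z_n\}$, with $\mathbb{E}X_1=0$ and $\sigma_0^2:=\mathbb{E}X_1^2\in(0,\infty)$. Let $S_k=\sum_{i=1}^kX_i$ and $L_n=\frac{S_{Z_n}}{Z_n}I_{\{Z_n>0\}}$. Let $\{\varepsilon_n\}$ be a sequence of positive numbers with $\varepsilon_n\to0$ and $n\varepsilon_n^2\to\infty$. When $X_1^+$ has a tail of index $\alpha$, put $\rho=\frac{1+\sigma-\alpha}{2\sigma-\alpha}$. Let $$\Upsilon(\sigma,\sigma_0)=\frac{2^{\sigma-1}\Gamma(\sigma+\frac12)}{\Gamma(\sigma)\gamma^{\sigma}\sigma\sqrt{\pi}}\,\sigma_0^{2\sigma}.$$ (a) If $\mathbb{E}(X_1^+)^{1+\sigma}<\infty$, or if $X_1^+$ has a tail of index $\alpha\in(2,1+\sigma)$ and $\varepsilon_nn^{\rho}\to0$ as $n\to\infty$, then $$\lim_{n\to\infty}\varepsilon_n^{2\sigma}n^{\sigma}\,\mathbb{P}(L_n\ge\varepsilon_n)=\Upsilon(\sigma,\sigma_0).$$ (b) If $X_1^+$ has a tail of index $\alpha\in(2,1+\sigma)$ and $\varepsilon_nn^{\rho}\to\infty$ as $n\to\infty$, then $$\lim_{n\to\infty}\varepsilon_n^{\alpha}n^{\alpha-1}\,\mathbb{P}(L_n\ge\varepsilon_n)=a\,I(\alpha-1,\sigma).$$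 (c) If $X_1^+$ has a tail of index $\alpha\in(2,1+\sigma)$ and $\varepsilon_nn^{\rho}\to\tau\in(0,\infty)$ as $n\to\infty$, then $$\lim_{n\to\infty}n^{\frac{\sigma(\alpha-2)}{2\sigma-\alpha}}\,\mathbb{P}(L_n\ge\varepsilon_n)=\tau^{-2\sigma}\Upsilon(\sigma,\sigma_0)+\tau^{-\alpha}a\,I(\alpha-1,\sigma).$$
   Context: Galton--Watson process with immigration: $\{\xi_{ni}: n,i\ge1\}$ are i.i.d. non-negative integer-valued random variables with generating function $f(s)=\sum_{i\ge0}p_is^i$; $\{Y_n:n\ge1\}$ are i.i.d. non-negative integer-valued random variables with generating function $h(s)=\sum_{i\ge0}h_is^i$, independent of $\{\xi_{ni}\}$. Define $Z_0=0$ and $Z_n=\sum_{i=1}^{Z_{n-1}}\xi_{ni}+Y_n$ for $n\ge1$. Let $m=\mathbb{E}\xi_{11}$, $\beta=h'(1)$, $\gamma=\frac12 f''(1)$, $\sigma=\beta/\gamma$. Condition (A): $\gcd\{k:p_k>0\}=1$, $0<p_0<1$, $0<h_0<1$, $m=1$, $0<\beta<\infty$, $0<\gamma<\infty$, $\sum_{j\ge1}p_jj^2\log j<\infty$, $\sum_{j\ge1}h_jj^2<\infty$. Tail index: $X_1^+=X_1\vee0$ has a tail of index $\alpha$ if $\mathbb{P}(X_1^+\ge x)\sim ax^{-\alpha}$ as $x\to\infty$ for some constant $a>0$; this is the constant $a$ in the claim. For $0<r<\sigma$: $I(r,\sigma)=\frac{1}{\Gamma(r)}\int_0^\infty(1+\gamma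 s)^{-\sigma}s^{r-1}\,ds$. $\Gamma$ is the Gamma function. *)

(* Defs.v *)
(* MathComp-Analysis *)
From HB Require Import structures.
From mathcomp Require Import all_boot all_order all_algebra.
From mathcomp Require Import finmap.
From mathcomp Require Import all_classical all_reals all_analysis.
Set Implicit Arguments.
Unset Strict Implicit.
Unset Printing Implicit Defensive.
Import Order.TTheory GRing.Theory Num.Theory.
Import numFieldNormedType.Exports.
Local Open Scope classical_set_scope.
Local Open Scope ring_scope.

Section independence.
Context d (Omega : measurableType d) (R : realType) (P : probability Omega R).

Definition mutually_independent (I : choiceType) d' (T : measurableType d')
    (X : I -> Omega -> T) : Prop :=
  forall (J : {fset I}) (B : I -> set T),
    (forall i, i \in J -> measurable (B i)) ->
    P (\bigcap_(i in [set` J]) (X i @^-1` B i)) =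
    (\prod_(i <- J) P (X i @^-1` B i))%E.

Definition iid (I : choiceType) d' (T : measurableType d')
    (X : I -> Omega -> T) : Prop :=
  mutually_independent X /\
  forall i j (B : set T), measurable B -> P (X i @^-1` B) = P (X j @^-1` B).

Definition sigma_of_family (I : Type) d' (T : measurableType d')
    (X : I -> Omega -> T) : set (set Omega) :=
  <<s \bigcup_i preimage_set_system [set: Omega] (X i) measurable >>.

Definition independent_families (I1 I2 : Type) d1 (T1 : measurableType d1)
    d2 (T2 : measurableType d2) (X : I1 -> Omega -> T1) (Y : I2 -> Omega -> T2)
    : Prop :=
  forall A B, sigma_of_family X A -> sigma_of_family Y B ->
    P (A `&` B) = (P A * P B)%E.

End independence.

Section generating_functions.
Context (R : realType).

Definition nat_pmf d (Omega : measurableType d) (P : probability Omega R)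
    (N : Omega -> nat) (k : nat) : R := fine (P (N @^-1` [set k])).

Definition gen_fun (p : nat -> R) (s : R) : R :=
  limn (series (fun i => p i * s ^+ i)).

(* The radius of convergence may be 1, so derivatives at 1 are limits from the
   left; these exist in [0, +oo] when p is nonnegative and summable. *)
Definition gen_fun_derive_at1 (n : nat) (p : nat -> R) : \bar R :=
  lim ((derive1n n (gen_fun p) s)%:E @[s --> 1^'-]).

End generating_functions.

Definition is_gcd_of (A : set nat) (g : nat) : Prop :=
  (forall k, A k -> (g %| k)%N) /\
  (forall e : nat, (forall k, A k -> (e %| k)%N) -> (e %| g)%N).

Section galton_watson.
Context (Omega : Type).

(* xi n i and Y n stand for $\xi_{n+1,i+1}$ and $Y_{n+1}$; Z itself is not
   shifted: GWI xi Y n is $Z_n$. *)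
Fixpoint GWI (xi : nat -> nat -> Omega -> nat) (Y : nat -> Omega -> nat)
    (n : nat) (w : Omega) : nat :=
  if n is n'.+1 then (\sum_(i < GWI xi Y n' w) xi n' i w + Y n' w)%N else 0%N.

(* X i stands for $X_{i+1}$, so S_k sums X 0, ..., X (k-1) *)
Definition partial_sum (R : realType) (X : nat -> Omega -> R) (k : nat)
    (w : Omega) : R := \sum_(i < k) X i w.

Definition sample_mean (R : realType) (X : nat -> Omega -> R)
    (Z : nat -> Omega -> nat) (n : nat) (w : Omega) : R :=
  partial_sum X (Z n w) w / (Z n w)%:R * (0 < Z n w)%N%:R.

End galton_watson.

Section condition_A.
Context d (Omega : measurableType d) (R : realType) (P : probability Omega R).

Definition offspring_immigration (xi : nat -> nat -> {RV P >-> nat})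
    (Y : nat -> {RV P >-> nat}) : Prop :=
  [/\ iid P (fun ni : nat * nat => xi ni.1 ni.2 : Omega -> nat),
      iid P (fun n => Y n : Omega -> nat) &
      independent_families P (fun ni : nat * nat => xi ni.1 ni.2 : Omega -> nat)
        (fun n => Y n : Omega -> nat)].

(* offspring variable xi and immigration variable Y; half of $f''(1)$ is
   finite and positive iff $f''(1)$ is *)
Definition condition_A (xi Y : {RV P >-> nat}) : Prop :=
  let p := nat_pmf P xi in
  let h := nat_pmf P Y in
  [/\ is_gcd_of [set k | 0 < p k] 1, 0 < p 0%N < 1 & 0 < h 0%N < 1] /\
  [/\ ('E_P[fun w => ((xi w)%:R)%R] = 1)%E,
      (0 < gen_fun_derive_at1 1 h < +oo)%E,
      (0 < (2^-1)%:E * gen_fun_derive_at1 2 p < +oo)%E,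
      (\sum_(1 <= j <oo) (p j * j%:R ^+ 2 * ln j%:R)%:E < +oo)%E &
      (\sum_(1 <= j <oo) (h j * j%:R ^+ 2)%:E < +oo)%E].

End condition_A.

Section constants.
Context (R : realType).

Definition Gamma (x : R) : R :=
  \int[lebesgue_measure]_(t in `]0, +oo[) (t `^ (x - 1) * expR (- t)).

Definition I_const (gamma r sigma : R) : R :=
  (Gamma r)^-1 *
  \int[lebesgue_measure]_(s in `]0, +oo[)
     ((1 + gamma * s) `^ (- sigma) * s `^ (r - 1)).

Definition Upsilon (gamma sigma sigma0 : R) : R :=
  2 `^ (sigma - 1) * Gamma (sigma + 2^-1) /
  (Gamma sigma * gamma `^ sigma * sigma * Num.sqrt pi) *
  sigma0 `^ (2 * sigma).

End constants.

Definition has_tail d (Omega : measurableType d) (R : realType)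
    (P : probability Omega R) (X : Omega -> R) (alpha a : R) : Prop :=
  0 < a /\
  fine (P [set w | x <= X w]) / (a * x `^ (- alpha)) @[x --> +oo] --> (1 : R).

(* Main.v *)
(** Condition on [Z_n].  The generating function of [Z_n] is the product of the
    immigration generating function along the iterates of the survival map
    [F u = 1 - f (1 - u)].  Since [1 / F u - 1 / u -> gamma] and [ln (h (1 - u))] is
    [- sigma * ln (u / F u)] up to a telescoping error, which is summable exactly
    because [sum_j p_j j^2 log j] is finite, the Laplace transform of [Z_n] at [t] is
    equivalent to [(1 + gamma n t)^(- sigma)] and bounded by a multiple of it.

    Values of [Z_n] of order [eps_n^(-2)] contribute through the central limit
    theorem.  The Gaussian tail at [x] is a mixture over [z] of the exponentials
    [exp (- x^2 (1 + z^2) / 2)], so its average over [Z_n] is an integral of Laplace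
    transforms, and this produces [Upsilon].  Values of [Z_n] of order [n] contribute
    through one large [X_i]: there [P (S_k >= eps k)] is close to
    [k P (X_1 >= eps k)], whose average is a multiple of the harmonic moment
    [E Z_n^(1 - alpha)], again a mixture of Laplace transforms.  The two contributions
    have the orders [(n eps^2)^(- sigma)] and [eps^(- alpha) n^(1 - alpha)], and their
    ratio is a power of [eps_n n^rho]; this separates the three regimes. *)

Require Import Defs.
From HB Require Import structures.
From mathcomp Require Import all_boot all_order all_algebra.
From mathcomp Require Import finmap.
From mathcomp Require Import all_classical all_reals all_analysis.
From mathcomp Require Import measurable_realfun.
From mathcomp Require Import zify ring lra.
Set Implicit Arguments.
Unset Strict Implicit.
Unset Printing Implicit Defensive.
Import Order.TTheory GRing.Theory Num.Theory.
Import numFieldNormedType.Exports.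
Local Open Scope classical_set_scope.
Local Open Scope ring_scope.

(** * Independence of blocks of variables *)

(** The central limit theorem gives only an absolute error, while the averages to be computed tend
    to 0. The range of cluster sizes is therefore cut at k = K / eps^2. Below the cut an absolute
    error eta costs eta P (0 < Z_n <= K / eps^2), which has the right order because P (0 < Z_n <= m)
    is at most C (m / n)^sigma. Above the cut the estimates are pointwise in k, with an error C (k
    eps^2)^(- (sigma + 2)): the exponent leaves one spare power, which makes its average O(1 / K)
    times (n eps^2)^(- sigma). [K] is fixed before n tends to infinity, and with a power tail the
    final error is kept relative to the sum of the two orders of magnitude, so that one estimate
    serves all three regimes. The event Z_n = 0 is removed from the Laplace transforms: its mass
    does not decay as t tends to infinity, whereas the mixtures need a bound for all t > 0. Only two
    moments of X are available for the central limit theorem; hence Lindeberg replacement with a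
    logistic test function, whose Taylor remainder is at most a multiple of y^2 min (1, |y|). *)

Lemma g_sigma_sub_dynkin (T : Type) (G D : set (set T)) :
  setI_closed G -> dynkin D -> G `<=` D -> <<s G >> `<=` D.
Proof.
move=> GI dD GD; rewrite -(setI_closed_g_dynkin_g_sigma_algebra GI).
exact: smallest_sub.
Qed.

Section sigma_independence.
Context d (Omega : measurableType d) (R : realType) (P : probability Omega R).
Local Open Scope ereal_scope.

Lemma dynkin_indep (B : set Omega) : measurable B ->
  dynkin [set A | measurable A /\ P (A `&` B) = P A * P B].
Proof.
move=> mB; split.
- by split => //=; rewrite setTI probability_setT mul1e.
- move=> A [mA AB]; split; first exact: measurableC.
  have : P (~` A `&` B) = P B - P (A `&` B).
    by rewrite setIC -setDE measureD// 1?setIC// -ge0_fin_numE// fin_num_measure.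
  move=> ->; rewrite AB probability_setC//.
  rewrite muleBl ?fin_num_measure// ?mul1e//.
- move=> F tF F_; split; first by apply: bigcupT_measurable => k; case: (F_ k).
  have mF k : measurable (F k) by case: (F_ k).
  rewrite setI_bigcupl !measure_bigcup//=; last 2 first.
  + by move=> k _; exact: measurableI.
  + exact: trivIset_setIr.
  rewrite muleC -(@fineK _ (P B)) ?fin_num_measure// -nneseriesZl//.
  apply: eq_eseriesr => k _; case: (F_ k) => _ ->.
  by rewrite fineK ?fin_num_measure// muleC.
Qed.

(** The pi-lambda argument is used twice: with A fixed in [G1] the formula extends to the whole
    second sigma-algebra, then with B fixed there it extends in the first factor. *)
Lemma g_sigma_indep (G1 G2 : set (set Omega)) :
  setI_closed G1 -> setI_closed G2 ->
  G1 `<=` measurable -> G2 `<=` measurable ->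
  (forall A B, G1 A -> G2 B -> P (A `&` B) = P A * P B) ->
  forall A B, <<s G1 >> A -> <<s G2 >> B -> P (A `&` B) = P A * P B.
Proof.
move=> I1 I2 m1 m2 G12.
have H A : G1 A -> <<s G2 >> `<=` [set B | measurable B /\ P (B `&` A) = P B * P A].
  move=> GA; apply: g_sigma_sub_dynkin => //; first exact/dynkin_indep/m1.
  by move=> B GB; split; [exact: m2|rewrite setIC G12// muleC].
move=> A B sA sB.
have mB : measurable B.
  have : <<s G2 >> `<=` (@measurable _ Omega).
    by apply: smallest_sub => //; exact: sigma_algebra_measurable.
  exact.
suff /(_ _ sA)[] : <<s G1 >> `<=` [set A | measurable A /\ P (A `&` B) = P A * P B] by [].
apply: g_sigma_sub_dynkin => //; first exact: dynkin_indep.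
move=> C GC; split; first exact: m1.
by have [_] := H _ GC _ sB; rewrite setIC muleC.
Qed.

End sigma_independence.

Section block_independence.
Context d (Omega : measurableType d) (R : realType) (P : probability Omega R).
Context (I : choiceType) d' (T : measurableType d').

Definition sigma_block (X : I -> Omega -> T) (J : set I) : set (set Omega) :=
  \bigcup_(i in J) preimage_set_system [set: Omega] (X i) measurable.

(** Finite-dimensional cylinders: unlike the generators of [sigma_block], they are stable under
    intersection. *)
Definition cylinders (X : I -> Omega -> T) (J : set I) : set (set Omega) :=
  [set A | exists (F : {fset I}) (B : I -> set T),
     [/\ [set` F] `<=` J, (forall i, measurable (B i)) &
         A = \bigcap_(i in [set` F]) (X i @^-1` B i)]].

Lemma setI_closed_cylinders X J : setI_closed (cylinders X J).
Proof.
move=> _ _ [F [B [FJ mB ->]]] [F' [B' [FJ' mB' ->]]].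
exists (F `|` F')%fset.
exists (fun i => (if i \in F then B i else setT) `&` (if i \in F' then B' i else setT)).
split.
- by move=> i /=; rewrite inE => /orP[/FJ|/FJ'].
- by move=> i; apply: measurableI; case: ifP.
- apply/seteqP; split => w /=.
    move=> [H1 H2] i /= iFF; split.
      by case: ifPn => // iF; exact: H1.
    by case: ifPn => // iF; exact: H2.
  move=> H; split => i /= iF.
    by have := H i; rewrite /= inE iF/= => /(_ isT)[].
  by have := H i; rewrite /= inE iF/= orbT => /(_ isT)[].
Qed.

Lemma g_sigma_block_cylinders X J : <<s sigma_block X J >> `<=` <<s cylinders X J >>.
Proof.
apply: sub_sigma_algebra2 => _ [i Ji [B mB <-]].
exists [fset i]%fset, (fun=> B); split => //.
- by move=> j /=; rewrite inE => /eqP ->.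
- by rewrite setTI set_fset1 bigcap_set1.
Qed.

Lemma g_sigma_block_sub X (J K : set I) : J `<=` K ->
  <<s sigma_block X J >> `<=` <<s sigma_block X K >>.
Proof. by move=> JK; apply: sub_sigma_algebra2 => A [i Ji XA]; exists i => //; exact: JK. Qed.

Lemma cylinders_measurable X J : (forall i, measurable_fun setT (X i)) ->
  cylinders X J `<=` measurable.
Proof.
move=> mX _ [F [B [FJ mB ->]]].
apply: fin_bigcap_measurable => // i _.
by rewrite -[X in measurable X]setTI; exact: mX.
Qed.

Lemma g_sigma_block_measurable X J : (forall i, measurable_fun setT (X i)) ->
  <<s sigma_block X J >> `<=` measurable.
Proof.
move=> mX; apply: smallest_sub; first exact: sigma_algebra_measurable.
by move=> _ [i _ [B mB <-]]; exact: mX.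
Qed.

(** On cylinders over disjoint index sets both sides are the same finite product over the union of
    the two sets; the general case follows because cylinders form pi-systems. *)
Lemma block_indep (X : I -> Omega -> T) (J K : set I) A B :
  (forall i, measurable_fun setT (X i)) ->
  mutually_independent P X -> J `&` K = set0 ->
  <<s sigma_block X J >> A -> <<s sigma_block X K >> B ->
  P (A `&` B) = (P A * P B)%E.
Proof.
move=> mX iX JK sA sB.
apply: (@g_sigma_indep _ _ _ P (cylinders X J) (cylinders X K)) => //;
  try exact: setI_closed_cylinders; try exact: cylinders_measurable;
  try exact: g_sigma_block_cylinders.
move=> _ _ [F [C [FJ mC ->]]] [F' [C' [FJ' mC' ->]]].
have dis : forall i, i \in F -> i \in F' -> False.
  by move=> i /FJ Ji /FJ' Ki; have : (J `&` K) i by []; rewrite JK.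
pose D i := if i \in F then C i else C' i.
have mD i : measurable (D i) by rewrite /D; case: ifP.
transitivity (P (\bigcap_(i in [set` (F `|` F')%fset]) (X i @^-1` D i))).
  congr (P _); apply/seteqP; split => w /=.
    move=> [H1 H2] i /=; rewrite inE /D; case: ifPn => [iF _|iF /= iF']; first exact: H1.
    exact: H2.
  move=> H; split => i /= iF.
    by have := H i; rewrite /= inE /D iF/=; exact.
  have := H i; rewrite /= inE /D iF/= orbT.
  by case: ifPn => [iF'|_]; [case: (dis i)|exact].
rewrite iX// (perm_big (enum_fset F ++ enum_fset F')); last first.
  apply: uniq_perm => [|| i]; rewrite ?fset_uniq//.
    rewrite cat_uniq !fset_uniq/= andbT; apply/hasPn => i iF'.
    by apply/negP => iF; exact: (dis i).
  by rewrite mem_cat inE.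
rewrite big_cat/= big_seq [X in (_ * X)%E]big_seq.
under eq_bigr => i iF do rewrite /D iF.
under [X in (_ * X)%E]eq_bigr => i iF.
  rewrite /D ifF; last by apply/negP => /(dis i); exact.
  over.
by rewrite -!big_seq -!iX.
Qed.

End block_independence.

Section independent_pair.
Context d (Omega : measurableType d) (R : realType) (P : probability Omega R).
Context d1 (T1 : measurableType d1) d2 (T2 : measurableType d2).
Context (U : Omega -> T1) (V : Omega -> T2).
Context (mU : measurable_fun setT U) (mV : measurable_fun setT V).
Context (indUV : forall A B, measurable A -> measurable B ->
  P (U @^-1` A `&` V @^-1` B) = (P (U @^-1` A) * P (V @^-1` B))%E).
Local Open Scope ereal_scope.

Let mUV : measurable_fun setT (fun w => (U w, V w)).
Proof. exact: measurable_fun_pair. Qed.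

Let U' : {RV P >-> T1} := HB.pack U (isMeasurableFun.Build _ _ _ _ U mU).
Let V' : {RV P >-> T2} := HB.pack V (isMeasurableFun.Build _ _ _ _ V mV).
Let UV' : {RV P >-> (T1 * T2)%type} :=
  HB.pack (fun w => (U w, V w)) (isMeasurableFun.Build _ _ _ _ _ mUV).

(** Independence identifies the joint law of (U, V) with the product of the marginal laws, by
    uniqueness on rectangles; Tonelli's theorem then gives the iterated integral. *)
Lemma integral_indep_pair (F : T1 * T2 -> \bar R) :
  measurable_fun [set: T1 * T2] F -> (forall z, 0 <= F z) ->
  \int[P]_w F (U w, V w) = \int[P]_w \int[P]_w' F (U w, V w').
Proof.
move=> mF F0.
transitivity (\int[distribution P UV']_z F z).
  by rewrite ge0_integral_distribution.
transitivity (\int[distribution P U' \x distribution P V']_z F z).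
  apply: eq_measure_integral => A mA _; apply/esym.
  by apply: product_measure_unique => // B C mB mC; rewrite -indUV.
rewrite fubini_tonelli1//= /fubini_F.
rewrite (@ge0_integral_distribution _ _ _ _ _ P U' (fun x => \int[distribution P V']_y F (x, y)))//=.
- apply: eq_integral => w _ /=.
  by rewrite (@ge0_integral_distribution _ _ _ _ _ P V' (fun y => F (U w, y)))//=; exact: measurableT_comp.
- exact: measurable_fun_fubini_tonelli_F.
- by move=> x; exact: integral_ge0.
Qed.

End independent_pair.

Section independent_product.
Context d (Omega : measurableType d) (R : realType) (P : probability Omega R).
Local Open Scope ereal_scope.

Lemma expectation_indepM (U V : Omega -> R) :
  measurable_fun setT U -> measurable_fun setT V ->
  (forall w, 0 <= U w)%R -> (forall w, 0 <= V w)%R ->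
  (forall A B, measurable A -> measurable B ->
    P (U @^-1` A `&` V @^-1` B) = P (U @^-1` A) * P (V @^-1` B)) ->
  \int[P]_w (U w * V w)%:E = \int[P]_w (U w)%:E * \int[P]_w (V w)%:E.
Proof.
move=> mU mV U0 V0 UV.
(* The absolute values make the integrand nonnegative on the whole plane; they are invisible along
   the nonnegative [U] and [V]. *)
have H := @integral_indep_pair _ _ _ P _ _ _ _ U V mU mV UV (fun z => (`|z.1| * `|z.2|)%:E).
transitivity (\int[P]_w (`|U w| * `|V w|)%:E).
  by apply: eq_integral => w _; rewrite !ger0_norm.
rewrite H//=; last first.
  apply/measurable_EFinP; apply: measurable_funM.
    by apply: measurableT_comp => //; exact: measurable_fst.
  by apply: measurableT_comp => //; exact: measurable_snd.
rewrite -ge0_integralZr//=; last 3 first.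
- exact/measurable_EFinP.
- by move=> w _; rewrite lee_fin.
- by apply: integral_ge0 => w _; rewrite lee_fin.
apply: eq_integral => w _.
under eq_integral do rewrite !ger0_norm// EFinM.
by rewrite ge0_integralZl_EFin//;
  [move=> w' _; rewrite lee_fin|exact/measurable_EFinP].
Qed.

End independent_product.

Section block_measurability.
Context d (Omega : measurableType d) (R : realType) (P : probability Omega R).
Context (I : choiceType) d' (T : measurableType d') (X : I -> Omega -> T).
Context (mX : forall i, measurable_fun setT (X i)).

(** Measurability with respect to the sigma-algebra of a block, stated by preimages so that [U]
    keeps [Omega] as its domain. *)
Definition block_measurable d1 (T1 : measurableType d1) (J : set I)
  (U : Omega -> T1) := forall B, measurable B -> <<s sigma_block X J >> (U @^-1` B).

Lemma block_measurableP d1 (T1 : measurableType d1) (J : set I) (U : Omega -> T1) :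
  block_measurable J U <->
  measurable_fun setT (U : g_sigma_algebraType (sigma_block X J) -> T1).
Proof.
split=> [H _ B mB|H B mB]; first by rewrite setTI; exact: H.
by have := H measurableT B mB; rewrite setTI.
Qed.

Lemma block_measurable_var (J : set I) i : J i -> block_measurable J (X i).
Proof.
by move=> Ji B mB; apply: sub_sigma_algebra; exists i => //; exists B => //; rewrite setTI.
Qed.

Lemma block_measurableS d1 (T1 : measurableType d1) (J K : set I) (U : Omega -> T1) :
  J `<=` K -> block_measurable J U -> block_measurable K U.
Proof. by move=> JK H B mB; exact: g_sigma_block_sub (H _ mB). Qed.

Lemma block_measurable_comp d1 (T1 : measurableType d1) d2 (T2 : measurableType d2)
    (J : set I) (U : Omega -> T1) (f : T1 -> T2) :
  measurable_fun setT f -> block_measurable J U -> block_measurable J (f \o U).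
Proof.
move=> mf mU B mB; apply: (mU (f @^-1` B)).
by rewrite -[X in measurable X]setTI; exact: mf.
Qed.

Lemma block_measurable_fun d1 (T1 : measurableType d1) (J : set I) (U : Omega -> T1) :
  block_measurable J U -> measurable_fun setT U.
Proof. by move=> H _ B mB; rewrite setTI; exact: g_sigma_block_measurable (H _ mB). Qed.

Lemma block_indep_fun d1 (T1 : measurableType d1) d2 (T2 : measurableType d2)
    (J K : set I) (U : Omega -> T1) (V : Omega -> T2) A B :
  mutually_independent P X -> J `&` K = set0 ->
  block_measurable J U -> block_measurable K V -> measurable A -> measurable B ->
  P (U @^-1` A `&` V @^-1` B) = (P (U @^-1` A) * P (V @^-1` B))%E.
Proof.
by move=> iX JK mU mV mA mB; exact: (block_indep mX iX JK (mU _ mA) (mV _ mB)).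
Qed.

Lemma block_measurable_prod (J : set I) (r : seq I) (phi : I -> T -> R) :
  (forall i, measurable_fun setT (phi i)) -> (forall i, i \in r -> J i) ->
  block_measurable J (fun w => \prod_(i <- r) phi i (X i w)).
Proof.
move=> mphi rJ; apply/block_measurableP.
apply: (@measurable_prod _ (g_sigma_algebraType (sigma_block X J)) _ _ _ _
  (fun i w => phi i (X i w))) => i ir.
apply/block_measurableP; apply: (block_measurable_comp (mphi i)).
by apply: block_measurable_var; exact: rJ.
Qed.

Lemma block_measurable_sum (J : set I) (r : seq I) (phi : I -> T -> R) :
  (forall i, measurable_fun setT (phi i)) -> (forall i, i \in r -> J i) ->
  block_measurable J (fun w => \sum_(i <- r) phi i (X i w)).
Proof.
move=> mphi; elim: r => [_|i r IH rJ].
  rewrite (_ : (fun _ => _) = cst 0); last by apply/funext => w; rewrite big_nil.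
  by apply/block_measurableP; exact: measurable_cst.
rewrite (_ : (fun _ => _) =
    (phi i \o X i) \+ (fun w => \sum_(j <- r) phi j (X j w))); last first.
  by apply/funext => w; rewrite big_cons.
apply/block_measurableP; apply: measurable_funD; apply/block_measurableP.
  apply: (block_measurable_comp (mphi i)).
  by apply: block_measurable_var; apply: rJ; rewrite inE eqxx.
by apply: IH => j jr; apply: rJ; rewrite inE jr orbT.
Qed.

(** This is conditioning on the past: [A] is an event of the block [J] and the variables listed in
    [r] lie outside it. The indicator of [A] is carried along as one more factor, independent of
    each new variable of the induction. *)
Lemma integral_indep_prod (J : set I) (A : set Omega) (r : seq I) (phi : I -> T -> R) :
  mutually_independent P X ->
  (forall i, measurable_fun setT (phi i)) -> (forall i x, 0 <= phi i x) ->
  <<s sigma_block X J >> A -> uniq r -> (forall i, i \in r -> ~ J i) ->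
  (\int[P]_(w in A) (\prod_(i <- r) phi i (X i w))%:E =
   P A * \prod_(i <- r) \int[P]_w (phi i (X i w))%:E)%E.
Proof.
move=> iX mphi phi0 sA; have mA : measurable A by exact: g_sigma_block_measurable sA.
elim: r => [_ _|i r IH /= /andP[ir ur] rJ].
  under eq_integral do rewrite big_nil.
  by rewrite integral_cst// mul1e big_nil mule1.
rewrite big_cons [in LHS]integral_mkcond/=.
transitivity (\int[P]_w ((\1_A w * \prod_(j <- r) phi j (X j w)) * phi i (X i w))%:E)%E.
  apply: eq_integral => w _; rewrite patchE indicE big_cons.
  by case: ifPn => wA; rewrite ?mul0r// mul1r mulrC.
rewrite (@expectation_indepM _ _ _ P (fun w => \1_A w * \prod_(j <- r) phi j (X j w))
  (fun w => phi i (X i w))).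
- rewrite [X in (X * _)%E](_ : _ = \int[P]_(w in A) (\prod_(i <- r) phi i (X i w))%:E)%E.
    rewrite IH//; first by rewrite -muleA; congr (_ * _)%E; rewrite muleC.
    by move=> j jr; apply: rJ; rewrite inE jr orbT.
  rewrite [in RHS]integral_mkcond/=; apply: eq_integral => w _.
  by rewrite patchE indicE; case: ifPn => _; rewrite ?mul0r// mul1r.
- apply: measurable_funM => //.
  by apply: measurable_prod => j _; exact: measurableT_comp.
- exact: measurableT_comp.
- by move=> w; rewrite mulr_ge0// prodr_ge0.
- by move=> w.
- move=> B C mB mC; apply: (@block_indep_fun _ _ _ _ (J `|` [set` r]) [set i]) => //.
  + apply/seteqP; split => // j /= [+ ji]; rewrite {}ji => -[|]; last by apply/negP.
    by apply: rJ; rewrite inE eqxx.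
  + apply/block_measurableP; apply: measurable_funM.
      apply/block_measurableP => D mD.
      have : <<s sigma_block X (J `|` [set` r]) >> A by apply: g_sigma_block_sub sA => j; left.
      move=> sA'.
      have : measurable_fun setT (\1_(A : set (g_sigma_algebraType (sigma_block X (J `|` [set` r])))) : _ -> R).
        exact: measurable_indic.
      by move=> /(_ measurableT D mD); rewrite setTI.
    by apply/block_measurableP; apply: block_measurable_prod => // j jr; right.
  + by apply: (block_measurable_comp (mphi i)); exact: block_measurable_var.
Qed.

End block_measurability.

Lemma integral_eq_law d (Omega : measurableType d) (R : realType)
    (P : probability Omega R) d' (T : measurableType d') (U V : Omega -> T)
    (f : T -> \bar R) :
  measurable_fun setT U -> measurable_fun setT V ->
  (forall B, measurable B -> P (U @^-1` B) = P (V @^-1` B)) ->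
  measurable_fun setT f -> (forall x, 0 <= f x)%E ->
  (\int[P]_w f (U w) = \int[P]_w f (V w))%E.
Proof.
move=> mU mV UV mf f0.
pose U' : {RV P >-> T} := HB.pack U (isMeasurableFun.Build _ _ _ _ U mU).
pose V' : {RV P >-> T} := HB.pack V (isMeasurableFun.Build _ _ _ _ V mV).
rewrite -(@ge0_integral_distribution _ _ _ _ _ P U' f)//.
rewrite -(@ge0_integral_distribution _ _ _ _ _ P V' f)//.
by apply: eq_measure_integral => B mB _; exact: UV.
Qed.

(** * The generating function of the process *)

Lemma measurable_fun_nat d (T : measurableType d) (f : T -> nat) :
  (forall k, measurable (f @^-1` [set k])) -> measurable_fun setT f.
Proof.
move=> mf _ B _; rewrite setTI.
rewrite (_ : f @^-1` B = \bigcup_(k in B) f @^-1` [set k]).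
  by apply: bigcup_measurable => k _.
by apply/seteqP; split => [w Bw|w [k Bk /= ->]//]; exists (f w).
Qed.

Lemma measurable_addn d (T : measurableType d) (f g : T -> nat) :
  measurable_fun setT f -> measurable_fun setT g ->
  measurable_fun setT (fun w => f w + g w)%N.
Proof.
move=> mf mg; apply: measurable_fun_nat => k.
rewrite (_ : _ @^-1` _ =
  \bigcup_(a in [set a | (a <= k)%N]) (f @^-1` [set a] `&` g @^-1` [set (k - a)%N])).
  apply: bigcup_measurable => a _; apply: measurableI.
    by rewrite -[X in measurable X]setTI; exact: mf.
  by rewrite -[X in measurable X]setTI; exact: mg.
apply/seteqP; split => [w /= <-|w [a /= ak [-> ->]]]; last by rewrite subnKC.
by exists (f w) => //=; [exact: leq_addr|rewrite addKn].
Qed.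

Lemma bounded_integrable d (T : measurableType d) (R : realType)
    (P : probability T R) (f : T -> R) (M : R) :
  measurable_fun setT f -> (forall w, `|f w| <= M) ->
  P.-integrable setT (EFin \o f).
Proof.
move=> mf fM; apply: measurable_bounded_integrable => //.
  exact: (le_lt_trans (probability_le1 P measurableT) (ltry _)).
exists M; split; first exact: num_real.
by move=> x Mx w _ /=; rewrite (le_trans (fM w))// ltW.
Qed.

Lemma bounded_integralE d (T : measurableType d) (R : realType)
    (P : probability T R) (f : T -> R) (M : R) :
  measurable_fun setT f -> (forall w, `|f w| <= M) ->
  (\int[P]_w (f w)%:E = (\int[P]_w f w)%:E)%E.
Proof.
move=> mf fM; rewrite fineK//; apply: integrable_fin_num => //.
exact: bounded_integrable fM.
Qed.

Lemma ge0_integral_partition_nat d (T : measurableType d) (R : realType)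
    (mu : {measure set T -> \bar R}) (N : T -> nat) (f : T -> \bar R) :
  measurable_fun setT N -> measurable_fun setT f -> (forall w, 0 <= f w)%E ->
  (\int[mu]_w f w = \sum_(j <oo) \int[mu]_(w in N @^-1` [set j]) f w)%E.
Proof.
move=> mN mf f0.
have UN : \bigcup_j N @^-1` [set j] = setT.
  by apply/seteqP; split => // w _; exists (N w).
rewrite -{1}UN ge0_integral_bigcup//.
- by move=> k; rewrite -[X in measurable X]setTI; exact: mN.
- by rewrite UN.
- by move=> i j _ _ [w [/= <- <-]].
Qed.

Lemma measurable_exprn d (T : measurableType d) (R : realType) (V : T -> nat) (t : R) :
  measurable_fun setT V -> measurable_fun setT (fun w => t ^+ V w).
Proof. by move=> mV; apply: (@measurableT_comp _ _ _ _ _ _ (fun k : nat => t ^+ k)). Qed.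

Lemma normr_exprn_le1 (R : realType) (t : R) k : 0 <= t <= 1 -> `|t ^+ k| <= 1.
Proof. by move=> /andP[t0 t1]; rewrite ger0_norm ?exprn_ge0// exprn_ile1. Qed.

Lemma pgf01 d (Omega : measurableType d) (R : realType) (P : probability Omega R)
    (V : Omega -> nat) (s : R) :
  measurable_fun setT V -> 0 <= s <= 1 -> 0 <= \int[P]_w (s ^+ V w) <= 1.
Proof.
move=> mV s01; have /andP[s0 s1] := s01.
rewrite Rintegral_ge0/=; last by move=> w _; exact: exprn_ge0.
rewrite (@le_trans _ _ (\int[P]_w 1))//; last first.
  by rewrite Rintegral_cst//= probability_setT mul1r.
apply: le_Rintegral => //.
- apply: (@bounded_integrable _ _ _ _ _ 1); first exact: measurable_exprn.
  by move=> w; exact: normr_exprn_le1.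
- by apply: (@bounded_integrable _ _ _ _ _ 1) => // w; rewrite normr1.
- by move=> w _; exact: exprn_ile1.
Qed.

Section sum_family.
Context d (Omega : measurableType d) (R : realType) (P : probability Omega R).
Context (I1 I2 : choiceType) d' (T : measurableType d').
Context (X : I1 -> Omega -> T) (Y : I2 -> Omega -> T).

(** Offspring and immigration variables become one mutually independent family, indexed by a
    disjoint sum, to which the block lemmas apply. *)
Definition sum_family (i : I1 + I2) : Omega -> T :=
  match i with inl i => X i | inr i => Y i end.

Lemma mutually_independent_sum_family :
  mutually_independent P X -> mutually_independent P Y ->
  independent_families P X Y -> mutually_independent P sum_family.
Proof.
move=> iX iY XY J B mB.
pose Jl := [fset x in pmap (fun i : I1 + I2 => if i is inl x then Some x else None) J]%fset.
pose Jr := [fset x in pmap (fun i : I1 + I2 => if i is inr x then Some x else None) J]%fset.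
have JlE x : (x \in Jl) = (inl x \in J).
  rewrite inE mem_pmap; apply/mapP/idP => [[[y|y] yJ []//] ->//|xJ].
  by exists (inl x).
have JrE x : (x \in Jr) = (inr x \in J).
  rewrite inE mem_pmap; apply/mapP/idP => [[[y|y] yJ []//] ->//|xJ].
  by exists (inr x).
rewrite [in RHS](perm_big (map inl (enum_fset Jl) ++ map inr (enum_fset Jr))); last first.
  apply: uniq_perm; rewrite ?fset_uniq//.
    rewrite cat_uniq !map_inj_uniq ?fset_uniq//=; try by move=> ? ? [].
    by rewrite andbT; apply/hasPn => _ /mapP[x _ ->]; apply/negP => /mapP[].
  move=> [x|x]; rewrite mem_cat.
    rewrite mem_map; last by move=> ? ? [].
    by rewrite -JlE; case: (x \in Jl) => //=; apply/esym/negP => /mapP[].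
  rewrite orbC mem_map; last by move=> ? ? [].
  by rewrite -JrE; case: (x \in Jr) => //=; apply/esym/negP => /mapP[].
rewrite big_cat !big_map/=.
have mBl i : i \in Jl -> measurable (B (inl i)) by rewrite JlE; exact: mB.
have mBr i : i \in Jr -> measurable (B (inr i)) by rewrite JrE; exact: mB.
rewrite -(iX Jl (fun i => B (inl i)))// -(iY Jr (fun i => B (inr i)))// -XY.
- congr (P _); apply/seteqP; split => [w H|w [H1 H2]].
    split => i /= iJ; first by apply: (H (inl i)); rewrite /= -JlE.
    by apply: (H (inr i)); rewrite /= -JrE.
  by move=> [i|i] /= iJ; [apply: H1; rewrite /= JlE|apply: H2; rewrite /= JrE].
- have : sigma_algebra setT (sigma_of_family X) by exact: smallest_sigma_algebra.
  rewrite /sigma_of_family => sX.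
  pose T' := g_sigma_algebraType (\bigcup_i preimage_set_system [set: Omega] (X i) measurable).
  have : measurable (\bigcap_(i in [set` Jl]) (X i @^-1` B (inl i)) : set T').
    apply: fin_bigcap_measurable => // i iJ.
    by apply: sub_sigma_algebra; exists i => //; exists (B (inl i)); [exact: mBl|rewrite setTI].
  by [].
- pose T' := g_sigma_algebraType (\bigcup_i preimage_set_system [set: Omega] (Y i) measurable).
  have : measurable (\bigcap_(i in [set` Jr]) (Y i @^-1` B (inr i)) : set T').
    apply: fin_bigcap_measurable => // i iJ.
    by apply: sub_sigma_algebra; exists i => //; exists (B (inr i)); [exact: mBr|rewrite setTI].
  by [].
Qed.

End sum_family.

Section galton_watson.
Context d (Omega : measurableType d) (R : realType) (P : probability Omega R).
Context (xi : nat -> nat -> {RV P >-> nat}) (Y : nat -> {RV P >-> nat}).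
Context (oi : offspring_immigration xi Y).

Let Z := GWI (fun n i => xi n i : Omega -> nat) (fun n => Y n : Omega -> nat).

Let W : ((nat * nat) + nat)%type -> Omega -> nat :=
  sum_family (fun ni => xi ni.1 ni.2 : Omega -> nat) (fun n => Y n : Omega -> nat).

Let mW i : measurable_fun setT (W i).
Proof. by case: i => [[n i]|n] /=; exact: measurable_funP. Qed.

Let iW : mutually_independent P W.
Proof. by case: oi => -[? _] [? _] ?; exact: mutually_independent_sum_family. Qed.

(** [xi n i] and [Y n] act in the step from generation n to n + 1, hence [Z n] depends only on
    indices strictly below n. *)
Definition generations_before (n : nat) : set ((nat * nat) + nat) :=
  [set i | match i with inl ni => (ni.1 < n)%N | inr k => (k < n)%N end].

Lemma measurable_GWI_block n : block_measurable W (generations_before n) (Z n).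
Proof.
elim: n => [|n IH].
  by apply/block_measurableP; exact: measurable_cst.
pose T' := g_sigma_algebraType (sigma_block W (generations_before n.+1)).
have mZ : measurable_fun setT (Z n : T' -> nat).
  by apply/block_measurableP; apply: block_measurableS IH => -[[m i]|m] /=; exact: ltnW.
have mY : measurable_fun setT (Y n : T' -> nat).
  by apply/block_measurableP; apply: (@block_measurable_var _ _ _ _ _ W _ (inr n)) => /=.
have mxi j : measurable_fun setT ((fun w => \sum_(i < j) xi n i w)%N : T' -> nat).
  elim: j => [|j IHj].
    by rewrite (_ : (fun _ => _) = cst 0%N)//; apply/funext => w; rewrite big_ord0.
  rewrite (_ : (fun _ => _) = (fun w => (\sum_(i < j) xi n i w) + xi n j w)%N).
    apply: (@measurable_addn _ T') => //.
    by apply/block_measurableP; apply: (@block_measurable_var _ _ _ _ _ W _ (inl (n, j))) => /=.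
  by apply/funext => w; rewrite big_ord_recr.
apply/block_measurableP; apply: (@measurable_fun_nat _ T') => k.
(* The number of summands is random: the event is cut along the values of [Z n], on each of which
   the sum has a fixed length. *)
rewrite (_ : _ @^-1` _ = \bigcup_j (Z n @^-1` [set j] `&`
   (fun w => \sum_(i < j) xi n i w + Y n w)%N @^-1` [set k])); last first.
  by apply/seteqP; split => [w /= H|w [j _ [/= <-]]//]; exists (Z n w).
apply: (@bigcupT_measurable _ T') => j; apply: (@measurableI _ T').
  by rewrite -[X in measurable X]setTI; exact: mZ.
by rewrite -[X in measurable X]setTI; exact: (@measurable_addn _ T').
Qed.

Lemma measurable_GWI n : measurable_fun setT (Z n).
Proof. by apply: block_measurable_fun (measurable_GWI_block (n := n)); exact: mW. Qed.

(** On {Z n = j} the next generation is a sum of j + 1 variables independent of the past, so the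
    value j contributes f(s)^j h(s) P(Z n = j). *)
Lemma GWI_gen_fun_rec n (s : R) : 0 <= s <= 1 ->
  \int[P]_w (s ^+ Z n.+1 w) =
  \int[P]_w ((\int[P]_w' (s ^+ xi 0 0 w')) ^+ Z n w) * \int[P]_w (s ^+ Y 0%N w).
Proof.
move=> /andP[s0 s1].
have s01 : 0 <= s <= 1 by rewrite s0.
set f := \int[P]_w (s ^+ xi 0 0 w); set h := \int[P]_w (s ^+ Y 0%N w).
have f01 : 0 <= f <= 1 by apply: pgf01 => //; exact: measurable_funP.
have fE i : (\int[P]_w (s ^+ xi n i w)%:E = f%:E)%E.
  rewrite -(@bounded_integralE _ _ _ _ _ 1)//; last 2 first.
  - by apply: measurable_exprn; exact: measurable_funP.
  - by move=> w; exact: normr_exprn_le1.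
  apply: (@integral_eq_law _ _ _ _ _ nat (xi n i) (xi 0 0) (fun k => (s ^+ k)%:E)) => //.
    by case: oi => -[_ H] _ _; exact: (H (n, i) (0, 0)).
  by move=> x; rewrite lee_fin exprn_ge0.
have hE : (\int[P]_w (s ^+ Y n w)%:E = h%:E)%E.
  rewrite -(@bounded_integralE _ _ _ _ _ 1)//; last 2 first.
  - by apply: measurable_exprn; exact: measurable_funP.
  - by move=> w; exact: normr_exprn_le1.
  apply: (@integral_eq_law _ _ _ _ _ nat (Y n) (Y 0%N) (fun k => (s ^+ k)%:E)) => //.
    by case: oi => _ [_ H] _; exact: (H n 0%N).
  by move=> x; rewrite lee_fin exprn_ge0.
apply: EFin_inj; rewrite EFinM -!(@bounded_integralE _ _ _ _ _ 1); last first.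
- by move=> w; exact: normr_exprn_le1.
- exact/measurable_exprn/measurable_GWI.
- by move=> w; exact: normr_exprn_le1.
- exact/measurable_exprn/measurable_GWI.
- by move=> w; exact: normr_exprn_le1.
- by apply: measurable_exprn; exact: measurable_funP.
rewrite (@ge0_integral_partition_nat _ _ _ _ (Z n)); last 3 first.
- exact: measurable_GWI.
- by apply/measurable_EFinP; exact/measurable_exprn/measurable_GWI.
- by move=> w; rewrite lee_fin exprn_ge0.
rewrite [in RHS](@ge0_integral_partition_nat _ _ _ _ (Z n)); last 3 first.
- exact: measurable_GWI.
- by apply/measurable_EFinP; exact/measurable_exprn/measurable_GWI.
- by move=> w; rewrite lee_fin exprn_ge0//; case/andP: f01.
rewrite [(\int[P]_w (s ^+ Y 0%N w)%:E)%E](_ : _ = h%:E)%E; last first.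
  rewrite (@bounded_integralE _ _ _ _ _ 1)//; last by move=> w; exact: normr_exprn_le1.
  by apply: measurable_exprn; exact: measurable_funP.
rewrite muleC -nneseriesZl; last first.
  move=> j _; apply: integral_ge0 => w _.
  by rewrite lee_fin exprn_ge0//; case/andP: f01.
apply: eq_eseriesr => j _.
have mZj : measurable (Z n @^-1` [set j]).
  by rewrite -[X in measurable X]setTI; exact: measurable_GWI.
(* The fresh variables of the step: the immigrants and the first j offspring numbers, with index
   n. *)
pose r : seq ((nat * nat) + nat)%type :=
  inr n :: map (fun i => inl (n, i)) (iota 0 j).
rewrite (eq_integral (fun w => (\prod_(i <- r) s ^+ W i w)%:E)); last first.
  move=> w; rewrite inE/= => Zj; have -> : Z n.+1 w = (\sum_(i < j) xi n i w + Y n w)%N by rewrite -Zj.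
  rewrite big_cons big_map/=.
  rewrite exprD mulrC; congr ((_ * _)%:E).
  rewrite -[in LHS](big_mkord predT (fun i => xi n i w)) /index_iota subn0.
  by rewrite (big_morph (fun k => s ^+ k) (exprD s) (expr0 s)).
rewrite (@integral_indep_prod _ _ _ P _ _ _ W mW (generations_before n) _ _
  (fun _ k => s ^+ k))//; last 4 first.
- by move=> i x; exact: exprn_ge0.
- exact: measurable_GWI_block.
- by rewrite /= map_inj_uniq ?iota_uniq ?andbT; [apply/negP => /mapP[]|move=> ? ? []].
- move=> i; rewrite inE => /orP[/eqP -> /=|/mapP[k _ -> /=]]; first by rewrite ltnn.
  by rewrite ltnn.
rewrite big_cons big_map/= hE.
under eq_bigr do rewrite fE.
rewrite (eq_integral (fun w => (f ^+ j)%:E)); last by move=> w; rewrite inE/= => ->.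
rewrite integral_cst//= muleCA; congr (_ * _)%E; rewrite muleC; congr (_ * _)%E.
rewrite -[in RHS](size_iota 0 j).
by elim: (iota 0 j) => [|k t IH]; rewrite ?big_nil// big_cons IH exprS EFinM.
Qed.

(** The recursion moves the argument: it splits off h(s) and continues at f(s). Hence the induction
    is over all [s], and iterates are unfolded from the inside. *)
Lemma GWI_gen_fun n (s : R) : 0 <= s <= 1 ->
  \int[P]_w (s ^+ Z n w) =
  \prod_(j < n) \int[P]_w
     ((iter j (fun t => \int[P]_w' (t ^+ xi 0 0 w')) s) ^+ Y 0%N w).
Proof.
elim: n s => [s _|n IH s s01].
  rewrite big_ord0; under eq_Rintegral do rewrite expr0.
  by rewrite Rintegral_cst//= probability_setT mul1r.
rewrite GWI_gen_fun_rec// IH; last by apply: pgf01 => //; exact: measurable_funP.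
rewrite big_ord_recl mulrC; congr (_ * _); apply: eq_bigr => j _.
by rewrite lift0 iterSr.
Qed.

End galton_watson.

Lemma cvgn_succ (R : realType) (u : nat -> R) (l : R) :
  u n @[n --> \oo] --> l -> u n.+1 @[n --> \oo] --> l.
Proof. by move=> H; rewrite cvg_shiftS. Qed.

Lemma cvg_dist_le (R : realType) (x b : nat -> R) (l : R) :
  (\forall n \near \oo, `|x n - l| <= b n) -> b n @[n --> \oo] --> (0 : R) ->
  x n @[n --> \oo] --> l.
Proof.
move=> xb b0; apply/cvgrPdist_le => e e0.
move/cvgrPdist_le : b0 => /(_ _ e0) be.
near=> n; rewrite distrC; have bn : `|x n - l| <= b n by near: n.
have : `|0 - b n| <= e by near: n.
by rewrite sub0r normrN; apply: le_trans; rewrite (le_trans bn)// ler_norm.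
Unshelve. all: by end_near. Qed.

(** * Iteration of the survival map *)

Section survival_iteration.
Context (R : realType) (F h Lam varpi : R -> R) (p0 gamma sigma : R).
Hypothesis p001 : 0 < p0 < 1.
Hypothesis gamma0 : 0 < gamma.
Hypothesis sigma0 : 0 < sigma.
Hypothesis F_ub : forall u : R, 0 < u <= 1 -> p0 * u ^+ 2 <= u - F u.
Hypothesis F_lb : forall u : R, 0 < u <= 1 -> (1 - p0) * u <= F u.
Hypothesis h_gt0 : forall u : R, 0 < u <= 1 -> 0 < h u.
Hypothesis Lam_ge0 : forall u : R, 0 < u <= 1 -> 0 <= Lam u.
(* [Lam] is a Lyapunov function: the errors telescope along the orbit of [F]. *)
Hypothesis lnh : forall u : R, 0 < u <= 1 ->
  `|ln (h u) + sigma * ln (u / F u)| <= Lam u - Lam (F u).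
Hypothesis varpi_ndecr : forall u v : R, 0 < u -> u <= v -> v <= 1 -> varpi u <= varpi v.
Hypothesis invF : forall u : R, 0 < u <= 1 -> `|(F u)^-1 - u^-1 - gamma| <= varpi u.

Lemma survival_iter_itv (u : R) n : 0 < u <= 1 -> 0 < iter n F u <= u.
Proof.
move=> u01; elim: n => [|n /andP[IH0 IHu]] /=.
  by case/andP: u01 => ->; rewrite lexx.
have /andP[u0 u1] := u01; have /andP[p00 p01] := p001.
have v01 : 0 < iter n F u <= 1 by rewrite IH0 (le_trans IHu).
rewrite (lt_le_trans _ (F_lb v01)) ?mulr_gt0 ?subr_gt0//=.
rewrite (le_trans _ IHu)// -subr_ge0 (le_trans _ (F_ub v01))//.
by rewrite mulr_ge0// ?ltW// exprn_gt0.
Qed.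

Lemma survival_iter01 (u : R) n : 0 < u <= 1 -> 0 < iter n F u <= 1.
Proof.
move=> u01; have /andP[-> H] := survival_iter_itv n u01.
by case/andP: u01 => _; apply: le_trans.
Qed.

(** One step adds (v - F v) / (v F v) to the inverse, and v - F v >= p0 v^2 >= p0 v F v. *)
Lemma survival_iter_inv_lb (u : R) n : 0 < u <= 1 -> u^-1 + p0 * n%:R <= (iter n F u)^-1.
Proof.
move=> u01; elim: n => [|n IH] /=; first by rewrite mulr0 addr0.
set v := iter n F u.
have v01 : 0 < v <= 1 by exact: survival_iter01.
have /andP[v0 _] := v01.
have /andP[Fv0 _] : 0 < F v <= 1 by exact: (@survival_iter01 u n.+1).
rewrite -natr1 mulrDr mulr1 addrA (le_trans (lerD IH (lexx p0)))// -/v -lerBrDl.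
have -> : (F v)^-1 - v^-1 = (v - F v) / (v * F v).
  by field; rewrite !gt_eqF.
rewrite ler_pdivlMr ?mulr_gt0//; apply: le_trans (F_ub v01).
have /andP[p00 p01] := p001.
rewrite expr2 ler_pM2l// ler_pM2l//.
by rewrite -subr_ge0 (le_trans _ (F_ub v01))// mulr_ge0// ?ltW// exprn_gt0.
Qed.

Definition survival_prod (n : nat) (u : R) : R := \prod_(j < n) h (iter j F u).

Lemma survival_prod_gt0 n (u : R) : 0 < u <= 1 -> 0 < survival_prod n u.
Proof. by move=> u01; apply: prodr_gt0 => j _; apply/h_gt0/survival_iter01. Qed.

Lemma ln_survival_prod n (u : R) : 0 < u <= 1 ->
  `|ln (survival_prod n u) + sigma * ln (u / iter n F u)| <= Lam u.
Proof.
move=> u01; have /andP[u0 _] := u01.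
(* The induction needs the telescoped form; dropping its nonnegative last term gives a bound uniform
   in n. *)
suff H : `|ln (survival_prod n u) + sigma * ln (u / iter n F u)|
    <= Lam u - Lam (iter n F u).
  by rewrite (le_trans H)// gerBl Lam_ge0//; exact: survival_iter01.
elim: n => [|n IH].
  by rewrite /survival_prod big_ord0 /= divff ?gt_eqF// !ln1 mulr0 addr0 normr0 subrr.
rewrite /survival_prod big_ord_recr/= -/(survival_prod n u).
set v := iter n F u in IH *.
have v01 : 0 < v <= 1 by exact: survival_iter01.
have /andP[v0 _] := v01.
have /andP[Fv0 _] : 0 < F v <= 1 by exact: (@survival_iter01 u n.+1).
rewrite lnM ?posrE ?survival_prod_gt0 ?h_gt0//.
have -> : u / F v = (u / v) * (v / F v) by field; rewrite !gt_eqF.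
rewrite lnM ?posrE ?divr_gt0// mulrDr addrACA (le_trans (ler_normD _ _))//.
rewrite (_ : Lam u - _ = (Lam u - Lam v) + (Lam v - Lam (F v))).
  by apply: lerD => //; exact: lnh.
by rewrite addrA subrK.
Qed.

(** The orbit stays below its starting point and [varpi] is nondecreasing, so each of the n errors
    is at most [varpi u]. *)
Lemma survival_iter_inv n (u : R) : 0 < u <= 1 ->
  `|(iter n F u)^-1 - u^-1 - gamma * n%:R| <= n%:R * varpi u.
Proof.
move=> u01; elim: n => [|n IH] /=.
  by rewrite mulr0 subr0 subrr normr0 mul0r.
set v := iter n F u in IH *.
have v01 : 0 < v <= 1 by exact: survival_iter01.
have /andP[v0 vu] : 0 < v <= u by exact: survival_iter_itv.
rewrite (_ : _ - _ = (v^-1 - u^-1 - gamma * n%:R) + ((F v)^-1 - v^-1 - gamma)).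
  rewrite (le_trans (ler_normD _ _))// -natr1 mulrDl mul1r lerD//.
  by rewrite (le_trans (invF v01))// varpi_ndecr//; case/andP: u01.
by rewrite -natr1; ring.
Qed.

Lemma survival_prod_ub n (u : R) : 0 < u <= 1 ->
  survival_prod n u <= expR (Lam u) * (1 + p0 * n%:R * u) `^ (- sigma).
Proof.
move=> u01; have := ln_survival_prod n u01.
have /andP[u0 _] := u01; have /andP[p00 _] := p001.
have /andP[v0 _] := survival_iter01 n u01.
rewrite ler_norml => /andP[_ H].
have D0 : 0 < 1 + p0 * n%:R * u by rewrite ltr_pwDl// !mulr_ge0// ?ltW//.
rewrite -[leLHS]lnK ?posrE ?survival_prod_gt0//.
rewrite /powR gt_eqF// -expRD ler_expR mulNr lerBrDr.
apply: le_trans H; rewrite lerD2l// ler_pM2l// ler_ln ?posrE//; last first.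
  by rewrite divr_gt0.
rewrite -(@ler_pM2l _ u^-1) ?invr_gt0// mulrA mulVf ?gt_eqF// mul1r.
apply: le_trans (survival_iter_inv_lb n u01).
by rewrite [leLHS](_ : _ = u^-1 + p0 * n%:R)//; field; rewrite gt_eqF.
Qed.

Lemma survival_prod_cvg (u_ : nat -> R) :
  (forall n, 0 < u_ n <= 1) -> Lam (u_ n) @[n --> \oo] --> 0 ->
  varpi (u_ n) @[n --> \oo] --> 0 ->
  (1 + gamma * n%:R * u_ n) `^ sigma * survival_prod n (u_ n) @[n --> \oo] --> (1 : R).
Proof.
move=> u01 Lam0 varpi0.
have D0 n : 0 < 1 + gamma * n%:R * u_ n.
  by have /andP[u0 _] := u01 n; rewrite ltr_pwDl// !mulr_ge0// ?ltW//.
have v0 n : 0 < iter n F (u_ n) by case/andP: (survival_iter01 n (u01 n)).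
(* [q] compares u / F^n(u) with 1 + gamma n u. Its distance to 1 is at most n u varpi(u) / (1 +
   gamma n u), hence at most varpi(u) / gamma however large n u is. *)
pose q n := (u_ n / iter n F (u_ n)) / (1 + gamma * n%:R * u_ n).
have q0 n : 0 < q n.
  by have /andP[u0 _] := u01 n; rewrite !divr_gt0.
have q1 : q n @[n --> \oo] --> (1 : R).
  apply: (@cvg_dist_le _ _ (fun n => gamma^-1 * varpi (u_ n))).
    apply: nearW => n; have /andP[u0 _] := u01 n.
    rewrite (_ : q n - 1 = (u_ n / (1 + gamma * n%:R * u_ n)) *
        ((iter n F (u_ n))^-1 - (u_ n)^-1 - gamma * n%:R)); last first.
      by rewrite /q; field; rewrite !gt_eqF.
    have D1 : 0 <= u_ n / (1 + gamma * n%:R * u_ n) by rewrite divr_ge0// ltW.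
    rewrite normrM ger0_norm//.
    rewrite (le_trans (ler_wpM2l D1 (survival_iter_inv n (u01 n))))//.
    have w0 : 0 <= varpi (u_ n) by apply: le_trans (invF (u01 n)).
    rewrite mulrA ler_wpM2r// -(@ler_pM2l _ gamma)// mulfV ?gt_eqF//.
    rewrite mulrAC mulrA ler_pdivrMr// mul1r mulrA -[gamma * _ * _]mulrAC.
    by rewrite lerDr.
  by rewrite -(mulr0 gamma^-1); exact: cvgMr.
have lnq : ln (q n) @[n --> \oo] --> (0 : R).
  by rewrite -(@ln1 R); apply: continuous_cvg => //; apply: continuous_ln.
pose l n := ln (survival_prod n (u_ n)) + sigma * ln (u_ n / iter n F (u_ n)).
have l0 : l n @[n --> \oo] --> (0 : R).
  apply: (@cvg_dist_le _ _ (fun n => Lam (u_ n))) => //.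
  by apply: nearW => n; rewrite subr0; exact: ln_survival_prod.
rewrite (_ : (fun n => _) = (fun n => expR (l n - sigma * ln (q n)))); last first.
  apply/funext => n; have /andP[u0 _] := u01 n.
  rewrite /l /q (@ln_div _ (_ / _)) ?posrE ?divr_gt0//.
  rewrite (_ : _ - _ = ln (survival_prod n (u_ n)) + sigma * ln (1 + gamma * n%:R * u_ n)); last by ring.
  by rewrite expRD lnK ?posrE ?survival_prod_gt0// /powR gt_eqF// mulrC.
rewrite -(@expR0 R); apply: continuous_cvg; first exact: continuous_expR.
rewrite -[X in _ --> X](subr0 0) -[X in _ --> _ - X](mulr0 sigma).
by apply: cvgB => //; exact: cvgMr.
Qed.

End survival_iteration.

(** * Generating functions near 1 *)

Section bernoulli_remainder.
Context (R : realType).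
Implicit Types (k : nat) (u : R).

(** Remainder in Bernoulli's inequality; averaged over a law of mean one it is u - F(u) for the
    survival map F. *)
Definition bern k u : R := (1 - u) ^+ k - 1 + k%:R * u.

Lemma bernS k u : bern k.+1 u = (1 - u) * bern k u + k%:R * u ^+ 2.
Proof. by rewrite /bern exprS -natr1; ring. Qed.

Lemma bern_ge0 k u : 0 <= u <= 1 -> 0 <= bern k u.
Proof.
move=> /andP[u0 u1]; elim: k => [|k IH]; first by rewrite /bern expr0 subrr mul0r addr0.
by rewrite bernS addr_ge0// mulr_ge0// ?subr_ge0// exprn_ge0.
Qed.

(** The indicator makes the coefficient vanish at k = 0, where it would be -1; over a law of mean
    one the coefficient then averages to the mass at 0. *)
Lemma bern_lb k u : 0 <= u <= 1 -> (k%:R - 1 + (k == 0%N)%:R) * u ^+ 2 <= bern k u.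
Proof.
move=> /[dup] /andP[u0 u1] u01; case: k => [|k].
  by rewrite eqxx sub0r addNr mul0r bern_ge0.
rewrite bernS /= addr0 -natr1 addrK lerDr mulr_ge0 ?subr_ge0// bern_ge0//.
Qed.

Lemma bern_ub k u : 0 <= u <= 1 -> bern k u <= k%:R * (k%:R - 1) / 2 * u ^+ 2.
Proof.
move=> /[dup] /andP[u0 u1] u01; elim: k => [|k IH].
  by rewrite /bern expr0 subrr !mul0r addr0.
rewrite bernS -natr1 addrK.
have : (1 - u) * bern k u <= bern k u.
  by rewrite ler_piMl ?bern_ge0// gerBl.
have : 0 <= u ^+ 2 by rewrite exprn_ge0.
move: IH; lra.
Qed.

Definition bern_gap k u : R := k%:R * (k%:R - 1) / 2 * u ^+ 2 - bern k u.

Lemma bern_gap_ge0 k u : 0 <= u <= 1 -> 0 <= bern_gap k u.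
Proof. by move=> u01; rewrite subr_ge0 bern_ub. Qed.

(** The gap is at most k^2 u^2 and at most k^3 u^3; adding the second bound to k u times the first
    produces the factor k u / (1 + k u), a smooth version of min (1, k u). This is the shape that a
    difference of logarithms absorbs later. *)
Lemma bern_gap_ub k u : 0 <= u <= 1 ->
  bern_gap k u <= 2 * u ^+ 2 * (k%:R ^+ 2 * (k%:R * u / (1 + k%:R * u))).
Proof.
move=> /[dup] /andP[u0 u1] u01.
have H1 : bern_gap k u <= k%:R ^+ 2 * u ^+ 2.
  rewrite /bern_gap lerBlDr; apply: (@le_trans _ _ (k%:R ^+ 2 * u ^+ 2)); last first.
    by rewrite lerDl bern_ge0.
  rewrite ler_wpM2r ?exprn_ge0//; have : 0 <= k%:R :> R by []. nra.
have H2 : bern_gap k u <= k%:R ^+ 3 * u ^+ 3.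
  elim: k {H1} => [|k IH].
    by rewrite /bern_gap /bern expr0 !mul0r subrr addr0 subrr expr0n mul0r.
  have -> : bern_gap k.+1 u = bern_gap k u + u * bern k u.
    by rewrite /bern_gap bernS -natr1; field.
  have := bern_ub k u01; move: IH; rewrite -[k.+1%:R]natr1.
  have k0 : 0 <= k%:R :> R by [].
  move: (bern_gap k u) (bern k u) => g b H H'.
  have : u * b <= u * (k%:R * (k%:R - 1) / 2 * u ^+ 2) by rewrite ler_wpM2l.
  have u3 : 0 <= u ^+ 3 by rewrite exprn_ge0.
  move=> H3; apply: (le_trans (lerD H H3)); rewrite -subr_ge0.
  rewrite (_ : _ - _ = u ^+ 3 * (5 / 2 * k%:R ^+ 2 + 7 / 2 * k%:R + 1)); last by field.
  by rewrite mulr_ge0// !addr_ge0// mulr_ge0// ?exprn_ge0//; lra.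
have ku : 0 <= k%:R * u by rewrite mulr_ge0.
have D0 : 0 < 1 + k%:R * u by rewrite ltr_pwDl.
rewrite !mulrA ler_pdivlMr//.
rewrite [leRHS](_ : _ = k%:R ^+ 2 * u ^+ 2 * (k%:R * u) + k%:R ^+ 3 * u ^+ 3); last by ring.
by rewrite mulrDr mulr1 addrC lerD// ler_wpM2r.
Qed.

End bernoulli_remainder.

Lemma dominated_cvg_Rintegral d (T : measurableType d) (R : realType)
    (mu : {measure set T -> \bar R}) (D : set T) (f_ : nat -> T -> R) (f g : T -> R) :
  measurable D -> (forall n, measurable_fun D (f_ n)) -> measurable_fun D f ->
  mu.-integrable D (EFin \o g) ->
  (forall x, D x -> f_ n x @[n --> \oo] --> f x) ->
  (forall n x, D x -> `|f_ n x| <= g x) ->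
  \int[mu]_(x in D) f_ n x @[n --> \oo] --> \int[mu]_(x in D) f x.
Proof.
move=> mD mf_ mf ig f_f f_g.
have [|||//||intf _ H] := @dominated_convergence _ _ _ mu D mD
  (fun n => EFin \o f_ n) (EFin \o f) (EFin \o g).
- by move=> n; apply/measurable_EFinP.
- exact/measurable_EFinP.
- apply: aeW => x Dx; apply: cvg_EFin; first exact: nearW.
  exact: f_f.
- by apply: aeW => x n Dx /=; rewrite lee_fin f_g.
apply: fine_cvg; rewrite /Rintegral fineK//; exact: integrable_fin_num.
Qed.

Section nat_expectation.
Context d (Omega : measurableType d) (R : realType) (P : probability Omega R).
Context (N : Omega -> nat) (mN : measurable_fun setT N).

Definition nat_integrable (g : nat -> R) := P.-integrable setT (EFin \o (g \o N)).

Definition nat_expect (g : nat -> R) : R := \int[P]_w g (N w).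

Lemma measurable_nat_comp (g : nat -> R) : measurable_fun setT (g \o N).
Proof. exact: measurableT_comp. Qed.

Lemma nat_integrable_cst (c : R) : nat_integrable (fun=> c).
Proof.
by apply: (@bounded_integrable _ _ _ _ (cst c) `|c|); first exact: measurable_cst.
Qed.

Lemma nat_integrable_le (g f : nat -> R) : nat_integrable f ->
  (forall k, `|g k| <= f k) -> nat_integrable g.
Proof.
move=> intf gf; apply: (le_integrable _ _ _ intf) => //.
  by apply/measurable_EFinP; exact: measurable_nat_comp.
by move=> w _ /=; rewrite lee_fin (le_trans (gf _))// ler_norm.
Qed.

Lemma nat_integrableD (f g : nat -> R) :
  nat_integrable f -> nat_integrable g -> nat_integrable (fun k => f k + g k).
Proof. by move=> mf mg; apply: (@integrableD _ _ _ _ _ _ _ _ mf mg). Qed.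

Lemma nat_integrableB (f g : nat -> R) :
  nat_integrable f -> nat_integrable g -> nat_integrable (fun k => f k - g k).
Proof. by move=> mf mg; apply: (@integrableB _ _ _ _ _ _ _ _ mf mg). Qed.

Lemma nat_integrableZ (c : R) (f : nat -> R) :
  nat_integrable f -> nat_integrable (fun k => c * f k).
Proof. by move=> mf; apply: (@integrableZl _ _ _ _ _ _ c _ mf). Qed.

Lemma nat_expect_le (f g : nat -> R) : nat_integrable f -> nat_integrable g ->
  (forall k, f k <= g k) -> nat_expect f <= nat_expect g.
Proof. by move=> mf mg fg; apply: le_Rintegral => // w _; exact: fg. Qed.

Lemma nat_expect_ge0 (f : nat -> R) : (forall k, 0 <= f k) -> 0 <= nat_expect f.
Proof. by move=> f0; apply: Rintegral_ge0 => w _; exact: f0. Qed.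

Lemma nat_expectD (f g : nat -> R) : nat_integrable f -> nat_integrable g ->
  nat_expect (fun k => f k + g k) = nat_expect f + nat_expect g.
Proof. by move=> mf mg; rewrite /nat_expect RintegralD. Qed.

Lemma nat_expectB (f g : nat -> R) : nat_integrable f -> nat_integrable g ->
  nat_expect (fun k => f k - g k) = nat_expect f - nat_expect g.
Proof. by move=> mf mg; rewrite /nat_expect RintegralB. Qed.

Lemma nat_expectZ (c : R) (f : nat -> R) : nat_integrable f ->
  nat_expect (fun k => c * f k) = c * nat_expect f.
Proof. by move=> mf; rewrite /nat_expect RintegralZl. Qed.

Lemma nat_expect_cst (c : R) : nat_expect (fun=> c) = c.
Proof. by rewrite /nat_expect Rintegral_cst//= probability_setT mulr1. Qed.

Lemma nat_expect0 : nat_expect (fun k => (k == 0%N)%:R) = nat_pmf P N 0.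
Proof.
rewrite /nat_expect /nat_pmf /Rintegral; congr fine.
transitivity (\int[P]_w (\1_(N @^-1` [set 0%N]) w)%:E)%E; last first.
  by rewrite integral_indic ?setIT// -[X in measurable X]setTI; exact: mN.
apply: eq_integral => w _; rewrite indicE; congr ((nat_of_bool _)%:R%:E).
by apply/idP/idP => [/eqP H|]; [exact/mem_set|rewrite inE => /eqP].
Qed.

Lemma nat_integrable_exprn (u : R) : 0 <= u <= 1 -> nat_integrable (fun k => (1 - u) ^+ k).
Proof.
move=> /andP[u0 u1]; apply: (nat_integrable_le (nat_integrable_cst 1)) => k.
by rewrite normr_exprn_le1// subr_ge0 u1 gerBl.
Qed.

Lemma nat_integrable_sq_log : nat_integrable (fun k => k%:R ^+ 2 * ln (1 + k%:R)) ->
  nat_integrable (fun k => k%:R ^+ 2).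
Proof.
move=> Nlog; have H : nat_integrable (fun k => 1 + (ln 2)^-1 * (k%:R ^+ 2 * ln (1 + k%:R))).
  apply: nat_integrableD; [exact: nat_integrable_cst|exact: nat_integrableZ].
apply: (nat_integrable_le H) => k; rewrite ger0_norm ?exprn_ge0//.
have ln2 : 0 < ln 2 :> R by rewrite ln_gt0// ltr1n.
case: k => [|k]; first by rewrite expr0n/= mul0r mulr0 addr0.
rewrite ler_wpDl// mulrCA ler_peMr ?exprn_ge0//.
rewrite -(@ler_pM2l _ (ln 2))// mulr1 mulrA mulfV ?gt_eqF// mul1r ler_ln ?posrE//.
by rewrite nat1r ler_nat.
Qed.

Hypothesis N2 : nat_integrable (fun k => k%:R ^+ 2).

Lemma nat_integrable_sq (g : nat -> R) (C : R) :
  (forall k, `|g k| <= C * (1 + k%:R ^+ 2)) -> nat_integrable g.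
Proof.
move=> gC; apply: nat_integrable_le gC; apply: nat_integrableZ.
by apply: nat_integrableD => //; exact: nat_integrable_cst.
Qed.

Lemma le_natr_sq k : k%:R <= k%:R ^+ 2 :> R.
Proof. by rewrite -natrX ler_nat; case: k => // k; rewrite -mulnn leq_pmulr. Qed.

Lemma nat_integrable_id : nat_integrable (fun k => k%:R).
Proof.
apply: (nat_integrable_sq (C := 1)) => k; rewrite mul1r ger0_norm//.
by rewrite ler_wpDl// le_natr_sq.
Qed.

Lemma nat_integrable_bern (u : R) : 0 <= u <= 1 -> nat_integrable (fun k => bern k u).
Proof.
move=> u01; apply: nat_integrableD.
  by apply: nat_integrableD; [exact: nat_integrable_exprn|exact: nat_integrable_cst].
by under [X in nat_integrable X]eq_fun do rewrite mulrC; exact/nat_integrableZ/nat_integrable_id.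
Qed.

Lemma nat_expect_bern (u : R) : 0 <= u <= 1 ->
  nat_expect (fun k => bern k u) =
  nat_expect (fun k => (1 - u) ^+ k) - 1 + nat_expect (fun k => k%:R) * u.
Proof.
move=> u01; rewrite /bern nat_expectD.
- rewrite nat_expectB ?nat_expect_cst//.
  + congr (_ + _); rewrite [RHS]mulrC -nat_expectZ ?nat_integrable_id//.
    by congr nat_expect; apply/funext => k; rewrite mulrC.
  + exact: nat_integrable_exprn.
  + exact: nat_integrable_cst.
- by apply: nat_integrableD; [exact: nat_integrable_exprn|exact: nat_integrable_cst].
- by under [X in nat_integrable X]eq_fun do rewrite mulrC; exact/nat_integrableZ/nat_integrable_id.
Qed.

End nat_expectation.

(** * The survival map of a critical law and its Lyapunov function *)

Section critical_offspring.
Context d (Omega : measurableType d) (R : realType) (P : probability Omega R).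
Context (N M : Omega -> nat) (mN : measurable_fun setT N) (mM : measurable_fun setT M).
Context (p0 h0 beta gamma sigma : R).
Implicit Types (u : R) (k : nat).
Local Notation E := (nat_expect P N).
Local Notation EM := (nat_expect P M).
Hypothesis Nlog : nat_integrable P N (fun k => k%:R ^+ 2 * ln (1 + k%:R)).
Hypothesis M2 : nat_integrable P M (fun k => k%:R ^+ 2).
Hypothesis N1 : E (fun k => k%:R) = 1.
Hypothesis N2 : E (fun k => k%:R * (k%:R - 1) / 2) = gamma.
Hypothesis M1 : EM (fun k => k%:R) = beta.
Hypothesis p0E : p0 = nat_pmf P N 0.
Hypothesis h0E : h0 = nat_pmf P M 0.
Hypothesis p001 : 0 < p0 < 1.
Hypothesis h00 : 0 < h0.
Hypothesis gamma0 : 0 < gamma.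
Hypothesis beta0 : 0 < beta.
Hypothesis sigmaE : sigma = beta / gamma.

Let intN2 : nat_integrable P N (fun k => k%:R ^+ 2).
Proof. exact: nat_integrable_sq_log Nlog. Qed.

Definition off_surv u : R := 1 - E (fun k => (1 - u) ^+ k).
Definition imm_pgf u : R := EM (fun k => (1 - u) ^+ k).
(** [off_eta] measures the second-order error of the survival map in units of u^2. [off_log] is its
    potential: u times the derivative of k^2 ln (1 + k u) is the summand of [off_eta]. *)
Definition off_eta u : R := E (fun k => k%:R ^+ 2 * (k%:R * u / (1 + k%:R * u))).
Definition off_log u : R := E (fun k => k%:R ^+ 2 * ln (1 + k%:R * u)).

Let itvW u : 0 < u <= 1 -> 0 <= u <= 1.
Proof. by case/andP => u0 ->; rewrite ltW. Qed.

Lemma off_survE u : 0 <= u <= 1 -> E (fun k => bern k u) = u - off_surv u.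
Proof.
by move=> u01; rewrite nat_expect_bern// N1 /off_surv; ring.
Qed.

Let int_bern u : 0 <= u <= 1 -> nat_integrable P N (fun k => bern k u).
Proof. exact: nat_integrable_bern. Qed.

Let int_ind : nat_integrable P N (fun k => (k == 0%N)%:R).
Proof.
apply: (nat_integrable_le mN (@nat_integrable_cst _ _ _ P N 1)) => k.
by rewrite ger0_norm//; case: (k == 0%N).
Qed.

(** Average of [bern_lb]: the mean of k - 1 vanishes, so only the mass at 0 is left. *)
Lemma off_surv_ub u : 0 < u <= 1 -> p0 * u ^+ 2 <= u - off_surv u.
Proof.
move=> /itvW u01; rewrite -off_survE// mulrC p0E -(nat_expect0 _ mN).
rewrite -[X in _ * X](_ : E (fun k => k%:R - 1 + (k == 0%N)%:R) = _); last first.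
  rewrite nat_expectD// ?nat_expectB// ?N1 ?nat_expect_cst ?subrr ?add0r//.
  - exact: nat_integrable_id.
  - exact: nat_integrable_cst.
  - by apply: nat_integrableB => //; [exact: nat_integrable_id|exact: nat_integrable_cst].
have H : nat_integrable P N (fun k => k%:R - 1 + (k == 0%N)%:R).
  apply: nat_integrableD => //.
  by apply: nat_integrableB => //; [exact: nat_integrable_id|exact: nat_integrable_cst].
rewrite -nat_expectZ//; apply: nat_expect_le => //.
- exact: nat_integrableZ.
- exact: int_bern.
- by move=> k; rewrite mulrC bern_lb.
Qed.

(** The bound (1 - u)^k <= 1 - u, valid for k >= 1, is averaged with the value k = 0 treated
    apart. *)
Lemma off_surv_lb u : 0 < u <= 1 -> (1 - p0) * u <= off_surv u.
Proof.
move=> /itvW /[dup] /andP[u0 u1] u01; rewrite /off_surv p0E -(nat_expect0 _ mN).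
have : E (fun k => (1 - u) ^+ k) <= E (fun k => u * (k == 0%N)%:R + (1 - u)).
  apply: nat_expect_le.
  - exact: nat_integrable_exprn.
  - by apply: nat_integrableD; [exact: nat_integrableZ|exact: nat_integrable_cst].
  - move=> [|k]; first by rewrite expr0 eqxx mulr1 addrC subrK.
    rewrite /= mulr0 add0r exprS ler_piMr ?subr_ge0// exprn_ile1 ?subr_ge0//.
    by rewrite gerBl.
rewrite nat_expectD; [|exact: nat_integrableZ|exact: nat_integrable_cst].
rewrite nat_expect_cst nat_expectZ//.
move: (E _) (E _) => x' e' H; rewrite -subr_ge0.
by rewrite (_ : _ - _ = u * x' + (1 - u) - e') ?subr_ge0//; ring.
Qed.

Let int_eta u : 0 <= u -> nat_integrable P N (fun k => k%:R ^+ 2 * (k%:R * u / (1 + k%:R * u))).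
Proof.
move=> u0; apply: (nat_integrable_le mN intN2) => k.
have ku : 0 <= k%:R * u by rewrite mulr_ge0.
have D0 : 0 < 1 + k%:R * u by rewrite ltr_pwDl.
rewrite ger0_norm; last by rewrite mulr_ge0 ?exprn_ge0// divr_ge0// ltW.
by rewrite ler_piMr ?exprn_ge0// ler_pdivrMr// mul1r lerDr.
Qed.

Let int_gap u : 0 <= u <= 1 -> nat_integrable P N (fun k => bern_gap k u).
Proof.
move=> /[dup] /andP[u0 u1] u01.
apply: (nat_integrable_le mN (nat_integrableZ (2 * u ^+ 2) (int_eta u0))) => k.
by rewrite ger0_norm ?bern_gap_ge0// bern_gap_ub.
Qed.

Let int_fact : nat_integrable P N (fun k => k%:R * (k%:R - 1) / 2).
Proof.
rewrite (_ : (fun k => _) = (fun k => 2^-1 * (k%:R ^+ 2 - k%:R))).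
  by apply: nat_integrableZ; apply: nat_integrableB => //; exact: nat_integrable_id.
by apply/funext => k; rewrite mulrC; congr (_ * _); ring.
Qed.

Lemma off_surv_gap u : 0 <= u <= 1 ->
  0 <= gamma * u ^+ 2 - (u - off_surv u) <= 2 * u ^+ 2 * off_eta u.
Proof.
move=> /[dup] /andP[u0 u1] u01.
have -> : gamma * u ^+ 2 - (u - off_surv u) = E (fun k => bern_gap k u).
  rewrite -N2 -off_survE// [RHS]nat_expectB; last 2 first.
  - under [X in nat_integrable _ _ X]eq_fun do rewrite mulrC.
    exact/nat_integrableZ/int_fact.
  - exact: int_bern.
  congr (_ - _); rewrite mulrC -nat_expectZ//.
  by congr nat_expect; apply/funext => k; rewrite mulrC.
rewrite nat_expect_ge0/=; last by move=> k; exact: bern_gap_ge0.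
rewrite /off_eta -nat_expectZ//; last exact: int_eta.
apply: nat_expect_le => //; [exact: int_gap|exact/nat_integrableZ/int_eta|].
by move=> k; exact: bern_gap_ub.
Qed.

Definition lam_cst : R :=
  EM (fun k => k%:R ^+ 2) + sigma * gamma ^+ 2 / (1 - p0) + beta ^+ 2 / h0.

(** Each term pays for one kind of error: under u -> F(u) the linear term drops by at least a
    multiple of u^2, and [off_log] by at least a multiple of u off_eta(u). [lam_cst] collects the
    coefficients of u^2 in [off_surv_ratio] and [imm_pgf_ratio]. *)
Definition off_Lam u : R := (lam_cst / p0) * u + (2 * sigma / p0) * off_log u.

Definition off_varpi u : R := 2 * off_eta u + gamma ^+ 2 * u / (1 - p0).

Let sigma0 : 0 < sigma. Proof. by rewrite sigmaE divr_gt0. Qed.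

Lemma ln_inv1B_itv (w : R) : 0 <= w < 1 -> w <= - ln (1 - w) <= w + w ^+ 2 / (1 - w).
Proof.
move=> /andP[w0 w1]; have D0 : 0 < 1 - w by rewrite subr_gt0.
apply/andP; split.
  by rewrite lerNr (@le_ln1Dx _ (- w))// ltrNl opprK.
rewrite -lnV ?posrE// [X in ln X](_ : _ = 1 + (w + w ^+ 2 / (1 - w))); last first.
  by field; rewrite gt_eqF.
rewrite le_ln1Dx// (lt_le_trans (ltrN10 _))// addr_ge0// divr_ge0 ?exprn_ge0//.
exact: ltW.
Qed.

(** With w = 1 - F(u) / u the logarithm is - ln (1 - w). Here w lies between gamma u - 2 u
    off_eta(u) and gamma u, and w <= p0 keeps 1 - w away from 0. *)
Lemma off_surv_ratio u : 0 < u <= 1 ->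
  gamma * u - 2 * u * off_eta u <= ln (u / off_surv u) <=
  gamma * u + gamma ^+ 2 / (1 - p0) * u ^+ 2.
Proof.
move=> u01; have /andP[u0 u1] := u01; have /andP[p00 p01] := p001.
have Fl := off_surv_lb u01; have Fu := off_surv_ub u01.
have /andP[g1 g2] := off_surv_gap (itvW u01).
have F0 : 0 < off_surv u by rewrite (lt_le_trans _ Fl)// mulr_gt0 ?subr_gt0.
set w := (u - off_surv u) / u.
have w0 : 0 <= w.
  by rewrite divr_ge0 ?ltW// (lt_le_trans _ Fu)// mulr_gt0// exprn_gt0.
have w1 : w <= p0.
  rewrite ler_pdivrMr//; move: Fl; rewrite mulrBl mul1r; lra.
have wg : w <= gamma * u.
  by rewrite ler_pdivrMr// -mulrA -expr2; lra.
have gw : gamma * u - 2 * u * off_eta u <= w.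
  rewrite ler_pdivlMr// mulrBl -!mulrA -expr2.
  by rewrite [off_eta u * u]mulrC !mulrA -[2 * u * u]mulrA -expr2; lra.
have -> : u / off_surv u = (1 - w)^-1.
  by rewrite /w; field; rewrite !gt_eqF//= subKr.
have wlt1 : w < 1 by rewrite (le_lt_trans w1).
rewrite lnV ?posrE ?subr_gt0//.
have /andP[l1 l2] : w <= - ln (1 - w) <= w + w ^+ 2 / (1 - w) by apply: ln_inv1B_itv; rewrite w0.
rewrite (le_trans gw l1)/= (le_trans l2)// lerD//.
rewrite [leRHS]mulrAC -exprMn ler_pM ?exprn_ge0//.
- by rewrite invr_ge0 subr_ge0 ltW.
- by rewrite lerXn2r ?nnegrE// mulr_ge0 ?(ltW gamma0) ?(ltW u0).
- by rewrite lef_pV2 ?posrE ?subr_gt0// lerB.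
Qed.

Lemma imm_pgf_gt0 u : 0 < u <= 1 -> h0 <= imm_pgf u.
Proof.
move=> /itvW u01; rewrite /imm_pgf h0E -(nat_expect0 _ mM).
have /andP[u0 u1] := u01.
apply: nat_expect_le; last first.
  by move=> [|k]; rewrite ?expr0//= exprn_ge0// subr_ge0.
- exact: nat_integrable_exprn.
apply: (nat_integrable_le mM (@nat_integrable_cst _ _ _ P M 1)) => k.
by rewrite ger0_norm//; case: (k == 0%N).
Qed.

(** Same expansion with v = 1 - h(1 - u): the second moment bounds beta u - v, and 1 - v >= h0
    bounds the quadratic term of the logarithm. *)
Lemma imm_pgf_ratio u : 0 < u <= 1 ->
  - (beta * u) - beta ^+ 2 / h0 * u ^+ 2 <= ln (imm_pgf u) <=
  - (beta * u) + EM (fun k => k%:R ^+ 2) * u ^+ 2.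
Proof.
move=> u01; have /andP[u0 u1] := u01; have H0 := imm_pgf_gt0 u01.
set v := 1 - imm_pgf u.
have vE : EM (fun k => bern k u) = beta * u - v.
  by rewrite nat_expect_bern ?itvW// M1 /v /imm_pgf; ring.
have b0 : 0 <= beta * u - v.
  by rewrite -vE nat_expect_ge0// => k; rewrite bern_ge0// itvW.
have b1 : beta * u - v <= EM (fun k => k%:R ^+ 2) * u ^+ 2.
  rewrite -vE mulrC -nat_expectZ//; apply: nat_expect_le.
  - by apply: nat_integrable_bern => //; exact: itvW.
  - exact: nat_integrableZ.
  move=> k; rewrite (le_trans (bern_ub k (itvW u01)))// mulrC ler_wpM2l//.
    by rewrite exprn_ge0// ltW.
  by have : 0 <= k%:R :> R by []; nra.
have v0 : 0 <= v.
  rewrite subr_ge0 -(nat_expect_cst P M 1); apply: nat_expect_le.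
  - by apply: nat_integrable_exprn => //; exact: itvW.
  - exact: nat_integrable_cst.
  - by move=> k; rewrite exprn_ile1 ?subr_ge0// gerBl ltW.
have v1 : v < 1 by rewrite /v gtrBl (lt_le_trans h00).
have -> : imm_pgf u = 1 - v by rewrite /v subKr.
have /andP[l1 l2] : v <= - ln (1 - v) <= v + v ^+ 2 / (1 - v) by apply: ln_inv1B_itv; rewrite v0.
have l3 : v ^+ 2 / (1 - v) <= beta ^+ 2 / h0 * u ^+ 2.
  rewrite [leRHS]mulrAC -exprMn ler_pM ?exprn_ge0//.
  - by rewrite invr_ge0 subr_ge0 ltW.
  - by rewrite lerXn2r ?nnegrE ?mulr_ge0// ?(ltW u0) ?(ltW beta0)// -subr_ge0.
  - by rewrite lef_pV2 ?posrE ?subr_gt0// /v subKr.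
by apply/andP; split; lra.
Qed.



Let int_log u : 0 <= u <= 1 -> nat_integrable P N (fun k => k%:R ^+ 2 * ln (1 + k%:R * u)).
Proof.
move=> /andP[u0 u1]; apply: (nat_integrable_le mN Nlog) => k.
have ku : 0 <= k%:R * u by rewrite mulr_ge0.
rewrite ger0_norm ?mulr_ge0 ?exprn_ge0 ?ln_ge0 ?lerDl//.
rewrite ler_wpM2l ?exprn_ge0// ler_ln ?posrE ?ltr_pwDl// lerD2l.
by rewrite ler_piMr.
Qed.

(** Termwise, ln ((1 + a) / (1 + b)) >= (a - b) / (1 + a) with a = k u and b = k F(u), and a - b >=
    p0 k u^2. *)
Lemma off_log_drop u : 0 < u <= 1 ->
  p0 * (u * off_eta u) <= off_log u - off_log (off_surv u).
Proof.
move=> u01; have /andP[u0 u1] := u01; have /andP[p00 p01] := p001.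
have Fl := off_surv_lb u01; have Fu := off_surv_ub u01.
have F0 : 0 < off_surv u by rewrite (lt_le_trans _ Fl)// mulr_gt0 ?subr_gt0.
have Fleu : off_surv u <= u.
  by rewrite -subr_ge0 (le_trans _ Fu)// mulr_ge0 ?exprn_ge0// ltW.
have F01 : 0 < off_surv u <= 1 by rewrite F0 (le_trans Fleu).
rewrite /off_log /off_eta -nat_expectB; [|exact/int_log/itvW|exact/int_log/itvW].
rewrite mulrA -nat_expectZ//; last exact/int_eta/ltW.
apply: nat_expect_le.
- exact/nat_integrableZ/int_eta/ltW.
- by apply: nat_integrableB; apply/int_log/itvW.
move=> k; rewrite -mulrBr mulrCA ler_wpM2l ?exprn_ge0//.
set a := k%:R * u; set b := k%:R * off_surv u.
have a0 : 0 <= a by rewrite mulr_ge0// ltW.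
have b0 : 0 <= b by rewrite mulr_ge0// ltW.
rewrite -ln_div ?posrE ?ltr_pwDl//.
have D0 : 0 < 1 + a by rewrite ltr_pwDl.
have D1 : 0 < 1 + b by rewrite ltr_pwDl.
have H : 1 - (1 + b) / (1 + a) <= ln ((1 + a) / (1 + b)).
  rewrite -[(1 + a) / _]invrK invf_div lnV ?posrE ?divr_gt0// lerNr opprB.
  have -> : (1 + b) / (1 + a) = 1 + ((1 + b) / (1 + a) - 1) by rewrite [RHS]addrC subrK.
  rewrite [leRHS]addrAC subrr add0r le_ln1Dx// ltrBDl subrr divr_gt0//.
apply: le_trans H; rewrite mulrA.
have -> : 1 - (1 + b) / (1 + a) = (a - b) / (1 + a) by field; rewrite gt_eqF.
rewrite ler_wpM2r ?invr_ge0 ?(ltW D0)// /a /b -mulrBr mulrCA ler_wpM2l//.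
by rewrite -mulrA -expr2.
Qed.

Lemma off_Lam_ge0 u : 0 < u <= 1 -> 0 <= off_Lam u.
Proof.
move=> u01; have /andP[u0 u1] := u01; have /andP[p00 p01] := p001.
rewrite addr_ge0// mulr_ge0//.
- rewrite divr_ge0 ?(ltW p00)// !addr_ge0//.
  + by apply: nat_expect_ge0 => k; rewrite exprn_ge0.
  + by rewrite divr_ge0 ?mulr_ge0 ?exprn_ge0 ?subr_ge0 ?(ltW sigma0) ?(ltW gamma0) ?(ltW p01).
  + by rewrite divr_ge0 ?exprn_ge0 ?(ltW beta0) ?(ltW h00).
- exact: ltW.
- by rewrite divr_ge0 ?mulr_ge0 ?(ltW sigma0) ?(ltW p00).
- apply: nat_expect_ge0 => k; rewrite mulr_ge0 ?exprn_ge0// ln_ge0// lerDl mulr_ge0//.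
  exact: ltW.
Qed.

(** The linear terms - beta u and sigma gamma u cancel because sigma = beta / gamma; the remaining
    terms in u^2 and u off_eta(u) are paid for by the drop of [off_Lam]. *)
Lemma off_ln u : 0 < u <= 1 ->
  `|ln (imm_pgf u) + sigma * ln (u / off_surv u)| <= off_Lam u - off_Lam (off_surv u).
Proof.
move=> u01; have /andP[u0 u1] := u01; have /andP[p00 p01] := p001.
have /andP[r1 r2] := off_surv_ratio u01; have /andP[i1 i2] := imm_pgf_ratio u01.
have sg : sigma * gamma = beta by rewrite sigmaE divfK// gt_eqF.
have Fu := off_surv_ub u01.
have eta0 : 0 <= off_eta u.
  apply: nat_expect_ge0 => k; have ku : 0 <= k%:R * u by rewrite mulr_ge0// ltW.
  by rewrite mulr_ge0 ?exprn_ge0// divr_ge0// addr_ge0.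
have c1 : 0 <= EM (fun k => k%:R ^+ 2) by apply: nat_expect_ge0 => k; rewrite exprn_ge0.
have c2 : 0 <= sigma * gamma ^+ 2 / (1 - p0).
  by rewrite divr_ge0 ?mulr_ge0 ?exprn_ge0 ?subr_ge0 ?(ltW sigma0) ?(ltW gamma0) ?(ltW p01).
have c3 : 0 <= beta ^+ 2 / h0 by rewrite divr_ge0 ?exprn_ge0 ?(ltW beta0) ?(ltW h00).
apply: (@le_trans _ _ (lam_cst * u ^+ 2 + 2 * sigma * (u * off_eta u))); last first.
  rewrite /off_Lam opprD addrACA -!mulrBr lerD//.
    by rewrite -mulrA ler_wpM2l ?addr_ge0// ler_pdivlMl.
  have H := off_log_drop u01.
  rewrite -[_ / p0 * _]mulrA ler_wpM2l ?mulr_ge0 ?(ltW sigma0)//.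
  by rewrite ler_pdivlMl.
have u2 : 0 <= u ^+ 2 by rewrite exprn_ge0// ltW.
have r1' := ler_wpM2l (ltW sigma0) r1; have r2' := ler_wpM2l (ltW sigma0) r2.
have d1 := mulr_ge0 c1 u2; have d2 := mulr_ge0 c2 u2; have d3 := mulr_ge0 c3 u2.
have e0 : 0 <= sigma * (u * off_eta u) by rewrite !mulr_ge0 ?(ltW sigma0)// ltW.
have E1 : sigma * (gamma * u - 2 * u * off_eta u) = beta * u - 2 * (sigma * (u * off_eta u)).
  by rewrite -sg; ring.
have E2 : sigma * (gamma * u + gamma ^+ 2 / (1 - p0) * u ^+ 2) =
    beta * u + sigma * gamma ^+ 2 / (1 - p0) * u ^+ 2.
  by rewrite -sg; ring.
rewrite /lam_cst [(_ + _ + _) * _]mulrDl [(_ + _) * u ^+ 2]mulrDl -[2 * sigma * _]mulrA.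
by move: r1' r2'; rewrite E1 E2 => r1' r2'; rewrite ler_norml; apply/andP; split; lra.
Qed.

Lemma off_eta_ndecr u v : 0 < u -> u <= v -> v <= 1 -> off_eta u <= off_eta v.
Proof.
move=> u0 uv v1; have v0 : 0 < v by exact: lt_le_trans uv.
apply: nat_expect_le; [exact/int_eta/ltW|exact/int_eta/ltW|] => k.
rewrite ler_wpM2l ?exprn_ge0//.
have ku : 0 <= k%:R * u by rewrite mulr_ge0// ltW.
have kuv : k%:R * u <= k%:R * v by rewrite ler_wpM2l.
rewrite ler_pdivrMr ?ltr_pwDl// mulrAC ler_pdivlMr; last by rewrite ltr_pwDl// (le_trans ku).
by rewrite !mulrDr !mulr1 lerD// mulrC.
Qed.

Lemma off_varpi_ndecr u v : 0 < u -> u <= v -> v <= 1 -> off_varpi u <= off_varpi v.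
Proof.
move=> u0 uv v1; have /andP[p00 p01] := p001.
rewrite lerD// ?ler_wpM2l ?off_eta_ndecr// ler_wpM2r ?invr_ge0 ?subr_ge0 ?(ltW p01)//.
by rewrite ler_wpM2l// exprn_ge0// ltW.
Qed.

Lemma off_invF u : 0 < u <= 1 ->
  `|(off_surv u)^-1 - u^-1 - gamma| <= off_varpi u.
Proof.
move=> u01; have /andP[u0 u1] := u01; have /andP[p00 p01] := p001.
have Fl := off_surv_lb u01; have Fu := off_surv_ub u01.
have /andP[g1 g2] := off_surv_gap (itvW u01).
have F0 : 0 < off_surv u by rewrite (lt_le_trans _ Fl)// mulr_gt0 ?subr_gt0.
have eta0 : 0 <= off_eta u.
  apply: nat_expect_ge0 => k; have ku : 0 <= k%:R * u by rewrite mulr_ge0// ltW.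
  by rewrite mulr_ge0 ?exprn_ge0// divr_ge0// addr_ge0.
have Fleu : off_surv u <= u.
  by rewrite -subr_ge0 (le_trans _ Fu)// mulr_ge0 ?exprn_ge0// ltW.
have E1 : (off_surv u)^-1 - u^-1 = (u - off_surv u) / (u * off_surv u).
  by field; rewrite !gt_eqF.
rewrite ler_norml lerBrDr lerBlDr E1; apply/andP; split.
  rewrite ler_pdivlMr ?mulr_gt0//.
  have : (- off_varpi u + gamma) * (u * off_surv u) <= (gamma - 2 * off_eta u) * (u * off_surv u).
    rewrite ler_wpM2r ?mulr_ge0 ?(ltW u0) ?(ltW F0)// /off_varpi addrC lerD2l lerN2.
    by rewrite lerDl divr_ge0 ?mulr_ge0 ?exprn_ge0 ?subr_ge0 ?(ltW u0) ?(ltW gamma0) ?(ltW p01).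
  move=> /le_trans; apply.
  (* As F(u) <= u, the product u F(u) may be replaced by u^2 when the coefficient is nonnegative;
     when it is negative the left side is nonpositive. *)
  have [c0|c0] := leP 0 (gamma - 2 * off_eta u); last first.
    apply: (@le_trans _ _ 0); last by rewrite subr_ge0.
    by rewrite mulr_le0_ge0 ?(ltW c0)// mulr_ge0 ?(ltW u0) ?(ltW F0).
  apply: (@le_trans _ _ ((gamma - 2 * off_eta u) * (u * u))).
    by rewrite ler_wpM2l// ler_wpM2l// ltW.
  by rewrite -expr2 mulrBl -[2 * _ * _]mulrAC; lra.
rewrite ler_pdivrMr ?mulr_gt0//.
apply: (@le_trans _ _ (gamma * u ^+ 2)); first by lra.
rewrite expr2 [leLHS]mulrCA [leRHS]mulrCA ler_wpM2l ?(ltW u0)//.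
have h1 : gamma ^+ 2 * u * u <= gamma ^+ 2 * u / (1 - p0) * off_surv u.
  rewrite -[leRHS]mulrA ler_wpM2l ?mulr_ge0 ?exprn_ge0 ?(ltW gamma0) ?(ltW u0)//.
  by rewrite mulrC ler_pdivlMr ?subr_gt0// mulrC.
have h2 : 0 <= 2 * off_eta u * off_surv u by rewrite !mulr_ge0 ?(ltW F0).
have h3 : gamma * (u - gamma * u ^+ 2) <= gamma * off_surv u.
  by rewrite ler_wpM2l ?(ltW gamma0)//; lra.
rewrite /off_varpi !mulrDl.
have h4 : gamma * (u - gamma * u ^+ 2) = gamma * u - gamma ^+ 2 * u * u by ring.
by move: h3; rewrite h4; lra.
Qed.


Lemma off_eta_cvg0 (u_ : nat -> R) : (forall n, 0 < u_ n <= 1) ->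
  u_ n @[n --> \oo] --> (0 : R) -> off_eta (u_ n) @[n --> \oo] --> (0 : R).
Proof.
move=> u01 u_0; rewrite -(nat_expect_cst P N 0).
apply: (@dominated_cvg_Rintegral _ _ _ P setT _ _ (fun w => (N w)%:R ^+ 2)) => //.
- move=> n; exact: (@measurable_nat_comp _ _ _ _ mN
    (fun k => k%:R ^+ 2 * (k%:R * u_ n / (1 + k%:R * u_ n)))).
- move=> w _; set a := (N w)%:R.
  rewrite -[X in _ --> X](mulr0 (a ^+ 2)); apply: cvgMr.
  rewrite -[X in _ --> X](mul0r (1 + 0 : R)^-1); apply: cvgM.
    by rewrite -[X in _ --> X](mulr0 a); exact: cvgMr.
  apply: cvgV; first by rewrite addr0 oner_neq0.
  by apply: cvgD; [exact: cvg_cst|rewrite -[X in _ --> X](mulr0 a); exact: cvgMr].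
- move=> n w _; have /andP[u0 u1] := u01 n.
  have ku : 0 <= (N w)%:R * u_ n by rewrite mulr_ge0// ltW.
  have D0 : 0 < 1 + (N w)%:R * u_ n by rewrite ltr_pwDl.
  rewrite ger0_norm; last by rewrite mulr_ge0 ?exprn_ge0// divr_ge0// ltW.
  by rewrite ler_piMr ?exprn_ge0// ler_pdivrMr// mul1r lerDr.
Qed.

(** Dominated convergence under k^2 ln (1 + k), integrable by the logarithmic moment of the
    offspring law. *)
Lemma off_log_cvg0 (u_ : nat -> R) : (forall n, 0 < u_ n <= 1) ->
  u_ n @[n --> \oo] --> (0 : R) -> off_log (u_ n) @[n --> \oo] --> (0 : R).
Proof.
move=> u01 u_0; rewrite -(nat_expect_cst P N 0).
apply: (@dominated_cvg_Rintegral _ _ _ P setT _ _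
  (fun w => (N w)%:R ^+ 2 * ln (1 + (N w)%:R))) => //.
- move=> n; exact: (@measurable_nat_comp _ _ _ _ mN (fun k => k%:R ^+ 2 * ln (1 + k%:R * u_ n))).
- move=> w _; set a := (N w)%:R.
  rewrite -[X in _ --> X](mulr0 (a ^+ 2)); apply: cvgMr.
  rewrite -(@ln1 R); apply: continuous_cvg; first exact: continuous_ln.
  rewrite -[X in _ --> X](addr0 1); apply: cvgD; first exact: cvg_cst.
  by rewrite -[X in _ --> X](mulr0 a); exact: cvgMr.
- move=> n w _; have /andP[u0 u1] := u01 n.
  have ku : 0 <= (N w)%:R * u_ n by rewrite mulr_ge0// ltW.
  rewrite ger0_norm; last by rewrite mulr_ge0 ?exprn_ge0// ln_ge0// lerDl.
  rewrite ler_wpM2l ?exprn_ge0// ler_ln ?posrE ?ltr_pwDl// lerD2l.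
  by rewrite ler_piMr.
Qed.

Lemma off_Lam_cvg0 (u_ : nat -> R) : (forall n, 0 < u_ n <= 1) ->
  u_ n @[n --> \oo] --> (0 : R) -> off_Lam (u_ n) @[n --> \oo] --> (0 : R).
Proof.
move=> u01 u_0; rewrite -[X in _ --> X](addr0 0).
apply: cvgD; first by rewrite -[X in _ --> X](mulr0 (lam_cst / p0)); exact: cvgMr.
by rewrite -[X in _ --> X](mulr0 (2 * sigma / p0)); apply: cvgMr; exact: off_log_cvg0.
Qed.

Lemma off_varpi_cvg0 (u_ : nat -> R) : (forall n, 0 < u_ n <= 1) ->
  u_ n @[n --> \oo] --> (0 : R) -> off_varpi (u_ n) @[n --> \oo] --> (0 : R).
Proof.
move=> u01 u_0; rewrite -[X in _ --> X](addr0 0); apply: cvgD.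
  by rewrite -[X in _ --> X](mulr0 2); apply: cvgMr; exact: off_eta_cvg0.
rewrite -[X in _ --> X](mul0r (1 - p0)^-1); apply: cvgMl.
by rewrite -[X in _ --> X](mulr0 (gamma ^+ 2)); exact: cvgMr.
Qed.

Lemma off_Lam_le u : 0 < u <= 1 -> off_Lam u <= off_Lam 1.
Proof.
move=> u01; have /andP[u0 u1] := u01; have /andP[p00 p01] := p001.
rewrite lerD//.
  rewrite ler_wpM2l// divr_ge0 ?(ltW p00)// !addr_ge0//.
  + by apply: nat_expect_ge0 => k; rewrite exprn_ge0.
  + by rewrite divr_ge0 ?mulr_ge0 ?exprn_ge0 ?subr_ge0 ?(ltW sigma0) ?(ltW gamma0) ?(ltW p01).
  + by rewrite divr_ge0 ?exprn_ge0 ?(ltW beta0) ?(ltW h00).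
rewrite ler_wpM2l ?divr_ge0 ?mulr_ge0 ?(ltW sigma0) ?(ltW p00)//.
apply: nat_expect_le; [exact/int_log/itvW|by apply: int_log; rewrite ler01 lexx|].
move=> k; rewrite ler_wpM2l ?exprn_ge0// ler_ln ?posrE ?ltr_pwDl ?mulr_ge0 ?(ltW u0)//.
by rewrite lerD2l ler_wpM2l.
Qed.

Definition gwi_pgf n u : R := \prod_(j < n)
  EM (fun k => (iter j (fun t => E (fun i => t ^+ i)) (1 - u)) ^+ k).

Lemma gwi_pgfE n u : gwi_pgf n u = survival_prod off_surv imm_pgf n u.
Proof.
apply: eq_bigr => j _; rewrite /imm_pgf; congr nat_expect; apply/funext => k; congr (_ ^+ _).
elim: {k} (j : nat) => [//|k IH] /=; rewrite IH.
by rewrite /off_surv subKr.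
Qed.

Lemma gwi_pgf_ub : exists2 C, 0 < C & forall n u, 0 < u <= 1 ->
  gwi_pgf n u <= C * (1 + n%:R * u) `^ (- sigma).
Proof.
have /andP[p00 p01] := p001.
(* Since p0 < 1, p0 (1 + n u) <= 1 + p0 n u: the bound of [survival_prod_ub] becomes a power of 1 +
   n u at the price of p0^(- sigma). *)
exists (expR (off_Lam 1) * p0 `^ (- sigma)).
  by rewrite mulr_gt0 ?expR_gt0 ?powR_gt0.
move=> n u u01; rewrite gwi_pgfE; have /andP[u0 u1] := u01.
apply: (le_trans (@survival_prod_ub _ _ _ _ _ _ p001 sigma0 off_surv_ub off_surv_lb
  (fun u h => lt_le_trans h00 (imm_pgf_gt0 h)) off_Lam_ge0 off_ln n _ u01)).
rewrite -[leRHS]mulrA ler_pM ?expR_ge0 ?powR_ge0// ?ler_expR ?off_Lam_le//.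
have nu : 0 <= n%:R * u by rewrite mulr_ge0// ltW.
rewrite -powRM ?(ltW p00) ?addr_ge0// !powRN lef_pV2 ?posrE ?powR_gt0//; last 2 first.
- by rewrite ltr_pwDl// -mulrA mulr_ge0// ltW.
- by rewrite mulr_gt0// ltr_pwDl.
rewrite ge0_ler_powR ?(ltW sigma0) ?nnegrE//.
- by rewrite mulr_ge0 ?addr_ge0// ltW.
- by rewrite addr_ge0// -mulrA mulr_ge0// ltW.
by rewrite mulrDr mulr1 mulrA lerD2r ltW.
Qed.

Lemma gwi_pgf_cvg (u_ : nat -> R) : (forall n, 0 < u_ n <= 1) ->
  u_ n @[n --> \oo] --> (0 : R) ->
  (1 + gamma * n%:R * u_ n) `^ sigma * gwi_pgf n (u_ n) @[n --> \oo] --> (1 : R).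
Proof.
move=> u01 u_0.
have H := @survival_prod_cvg _ _ _ _ _ _ _ _ p001 gamma0 off_surv_ub off_surv_lb
  (fun u h => lt_le_trans h00 (imm_pgf_gt0 h)) off_Lam_ge0 off_ln
  off_varpi_ndecr off_invF u_ u01 (off_Lam_cvg0 u01 u_0) (off_varpi_cvg0 u01 u_0).
rewrite (_ : (fun n => _) =
  (fun n => (1 + gamma * n%:R * u_ n) `^ sigma * survival_prod off_surv imm_pgf n (u_ n))) //.
by apply/funext => n; rewrite gwi_pgfE.
Qed.

End critical_offspring.

(** * Factorial moments as left derivatives at 1 *)

Section power_series_derivative.
Context (R : realType).
Implicit Types (c : nat -> R) (x K r : R).

(** Each of the i + 1 powers r^0, ..., r^i is at least r^i, and their sum is below the geometric
    series. *)
Lemma natr_exprn_bound r i : 0 <= r < 1 -> i.+1%:R * r ^+ i <= (1 - r)^-1.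
Proof.
move=> /andP[r0 r1].
have H : i.+1%:R * r ^+ i <= \sum_(j < i.+1) r ^+ j.
  rewrite -[X in X%:R](card_ord i.+1) -sum1_card natr_sum mulr_suml.
  apply: ler_sum => j _; rewrite mul1r; apply: ler_wiXn2l => //; first exact: ltW.
  by rewrite -ltnS.
apply: (le_trans H).
rewrite -(@ler_pM2l _ (1 - r)) ?subr_gt0// mulfV ?gt_eqF ?subr_gt0//.
by rewrite -opprB mulNr -subrX1 opprB gerBl exprn_ge0.
Qed.

Lemma is_cvg_pseries_diffs c : (forall K, `|K| < 1 -> cvgn (pseries c K)) ->
  forall K, `|K| < 1 -> cvgn (pseries (pseries_diffs c) K).
Proof.
move=> cc K K1.
(* Two intermediate radii |K| < K1' < K2 < 1: the coefficients are bounded against K2^i, the ratio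
   |K| / K1' absorbs the factor n + 1, and K1' / K2 is the ratio of the majorizing geometric
   series. *)
pose K2 := (1 + `|K|) / 2; pose K1' := (`|K| + K2) / 2.
have K20 : 0 < K2 by rewrite divr_gt0// ltr_pwDl.
have K2lt1 : K2 < 1 by rewrite /K2; lra.
have KK2 : `|K| < K2 by rewrite /K2; lra.
have [B [Breal Bf]] := cvg_series_bounded (cc K2 ltac:(by rewrite ger0_norm// ltW)).
have {Breal}Bf i : `|c i * K2 ^+ i| <= B + 1 by apply: Bf => //; rewrite ltrDl.
have B0 : 0 <= B + 1 by apply: le_trans (Bf 0%N).
pose r := `|K| / K1'; pose q := K1' / K2.
have K1'0 : 0 < K1' by rewrite divr_gt0// ltr_wpDl.
have r01 : 0 <= r < 1.
  by rewrite divr_ge0 ?(ltW K1'0)//= ltr_pdivrMr// mul1r /K1'; lra.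
have q01 : 0 <= q < 1.
  by rewrite divr_ge0 ?(ltW K1'0) ?(ltW K20)//= ltr_pdivrMr// mul1r /K1'; lra.
apply: normed_cvg.
apply: (@series_le_cvg _ _ (geometric ((B + 1) / K2 * (1 - r)^-1) q)) => [n|n|n|].
- exact: normr_ge0.
- have /andP[_ /ltW r1] := r01; have /andP[q0 _] := q01.
  by rewrite /geometric /= !mulr_ge0 ?exprn_ge0// ?invr_ge0 ?(ltW K20)// subr_ge0.
- rewrite /geometric /= /pseries_diffs !normrM normr_nat normrX.
  have E : n.+1%:R * `|c n.+1| * `|K| ^+ n =
      (`|c n.+1 * K2 ^+ n.+1| / K2) * (n.+1%:R * r ^+ n) * q ^+ n.
    have aux (a b k z m : R) : 0 < a -> 0 < b ->
        m * z * k ^+ n = (z * (a * a ^+ n) / a) * (m * (k / b) ^+ n) * (b / a) ^+ n.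
      by move=> a0 b0; rewrite !expr_div_n; field; rewrite !expf_neq0 ?gt_eqF.
    by rewrite normrM (ger0_norm (exprn_ge0 _ (ltW K20))) exprS -aux.
  rewrite E ler_wpM2r ?exprn_ge0//; first by case/andP: q01.
  rewrite ler_pM// ?mulr_ge0 ?invr_ge0 ?(ltW K20)//.
  + by rewrite exprn_ge0//; case/andP: r01.
  + by rewrite ler_wpM2r ?invr_ge0 ?(ltW K20).
  + exact: natr_exprn_bound.
- apply: is_cvg_geometric_series; rewrite ger0_norm; by case/andP: q01.
Qed.

Lemma is_derive_pseries c x : (forall K, `|K| < 1 -> cvgn (pseries c K)) -> `|x| < 1 ->
  is_derive x (1 : R) (fun x => limn (pseries c x)) (limn (pseries (pseries_diffs c) x)).
Proof.
move=> cc x1; pose K := (1 + `|x|) / 2.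
have K1 : `|K| < 1 by rewrite ger0_norm ?divr_ge0 ?addr_ge0// /K; lra.
apply: (@pseries_snd_diffs _ _ K).
- exact: cc.
- exact: is_cvg_pseries_diffs.
- by apply: is_cvg_pseries_diffs => //; exact: is_cvg_pseries_diffs.
- by rewrite [X in _ < X]ger0_norm ?divr_ge0 ?addr_ge0// /K; lra.
Qed.

Lemma derive1n_pseries c n : (forall K, `|K| < 1 -> cvgn (pseries c K)) ->
  forall x, `|x| < 1 ->
  derive1n n (fun x => limn (pseries c x)) x = limn (pseries (iter n (@pseries_diffs R) c) x).
Proof.
elim: n => [//|n IH] cc x x1.
rewrite derive1nS derive1E.
have cn : forall m K, `|K| < 1 -> cvgn (pseries (iter m (@pseries_diffs R) c) K).
  by elim => [//|m IHm] K K1 /=; exact: is_cvg_pseries_diffs.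
have [_ <-] := is_derive_pseries (cn n) x1.
apply: near_eq_derive; near=> y; apply: IH => //.
near: y; apply: (@cvgr_norm_lt _ _ _ (nbhs x) _ id x) => //.
Unshelve. all: by end_near. Qed.

End power_series_derivative.

Lemma cvg_maxr0 (R : realType) (u : nat -> R) : u n @[n --> \oo] --> (1 : R) ->
  Num.max (u n) 0 @[n --> \oo] --> (1 : R).
Proof.
move=> u1; apply: (@cvg_dist_le _ _ (fun n => `|u n - 1|)); last first.
  by rewrite -(@normr0 _ R^o); apply: cvg_norm; apply/subr_cvg0.
apply: nearW => n; have [//|un0] := leP 0 (u n).
rewrite sub0r normrN normr1 distrC (le_trans _ (ler_norm _))//.
by rewrite lerBrDr gerDl ltW.
Qed.

Section pmf_series.
Context d (Omega : measurableType d) (R : realType) (P : probability Omega R).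
Context (N : Omega -> nat) (mN : measurable_fun setT N).

Lemma ge0_nat_expect_series (g : nat -> R) : (forall k, 0 <= g k) ->
  (\int[P]_w (g (N w))%:E = \sum_(0 <= k <oo) (nat_pmf P N k * g k)%:E)%E.
Proof.
move=> g0; rewrite (@ge0_integral_partition_nat _ _ _ _ N)//; last 2 first.
- by apply/measurable_EFinP; exact: measurable_nat_comp.
- by move=> w; rewrite lee_fin.
have mNk k : measurable (N @^-1` [set k]) by rewrite -[X in measurable X]setTI; exact: mN.
apply: eq_eseriesr => k _.
rewrite (eq_integral (fun=> (g k)%:E)); last by move=> w; rewrite inE/= => ->.
by rewrite integral_cst//= EFinM muleC /nat_pmf fineK// fin_num_measure.
Qed.

Lemma nat_integrable_series (g : nat -> R) : (forall k, 0 <= g k) ->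
  (\sum_(0 <= k <oo) (nat_pmf P N k * g k)%:E < +oo)%E -> nat_integrable P N g.
Proof.
move=> g0 H; apply/integrableP; split.
  by apply/measurable_EFinP; exact: measurable_nat_comp.
under eq_integral do rewrite /= ger0_norm//.
by rewrite ge0_nat_expect_series.
Qed.

Lemma nat_expect_cvg_series (g : nat -> R) : (forall k, 0 <= g k) ->
  nat_integrable P N g ->
  series (fun k => nat_pmf P N k * g k) @ \oo --> nat_expect P N g.
Proof.
move=> g0 intg.
have pg0 k : (0 <= (nat_pmf P N k * g k)%:E)%E by rewrite lee_fin mulr_ge0// fine_ge0.
have H : (fun n => (series (fun k => nat_pmf P N k * g k) n)%:E) @ \oo -->
    (nat_expect P N g)%:E.
  rewrite /nat_expect fineK; last exact: (@integrable_fin_num _ _ _ P _ measurableT _ intg).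
  rewrite ge0_nat_expect_series//.
  rewrite (_ : (fun n => _) = (fun n => \sum_(0 <= k < n) (nat_pmf P N k * g k)%:E)%E).
    by apply: is_cvg_nneseries => k _ _; exact: pg0.
  by apply/funext => n; rewrite /series/= sumEFin.
exact: (fine_cvg H).
Qed.

Lemma nat_pmf_ge0 k : 0 <= nat_pmf P N k. Proof. exact: fine_ge0. Qed.

Lemma nat_pmf_le1 k : nat_pmf P N k <= 1.
Proof.
have mNk : measurable (N @^-1` [set k]) by rewrite -[X in measurable X]setTI; exact: mN.
by rewrite -lee_fin /nat_pmf fineK ?fin_num_measure// probability_le1.
Qed.

Lemma is_cvg_pseries_pmf (K : R) : `|K| < 1 -> cvgn (pseries (nat_pmf P N) K).
Proof.
move=> K1; apply: normed_cvg.
apply: (@series_le_cvg _ _ (geometric 1 `|K|)) => [n|n|n|].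
- exact: normr_ge0.
- by rewrite /geometric /= mul1r exprn_ge0.
- rewrite /geometric /= normrM mul1r normrX ler_piMl ?exprn_ge0//.
  by rewrite ger0_norm ?nat_pmf_le1// nat_pmf_ge0.
- by apply: is_cvg_geometric_series; rewrite normr_id.
Qed.

Hypothesis N2 : nat_integrable P N (fun k => k%:R ^+ 2).

Lemma gen_fun_derive1 (s : R) : 0 <= s < 1 ->
  derive1n 1 (gen_fun (nat_pmf P N)) s = nat_expect P N (fun k => k%:R * s ^+ k.-1).
Proof.
move=> /andP[s0 s1].
have s1' : `|s| < 1 by rewrite ger0_norm.
rewrite (@derive1n_pseries _ (nat_pmf P N) 1 is_cvg_pseries_pmf s s1') /=.
have H1 := pseries_diffs_equiv (is_cvg_pseries_diffs is_cvg_pseries_pmf s1').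
have g0 (k : nat) : 0 <= k%:R * s ^+ k.-1 :> R by rewrite mulr_ge0// exprn_ge0.
have H2 : series (fun k => nat_pmf P N k * (k%:R * s ^+ k.-1)) @ \oo -->
   nat_expect P N (fun k => k%:R * s ^+ k.-1).
  apply: nat_expect_cvg_series => //.
  apply: (nat_integrable_le mN (nat_integrable_id mN N2)) => k.
  by rewrite ger0_norm// ler_piMr// exprn_ile1// ltW.
rewrite (_ : (fun k => nat_pmf P N k * (k%:R * s ^+ k.-1)) =
  (fun i => i%:R * nat_pmf P N i * s ^+ i.-1)) in H2; last by apply/funext => k; ring.
by rewrite -(cvg_lim _ H1)// -(cvg_lim _ H2).
Qed.

Lemma gen_fun_derive2 (s : R) : 0 <= s < 1 ->
  derive1n 2 (gen_fun (nat_pmf P N)) s =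
  nat_expect P N (fun k => k%:R * k.-1%:R * s ^+ k.-2).
Proof.
move=> /andP[s0 s1].
have s1' : `|s| < 1 by rewrite ger0_norm.
rewrite (@derive1n_pseries _ (nat_pmf P N) 2 is_cvg_pseries_pmf s s1') /=.
have H1 := pseries_diffs_equiv
  (is_cvg_pseries_diffs (is_cvg_pseries_diffs is_cvg_pseries_pmf) s1').
have g0 (k : nat) : 0 <= k%:R * k.-1%:R * s ^+ k.-2 :> R by rewrite mulr_ge0// exprn_ge0.
have H2 : series (fun k => nat_pmf P N k * (k%:R * k.-1%:R * s ^+ k.-2)) @ \oo -->
   nat_expect P N (fun k => k%:R * k.-1%:R * s ^+ k.-2).
  apply: nat_expect_cvg_series => //.
  apply: (nat_integrable_le mN N2) => k.
  rewrite ger0_norm// (@le_trans _ _ (k%:R * k.-1%:R))//.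
    by rewrite ler_piMr// ?mulr_ge0// exprn_ile1// ltW.
  by rewrite expr2 ler_wpM2l// ler_nat leq_pred.
rewrite -(cvg_lim _ H1)//; apply: cvg_lim => //.
rewrite -cvg_shiftS in H2.
rewrite (_ : series _ = (fun n => series (fun k => nat_pmf P N k * (k%:R * k.-1%:R * s ^+ k.-2)) n.+1)) //.
apply/funext => n; rewrite /series/= big_nat_recl//= !mul0r mulr0 add0r.
by apply: eq_bigr => i _; rewrite /pseries_diffs; ring.
Qed.

Lemma gen_fun_derive1_at1 :
  gen_fun_derive_at1 1 (nat_pmf P N) = (nat_expect P N (fun k => k%:R))%:E.
Proof.
apply: cvg_lim => //; apply: cvg_EFin; first exact: nearW.
(* Left limits are tested on sequences below 1, which may start below 0; truncation at 0 keeps the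
   integrand dominated at every index. *)
have H : nat_expect P N (fun k => k%:R * (Num.max s 0) ^+ k.-1) @[s --> 1^'-] -->
    nat_expect P N (fun k => k%:R).
  apply/cvg_at_leftP => u [u1 ucvg].
  apply: (@dominated_cvg_Rintegral _ _ _ P setT _ _ (fun w => (N w)%:R)) => //.
  - move=> n; exact: (@measurable_nat_comp _ _ _ _ mN (fun k => k%:R * Num.max (u n) 0 ^+ k.-1)).
  - exact: (@measurable_nat_comp _ _ _ _ mN (fun k => k%:R)).
  - exact: nat_integrable_id.
  - move=> w _; rewrite -[X in _ --> X]mulr1; apply: cvgMr.
    rewrite -[X in _ --> X](expr1n _ (N w).-1).
    apply: (@cvg_comp _ _ _ _ (fun x : R => x ^+ (N w).-1)); last exact: exprn_continuous.
    exact: cvg_maxr0.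
  - move=> n w _.
    have m1 : Num.max (u n) 0 <= 1 by rewrite ge_max ler01 andbT ltW.
    have m0 : 0 <= Num.max (u n) 0 by rewrite le_max lexx orbT.
    by rewrite ger0_norm ?mulr_ge0 ?exprn_ge0// ler_piMr// exprn_ile1.
apply: cvg_trans H; apply: near_eq_cvg; near=> s.
have s0 : 0 < s by near: s; apply: nbhs_left_gt.
have s1 : s < 1 by near: s; exact: nbhs_left_lt.
transitivity (derive1n 1 (gen_fun (nat_pmf P N)) s); last by [].
by rewrite gen_fun_derive1 ?(ltW s0)// max_l// ltW.
Unshelve. all: by end_near. Qed.

Lemma gen_fun_derive2_at1 :
  gen_fun_derive_at1 2 (nat_pmf P N) = (nat_expect P N (fun k => k%:R * (k%:R - 1)))%:E.
Proof.
rewrite (_ : (fun k : nat => k%:R * (k%:R - 1) : R) = (fun k => k%:R * k.-1%:R)); last first.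
  by apply/funext => -[|k]; rewrite ?mul0r// -[in _ - 1]natr1 addrK.
apply: cvg_lim => //; apply: cvg_EFin; first exact: nearW.
have H : nat_expect P N (fun k => k%:R * k.-1%:R * (Num.max s 0) ^+ k.-2) @[s --> 1^'-] -->
    nat_expect P N (fun k => k%:R * k.-1%:R).
  apply/cvg_at_leftP => u [u1 ucvg].
  apply: (@dominated_cvg_Rintegral _ _ _ P setT _ _ (fun w => (N w)%:R ^+ 2)) => //.
  - move=> n; exact: (@measurable_nat_comp _ _ _ _ mN
      (fun k => k%:R * k.-1%:R * Num.max (u n) 0 ^+ k.-2)).
  - exact: (@measurable_nat_comp _ _ _ _ mN (fun k => k%:R * k.-1%:R)).
  - move=> w _; rewrite -[X in _ --> X]mulr1; apply: cvgMr.
    rewrite -[X in _ --> X](expr1n _ (N w).-2).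
    apply: (@cvg_comp _ _ _ _ (fun x : R => x ^+ (N w).-2)); last exact: exprn_continuous.
    exact: cvg_maxr0.
  - move=> n w _.
    have m1 : Num.max (u n) 0 <= 1 by rewrite ge_max ler01 andbT ltW.
    have m0 : 0 <= Num.max (u n) 0 by rewrite le_max lexx orbT.
    rewrite ger0_norm ?mulr_ge0 ?exprn_ge0// (@le_trans _ _ ((N w)%:R * (N w).-1%:R))//.
      by rewrite ler_piMr// ?mulr_ge0// exprn_ile1.
    by rewrite expr2 ler_wpM2l// ler_nat leq_pred.
apply: cvg_trans H; apply: near_eq_cvg; near=> s.
have s0 : 0 < s by near: s; apply: nbhs_left_gt.
have s1 : s < 1 by near: s; exact: nbhs_left_lt.
transitivity (derive1n 2 (gen_fun (nat_pmf P N)) s); last by [].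
by rewrite gen_fun_derive2 ?(ltW s0)// max_l// ltW.
Unshelve. all: by end_near. Qed.

End pmf_series.

(** * The Laplace transform of the process under condition (A) *)

Section gwi_laplace.
Context d (Omega : measurableType d) (R : realType) (P : probability Omega R).
Context (xi : nat -> nat -> {RV P >-> nat}) (Y : nat -> {RV P >-> nat}).
Context (beta gamma sigma : R).
Hypothesis oi : offspring_immigration xi Y.
Hypothesis cA : condition_A (xi 0%N 0%N) (Y 0%N).
Hypothesis betaE : beta = fine (gen_fun_derive_at1 1 (nat_pmf P (Y 0%N))).
Hypothesis gammaE : gamma = 2^-1 * fine (gen_fun_derive_at1 2 (nat_pmf P (xi 0%N 0%N))).
Hypothesis sigmaE : sigma = beta / gamma.

Let Z := GWI (fun n i => xi n i : Omega -> nat) (fun n => Y n : Omega -> nat).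
Let N : Omega -> nat := xi 0%N 0%N.
Let M : Omega -> nat := Y 0%N.
Let mN : measurable_fun setT N. Proof. exact: measurable_funP. Qed.
Let mM : measurable_fun setT M. Proof. exact: measurable_funP. Qed.

Let p001 : 0 < nat_pmf P N 0 < 1. Proof. by case: cA => -[]. Qed.
Let h00 : 0 < nat_pmf P M 0. Proof. by case: cA => -[_ _ /andP[]]. Qed.

(** The sums of condition (A) start at j = 1; for the weights at hand the term j = 0 vanishes. *)
Let series_shift (g : nat -> R) (p : nat -> R) : (forall k, 0 <= p k * g k) -> g 0%N = 0 ->
  (\sum_(1 <= j <oo) (p j * g j)%:E < +oo)%E -> (\sum_(0 <= j <oo) (p j * g j)%:E < +oo)%E.
Proof.
move=> pg0 g0; rewrite nneseries_recl//; last by move=> k _; rewrite lee_fin.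
by rewrite g0 mulr0 add0e.
Qed.

Let M2 : nat_integrable P M (fun k => k%:R ^+ 2).
Proof.
case: cA => _ [_ _ _ _ H]; apply: nat_integrable_series => //.
apply: series_shift => //.
- by move=> k; rewrite mulr_ge0// fine_ge0.
- by rewrite expr0n.
Qed.

Let Nlog0 : nat_integrable P N (fun k => k%:R ^+ 2 * ln k%:R).
Proof.
have lnk (k : nat) : 0 <= ln k%:R :> R.
  by case: k => [|k]; [rewrite ln0|rewrite ln_ge0// ler1n].
case: cA => _ [_ _ _ H _]; apply: nat_integrable_series => //.
  by move=> k; rewrite mulr_ge0// exprn_ge0.
apply: series_shift => //.
- by move=> k; rewrite mulr_ge0 ?fine_ge0// mulr_ge0// exprn_ge0.
- by rewrite expr0n mul0r.
- by under eq_eseriesr do rewrite mulrA.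
Qed.

Let Nlog : nat_integrable P N (fun k => k%:R ^+ 2 * ln (1 + k%:R)).
Proof.
have H : nat_integrable P N (fun k => ln 2 + 2 * (k%:R ^+ 2 * ln k%:R)).
  by apply: nat_integrableD => //; [exact: nat_integrable_cst|exact: nat_integrableZ].
apply: (nat_integrable_le mN H) => k.
have ln2 : 0 <= ln 2 :> R by rewrite ln_ge0// ler1n.
rewrite ger0_norm ?mulr_ge0 ?exprn_ge0 ?ln_ge0 ?lerDl//.
(* For k >= 2, 1 + k <= k^2 gives ln (1 + k) <= 2 ln k; the constant ln 2 covers k = 1. *)
case: k => [|[|k]]; first by rewrite expr0n/= !mul0r mulr0 addr0.
  by rewrite expr1n !mul1r ln1 mulr0 addr0.
rewrite ler_wpDl// mulrCA ler_wpM2l ?exprn_ge0//.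
have -> : 2 * ln k.+2%:R = ln (k.+2%:R ^+ 2) :> R by rewrite lnXn// mulr_natl.
rewrite ler_ln ?posrE ?ltr_pwDl// ?exprn_gt0// -natrX nat1r ler_nat.
by rewrite -mulnn !mulnS !mulSn; lia.
Qed.

Let N2 : nat_integrable P N (fun k => k%:R ^+ 2).
Proof. exact: nat_integrable_sq_log Nlog. Qed.

Let N1 : nat_expect P N (fun k => k%:R) = 1.
Proof. by case: cA => _ [+ _ _ _ _]; rewrite unlock /nat_expect /Rintegral => ->. Qed.

Let M1 : nat_expect P M (fun k => k%:R) = beta.
Proof. by rewrite betaE (gen_fun_derive1_at1 mM M2). Qed.

Let beta0 : 0 < beta.
Proof.
case: cA => _ [_ + _ _ _]; rewrite (gen_fun_derive1_at1 mM M2) => /andP[+ _].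
by rewrite lte_fin M1.
Qed.

Let N2' : nat_expect P N (fun k => k%:R * (k%:R - 1) / 2) = gamma.
Proof.
rewrite gammaE (gen_fun_derive2_at1 mN N2)/= -nat_expectZ//.
  by congr nat_expect; apply/funext => k; rewrite mulrC.
rewrite (_ : (fun k : nat => _) = (fun k => k%:R ^+ 2 - k%:R)).
  by apply: nat_integrableB => //; exact: nat_integrable_id.
by apply/funext => k; ring.
Qed.

Lemma gwi_gamma_gt0 : 0 < gamma.
Proof.
case: cA => _ [_ _ + _ _]; rewrite (gen_fun_derive2_at1 mN N2) => /andP[+ _].
by rewrite -EFinM lte_fin gammaE (gen_fun_derive2_at1 mN N2).
Qed.

Lemma gwi_pgf_int n (u : R) : 0 < u <= 1 ->
  \int[P]_w ((1 - u) ^+ Z n w) = gwi_pgf P N M n u.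
Proof.
move=> /andP[u0 u1]; rewrite /Z (GWI_gen_fun oi)//.
by rewrite subr_ge0 u1 gerBl ltW.
Qed.

Lemma gwi_laplace_ub : exists2 C : R, 0 < C & forall n (u : R), 0 < u <= 1 ->
  \int[P]_w ((1 - u) ^+ Z n w) <= C * (1 + n%:R * u) `^ (- sigma).
Proof.
have [C C0 H] := gwi_pgf_ub mN mM Nlog M2 N1 N2' M1 erefl erefl p001 h00
  gwi_gamma_gt0 beta0 sigmaE.
by exists C => // n u u01; rewrite gwi_pgf_int// H.
Qed.

Lemma gwi_laplace_cvg (u_ : nat -> R) : (forall n, 0 < u_ n <= 1) ->
  u_ n @[n --> \oo] --> (0 : R) ->
  (1 + gamma * n%:R * u_ n) `^ sigma * \int[P]_w ((1 - u_ n) ^+ Z n w)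
    @[n --> \oo] --> (1 : R).
Proof.
move=> u01 u_0.
have := gwi_pgf_cvg mN mM Nlog M2 N1 N2' M1 erefl erefl p001 h00
  gwi_gamma_gt0 beta0 sigmaE u01 u_0.
by under eq_fun do rewrite -gwi_pgf_int//.
Qed.

End gwi_laplace.

(** * Gamma and Gaussian integrals *)

Lemma is_derive_eqfun (R : realType) (f g : R -> R) (x df dg : R) :
  f =1 g -> df = dg -> is_derive x (1 : R) f df -> is_derive x (1 : R) g dg.
Proof. by move=> /funext -> ->. Qed.

Section half_line_integrals.
Context (R : realType).
Local Notation mu := (@lebesgue_measure R).

Lemma ge0_FTC_pinfty (f F : R -> R) (a l : R) :
  (forall x, a <= x -> 0 <= f x) -> (forall x, a <= x -> {for x, continuous f}) ->
  (forall x, a <= x -> is_derive x (1 : R) F (f x)) ->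
  F x @[x --> +oo] --> l ->
  (\int[mu]_(x in `[a, +oo[) (f x)%:E = (l - F a)%:E)%E.
Proof.
move=> f0 cf dF Fl; rewrite EFinB.
apply: (@ge0_continuous_FTC2y _ f F a l) => //.
- apply: continuous_in_subspaceT => x; rewrite inE/= in_itv/= andbT; exact: cf.
- by move=> x /ltW /dF [].
- apply: cvg_at_right_filter.
  have [dFa _] := dF a (lexx a).
  exact/differentiable_continuous/derivable1_diffP.
- move=> x; rewrite in_itv/= andbT => /ltW ax.
  by rewrite derive1E; have [_ ->] := dF x ax.
Qed.

Lemma is_derive_expRN (z x : R) :
  is_derive x (1 : R) (fun x => - expR (- (z * x))) (z * expR (- (z * x))).
Proof.
have H := @is_derive1_comp _ expR (- (z \*: id)) x _ _ (is_derive_expR _)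
  (is_deriveN (is_deriveZ z (is_derive_id x 1))).
apply: is_derive_eqfun (is_deriveN H) => //.
by rewrite /= [_ *: 1]mulr1 mulrN opprK mulrC.
Qed.

Lemma integral_expRN_pinfty (z a : R) : 0 < z ->
  (\int[mu]_(x in `[a, +oo[) (z * expR (- (z * x)))%:E = (expR (- (z * a)))%:E)%E.
Proof.
move=> z0; rewrite -[X in _ = X%:E]opprK -[X in _ = X%:E]sub0r.
apply: (@ge0_FTC_pinfty _ (fun x => - expR (- (z * x))) a 0).
- by move=> x _; rewrite mulr_ge0 ?expR_ge0// ltW.
- move=> x _; apply: cvgMr.
  apply: (@continuous_comp _ _ _ (fun x : R => - (z * x)) expR); last exact: continuous_expR.
  by apply: cvgN; apply: cvgMr; exact: cvg_id.
- by move=> x _; exact: is_derive_expRN.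
- rewrite -oppr0; apply: cvgN.
  apply: (@cvg_comp _ _ _ (fun x : R => z * x) (fun y => expR (- y))); last exact: cvgr_expR.
  exact: gt0_cvgMry.
Qed.

Lemma is_derive_gaussN (b x : R) : b != 0 ->
  is_derive x (1 : R) (fun y => - (expR (- (b * y ^+ 2)) / (2 * b))) (x * expR (- (b * x ^+ 2))).
Proof.
move=> b0.
have H := @is_derive1_comp _ expR (- (b \*: (id ^+ 2))) x _ _ (is_derive_expR _)
  (is_deriveN (is_deriveZ b (is_deriveX 2 (is_derive_id x 1)))).
apply: is_derive_eqfun (is_deriveZ (2 * b)^-1 (is_deriveN H)) => [y|].
  by rewrite /= /GRing.scale /= mulrN mulrC.
rewrite /= /GRing.scale /= expr1 mulr1.
rewrite (_ : (- (b \*: (id ^+ 2)) : R -> R) x = - (b * x ^+ 2))//.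
by field.
Qed.

Lemma integral_gauss_pinfty (b a : R) : 0 < b -> 0 <= a ->
  (\int[mu]_(y in `[a, +oo[) (y * expR (- (b * y ^+ 2)))%:E =
   (expR (- (b * a ^+ 2)) / (2 * b))%:E)%E.
Proof.
move=> b0 a0; rewrite -[X in _ = X%:E]opprK -[X in _ = X%:E]sub0r.
apply: (@ge0_FTC_pinfty _ (fun y => - (expR (- (b * y ^+ 2)) / (2 * b))) a 0).
- by move=> x ax; rewrite mulr_ge0 ?expR_ge0// (le_trans a0).
- move=> x _; apply: cvgM; first exact: cvg_id.
  apply: (@continuous_comp _ _ _ (fun x : R => - (b * x ^+ 2)) expR); last exact: continuous_expR.
  by apply: cvgN; apply: cvgMr; exact: exprn_continuous.
- by move=> x _; apply: is_derive_gaussN; rewrite gt_eqF.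
- rewrite -oppr0; apply: cvgN; rewrite -[X in _ --> X](mul0r (2 * b)^-1); apply: cvgMl.
  apply: (@cvg_comp _ _ _ (fun x : R => b * x ^+ 2) (fun y => expR (- y))); last exact: cvgr_expR.
  apply: gt0_cvgMry => //; exact: cvgr_expr2.
Qed.

Lemma cvgr_powRN (r : R) : 0 < r -> z `^ (- r) @[z --> +oo] --> (0 : R).
Proof.
move=> r0; apply/cvgrPdist_le => e e0; near=> z.
have z0 : 0 < z by near: z; exact: nbhs_pinfty_gt.
have zb : e^-1 `^ r^-1 <= z by near: z; apply: nbhs_pinfty_ge; exact: num_real.
rewrite sub0r normrN ger0_norm ?powR_ge0// powRN.
rewrite -[leRHS]invrK lef_pV2 ?posrE ?powR_gt0 ?invr_gt0//.
have -> : e^-1 = (e^-1 `^ r^-1) `^ r by rewrite -powRrM mulVf ?gt_eqF// powRr1// invr_ge0 ltW.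
by rewrite ge0_ler_powR ?nnegrE ?powR_ge0 ?(ltW r0) ?(ltW z0).
Unshelve. all: by end_near. Qed.

Lemma integral_shift_powR_pinfty (r b a : R) : 0 < r -> 0 < b + a ->
  (\int[mu]_(z in `[a, +oo[) ((b + z) `^ (- r - 1))%:E = ((b + a) `^ (- r) / r)%:E)%E.
Proof.
move=> r0 ba0; rewrite -[X in _ = X%:E]opprK -[X in _ = X%:E]sub0r.
have bx0 x : a <= x -> 0 < b + x by move=> ax; rewrite (lt_le_trans ba0)// lerD2l.
have dp (p x : R) : a <= x -> is_derive x (1 : R) (fun z => (b + z) `^ p) (p * (b + x) `^ (p - 1)).
  move=> ax.
  have H := @is_derive1_comp _ (@powR R ^~ p) (cst b + id) x _ _ (is_derive1_powR p (bx0 x ax))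
    (is_deriveD (is_derive_cst b x 1) (is_derive_id x 1)).
  by apply: is_derive_eqfun H => //; rewrite add0r mulr1.
apply: (@ge0_FTC_pinfty _ (fun z => - ((b + z) `^ (- r) / r)) a 0).
- by move=> x _; rewrite powR_ge0.
- by move=> x ax; have [+ _] := dp (- r - 1) x ax => /derivable1_diffP /differentiable_continuous.
- move=> x ax.
  apply: is_derive_eqfun (is_deriveZ r^-1 (is_deriveN (dp (- r) x ax))) => [y|].
    have -> : (r^-1 \*: - (fun z => (b + z) `^ (- r))) y = r^-1 * - ((b + y) `^ (- r)) by [].
    by rewrite mulrN mulrC.
  by rewrite /GRing.scale /= mulNr opprK mulKf ?gt_eqF.
- rewrite -oppr0; apply: cvgN; rewrite -[X in _ --> X](mul0r r^-1); apply: cvgMl.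
  apply: (@cvg_comp _ _ _ (fun z : R => b + z) (fun z : R => z `^ (- r))); last exact: cvgr_powRN.
  apply/cvgryPge => A; near=> z; rewrite -lerBlDl.
  by near: z; apply: nbhs_pinfty_ge; exact: num_real.
Unshelve. all: by end_near. Qed.

Lemma integral_powR_pinfty (r : R) : 0 < r ->
  (\int[mu]_(z in `[1%R, +oo[) (z `^ (- r - 1))%:E = (r^-1)%:E)%E.
Proof.
move=> r0; have := @integral_shift_powR_pinfty r 0 1 r0.
have E1 : 1 `^ (- r) = 1 :> R by rewrite powR1.
rewrite add0r E1 div1r => <-//.
by apply: eq_integral => z _; rewrite add0r.
Qed.

End half_line_integrals.

(** * Affine changes of variables and Tonelli's theorem on subsets *)

Section lebesgue_scaling.
Context (R : realType).
Local Notation mu := (@lebesgue_measure R).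
Variables (b c : R) (c0 : 0 < c).
Let phi : measurableTypeR R -> measurableTypeR R := fun x => b + c * x.
Let mphi : measurable_fun setT phi.
Proof. by apply: measurable_funD => //; exact: measurable_funM. Qed.
Let phi_pack := HB.pack_for {mfun measurableTypeR R >-> measurableTypeR R} phi (isMeasurableFun.Build _ _ _ _ _ mphi).

(** Both sides agree on half-open intervals, which determine Lebesgue measure. *)
Let lebesgue_measure_affine (A : set R) : measurable A ->
  (c%:E * pushforward mu phi A = mu A)%E.
Proof.
move=> mA; have c0' : 0 <= c by rewrite ltW.
apply/esym/(@lebesgue_measure_unique _ (mscale (NngNum c0') (pushforward mu phi_pack))) => //= _ [[x y]] _ <-.
rewrite /mscale/= /pushforward.
rewrite (_ : phi @^-1` `]x, y] = `]((x - b) / c)%R, ((y - b) / c)%R]%classic); last first.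
  apply/seteqP; split => z /=; rewrite !in_itv/= /phi ltr_pdivrMr// ler_pdivlMr// mulrC ltrBlDl lerBrDl//.
rewrite !lebesgue_measure_itv/= !lte_fin ltr_pM2r ?invr_gt0// ltrD2r.
case: ifP => _; last by rewrite mule0.
by rewrite -!EFinD -EFinM; congr EFin; rewrite /=; field; rewrite gt_eqF.
Qed.

Lemma ge0_integral_affine (f : R -> \bar R) :
  measurable_fun setT f -> (forall x, 0 <= f x)%E ->
  (c%:E * \int[mu]_x f (b + c * x)%R = \int[mu]_x f x)%E.
Proof.
move=> mf f0; have c0' : 0 <= c by rewrite ltW.
rewrite (_ : (\int[mu]_x f (b + c * x)%R)%E = (\int[pushforward mu phi_pack]_x f x)%E); last first.
  by rewrite ge0_integral_pushforward.
rewrite -[c%:E]/((NngNum c0')%:num%:E) -ge0_integral_mscale//.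
by apply: eq_measure_integral => A mA _; exact: lebesgue_measure_affine.
Qed.
End lebesgue_scaling.

Lemma ge0_integral_scale (R : realType) (c : R) (c0 : 0 < c) (f : R -> \bar R) :
  measurable_fun setT f -> (forall x, 0 <= f x)%E ->
  (c%:E * \int[@lebesgue_measure R]_x f (c * x)%R = \int[@lebesgue_measure R]_x f x)%E.
Proof.
move=> mf f0; rewrite -[RHS](ge0_integral_affine 0 c0)//.
by under [in RHS]eq_integral do rewrite add0r.
Qed.


Section tonelli.
Local Open Scope ereal_scope.
Context d1 d2 (T1 : measurableType d1) (T2 : measurableType d2) (R : realType).
Context (m1 : {sigma_finite_measure set T1 -> \bar R}) (m2 : {sigma_finite_measure set T2 -> \bar R}).

Lemma fubini_tonelli_set (D1 : set T1) (D2 : set T2) (f : T1 * T2 -> \bar R) :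
  measurable D1 -> measurable D2 -> measurable_fun [set: T1 * T2] f -> (forall z, 0 <= f z) ->
  \int[m1]_(x in D1) \int[m2]_(y in D2) f (x, y) =
  \int[m2]_(y in D2) \int[m1]_(x in D1) f (x, y).
Proof.
move=> mD1 mD2 mf f0.
pose g := f \_ (D1 `*` D2).
have mg : measurable_fun setT g.
  apply/(measurable_restrictT _ _).1; first exact: measurableX.
  exact: measurable_funTS.
have g0 z : 0 <= g z by rewrite /g patchE; case: ifP.
transitivity (\int[m1]_x \int[m2]_y g (x, y)).
  rewrite [LHS]integral_mkcond; apply: eq_integral => x _; rewrite patchE.
  case: ifPn => xD; last first.
    rewrite integral0_eq// => y _; rewrite /g patchE ifF//.
    by rewrite in_setX/= (negbTE xD).
  rewrite [LHS]integral_mkcond; apply: eq_integral => y _; rewrite /g !patchE.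
  by rewrite in_setX/= xD.
transitivity (\int[m2]_y \int[m1]_x g (x, y)); first exact: fubini_tonelli.
rewrite [RHS]integral_mkcond; apply: eq_integral => y _; rewrite patchE.
case: ifPn => yD; last first.
  rewrite integral0_eq// => x _; rewrite /g patchE ifF//.
  by rewrite in_setX/= (negbTE yD) andbF.
rewrite [RHS]integral_mkcond; apply: eq_integral => x _; rewrite /g !patchE.
by rewrite in_setX/= yD andbT.
Qed.

End tonelli.


Section gamma_integrals.
Context (R : realType).
Local Notation mu := (@lebesgue_measure R).
Implicit Types r z s p : R.

Lemma gt0_powRD (x a b : R) : 0 < x -> x `^ (a + b) = x `^ a * x `^ b.
Proof. by move=> x0; rewrite powRD// (gt_eqF x0) implybT. Qed.

Lemma powR_expR (u a : R) : expR u `^ a = expR (a * u).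
Proof. by rewrite /powR gt_eqF ?expR_gt0// expRK. Qed.

(** Comes from s <= b exp (s / b) with b = 2 (a + 1), raised to the power a; this b makes a^2 / b,
    hence the exponent obtained, small enough only through a / b <= 1 / 2. *)
Lemma powR_le_expR (a s : R) : 0 <= a -> 0 <= s ->
  s `^ a <= (2 * (a + 1)) `^ a * expR (s / 2).
Proof.
move=> a0 s0; have b0 : 0 < 2 * (a + 1) by rewrite mulr_gt0// ltr_wpDl.
have sb : s <= 2 * (a + 1) * expR (s / (2 * (a + 1))).
  rewrite -ler_pdivrMl// mulrC; apply: le_trans (expR_ge1Dx _).
  by rewrite lerDr.
apply: (@le_trans _ _ ((2 * (a + 1) * expR (s / (2 * (a + 1)))) `^ a)).
  by rewrite ge0_ler_powR// nnegrE mulr_ge0 ?expR_ge0// ltW.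
rewrite powRM ?expR_ge0 ?(ltW b0)// powR_expR ler_wpM2l ?powR_ge0// ler_expR.
rewrite mulrCA ler_wpM2l// invfM mulrA [a / 2]mulrC -mulrA.
by rewrite ler_piMr ?invr_ge0// ler_pdivrMr ?ltr_wpDl// mul1r lerDl.
Qed.

(** The integral equal to Gamma(r) z^(- r), kept in the extended reals so that it can be exchanged
    with other integrals before finiteness is discussed. *)
Definition egam (r z : R) : \bar R :=
  (\int[mu]_(s in `]0%R, +oo[) (s `^ (r - 1) * expR (- (z * s)))%:E)%E.

Lemma measurable_egam (r z : R) : measurable_fun setT (fun s : R => s `^ (r - 1) * expR (- (z * s))).
Proof.
apply: measurable_funM => //; apply: measurableT_comp => //.
by apply: measurableT_comp => //; exact: measurable_funM.
Qed.

Lemma ge0_integral_scale_pos (f : R -> \bar R) (c : R) : 0 < c ->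
  measurable_fun setT f -> (forall x, 0 <= f x)%E ->
  (c%:E * \int[mu]_(x in `]0%R, +oo[) f (c * x)%R = \int[mu]_(x in `]0%R, +oo[) f x)%E.
Proof.
move=> c0 mf f0; rewrite [RHS]integral_mkcond -(ge0_integral_scale c0).
- congr (_ * _)%E; rewrite integral_mkcond; apply: eq_integral => x _.
  rewrite !patchE; congr (if _ then _ else _).
  by apply/idP/idP; rewrite !inE/= !in_itv/= !andbT pmulr_rgt0.
- by apply/(measurable_restrictT _ _).1 => //; exact: measurable_funTS.
- by move=> x; rewrite patchE; case: ifP.
Qed.

Lemma egam_scale (r z : R) : 0 < z -> egam r z = ((z `^ (- r))%:E * egam r 1)%E.
Proof.
move=> z0; rewrite /egam -(@ge0_integral_scale_pos (fun s => (s `^ (r - 1) * expR (- (1 * s)))%:E) z)//; last 2 first.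
- by apply/measurable_EFinP; exact: measurable_egam.
- by move=> x; rewrite lee_fin mulr_ge0 ?powR_ge0 ?expR_ge0.
rewrite muleA -EFinM -ge0_integralZl_EFin//; last 3 first.
- by move=> x _; rewrite lee_fin mulr_ge0 ?powR_ge0 ?expR_ge0.
- apply/measurable_EFinP/measurable_funTS.
  exact: (@measurableT_comp _ _ _ _ _ _ (fun s : R => s `^ (r - 1) * expR (- (1 * s))) _ ( *%R z) (measurable_egam _ _)).
- by rewrite mulr_ge0 ?powR_ge0// ltW.
apply: eq_integral => s; rewrite inE/= in_itv/= andbT => s0.
rewrite -EFinM mul1r powRM ?(ltW z0) ?(ltW s0)//; congr EFin.
suff E : z `^ (- r) * z * z `^ (r - 1) = 1 by rewrite !mulrA E mul1r.
have -> : z `^ (- r) * z = z `^ (- r) * z `^ 1 by rewrite powRr1// ltW.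
by rewrite -!gt0_powRD// (_ : - r + 1 + (r - 1) = 0) ?powRr0//; ring.
Qed.

Lemma egam_fin (r : R) : 1 <= r -> (egam r 1 < +oo)%E.
Proof.
move=> r1; rewrite /egam.
pose K := (2 * (r - 1 + 1)) `^ (r - 1) * 2.
apply: (@le_lt_trans _ _ (\int[mu]_(s in `]0%R, +oo[) (K%:E * (2^-1 * expR (- (2^-1 * s)))%:E))%E).
  apply: ge0_le_integral => //.
  - by move=> s _; rewrite lee_fin mulr_ge0 ?powR_ge0 ?expR_ge0.
  - by apply/measurable_EFinP/measurable_funTS; exact: measurable_egam.
  - apply/measurable_EFinP/measurable_funTS; apply: measurable_funM => //; apply: measurable_funM => //.
    by apply: measurableT_comp => //; apply: measurableT_comp => //; exact: measurable_funM.
  move=> s; rewrite /= in_itv/= andbT => s0; rewrite -EFinM lee_fin mul1r.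
  have := @powR_le_expR (r - 1) s; rewrite subr_ge0 r1 (ltW s0) => /(_ isT isT) H.
  rewrite -ler_pdivlMr ?expR_gt0//; apply: le_trans H _.
  rewrite -expRN opprK /K -!mulrA ler_wpM2l ?powR_ge0// mulrA divff// mul1r -expRD.
  by rewrite ler_expR; lra.
rewrite ge0_integralZl_EFin//; last 2 first.
- apply/measurable_EFinP/measurable_funTS; apply: measurable_funM => //.
  by apply: measurableT_comp => //; apply: measurableT_comp => //; exact: measurable_funM.
- by rewrite mulr_ge0 ?powR_ge0.
rewrite integral_itv_obnd_cbnd; last first.
  apply/measurable_EFinP/measurable_funTS; apply: measurable_funM => //.
  by apply: measurableT_comp => //; apply: measurableT_comp => //; exact: measurable_funM.
by rewrite integral_expRN_pinfty// -EFinM ltry.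
Qed.

Lemma egamE (r z : R) : 1 <= r -> 0 < z -> egam r z = (Gamma r * z `^ (- r))%:E.
Proof.
move=> r1 z0; rewrite egam_scale// mulrC EFinM; congr (_ * _)%E.
transitivity (fine (egam r 1))%:E.
  apply/esym/fineK; rewrite ge0_fin_numE ?egam_fin//.
  by apply: integral_ge0 => s _; rewrite lee_fin mulr_ge0 ?powR_ge0 ?expR_ge0.
rewrite /Gamma /egam /Rintegral; congr ((fine _)%:E); apply: eq_integral => s _.
by rewrite mul1r.
Qed.

Lemma Gamma_gt0 (r : R) : 1 <= r -> 0 < Gamma r.
Proof.
move=> r1; rewrite -lte_fin.
have -> : (Gamma r)%:E = egam r 1 by rewrite egamE// powR1 mulr1.
apply: (@lt_le_trans _ _ (\int[mu]_(s in `[1%R, 2%R]) (expR (- 2))%:E)%E).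
  rewrite integral_cst//= lebesgue_measure_itv/= lte_fin ltr1n.
  by rewrite -EFinD -EFinM lte_fin mulr_gt0 ?expR_gt0//; lra.
apply: (@le_trans _ _ (\int[mu]_(s in `[1%R, 2%R]) (s `^ (r - 1) * expR (- (1 * s)))%:E)%E).
  apply: ge0_le_integral => //.
  - by apply/measurable_EFinP/measurable_funTS; exact: measurable_egam.
  move=> s /=; rewrite in_itv/= => /andP[s1 s2]; rewrite lee_fin mul1r.
  rewrite -[leLHS]mul1r ler_pM ?expR_ge0//; last by rewrite ler_expR lerN2.
  by rewrite -[leLHS](powRr0 s) ler_powR// subr_ge0.
apply: ge0_subset_integral => //.
- by apply/measurable_EFinP/measurable_funTS; exact: measurable_egam.
- by move=> s _; rewrite lee_fin mulr_ge0 ?powR_ge0 ?expR_ge0.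
- by apply: subset_itv; rewrite bnd_simp.
Qed.

(** [egam (r + 1) z] is integrated over z >= 1 in both orders. Its closed form Gamma(r + 1) z^(- r -
    1) gives Gamma(r + 1) / r; integrating s exp (- s z) over z first gives exp (- s), hence
    Gamma(r). *)
Lemma GammaS (r : R) : 1 <= r -> Gamma (r + 1) = r * Gamma r.
Proof.
move=> r1; have r0 : 0 < r by exact: lt_le_trans r1.
suff H : (Gamma (r + 1) / r)%:E = (Gamma r)%:E.
  by case: H => <-; rewrite mulrC divfK// gt_eqF.
have -> : (Gamma r)%:E = egam r 1 by rewrite egamE// powR1 mulr1.
rewrite EFinM -(integral_powR_pinfty r0).
rewrite -ge0_integralZl_EFin//; last 3 first.
- by move=> s _; rewrite lee_fin powR_ge0.
- by apply/measurable_EFinP/measurable_funTS.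
- by rewrite ltW// Gamma_gt0// lerDr ltW.
transitivity (\int[mu]_(z in `[1%R, +oo[) egam (r + 1) z)%E.
  apply: eq_integral => z; rewrite inE/= in_itv/= andbT => z1.
  rewrite egamE ?lerDr ?(ltW r0)//; last exact: lt_le_trans z1.
  by rewrite -EFinM opprD.
rewrite /egam (@fubini_tonelli_set _ _ _ _ R mu mu `[1%R, +oo[ `]0%R, +oo[
  (fun zs : R * R => (zs.2 `^ (r + 1 - 1) * expR (- (zs.1 * zs.2)))%:E))//; last 2 first.
- apply/measurable_EFinP; apply: measurable_funM => //.
    exact: (measurableT_comp (measurable_powR _)).
  apply: measurableT_comp => //; apply: measurableT_comp => //.
  exact: measurable_funM.
- by move=> z; rewrite lee_fin mulr_ge0 ?powR_ge0 ?expR_ge0.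
apply: eq_integral => s; rewrite inE/= in_itv/= andbT => s0.
transitivity (\int[mu]_(z in `[1%R, +oo[) ((s `^ (r - 1))%:E * (s * expR (- (s * z)))%:E))%E.
  apply: eq_integral => z _; rewrite -EFinM mulrA; congr ((_ * expR (- _))%:E); last exact: mulrC.
  rewrite -{3}[s]powRr1 ?(ltW s0)// -gt0_powRD//.
  by congr (_ `^ _); ring.
rewrite ge0_integralZl_EFin ?powR_ge0//; last 2 first.
- by move=> z _; rewrite lee_fin mulr_ge0 ?expR_ge0 ?(ltW s0).
- apply/measurable_EFinP/measurable_funTS; apply: measurable_funM => //.
  by apply: measurableT_comp => //; apply: measurableT_comp => //; exact: measurable_funM.
by rewrite integral_expRN_pinfty// -EFinM mulr1 mul1r.
Qed.

Lemma integral_gauss_scale (s : R) : 0 < s ->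
  (\int[mu]_z (expR (- (s * z ^+ 2)))%:E = (Num.sqrt pi * s `^ (- 2^-1))%:E)%E.
Proof.
move=> s0; have q0 : 0 < Num.sqrt s by rewrite sqrtr_gt0.
have := @ge0_integral_scale R _ q0 (fun x => (gauss_fun x)%:E).
rewrite integralT_gauss => H.
rewrite powRN powR12_sqrt ?(ltW s0)// mulrC EFinM -H; last 2 first.
- by apply/measurable_EFinP; exact: measurable_gauss_fun.
- by move=> x; rewrite lee_fin gauss_fun_ge0.
rewrite muleA -EFinM mulVf ?gt_eqF// mul1e; apply: eq_integral => z _.
by rewrite /gauss_fun exprMn sqr_sqrtr// ltW.
Qed.

Lemma measurable_1Dsqr_powR (p : R) : measurable_fun setT (fun z : R => (1 + z ^+ 2) `^ p).
Proof.
apply: (measurableT_comp (measurable_powR _)).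
by apply: measurable_funD => //; exact: exprn_measurable.
Qed.

(** Gamma(p) (1 + z^2)^(- p) is [egam p (1 + z^2)]; integrating over z first leaves the Gaussian
    integral sqrt (pi / s), which lowers the exponent of s by 1/2. The bound on p keeps both Gamma
    arguments at least 1. *)
Lemma integral_inv1Dsqr_powR (p : R) : 3/2 <= p ->
  (\int[mu]_z ((1 + z ^+ 2) `^ (- p))%:E = (Num.sqrt pi * Gamma (p - 2^-1) / Gamma p)%:E)%E.
Proof.
move=> p32; have p1 : 1 <= p by lra.
have pp1 : 1 <= p - 2^-1 by lra.
have G0 := Gamma_gt0 p1.
have mf : measurable_fun setT (fun zs : R * R => (zs.2 `^ (p - 1) * expR (- ((1 + zs.1 ^+ 2) * zs.2)))%:E).
  apply/measurable_EFinP; apply: measurable_funM => //.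
    exact: (measurableT_comp (measurable_powR _)).
  apply: measurableT_comp => //; apply: measurableT_comp => //.
  apply: measurable_funM => //; apply: measurable_funD => //.
  exact: (measurableT_comp (exprn_measurable _)).
have H : ((Gamma p)%:E * \int[mu]_z ((1 + z ^+ 2) `^ (- p))%:E = (Num.sqrt pi * Gamma (p - 2^-1))%:E)%E.
  rewrite -ge0_integralZl_EFin ?(ltW G0)//; last 2 first.
  - by move=> z _; rewrite lee_fin powR_ge0.
  - by apply/measurable_EFinP; exact: measurable_1Dsqr_powR.
  transitivity (\int[mu]_z egam p (1 + z ^+ 2))%E.
    by apply: eq_integral => z _; rewrite -EFinM egamE// ltr_pwDl// sqr_ge0.
  rewrite /egam (@fubini_tonelli_set _ _ _ _ R mu mu setT `]0%R, +oo[
    (fun zs : R * R => (zs.2 `^ (p - 1) * expR (- ((1 + zs.1 ^+ 2) * zs.2)))%:E))//; last first.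
    by move=> z; rewrite lee_fin mulr_ge0 ?powR_ge0 ?expR_ge0.
  rewrite EFinM; have -> : (Gamma (p - 2^-1))%:E = egam (p - 2^-1) 1 by rewrite egamE// powR1 mulr1.
  rewrite -ge0_integralZl_EFin ?sqrtr_ge0//; last 2 first.
  - by move=> s _; rewrite lee_fin mulr_ge0 ?powR_ge0 ?expR_ge0.
  - by apply/measurable_EFinP/measurable_funTS; exact: measurable_egam.
  apply: eq_integral => s; rewrite inE/= in_itv/= andbT => s0.
  transitivity (\int[mu]_z ((s `^ (p - 1) * expR (- s))%:E * (expR (- (s * z ^+ 2)))%:E))%E.
    apply: eq_integral => z _; rewrite -EFinM -mulrA -expRD; congr ((_ * expR _)%:E).
    by rewrite /=; ring.
  rewrite ge0_integralZl_EFin//; last 2 first.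
  - apply/measurable_EFinP; apply: measurableT_comp => //; apply: measurableT_comp => //.
    by apply: measurable_funM => //; exact: exprn_measurable.
  - by rewrite mulr_ge0 ?powR_ge0 ?expR_ge0.
  rewrite integral_gauss_scale// -!EFinM; congr EFin; rewrite mul1r.
  rewrite (_ : p - 2^-1 - 1 = (p - 1) + - 2^-1); last by ring.
  by rewrite (gt0_powRD (p - 1) (- 2^-1) s0); move: (_ `^ _) (_ `^ _) => u v; ring.
by rewrite EFinM -H muleC muleA -EFinM mulVf ?gt_eqF// mul1e.
Qed.

(** Craig's formula, z being the cotangent of the angle: the Gaussian density at y > 0 is the
    integral over z of y exp (- (1 + z^2) y^2 / 2) / (2 pi), after which the integral over y >= x is
    elementary. *)
Lemma gauss_tail_mixture (x : R) : 0 < x ->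
  (normal_prob 0 1 `[x, +oo[ = \int[mu]_z ((2 * pi * (1 + z ^+ 2))^-1 * expR (- (x ^+ 2 / 2 * (1 + z ^+ 2))))%:E)%E.
Proof.
move=> x0; rewrite /normal_prob; have pi0 := pi_gt0 R.
have z10 (z : R) : 0 < 1 + z ^+ 2 by rewrite ltr_pwDl// sqr_ge0.
(* The absolute value of y makes the integrand nonnegative on the whole plane, as the exchange of
   integrals requires. *)
transitivity (\int[mu]_(y in `[x, +oo[) \int[mu]_z (`|y| * expR (- ((1 + z ^+ 2) / 2 * y ^+ 2)) / (2 * pi))%:E)%E.
  apply: eq_integral => y; rewrite inE/= in_itv/= andbT => xy.
  have y0 : 0 < y by exact: lt_le_trans xy.
  rewrite gtr0_norm//.
  have -> : normal_pdf 0 1 y = (Num.sqrt (1 ^+ 2 * pi *+ 2))^-1 * expR (- (y - 0) ^+ 2 / (1 ^+ 2 *+ 2)).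
    by rewrite /normal_pdf oner_eq0.
  rewrite subr0 expr1n.
  transitivity (\int[mu]_z ((y * expR (- (y ^+ 2 / 2)) / (2 * pi))%:E * (expR (- (y ^+ 2 / 2 * z ^+ 2)))%:E))%E; last first.
    apply: eq_integral => z _; rewrite -EFinM.
    rewrite (_ : - ((1 + z ^+ 2) / 2 * y ^+ 2) = - (y ^+ 2 / 2) + - (y ^+ 2 / 2 * z ^+ 2)); last by field.
    rewrite [in RHS]expRD; congr EFin; move: (expR _) (expR _) => u v.
    by rewrite -!mulrA; congr (_ * (_ * _)); rewrite mulrC.
  rewrite ge0_integralZl_EFin//; last 2 first.
  - apply/measurable_EFinP; apply: measurableT_comp => //; apply: measurableT_comp => //.
    by apply: measurable_funM => //; exact: exprn_measurable.
  - by rewrite !mulr_ge0 ?expR_ge0 ?invr_ge0 ?mulr_ge0 ?(ltW y0) ?(ltW pi0).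
  rewrite integral_gauss_scale ?divr_gt0 ?exprn_gt0// -EFinM; congr EFin.
  rewrite powRN powR12_sqrt ?divr_ge0 ?exprn_ge0 ?(ltW y0)//.
  rewrite sqrtrM ?exprn_ge0 ?(ltW y0)// sqrtr_sqr gtr0_norm// sqrtrV//.
  rewrite mul1r -mulr_natl sqrtrM//.
  have : Num.sqrt pi ^+ 2 = pi :> R by rewrite sqr_sqrtr// ltW.
  have : Num.sqrt 2 ^+ 2 = 2 :> R by rewrite sqr_sqrtr.
  have : Num.sqrt pi != 0 :> R by rewrite gt_eqF// sqrtr_gt0.
  have : Num.sqrt 2 != 0 :> R by rewrite gt_eqF// sqrtr_gt0.
  rewrite mulNr; move: (expR _) (Num.sqrt pi) (Num.sqrt 2) => e u v v0 u0 v2 u2.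
  rewrite -u2 -v2; field.
  by rewrite v0 u0 (gt_eqF y0).
rewrite (@fubini_tonelli_set _ _ _ _ R mu mu `[x, +oo[ setT
  (fun yz : R * R => (`|yz.1| * expR (- ((1 + yz.2 ^+ 2) / 2 * yz.1 ^+ 2)) / (2 * pi))%:E))//; last 2 first.
- apply/measurable_EFinP; apply: measurable_funM => //; apply: measurable_funM.
    exact: measurableT_comp.
  apply: measurableT_comp => //; apply: measurableT_comp => //; apply: measurable_funM; last first.
    exact: (measurableT_comp (exprn_measurable _)).
  apply: measurable_funM => //; apply: measurable_funD => //.
  exact: (measurableT_comp (exprn_measurable _)).
- by move=> yz; rewrite lee_fin !mulr_ge0 ?expR_ge0 ?invr_ge0 ?mulr_ge0 ?(ltW pi0).
apply: eq_integral => z _.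
transitivity (\int[mu]_(y in `[x, +oo[) ((2 * pi)^-1%:E * (y * expR (- ((1 + z ^+ 2) / 2 * y ^+ 2)))%:E))%E.
  apply: eq_integral => y; rewrite inE/= in_itv/= andbT => xy.
  by rewrite gtr0_norm ?(lt_le_trans x0)// -EFinM mulrC.
rewrite ge0_integralZl_EFin//; last 3 first.
- move=> y /=; rewrite in_itv/= andbT => xy; rewrite lee_fin mulr_ge0 ?expR_ge0//.
  by rewrite (le_trans (ltW x0)).
- apply/measurable_EFinP/measurable_funTS; apply: measurable_funM => //.
  by apply: measurableT_comp => //; apply: measurableT_comp => //; apply: measurable_funM.
- by rewrite invr_ge0 mulr_ge0// ltW.
rewrite integral_gauss_pinfty ?divr_gt0 ?(ltW x0)// -EFinM; congr EFin.
rewrite (_ : (1 + z ^+ 2) / 2 * x ^+ 2 = x ^+ 2 / 2 * (1 + z ^+ 2)); last by ring.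
by rewrite [2 * (_ / 2)]mulrC divfK// mulrCA -invfM mulrC.
Qed.

End gamma_integrals.

(** * Moments of the process from its Laplace transform *)

(** Joint measurability: a preimage is a countable union of rectangles, one for each value of
    [N]. *)
Lemma measurable_nat_fun2 d (Omega : measurableType d) d' (T : measurableType d') (R : realType)
    (N : Omega -> nat) (phi : nat -> T -> R) :
  measurable_fun setT N -> (forall k, measurable_fun setT (phi k)) ->
  measurable_fun setT (fun sw : T * Omega => phi (N sw.2) sw.1).
Proof.
move=> mN mphi _ B mB; rewrite setTI.
rewrite (_ : _ @^-1` B = \bigcup_k (phi k @^-1` B `*` N @^-1` [set k])).
  apply: bigcupT_measurable => k; apply: measurableX.
    by rewrite -[X in measurable X]setTI; exact: mphi.
  by rewrite -[X in measurable X]setTI; exact: mN.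
apply/seteqP; split => [[s w]/= H|[s w] [k _ [/= H NwE]]/=]; last by rewrite NwE.
by exists (N w).
Qed.

Section nat_expect_extra.
Context d (Omega : measurableType d) (R : realType) (P : probability Omega R).
Context (N : Omega -> nat) (mN : measurable_fun setT N).
Local Notation E := (nat_expect P N).
Local Notation mu := (@lebesgue_measure R).
Implicit Types f g : nat -> R.

Lemma nat_integrable_bounded (M : R) g : (forall k, `|g k| <= M) -> nat_integrable P N g.
Proof. by move=> gM; apply: (nat_integrable_le mN (@nat_integrable_cst _ _ _ P N M)). Qed.

Lemma nat_expectE g : nat_integrable P N g -> (\int[P]_w (g (N w))%:E = (E g)%:E)%E.
Proof. by move=> ig; rewrite fineK//; exact: integrable_fin_num. Qed.

Lemma nat_expect_tonelli (D : set R) (phi : nat -> R -> R) :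
  measurable D -> (forall k, measurable_fun setT (phi k)) -> (forall k s, 0 <= phi k s) ->
  (forall s, D s -> nat_integrable P N (fun k => phi k s)) ->
  (\int[mu]_(s in D) (E (fun k => phi k s))%:E =
   \int[P]_w \int[mu]_(s in D) (phi (N w) s)%:E)%E.
Proof.
move=> mD mphi phi0 iphi.
transitivity (\int[mu]_(s in D) \int[P]_w (phi (N w) s)%:E)%E.
  by apply: eq_integral => s /set_mem Ds; rewrite -(nat_expectE (iphi s Ds)).
rewrite (@fubini_tonelli_set _ _ _ _ R mu P D setT (fun sw : R * Omega => (phi (N sw.2) sw.1)%:E))//; last first.
  by move=> z; rewrite lee_fin.
by apply/measurable_EFinP; exact: (@measurable_nat_fun2 _ _ _ _ _ N phi mN mphi).
Qed.

End nat_expect_extra.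

Lemma measurable_nat_expect d (Omega : measurableType d) (R : realType) (P : probability Omega R)
    (N : Omega -> nat) (phi : nat -> R -> R) :
  measurable_fun setT N -> (forall k, measurable_fun setT (phi k)) -> (forall k s, 0 <= phi k s) ->
  measurable_fun setT (fun s => nat_expect P N (phi^~ s)).
Proof.
move=> mN mphi phi0.
apply: (@measurableT_comp _ _ _ _ _ _ (@fine R) _ (fun s => (\int[P]_w (phi (N w) s)%:E)%E)) => //.
apply: (@measurable_fun_fubini_tonelli_F _ _ _ _ R P (fun sw : R * Omega => (phi (N sw.2) sw.1)%:E)).
- by apply/measurable_EFinP; exact: (@measurable_nat_fun2 _ _ _ _ _ N phi mN mphi).
- by move=> z; rewrite lee_fin.
Qed.

Lemma measurable_expRN (R : realType) (c z : R) : measurable_fun setT (fun s : R => c * expR (- (z * s))).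
Proof.
apply: measurable_funM => //; apply: measurableT_comp => //.
by apply: measurableT_comp => //; exact: measurable_funM.
Qed.

Definition gauss_tail (R : realType) (x : R) : R := fine (normal_prob 0 1 `[x, +oo[).

Lemma measurable_gauss_weight (R : realType) :
  measurable_fun setT (fun z : R => (2 * pi * (1 + z ^+ 2))^-1).
Proof.
rewrite (_ : (fun z => _) = (fun z : R => (2 * pi)^-1 * (1 + z ^+ 2) `^ (- 1))); last first.
  by apply/funext => z; rewrite invfM powR_inv1// addr_ge0// sqr_ge0.
by apply: measurable_funM => //; exact: measurable_1Dsqr_powR.
Qed.

Lemma ge0_integrable d (T : measurableType d) (R : realType) (mu : {measure set T -> \bar R})
    (D : set T) (f : T -> R) : measurable D -> measurable_fun setT f -> (forall x, 0 <= f x) ->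
  (\int[mu]_(x in D) (f x)%:E < +oo)%E -> mu.-integrable D (EFin \o f).
Proof.
move=> mD mf f0 fi; apply/integrableP; split; first exact/measurable_EFinP/measurable_funTS.
by under eq_integral => x _ do rewrite /= ger0_norm//.
Qed.

Lemma ge0_RintegralZl d (T : measurableType d) (R : realType) (mu : {measure set T -> \bar R})
    (c : R) (f : T -> R) : 0 <= c -> measurable_fun setT f -> (forall x, 0 <= f x) ->
  \int[mu]_x (c * f x) = c * \int[mu]_x f x.
Proof.
move=> c0 mf f0; rewrite /Rintegral; under eq_integral do rewrite EFinM.
rewrite ge0_integralZl_EFin//; last 2 first.
- by move=> x _; rewrite lee_fin.
- exact/measurable_EFinP.
have [->|cn0] := eqVneq c 0; first by rewrite mul0e mul0r.
case: (\int[mu]_x _)%E => [r||]//=; first by rewrite mulr0 gt0_muley// lte_fin lt0r cn0.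
by rewrite mulr0 gt0_muleNy// lte_fin lt0r cn0.
Qed.

Lemma measurable_affine (R : realType) (a b : R) : measurable_fun setT (fun s : R => a + b * s).
Proof. by apply: measurable_funD => //; exact: measurable_funM. Qed.

Lemma expRN_powR_ub (R : realType) (a s : R) : 0 <= a -> 0 < s ->
  expR (- s) <= (2 * (a + 1)) `^ a * s `^ (- a).
Proof.
move=> a0 s0; rewrite expRN powRN -[leLHS]mul1r ler_pdivrMr ?expR_gt0//.
rewrite mulrAC ler_pdivlMr ?powR_gt0// mul1r.
apply: le_trans (powR_le_expR a0 (ltW s0)) _.
by rewrite ler_wpM2l ?powR_ge0// ler_expR; lra.
Qed.

Lemma powRN_le (R : realType) (a x y : R) : 0 <= a -> 0 < x -> x <= y -> y `^ (- a) <= x `^ (- a).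
Proof.
move=> a0 x0 xy; have y0 := lt_le_trans x0 xy.
rewrite !powRN lef_pV2 ?posrE ?powR_gt0//.
by rewrite ge0_ler_powR// nnegrE ltW.
Qed.

Lemma cvg_powR (R : realType) (T : Type) (F : set_system T) {FF : Filter F} (f : T -> R) (a l : R) :
  0 < l -> f x @[x --> F] --> l -> f x `^ a @[x --> F] --> l `^ a.
Proof.
move=> l0 fl; have [/derivable1_diffP/differentiable_continuous H _] := is_derive1_powR a l0.
exact: (cvg_comp _ (@powR R ^~ a) fl H).
Qed.

Lemma cvgn_powRN (R : realType) (a : R) : 0 < a -> n%:R `^ (- a) @[n --> \oo] --> (0 : R).
Proof.
move=> a0; apply: (@cvg_comp _ _ _ (fun n : nat => n%:R : R) (fun x : R => x `^ (- a))).
  exact: cvgr_idn.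
exact: cvgr_powRN.
Qed.

Lemma onem_expRN_lb (R : realType) (t : R) : 0 < t -> t / (1 + t) <= 1 - expR (- t).
Proof.
move=> t0; have t10 : 0 < 1 + t by rewrite addr_gt0.
have : expR (- t) <= (1 + t)^-1.
  by rewrite expRN lef_pV2 ?posrE ?expR_gt0// expR_ge1Dx.
rewrite -lerN2 -(lerD2l 1) => /(le_trans _); apply.
by rewrite -[X in _ <= X - _](divff (lt0r_neq0 t10)) -[X in _ <= _ - X]mul1r -mulrBl addrAC subrr add0r.
Qed.

Lemma onem_expRN (R : realType) (t : R) : 0 < t <= 1 -> t / 2 <= 1 - expR (- t).
Proof.
move=> /andP[t0 t1]; apply: le_trans (onem_expRN_lb t0).
by rewrite ler_wpM2l ?(ltW t0)// lef_pV2 ?posrE ?addr_gt0// lerD2l.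
Qed.

Section scaled_laplace.
Context d (Omega : measurableType d) (R : realType) (P : probability Omega R).
Context (Z : nat -> Omega -> nat) (mZ : forall n, measurable_fun setT (Z n)).
Context (gamma sigma : R).
Hypothesis gamma0 : 0 < gamma.
Hypothesis sigma1 : 1 < sigma.
Hypothesis Zub : exists2 C : R, 0 < C & forall n (u : R), 0 < u <= 1 ->
  \int[P]_w ((1 - u) ^+ Z n w) <= C * (1 + n%:R * u) `^ (- sigma).
Hypothesis Zcvg : forall u_ : nat -> R, (forall n, 0 < u_ n <= 1) ->
  u_ n @[n --> \oo] --> (0 : R) ->
  (1 + gamma * n%:R * u_ n) `^ sigma * \int[P]_w ((1 - u_ n) ^+ Z n w)
    @[n --> \oo] --> (1 : R).
Local Notation E n := (nat_expect P (Z n)).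
Local Notation mu := (@lebesgue_measure R).
Implicit Types (k n : nat) (s t m : R).

Let sigma0 : 0 < sigma. Proof. exact: lt_trans ltr01 _. Qed.

(** The atom at k = 0 is removed: the full Laplace transform tends to P(Z n = 0) as t grows, which
    excludes a bound by a multiple of (n t)^(- sigma) for all t. *)
Definition lap n t : R := E n (fun k => (0 < k)%N%:R * expR (- (t * k%:R))).

Lemma lap_term_bound t k : 0 <= t -> `|(0 < k)%N%:R * expR (- (t * k%:R))| <= 1 :> R.
Proof.
move=> t0; rewrite ger0_norm ?mulr_ge0 ?expR_ge0//.
by rewrite mulr_ile1 ?expR_ge0 ?lern1 ?leq_b1// -expR0 ler_expR oppr_le0 mulr_ge0.
Qed.

Lemma lap_integrable n t : 0 <= t ->
  nat_integrable P (Z n) (fun k => (0 < k)%N%:R * expR (- (t * k%:R))).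
Proof. by move=> t0; apply: (@nat_integrable_bounded _ _ _ _ _ (mZ n) 1) => k; exact: lap_term_bound. Qed.

Lemma lap_ge0 n t : 0 <= lap n t.
Proof. by apply: nat_expect_ge0 => k; rewrite mulr_ge0 ?expR_ge0. Qed.

Let expRNE t k : expR (- (t * k%:R)) = (1 - (1 - expR (- t))) ^+ k.
Proof. by rewrite opprB addrC subrK -expRM_natr mulNr. Qed.

Let onem_itv t : 0 < t -> 0 < 1 - expR (- t) <= 1.
Proof. by move=> t0; rewrite subr_gt0 -expR0 ltr_expR oppr_lt0 t0/= gerBl expR_ge0. Qed.

Lemma lapE n t : 0 < t ->
  lap n t = \int[P]_w ((1 - (1 - expR (- t))) ^+ Z n w) - nat_pmf P (Z n) 0.
Proof.
move=> t0; rewrite -(nat_expect0 _ (mZ n)).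
have -> : \int[P]_w ((1 - (1 - expR (- t))) ^+ Z n w) = E n (fun k => expR (- (t * k%:R))).
  by apply: eq_Rintegral => w _; rewrite expRNE.
rewrite -nat_expectB//; last 2 first.
- apply: (@nat_integrable_bounded _ _ _ _ _ (mZ n) 1) => k.
  by rewrite ger0_norm ?expR_ge0// -expR0 ler_expR oppr_le0 mulr_ge0// ltW.
- by apply: (@nat_integrable_bounded _ _ _ _ _ (mZ n) 1) => k; rewrite ger0_norm// lern1 leq_b1.
congr (E n _); apply/funext => -[|k]; rewrite ?mul0r ?mulr0 ?oppr0 ?expR0 ?subrr//.
by rewrite mul1r addr0.
Qed.

(** The generating function at 0, that is u = 1: since 0^0 = 1, the power [(1 - 1) ^+ k] is the
    indicator of k = 0. *)
Lemma nat_pmf0_ub : exists2 C : R, 0 < C & forall n, (0 < n)%N ->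
  nat_pmf P (Z n) 0 <= C * n%:R `^ (- sigma).
Proof.
have [C C0 H] := Zub; exists C => // n n0.
have := H n 1; rewrite ltr01 lexx => /(_ isT) H1.
apply: le_trans (le_trans _ H1) _; last first.
  by rewrite mulr1 ler_wpM2l ?(ltW C0)// powRN_le ?(ltW sigma0) ?ltr0n// lerDr.
rewrite -(nat_expect0 _ (mZ n)) /nat_expect; rewrite le_eqVlt; apply/orP; left; apply/eqP; apply: eq_Rintegral => w _.
by rewrite subrr expr0n.
Qed.

Lemma nat_pmf0_cvg : nat_pmf P (Z n) 0 @[n --> \oo] --> (0 : R).
Proof.
have [C C0 H] := nat_pmf0_ub.
apply: (@cvg_dist_le _ _ (fun n => C * n%:R `^ (- sigma))).
  near=> n; rewrite subr0 ger0_norm /nat_pmf ?fine_ge0//; apply: H.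
  by near: n; exact: nbhs_infty_gt.
by rewrite -(mulr0 C); apply: cvgMr; exact: cvgn_powRN.
Unshelve. all: by end_near. Qed.

(** For t <= 1 this is the bound on the generating function, with 1 - exp (- t) >= t / 2. For t > 1,
    k >= 1 gives exp (- t k) <= exp (1 - t) exp (- k), and the exponential in t beats the power. *)
Lemma lap_ub : exists2 C : R, 0 < C & forall n t, (0 < n)%N -> 0 < t ->
  lap n t <= C * (n%:R * t) `^ (- sigma).
Proof.
have [C C0 H] := Zub.
have H1 n t : (0 < n)%N -> 0 < t <= 1 -> lap n t <= C * 2 `^ sigma * (n%:R * t) `^ (- sigma).
  move=> n0 /[dup] t01 /andP[t0 t1].
  apply: (@le_trans _ _ (C * (1 + n%:R * (1 - expR (- t))) `^ (- sigma))).
    rewrite lapE//; apply: le_trans (H n _ (onem_itv t0)).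
    by rewrite gerBl /nat_pmf fine_ge0.
  rewrite -mulrA ler_wpM2l ?(ltW C0)//.
  have -> : 2 `^ sigma * (n%:R * t) `^ (- sigma) = (n%:R * (t / 2)) `^ (- sigma).
    rewrite mulrA [RHS]powRM ?mulr_ge0 ?(ltW t0)// mulrC; congr (_ * _).
    by rewrite -powR_inv1// -powRrM mulN1r opprK.
  have nt : 0 < n%:R * (t / 2) by rewrite mulr_gt0 ?divr_gt0 ?ltr0n.
  have le2 : n%:R * (t / 2) <= 1 + n%:R * (1 - expR (- t)).
    by rewrite ler_wpDl// ler_wpM2l// onem_expRN.
  by rewrite powRN_le ?(ltW sigma0).
pose K := (2 * (sigma + 1)) `^ sigma.
have K0 : 0 < K by rewrite powR_gt0 ?mulr_gt0 ?addr_gt0.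
exists (C * 2 `^ sigma * (1 + expR 1 * K)).
  by rewrite !mulr_gt0 ?powR_gt0// addr_gt0 ?mulr_gt0 ?expR_gt0.
move=> n t n0 t0; have [t1|t1] := leP t 1.
  apply: le_trans (H1 n t n0 _) _; first by rewrite t0.
  rewrite -mulrA -[leLHS]mulr1 -!mulrA !ler_wpM2l ?powR_ge0 ?(ltW C0)//.
  rewrite mulrC ler_wpM2r ?powR_ge0//.
  by rewrite lerDl mulr_ge0 ?expR_ge0// ltW.
apply: (@le_trans _ _ (expR (1 - t) * lap n 1)).
  rewrite /lap -nat_expectZ//; last exact: lap_integrable.
  apply: nat_expect_le; first exact/lap_integrable/ltW.
    by apply: nat_integrableZ; exact: lap_integrable.
  move=> [|k]; first by rewrite !mul0r mulr0.
  rewrite !mul1r -expRD ler_expR -[k.+1%:R]natr1.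
  have : 0 <= k%:R :> R by [].
  nra.
apply: (@le_trans _ _ (expR (1 - t) * (C * 2 `^ sigma * (n%:R * 1) `^ (- sigma)))).
  by rewrite ler_wpM2l ?expR_ge0// H1// ltr01 lexx.
rewrite mulr1 mulrCA -!mulrA !ler_wpM2l ?powR_ge0 ?(ltW C0)//.
rewrite [leRHS](_ : _ = n%:R `^ (- sigma) * ((1 + expR 1 * K) * t `^ (- sigma))); last first.
  by rewrite powRM ?(ltW t0)//; ring.
rewrite mulrC ler_wpM2l ?powR_ge0//.
apply: (@le_trans _ _ (expR 1 * K * t `^ (- sigma))).
  by rewrite expRD -mulrA ler_wpM2l ?expR_ge0// expRN_powR_ub// ltW.
by rewrite ler_wpM2r ?powR_ge0// lerDr.
Qed.

Lemma lap_cvg (t_ : nat -> R) : (\forall n \near \oo, 0 < t_ n) ->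
  t_ n @[n --> \oo] --> (0 : R) ->
  (1 + gamma * (n%:R * t_ n)) `^ sigma * (lap n (t_ n) + nat_pmf P (Z n) 0) @[n --> \oo] --> (1 : R).
Proof.
move=> tpos t0.
(* [Zcvg] asks for 0 < u_n <= 1 at every n, hence the default value 1 at the finitely many n where
   t_n <= 0. *)
pose u n := if 0 < t_ n then 1 - expR (- t_ n) else 1.
have u01 n : 0 < u n <= 1.
  by rewrite /u; case: ifP => [/onem_itv//|_]; rewrite ltr01 lexx.
have uE : \forall n \near \oo, u n = 1 - expR (- t_ n) by near=> n; rewrite /u ifT//; near: n.
have u0 : u n @[n --> \oo] --> (0 : R).
  apply: (@cvg_trans _ ((1 - expR (- t_ n)) @[n --> \oo])).
    by apply: near_eq_cvg; near=> n; apply/esym; near: n.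
  suff : 1 - expR (- t_ n) @[n --> \oo] --> (1 - 1 : R) by rewrite subrr.
  apply: cvgB; first exact: cvg_cst.
  rewrite -[X in _ --> X]expR0 -oppr0; apply: (@cvg_comp _ _ _ _ expR); last exact: continuous_expR.
  exact: cvgN.
have H1 := Zcvg u01 u0.
pose q n := (1 + gamma * (n%:R * t_ n)) / (1 + gamma * (n%:R * u n)).
have D0 n : 0 < 1 + gamma * (n%:R * u n).
  by have /andP[un0 _] := u01 n; rewrite ltr_pwDl// !mulr_ge0// ltW.
(* From u = 1 - exp (- t) follow u <= t <= (1 + t) u, so the quotient of the two brackets lies in
   [1, 1 + t_n] whatever the size of n t_n. *)
have q1 : q n @[n --> \oo] --> (1 : R).
  apply: (@squeeze_cvgr _ _ _ _ (fun=> 1) (fun n => 1 + t_ n)).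
  - near=> n; have tn : 0 < t_ n by near: n.
    have un : u n = 1 - expR (- t_ n) by near: n.
    have ut : u n <= t_ n by rewrite un lerBlDr -lerBlDl; exact: expR_ge1Dx.
    have tu : t_ n <= (1 + t_ n) * u n.
      by have := onem_expRN_lb tn; rewrite -un ler_pdivrMr ?addr_gt0// mulrC.
    apply/andP; split.
      by rewrite ler_pdivlMr// mul1r lerD2l ler_wpM2l ?(ltW gamma0)// ler_wpM2l.
    rewrite ler_pdivrMr// mulrDr mulr1 lerD ?lerDl ?(ltW tn)//.
    by rewrite [leRHS]mulrCA ler_wpM2l ?(ltW gamma0)// [leRHS]mulrCA ler_wpM2l.
  - exact: cvg_cst.
  - by rewrite -[X in _ --> X]addr0; apply: cvgD => //; exact: cvg_cst.
have q1s : q n `^ sigma @[n --> \oo] --> (1 : R).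
  have E1 : 1 `^ sigma = 1 :> R by rewrite powR1.
  by rewrite -[X in _ --> X]E1; apply: cvg_powR.
rewrite -[X in _ --> X]mul1r.
apply: cvg_trans (cvgM q1s H1); apply: near_eq_cvg; near=> n.
have tn : 0 < t_ n by near: n.
have un : u n = 1 - expR (- t_ n) by near: n.
have <- : \int[P]_w ((1 - u n) ^+ Z n w) = lap n (t_ n) + nat_pmf P (Z n) 0 by rewrite un lapE// subrK.
rewrite /= -[LHS]/(_ * (_ * _)) [LHS]mulrA; congr (_ * _).
rewrite /q -powRM ?divr_ge0 ?(ltW (D0 _))//; last 2 first.
- by rewrite addr_ge0// !mulr_ge0// ltW.
- by rewrite -mulrA ltW.
by rewrite -[gamma * n%:R * u n]mulrA divfK// gt_eqF.
Unshelve. all: by end_near. Qed.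

Lemma lap_cvg_infty (t_ : nat -> R) : (\forall n \near \oo, 0 < t_ n) ->
  t_ n @[n --> \oo] --> (0 : R) -> n%:R * t_ n @[n --> \oo] --> +oo ->
  (n%:R * t_ n) `^ sigma * lap n (t_ n) @[n --> \oo] --> gamma `^ (- sigma).
Proof.
move=> tpos t0 too.
have H1 := lap_cvg tpos t0.
have xpos : \forall n \near \oo, 0 < n%:R * t_ n.
  by near=> n; rewrite mulr_gt0 ?ltr0n//; near: n => //; exact: nbhs_infty_gt.
(* With x = n t_n, the product of (1 / x + gamma)^(- 1) and 1 + gamma x is x: this factor turns the
   normalization (1 + gamma x)^sigma into x^sigma. *)
have Hq : ((n%:R * t_ n)^-1 + gamma)^-1 @[n --> \oo] --> gamma^-1.
  apply: cvgV; first by rewrite gt_eqF.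
  rewrite -[X in _ --> X]add0r; apply: cvgD; last exact: cvg_cst.
  exact/(gtr0_cvgV0 xpos).
have {}Hq : ((n%:R * t_ n)^-1 + gamma)^-1 `^ sigma @[n --> \oo] --> gamma `^ (- sigma).
  rewrite (_ : gamma `^ (- sigma) = gamma^-1 `^ sigma); last first.
    by rewrite -powR_inv1 ?(ltW gamma0)// -powRrM mulN1r.
  by apply: cvg_powR => //; rewrite invr_gt0.
have [C C0 pC] := nat_pmf0_ub.
(* The atom at 0 is O(n^(- sigma)), so after normalization it weighs at most C t_n^sigma. *)
have Hp : (n%:R * t_ n) `^ sigma * nat_pmf P (Z n) 0 @[n --> \oo] --> (0 : R).
  apply: (@cvg_dist_le _ _ (fun n => C * Num.max 0 (t_ n) `^ sigma)).
    near=> n; have n0 : (0 < n)%N by near: n; exact: nbhs_infty_gt.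
    have tn : 0 < t_ n by near: n.
    rewrite subr0 ger0_norm /nat_pmf ?mulr_ge0 ?powR_ge0 ?fine_ge0// (max_idPr (ltW tn)).
    apply: le_trans (ler_wpM2l _ (pC _ n0)) _; first exact: powR_ge0.
    rewrite powRM ?(ltW tn)// powRN mulrCA mulrAC mulfV ?mul1r// gt_eqF// powR_gt0// ltr0n//.
  rewrite -[X in _ --> X](mulr0 C); apply: cvgMr.
  apply/cvgrPdist_le => e e0; near=> n.
  have tn : 0 < t_ n by near: n.
  rewrite sub0r normrN ger0_norm ?powR_ge0// (max_idPr (ltW tn)).
  rewrite (_ : e = (e `^ sigma^-1) `^ sigma); last first.
    by rewrite -powRrM mulVf ?gt_eqF// powRr1// ltW.
  rewrite ge0_ler_powR ?nnegrE ?powR_ge0 ?(ltW tn) ?(ltW sigma0)//.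
  near: n; apply: (cvgr_le _ t0); exact: powR_gt0.
rewrite -[X in _ --> X]mulr1 -[X in _ --> X]subr0.
apply: cvg_trans (cvgB (cvgM Hq H1) Hp); apply: near_eq_cvg; near=> n.
have tn : 0 < n%:R * t_ n by near: n.
have D0 : 0 < 1 + gamma * (n%:R * t_ n) by rewrite addr_gt0// mulr_gt0.
rewrite /= -[LHS]/(_ * _ - _).
rewrite [X in X - _]mulrA -powRM ?(ltW D0)//; last by rewrite invr_ge0 addr_ge0 ?invr_ge0 ?(ltW tn) ?(ltW gamma0).
rewrite (_ : _^-1 * (1 + _) = n%:R * t_ n); first by rewrite mulrDr addrK.
move: tn D0; move: (n%:R * t_ n) => x x0 D0.
rewrite -{1}(mulfK (lt0r_neq0 x0) gamma) -{1}[x^-1]mul1r -mulrDl invfM invrK.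
by rewrite mulrAC mulVf ?mul1r// gt_eqF.
Unshelve. all: by end_near. Qed.

Lemma lap_cvg_scale (s : R) : 0 < s ->
  lap n (s / n%:R) @[n --> \oo] --> (1 + gamma * s) `^ (- sigma).
Proof.
move=> s0; have D0 : 0 < 1 + gamma * s by rewrite addr_gt0 ?mulr_gt0.
have H1 : (1 + gamma * (n%:R * (s / n%:R))) `^ sigma * (lap n (s / n%:R) + nat_pmf P (Z n) 0)
    @[n --> \oo] --> (1 : R).
  apply: lap_cvg.
    by near=> n; rewrite divr_gt0// ltr0n; near: n; exact: nbhs_infty_gt.
  rewrite -[X in _ --> X](mulr0 s); apply: cvgMr.
  apply/gtr0_cvgV0; last exact: cvgr_idn.
  by near=> n; rewrite ltr0n; near: n; exact: nbhs_infty_gt.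
rewrite -[X in _ --> X]subr0 -[X in _ --> X - _]mulr1.
apply: cvg_trans (cvgB (cvgM (cvg_cst _) H1) nat_pmf0_cvg); apply: near_eq_cvg; near=> n.
have n0 : (n%:R : R) != 0 by rewrite pnatr_eq0 -lt0n; near: n; exact: nbhs_infty_gt.
rewrite /= -[LHS]/(_ * _ - _).
by rewrite [n%:R * _]mulrC divfK// mulrA -gt0_powRD// addNr powRr0 mul1r addrK.
Unshelve. all: by end_near. Qed.

(** Markov's inequality: the indicator of k <= m is at most exp (1 - k / m), which leads to the
    Laplace transform at t = 1 / m. *)
Lemma small_ub : exists2 C : R, 0 < C & forall n m, (0 < n)%N -> 0 < m ->
  E n (fun k => ((0 < k)%N && (k%:R <= m))%:R) <= C * (m / n%:R) `^ sigma.
Proof.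
have [C C0 H] := lap_ub; exists (expR 1 * C); first by rewrite mulr_gt0 ?expR_gt0.
move=> n m n0 m0; have mV0 : 0 < m^-1 by rewrite invr_gt0.
apply: (@le_trans _ _ (expR 1 * lap n m^-1)).
  rewrite /lap -nat_expectZ//; last exact/lap_integrable/ltW.
  apply: nat_expect_le.
  - by apply: (@nat_integrable_bounded _ _ _ _ _ (mZ n) 1) => k; rewrite ger0_norm// lern1 leq_b1.
  - exact/nat_integrableZ/lap_integrable/ltW.
  move=> k; case: (0 < k)%N; rewrite ?mul0r ?mulr0//= mul1r -expRD.
  have [km|_] := leP (k%:R : R) m; last exact: expR_ge0.
  by rewrite -[leLHS]expR0 ler_expR subr_ge0 mulrC ler_pdivrMr// mul1r.
rewrite -mulrA ler_wpM2l ?expR_ge0//; apply: le_trans (H _ _ n0 mV0) _.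
rewrite le_eqVlt; apply/orP; left; apply/eqP; congr (_ * _).
rewrite -[m / _]invrK invfM invrK -[in RHS]powR_inv1 ?mulr_ge0 ?(ltW mV0)//.
by rewrite -powRrM mulN1r mulrC.
Qed.

Lemma gamma_mixture n (r : R) (z : nat -> R) : 1 <= r -> (forall k, (0 < k)%N -> 1 <= z k) ->
  ((Gamma r * E n (fun k => (0 < k)%N%:R * z k `^ (- r)))%:E =
   \int[mu]_(s in `]0%R, +oo[)
     (s `^ (r - 1) * E n (fun k => (0 < k)%N%:R * expR (- (z k * s))))%:E)%E.
Proof.
move=> r1 z1; have r0 : 0 <= r by exact: le_trans r1.
have b1 k : `|(0 < k)%N%:R * z k `^ (- r)| <= 1 :> R.
  rewrite ger0_norm ?mulr_ge0 ?powR_ge0//; case: k => [|k]; rewrite ?mul0r// mul1r.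
  by have := powRN_le r0 ltr01 (z1 k.+1 isT); rewrite powR1.
have b2 s k : 0 < s -> `|(0 < k)%N%:R * expR (- (z k * s))| <= 1 :> R.
  move=> s0; rewrite ger0_norm ?mulr_ge0 ?expR_ge0//; case: k => [|k]; rewrite ?mul0r// mul1r.
  by rewrite -expR0 ler_expR oppr_le0 mulr_ge0 ?(ltW s0)// (le_trans ler01)// z1.
have i1 := nat_integrable_bounded P (mZ n) b1.
have i2 s (s0 : 0 < s) := nat_integrable_bounded P (mZ n) (fun k => b2 s k s0).
rewrite -nat_expectZ// -nat_expectE//; last exact: nat_integrableZ.
transitivity (\int[P]_w \int[mu]_(s in `]0%R, +oo[)
   (s `^ (r - 1) * ((0 < Z n w)%N%:R * expR (- (z (Z n w) * s))))%:E)%E.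
  apply: eq_integral => w _; move: (Z n w) => k.
  transitivity (((0 < k)%N%:R)%:E * egam r (z k))%E.
    case: (posnP k) => [->|k0]; first by rewrite !mul0r mulr0 mul0e.
    rewrite egamE//; last exact: lt_le_trans (z1 _ k0).
    by rewrite -EFinM; congr EFin; ring.
  rewrite -ge0_integralZl_EFin//; last 2 first.
  - by move=> s _; rewrite lee_fin mulr_ge0 ?powR_ge0 ?expR_ge0.
  - by apply/measurable_EFinP/measurable_funTS; exact: measurable_egam.
  by apply: eq_integral => s _; rewrite -EFinM; congr EFin; ring.
rewrite -(@nat_expect_tonelli _ _ _ _ _ (mZ n) `]0%R, +oo[
  (fun k s => s `^ (r - 1) * ((0 < k)%N%:R * expR (- (z k * s)))))//; last 3 first.
- move=> k; apply: measurable_funM => //; apply: measurable_funM => //.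
  apply: measurableT_comp => //; apply: measurableT_comp => //; exact: measurable_funM.
- by move=> k s; rewrite !mulr_ge0 ?powR_ge0 ?expR_ge0.
- by move=> s; rewrite /= in_itv/= andbT => s0; apply: nat_integrableZ; exact: i2.
apply: eq_integral => s; rewrite inE/= in_itv/= andbT => s0.
by rewrite nat_expectZ//; exact: i2.
Qed.

(** With exponent sigma + 1 the weight s^sigma of the Gamma mixture cancels the factor s^(- sigma)
    of [lap_ub]; the factor exp (- s), due to the 1 in 1 + k e, is left to integrate. *)
Lemma inv1D_moment_ub : exists2 C : R, 0 < C & forall n (e : R), (0 < n)%N -> 0 < e ->
  E n (fun k => (0 < k)%N%:R * (1 + k%:R * e) `^ (- (sigma + 1))) <= C * (n%:R * e) `^ (- sigma).
Proof.
have [C C0 H] := lap_ub.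
have p1 : 1 <= sigma + 1 by rewrite lerDr ltW.
have G0 := Gamma_gt0 p1.
have G1 := Gamma_gt0 (lexx (1 : R)).
exists (C * Gamma 1 / Gamma (sigma + 1)); first exact: divr_gt0 (mulr_gt0 C0 G1) G0.
move=> n e n0 e0; rewrite -(ler_pM2l G0) -lee_fin gamma_mixture//; last first.
  by move=> k _; rewrite lerDl mulr_ge0// ltW.
apply: (@le_trans _ _ ((C * (n%:R * e) `^ (- sigma))%:E * egam 1 1)%E); last first.
  have E1 : 1 `^ (- 1) = 1 :> R by rewrite powR1.
  have E2 : Gamma (sigma + 1) * (C * Gamma 1 / Gamma (sigma + 1) * (n%:R * e) `^ (- sigma)) =
      C * (n%:R * e) `^ (- sigma) * Gamma 1.
    by move: (Gamma 1) (Gamma (sigma + 1)) G0 => u v v0; field; rewrite gt_eqF.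
  by rewrite egamE// E1 mulr1 -EFinM E2.
rewrite -ge0_integralZl_EFin//; last 3 first.
- by move=> s _; rewrite lee_fin mulr_ge0 ?powR_ge0 ?expR_ge0.
- by apply/measurable_EFinP/measurable_funTS; exact: measurable_egam.
- by rewrite mulr_ge0 ?powR_ge0// ltW.
apply: ge0_le_integral => //.
- by move=> s _; rewrite lee_fin mulr_ge0 ?powR_ge0//; apply: nat_expect_ge0 => k; rewrite mulr_ge0 ?expR_ge0.
- apply/measurable_EFinP/measurable_funTS; apply: measurable_funM => //.
  apply: (@measurable_nat_expect _ _ _ _ (Z n) (fun k s => (0 < k)%N%:R * expR (- ((1 + k%:R * e) * s)))) => //.
  by move=> k; exact: measurable_expRN.
- by apply: measurable_funeM; apply/measurable_EFinP/measurable_funTS; exact: measurable_egam.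
move=> s; rewrite /= in_itv/= andbT => s0; rewrite -EFinM lee_fin addrK mul1r.
have -> : E n (fun k => (0 < k)%N%:R * expR (- ((1 + k%:R * e) * s))) = expR (- s) * lap n (s * e).
  rewrite -nat_expectZ//; last by apply: lap_integrable; rewrite mulr_ge0// ltW.
  congr (E n _); apply/funext => k; rewrite mulrCA -expRD; congr (_ * expR _); ring.
apply: (@le_trans _ _ (s `^ sigma * (expR (- s) * (C * (n%:R * (s * e)) `^ (- sigma))))).
  by rewrite !ler_wpM2l ?powR_ge0 ?expR_ge0// H// mulr_gt0.
have -> : (n%:R * (s * e)) `^ (- sigma) = (s `^ sigma)^-1 * (n%:R * e) `^ (- sigma).
  have ne0 : 0 <= n%:R * e by rewrite mulr_ge0// ltW.
  by rewrite mulrCA (powRM _ (ltW s0) ne0) powRN.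
rewrite subrr powRr0 mul1r.
rewrite [leLHS](_ : _ = (s `^ sigma / s `^ sigma) * (C * (n%:R * e) `^ (- sigma) * expR (- s))); last by ring.
by rewrite divff ?mul1r// gt_eqF// powR_gt0.
Qed.

Lemma measurable_lap n : measurable_fun setT (lap n).
Proof.
rewrite /lap; apply: (@measurable_nat_expect _ _ _ _ (Z n) (fun k s => (0 < k)%N%:R * expR (- (s * k%:R)))) => //.
  move=> k; under eq_fun do rewrite mulrC; under eq_fun do rewrite [_ * k%:R]mulrC mulrC.
  exact: measurable_expRN.
Qed.

Lemma harmonic_laplace n (r : R) : (0 < n)%N -> 1 <= r ->
  n%:R `^ r * (Gamma r * E n (fun k => (0 < k)%N%:R * k%:R `^ (- r))) =
  \int[mu]_(s in `]0, +oo[) (s `^ (r - 1) * lap n (s / n%:R)).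
Proof.
move=> n0 r1; have n0R : 0 < n%:R :> R by rewrite ltr0n.
have mf : measurable_fun setT (fun s => s `^ (r - 1) * lap n s).
  by apply: measurable_funM => //; exact: measurable_lap.
rewrite /Rintegral -[LHS]/(fine (_%:E)); congr fine.
rewrite EFinM gamma_mixture//; last by move=> [|k]// _; rewrite ler1n.
transitivity ((n%:R `^ r)%:E * \int[mu]_(s in `]0%R, +oo[) (s `^ (r - 1) * lap n s)%:E)%E.
  have lapC s : E n (fun k => (0 < k)%N%:R * expR (- (k%:R * s))) = lap n s.
    by congr (nat_expect _ _ _); apply/funext => k; rewrite [s * _]mulrC.
  by under eq_integral do rewrite lapC.
have nV0 : 0 < n%:R^-1 :> R by rewrite invr_gt0.
rewrite -(ge0_integral_scale_pos nV0)//; last 2 first.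
- exact/measurable_EFinP.
- by move=> s; rewrite lee_fin mulr_ge0 ?powR_ge0 ?lap_ge0.
rewrite muleA -EFinM -ge0_integralZl_EFin//; last 2 first.
- by move=> s _; rewrite lee_fin mulr_ge0 ?powR_ge0 ?lap_ge0.
- apply/measurable_EFinP/measurable_funTS.
  by apply: (measurableT_comp mf); exact: measurable_funM.
apply: eq_integral => s; rewrite inE/= in_itv/= andbT => s0.
rewrite -EFinM; congr EFin; rewrite mulrA [s / _]mulrC; congr (_ * _).
rewrite powRM ?(ltW s0) ?(ltW nV0)// mulrA -[RHS]mul1r; congr (_ * _).
rewrite -[X in _ * X * _]powRr1 ?(ltW nV0)// -powR_inv1 ?(ltW n0R)// -!powRrM -!gt0_powRD//.
by rewrite (_ : _ + _ = 0) ?powRr0//; ring.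
Qed.

(** In the scaled mixture, lap n (s / n) tends to (1 + gamma s)^(- sigma) and is at most a multiple
    of (1 + s)^(- sigma), by the trivial bound 1 for s <= 1 and by [lap_ub] beyond; r < sigma makes
    the product with s^(r - 1) integrable. *)
Lemma harmonic_cvg (r : R) : 1 <= r < sigma ->
  n%:R `^ r * E n (fun k => (0 < k)%N%:R * k%:R `^ (- r)) @[n --> \oo] --> I_const gamma r sigma.
Proof.
move=> /andP[r1 rs]; have G0 := Gamma_gt0 r1.
have [C C0 H] := lap_ub.
rewrite /I_const.
have K0 : 0 < 2 `^ sigma * (1 + C) by rewrite mulr_gt0 ?powR_gt0// addr_gt0.
have lapb n s : (0 < n)%N -> 0 < s -> lap n (s / n%:R) <= 2 `^ sigma * (1 + C) * (1 + s) `^ (- sigma).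
  move=> n0 s0; have n0R : 0 < n%:R :> R by rewrite ltr0n.
  have [s1|s1] := leP s 1.
    apply: (@le_trans _ _ 1).
      rewrite -[leRHS](nat_expect_cst P (Z n)); apply: nat_expect_le.
      - by apply: lap_integrable; rewrite divr_ge0// ltW.
      - exact: nat_integrable_cst.
      by move=> k; rewrite (le_trans (ler_norm _))// lap_term_bound// divr_ge0// ltW.
    apply: (@le_trans _ _ (2 `^ sigma * 2 `^ (- sigma))).
      by rewrite -gt0_powRD// subrr powRr0.
    rewrite ler_pM ?powR_ge0//; first by rewrite ler_peMr ?powR_ge0// lerDl ltW.
    by rewrite powRN_le ?(ltW sigma0) ?addr_gt0// -natr1 addrC lerD2r.
  apply: le_trans (H _ _ n0 _) _; first by rewrite divr_gt0.
  rewrite mulrC [_ * (s / _)]mulrC divfK ?gt_eqF//.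
  rewrite [leRHS](_ : _ = (1 + C) * (2 `^ sigma * (1 + s) `^ (- sigma))); last by ring.
  rewrite mulrC ler_pM ?powR_ge0 ?(ltW C0)//; first by rewrite lerDr.
  have -> : 2 `^ sigma * (1 + s) `^ (- sigma) = ((1 + s) / 2) `^ (- sigma).
    rewrite [RHS]powRM ?addr_ge0 ?(ltW s0)// mulrC; congr (_ * _).
    by rewrite -powR_inv1// -powRrM mulN1r opprK.
  by rewrite powRN_le ?(ltW sigma0)//; lra.
(* The index is shifted to n + 1 because the domination requires a positive index for every term. *)
suff Hc : \int[mu]_(s in `]0, +oo[) (s `^ (r - 1) * lap n.+1 (s / n.+1%:R)) @[n --> \oo] -->
    \int[mu]_(s in `]0, +oo[) ((1 + gamma * s) `^ (- sigma) * s `^ (r - 1)).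
  suff Hd : n.+1%:R `^ r * E n.+1 (fun k => (0 < k)%N%:R * k%:R `^ (- r)) @[n --> \oo] -->
      (Gamma r)^-1 * \int[mu]_(s in `]0, +oo[) ((1 + gamma * s) `^ (- sigma) * s `^ (r - 1)).
    by rewrite -cvg_shiftS; exact: Hd.
  apply: cvg_trans (cvgM (cvg_cst (Gamma r)^-1) Hc); apply: near_eq_cvg; near=> n.
  rewrite /= -[LHS]/(_ * _) -harmonic_laplace// mulrC -mulrA; congr (_ * _).
  by rewrite mulrC mulKf// gt_eqF.
have mlap n : measurable_fun setT (fun s : R => s `^ (r - 1) * lap n.+1 (s / n.+1%:R)).
  apply: measurable_funM => //; apply: (measurableT_comp (measurable_lap n.+1)).
  exact: measurable_funM.
apply: (@dominated_cvg_Rintegral _ _ _ mu _ (fun n s => s `^ (r - 1) * lap n.+1 (s / n.+1%:R))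
  (fun s => (1 + gamma * s) `^ (- sigma) * s `^ (r - 1))
  (fun s => 2 `^ sigma * (1 + C) * (1 + s) `^ (- (sigma - r) - 1))) => //.
- by move=> n; apply: measurable_funTS; exact: mlap.
- apply: measurable_funM; apply: measurable_funTS; apply: (measurableT_comp (measurable_powR _)) => //.
  exact: measurable_affine.
- have mp : measurable_fun setT (fun s : R => (1 + s) `^ (- (sigma - r) - 1)).
    by apply: (measurableT_comp (measurable_powR _)); exact: measurable_funD.
  apply: (@integrableZl _ _ _ mu `]0, +oo[ _ _ (EFin \o (fun s => (1 + s) `^ (- (sigma - r) - 1)))) => //.
  apply: ge0_integrable => //; first by move=> s; exact: powR_ge0.
  rewrite integral_itv_obnd_cbnd; last exact/measurable_EFinP/measurable_funTS.
  by rewrite integral_shift_powR_pinfty ?subr_gt0 ?addr0// ltry.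
- move=> s; rewrite /= in_itv/= andbT => s0; rewrite mulrC; apply: cvgMr.
  exact: (cvgn_succ (lap_cvg_scale s0)).
- move=> n s; rewrite /= in_itv/= andbT => s0.
  rewrite ger0_norm ?mulr_ge0 ?powR_ge0 ?lap_ge0//.
  apply: le_trans (ler_wpM2l _ (lapb n.+1 s isT s0)) _; first exact: powR_ge0.
  rewrite mulrCA ler_wpM2l ?(ltW K0)//.
  rewrite (_ : - (sigma - r) - 1 = (r - 1) + - sigma); last by ring.
  have s10 : 0 < 1 + s by rewrite addr_gt0.
  rewrite (gt0_powRD (r - 1) (- sigma) s10) ler_wpM2r ?powR_ge0// ge0_ler_powR ?nnegrE ?subr_ge0 ?addr_ge0 ?(ltW s0)//.
  by rewrite lerDr.
Unshelve. all: by end_near. Qed.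

(** An exponent q strictly between r and sigma is inserted: k^(- r) <= m^(q - r) k^(- q) for k <= m,
    and the moment of order - q is still O(n^(- q)). The gain is b = q - r. *)
Lemma harmonic_small_ub (r : R) : 1 <= r < sigma ->
  exists b C : R, [/\ 0 < b, 0 < C & \forall n \near \oo, forall m, 0 < m ->
  E n (fun k => ((0 < k)%N && (k%:R <= m))%:R * k%:R `^ (- r)) <= C * n%:R `^ (- r) * (m / n%:R) `^ b].
Proof.
move=> /andP[r1 rs]; pose q := (r + sigma) / 2.
have rq : r < q by rewrite /q; lra.
have qs : q < sigma by rewrite /q; lra.
have q1 : 1 <= q by rewrite (le_trans r1)// ltW.
have Hq : 1 <= q < sigma by rewrite q1.
have H := harmonic_cvg Hq.
exists (q - r), (1 + `|I_const gamma q sigma|); split; rewrite ?subr_gt0 ?ltr_pwDl//.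
near=> n; move=> m m0; have n0 : (0 < n)%N by near: n; exact: nbhs_infty_gt.
have n0R : 0 < n%:R :> R by rewrite ltr0n.
have Hn : n%:R `^ q * E n (fun k => (0 < k)%N%:R * k%:R `^ (- q)) <= 1 + `|I_const gamma q sigma|.
  near: n; apply: (cvgr_le _ H); rewrite (le_lt_trans (ler_norm _))// ltrDr//.
have bnd (p : R) k : 1 <= p -> `|(0 < k)%N%:R * k%:R `^ (- p)| <= 1 :> R.
  move=> p1; rewrite ger0_norm ?mulr_ge0 ?powR_ge0//; case: k => [|k]; rewrite ?mul0r// mul1r.
  by rewrite -[leRHS](powRr0 k.+1%:R) ler_powR ?ler1n// oppr_le0 (le_trans ler01).
have iq := nat_integrable_bounded P (mZ n) (fun k => bnd q k q1).
apply: (@le_trans _ _ (m `^ (q - r) * E n (fun k => (0 < k)%N%:R * k%:R `^ (- q)))).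
  rewrite -nat_expectZ//; apply: nat_expect_le; last 2 first.
  - exact: nat_integrableZ.
  - move=> [|k]; first by rewrite !mul0r mulr0.
    have [km|_] := leP (k.+1%:R : R) m; last by rewrite !mul0r !mulr_ge0 ?powR_ge0.
    rewrite !mul1r.
    have -> : k.+1%:R `^ (- r) = k.+1%:R `^ (q - r) * k.+1%:R `^ (- q) :> R.
      by rewrite -gt0_powRD//; congr (_ `^ _); ring.
    by rewrite ler_wpM2r ?powR_ge0// ge0_ler_powR ?nnegrE ?subr_ge0 ?(ltW rq) ?(ltW m0).
  apply: (@nat_integrable_bounded _ _ _ _ _ (mZ n) 1) => k.
  case: (0 < k)%N (bnd r k r1) => /=; last by rewrite mul0r normr0.
  by case: (_ <= m); rewrite ?mul0r ?normr0.
rewrite powRM ?invr_ge0 ?(ltW m0)// [leRHS]mulrCA ler_wpM2l ?powR_ge0//.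
rewrite -ler_pdivlMl ?powR_gt0// in Hn.
apply: le_trans Hn _; rewrite -powRN mulrC -mulrA ler_wpM2l ?addr_ge0//.
by rewrite -powR_inv1 ?(ltW n0R)// -powRrM -gt0_powRD// (_ : - q = - r + -1 * (q - r))//; ring.
Unshelve. all: by end_near. Qed.

Lemma gauss_tail_lap n (e s0 : R) : (0 < n)%N -> 0 < e -> 0 < s0 ->
  E n (fun k => (0 < k)%N%:R * gauss_tail (e * Num.sqrt k%:R / s0)) =
  \int[mu]_z ((2 * pi * (1 + z ^+ 2))^-1 * lap n (e ^+ 2 / (2 * s0 ^+ 2) * (1 + z ^+ 2))).
Proof.
move=> n0 e0 s00; rewrite /nat_expect /Rintegral; congr fine.
have c0 (z : R) : 0 <= (2 * pi * (1 + z ^+ 2))^-1.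
  by rewrite invr_ge0 !mulr_ge0 ?pi_ge0 ?addr_ge0 ?sqr_ge0.
have c1 (z : R) : 0 <= e ^+ 2 / (2 * s0 ^+ 2) * (1 + z ^+ 2).
  by rewrite mulr_ge0 ?addr_ge0 ?sqr_ge0// divr_ge0 ?sqr_ge0// mulr_ge0 ?sqr_ge0.
transitivity (\int[P]_w \int[mu]_z ((2 * pi * (1 + z ^+ 2))^-1 *
    ((0 < Z n w)%N%:R * expR (- (e ^+ 2 / (2 * s0 ^+ 2) * (1 + z ^+ 2) * (Z n w)%:R))))%:E)%E.
  apply: eq_integral => w _; move: (Z n w) => [|k].
    by rewrite mul0r; under eq_integral do rewrite mul0r mulr0; rewrite integral0.
  rewrite mul1r /gauss_tail fineK ?fin_num_measure// gauss_tail_mixture; last first.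
    by rewrite divr_gt0 ?mulr_gt0 ?sqrtr_gt0.
  apply: eq_integral => z _; rewrite mul1r; congr ((_ * expR (- _))%:E).
  rewrite expr_div_n exprMn sqr_sqrtr//; field; rewrite gt_eqF//.
rewrite -(@nat_expect_tonelli _ _ _ _ _ (mZ n) setT (fun k z => (2 * pi * (1 + z ^+ 2))^-1 *
    ((0 < k)%N%:R * expR (- (e ^+ 2 / (2 * s0 ^+ 2) * (1 + z ^+ 2) * k%:R)))))//; last 3 first.
- move=> k; apply: measurable_funM.
    by apply: measurable_gauss_weight.
  apply: measurable_funM => //; apply: measurableT_comp => //; apply: measurableT_comp => //.
  by apply: measurable_funM => //; apply: measurable_funM => //; apply: measurable_funD.
- by move=> k z; rewrite !mulr_ge0 ?expR_ge0.
- by move=> z _; apply: nat_integrableZ; exact: lap_integrable.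
by apply: eq_integral => z _; rewrite nat_expectZ//; exact: lap_integrable.
Qed.

(** By [gauss_tail_lap] the average is an integral over z of the transform at e^2 (1 + z^2) / (2
    s0^2). As n e^2 tends to infinity, [lap_cvg_infty] gives the pointwise limit and [lap_ub] a
    majorant proportional to (1 + z^2)^(- (sigma + 1)). *)
Lemma gauss_functional_cvg (e : nat -> R) (s0 : R) : 0 < s0 -> (forall n, 0 < e n) ->
  e n @[n --> \oo] --> (0 : R) -> n%:R * e n ^+ 2 @[n --> \oo] --> +oo ->
  (n%:R * e n ^+ 2) `^ sigma * E n (fun k => (0 < k)%N%:R * gauss_tail (e n * Num.sqrt k%:R / s0))
    @[n --> \oo] --> Upsilon gamma sigma s0.
Proof.
move=> s00 e0 ec eoo.
have [C C0 H] := lap_ub.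
pose c (z : R) := (1 + z ^+ 2) / (2 * s0 ^+ 2).
have z10 (z : R) : 0 < 1 + z ^+ 2 by rewrite ltr_pwDl// sqr_ge0.
have s20 : 0 < 2 * s0 ^+ 2 by rewrite mulr_gt0 ?exprn_gt0.
have cp z : 0 < c z by rewrite divr_gt0.
have pi0 := pi_gt0 R.
have e20 n : 0 < e n ^+ 2 by rewrite exprn_gt0.
have e2c : e n ^+ 2 @[n --> \oo] --> (0 : R).
  suff : e n * e n @[n --> \oo] --> (0 * 0 : R) by rewrite mul0r.
  exact: cvgM.
pose K := (2 * pi)^-1 * (2 * s0 ^+ 2) `^ sigma.
have wE z b : (2 * pi * (1 + z ^+ 2))^-1 * (b * c z `^ (- sigma)) = b * K * (1 + z ^+ 2) `^ (- (sigma + 1)).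
  rewrite opprD gt0_powRD// powR_inv1 ?(ltW (z10 z))// /c powRM ?invr_ge0 ?(ltW (z10 z)) ?(ltW s20)//.
  rewrite -(powR_inv1 (ltW s20)) -powRrM mulN1r opprK invfM /K; ring.
have mw : measurable_fun setT (fun z : R => (1 + z ^+ 2) `^ (- (sigma + 1))) by exact: measurable_1Dsqr_powR.
have p32 : 3 / 2 <= sigma + 1 by move: sigma1 => {H ec eoo e2c}; lra.
(* The limit is a multiple of the integral of (1 + z^2)^(- (sigma + 1)), a quotient of Gamma values;
   Gamma(sigma + 1) = sigma Gamma(sigma) brings it to the form of [Upsilon]. *)
have UE : Upsilon gamma sigma s0 = \int[mu]_z ((2 * pi * (1 + z ^+ 2))^-1 * (gamma `^ (- sigma) * c z `^ (- sigma))).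
  under eq_Rintegral do rewrite wE.
  have -> : \int[mu]_z (gamma `^ (- sigma) * K * (1 + z ^+ 2) `^ (- (sigma + 1))) =
      gamma `^ (- sigma) * K * (Num.sqrt pi * Gamma (sigma + 1 - 2^-1) / Gamma (sigma + 1)).
    rewrite /Rintegral; under eq_integral do rewrite EFinM.
    rewrite ge0_integralZl_EFin//; last 3 first.
    - by move=> z _; rewrite lee_fin powR_ge0.
    - by apply/measurable_EFinP; exact: measurable_1Dsqr_powR.
    - by rewrite !mulr_ge0 ?powR_ge0 ?invr_ge0 ?mulr_ge0 ?(ltW pi0).
    by rewrite integral_inv1Dsqr_powR.
  rewrite /Upsilon GammaS ?(ltW sigma1)// (_ : sigma + 1 - 2^-1 = sigma + 2^-1); last by field.
  rewrite /K powRM ?exprn_ge0 ?(ltW s00)// -powR_mulrn ?(ltW s00)// -powRrM powRN.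
  rewrite (_ : 2 `^ (sigma - 1) = 2 `^ sigma / 2); last by rewrite gt0_powRD// powR_inv1.
  have : Num.sqrt pi ^+ 2 = pi :> R by rewrite sqr_sqrtr// ltW.
  have : Num.sqrt pi != 0 :> R by rewrite gt_eqF// sqrtr_gt0.
  have := Gamma_gt0 (ltW sigma1); have := powR_gt0 sigma gamma0; have := sigma0.
  move: (Num.sqrt pi) (Gamma sigma) (gamma `^ sigma) (Gamma _) (2 `^ _) (s0 `^ _) => p G g G' t u sg g0 G0 p0 <-.
  by field; rewrite p0 !gt_eqF.
rewrite UE.
suff Hc : \int[mu]_z ((2 * pi * (1 + z ^+ 2))^-1 * ((n.+1%:R * e n.+1 ^+ 2) `^ sigma * lap n.+1 (e n.+1 ^+ 2 * c z)))
    @[n --> \oo] --> \int[mu]_z ((2 * pi * (1 + z ^+ 2))^-1 * (gamma `^ (- sigma) * c z `^ (- sigma))).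
  suff Hd : (n.+1%:R * e n.+1 ^+ 2) `^ sigma * E n.+1 (fun k => (0 < k)%N%:R * gauss_tail (e n.+1 * Num.sqrt k%:R / s0))
    @[n --> \oo] --> \int[mu]_z ((2 * pi * (1 + z ^+ 2))^-1 * (gamma `^ (- sigma) * c z `^ (- sigma))).
    by rewrite -cvg_shiftS; exact: Hd.
  apply: cvg_trans Hc; apply: near_eq_cvg; near=> n.
  pose f (z : R) := (2 * pi * (1 + z ^+ 2))^-1 * lap n.+1 (e n.+1 ^+ 2 / (2 * s0 ^+ 2) * (1 + z ^+ 2)).
  have mf : measurable_fun setT f.
    apply: measurable_funM; first exact: measurable_gauss_weight.
    apply: (measurableT_comp (measurable_lap n.+1)).
    by apply: measurable_funM => //; apply: measurable_funD.
  have f0 z : 0 <= f z by rewrite mulr_ge0 ?lap_ge0 ?invr_ge0 ?mulr_ge0 ?(ltW pi0) ?(ltW (z10 z)).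
  have Hf := ge0_RintegralZl mu (powR_ge0 (n.+1%:R * e n.+1 ^+ 2) sigma) mf f0.
  have Hg : _ = \int[mu]_z f z := gauss_tail_lap (ltn0Sn n) (e0 n.+1) s00.
  rewrite Hg -Hf; apply: eq_Rintegral => z _; rewrite mulrCA; congr (_ * (_ * lap _ _)).
  by rewrite /c mulrA mulrAC.
apply: (@dominated_cvg_Rintegral _ _ _ mu _
  (fun n z => (2 * pi * (1 + z ^+ 2))^-1 * ((n.+1%:R * e n.+1 ^+ 2) `^ sigma * lap n.+1 (e n.+1 ^+ 2 * c z)))
  (fun z => (2 * pi * (1 + z ^+ 2))^-1 * (gamma `^ (- sigma) * c z `^ (- sigma)))
  (fun z => C * K * (1 + z ^+ 2) `^ (- (sigma + 1)))) => //.
- move=> n; apply: measurable_funM; first exact: measurable_gauss_weight.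
  apply: measurable_funM => //; apply: (measurableT_comp (measurable_lap n.+1)).
  by apply: measurable_funM => //; apply: measurable_funM => //; apply: measurable_funD.
- apply: measurable_funM; first exact: measurable_gauss_weight.
  apply: measurable_funM => //; apply: (measurableT_comp (measurable_powR _)).
  by apply: measurable_funM => //; apply: measurable_funD.
- apply: (@integrableZl _ _ _ mu setT _ _ (EFin \o (fun z => (1 + z ^+ 2) `^ (- (sigma + 1))))) => //.
  apply: ge0_integrable => //; first by move=> z; exact: powR_ge0.
  by rewrite integral_inv1Dsqr_powR// ltry.
- move=> z _; apply: cvgMr.
  have tp : \forall n \near \oo, 0 < e n ^+ 2 * c z by near=> n; rewrite mulr_gt0.
  have tc : e n ^+ 2 * c z @[n --> \oo] --> (0 : R) by rewrite -[X in _ --> X](mul0r (c z)); apply: cvgMl.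
  have too : n%:R * (e n ^+ 2 * c z) @[n --> \oo] --> +oo.
    apply/cvgryPge => A; near=> n; rewrite mulrA -ler_pdivrMr//.
    by near: n; exact: (cvgry_ge eoo).
  suff : (n%:R * e n ^+ 2) `^ sigma * lap n (e n ^+ 2 * c z) @[n --> \oo] --> gamma `^ (- sigma) * c z `^ (- sigma).
    exact: (@cvgn_succ _ (fun n => (n%:R * e n ^+ 2) `^ sigma * lap n (e n ^+ 2 * c z))).
  rewrite mulrC; apply: cvg_trans (cvgM (cvg_cst (c z `^ (- sigma))) (lap_cvg_infty tp tc too)).
  apply: near_eq_cvg; near=> n.
  have cc : c z `^ (- sigma) * c z `^ sigma = 1 by rewrite -gt0_powRD// addNr powRr0.
  have x0 : 0 <= n%:R * e n ^+ 2 by rewrite mulr_ge0// ltW.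
  rewrite /= -[LHS]/(_ * (_ * _)) mulrA mulrA (powRM _ x0 (ltW (cp z))) -[RHS]mul1r -[X in _ = X * _]cc.
  by rewrite !mulrA; congr (_ * _); rewrite -!mulrA; congr (_ * _); rewrite mulrC.
- move=> n z _; rewrite ger0_norm ?mulr_ge0 ?powR_ge0 ?lap_ge0 ?invr_ge0 ?mulr_ge0 ?(ltW pi0) ?(ltW (z10 z))//.
  rewrite -wE ler_wpM2l ?invr_ge0 ?mulr_ge0 ?(ltW pi0) ?(ltW (z10 z))//.
  have tz : 0 < e n.+1 ^+ 2 * c z by rewrite mulr_gt0.
  apply: le_trans (ler_wpM2l _ (H n.+1 _ isT tz)) _; first exact: powR_ge0.
  have x0 : 0 < n.+1%:R * e n.+1 ^+ 2 by rewrite mulr_gt0.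
  rewrite mulrCA ler_wpM2l ?(ltW C0)// mulrA (powRM _ (ltW x0) (ltW (cp z))) mulrA.
  by rewrite -gt0_powRD// subrr powRr0 mul1r.
Unshelve. all: by end_near. Qed.

End scaled_laplace.

(** * The central limit theorem, uniformly in the level *)

Section logistic.
Context (R : realType).
Implicit Types x y : R.

(** Smooth substitute for the indicator of a half-line: its derivatives are polynomials in itself,
    hence easily bounded, and it approaches 0 and 1 exponentially fast. *)
Definition logistic x : R := (1 + expR (- x))^-1.
Local Notation g := logistic.
Definition logistic1 x : R := g x * (1 - g x).
Definition logistic2 x : R := logistic1 x * (1 - 2 * g x).
Definition logistic3 x : R := logistic1 x * (1 - 6 * g x + 6 * g x ^+ 2).

Lemma logistic_itv x : 0 < g x < 1.
Proof.
have e0 := expR_gt0 (- x); have D0 : 0 < 1 + expR (- x) by rewrite addr_gt0.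
by rewrite invr_gt0 D0 invf_lt1// ltrDl.
Qed.

Lemma logistic1_itv x : 0 <= logistic1 x <= 1.
Proof.
have /andP[g0 g1] := logistic_itv x; rewrite /logistic1.
by apply/andP; split; nra.
Qed.

Lemma logistic2_bound x : `|logistic2 x| <= 1.
Proof.
have /andP[g0 g1] := logistic_itv x; have /andP[h0 h1] := logistic1_itv x.
rewrite /logistic2 normrM mulr_ile1 ?normr_ge0//; first by rewrite ger0_norm.
by rewrite ler_norml; apply/andP; split; lra.
Qed.

Lemma logistic3_bound x : `|logistic3 x| <= 1.
Proof.
have /andP[g0 g1] := logistic_itv x; have /andP[h0 h1] := logistic1_itv x.
rewrite /logistic3 normrM mulr_ile1 ?normr_ge0//; first by rewrite ger0_norm.
by rewrite ler_norml; apply/andP; split; nra.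
Qed.

Lemma is_derive_logistic x : is_derive x (1 : R) g (logistic1 x).
Proof.
have e0 := expR_gt0 (- x); have D0 : 0 < 1 + expR (- x) by rewrite addr_gt0.
have H1 := @is_derive1_comp _ expR (- (id : R -> R)) x _ _ (is_derive_expR _) (is_deriveN (is_derive_id x 1)).
have H2 := @is_deriveV _ (cst 1 + (expR \o - (id : R -> R))) x _ 1 (lt0r_neq0 D0) (is_deriveD (is_derive_cst (1 : R) x 1) H1).
apply: is_derive_eqfun H2 => //.
rewrite (_ : (cst 1 + (expR \o - id)) x = 1 + expR (- x))// (_ : (- id) x = - x)//.
rewrite /logistic1 /logistic /GRing.scale /=.
by field; rewrite gt_eqF.
Qed.

Lemma is_derive_logistic1 x : is_derive x (1 : R) logistic1 (logistic2 x).
Proof.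
have H := is_deriveM (is_derive_logistic x) (is_deriveB (is_derive_cst (1 : R) x 1) (is_derive_logistic x)).
apply: is_derive_eqfun H => //; rewrite /GRing.scale /= /logistic2 /logistic1.
by rewrite (_ : (cst 1 - g) x = 1 - g x)//; ring.
Qed.

Lemma is_derive_logistic2 x : is_derive x (1 : R) logistic2 (logistic3 x).
Proof.
have H := is_deriveM (is_derive_logistic1 x) (is_deriveB (is_derive_cst (1 : R) x 1) (is_deriveZ 2 (is_derive_logistic x))).
apply: is_derive_eqfun H => //; rewrite /GRing.scale /= /logistic3 /logistic2 /logistic1.
by rewrite (_ : (cst 1 - 2 \*: g) x = 1 - 2 * g x)//; ring.
Qed.

Lemma MVT_bound (f df : R -> R) y (B : R) : (forall x, is_derive x (1 : R) f (df x)) ->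
  (forall x, `|x| <= `|y| -> `|df x| <= B) -> `|f y - f 0| <= B * `|y|.
Proof.
move=> fdf dfB.
have cf : continuous f.
  by move=> x; have [+ _] := fdf x => /derivable1_diffP /differentiable_continuous.
have [y0|y0] := leP 0 y.
  have [c] := @MVT_segment _ f df 0 y y0 (fun x _ => fdf x) (continuous_subspaceT cf).
  rewrite in_itv/= => /andP[c0 cy] ->; rewrite subr0 normrM ler_wpM2r// dfB//.
  by rewrite !ger0_norm.
have [c] := @MVT_segment _ f df y 0 (ltW y0) (fun x _ => fdf x) (continuous_subspaceT cf).
rewrite in_itv/= => /andP[cy c0]; rewrite distrC => ->.
by rewrite sub0r normrM normrN ler_wpM2r// dfB// !ler0_norm ?lerN2// ltW.
Qed.

Lemma logistic2_lip x y : `|logistic2 (x + y) - logistic2 x| <= 2 * Num.min 1 `|y|.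
Proof.
have [y1|y1] := leP 1 `|y|.
  apply: le_trans (ler_normB _ _) _.
  by have := logistic2_bound (x + y); have := logistic2_bound x; lra.
have := @MVT_bound (fun y => logistic2 (x + y)) (fun y => logistic3 (x + y)) y 1.
rewrite addr0 => H; apply: (le_trans (H _ _)); last by rewrite ler_wpM2r//; lra.
- move=> z; have H1 := @is_derive1_comp _ logistic2 (cst x + id) z _ _ (is_derive_logistic2 _)
    (is_deriveD (is_derive_cst x z 1) (is_derive_id z 1)).
  by apply: is_derive_eqfun H1 => //; rewrite add0r mulr1.
- by move=> z _; exact: logistic3_bound.
Qed.

(** The mean value bound is applied twice, starting from [logistic2_lip]; the factor min (1, |z|) is
    monotone in |z|, so its value at y serves along the whole segment. *)
Lemma logistic_taylor x y :
  `|g (x + y) - g x - y * logistic1 x - y ^+ 2 * (logistic2 x / 2)| <= 2 * (y ^+ 2 * Num.min 1 `|y|).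
Proof.
have shift (f df : R -> R) : (forall x, is_derive x (1 : R) f (df x)) ->
    forall z, is_derive z (1 : R) (fun z => f (x + z)) (df (x + z)).
  move=> fdf z; have H1 := @is_derive1_comp _ f (cst x + id) z _ _ (fdf _)
    (is_deriveD (is_derive_cst x z 1) (is_derive_id z 1)).
  by apply: is_derive_eqfun H1 => //; rewrite add0r mulr1.
have minle (z : R) : `|z| <= `|y| -> Num.min 1 `|z| <= Num.min 1 `|y|.
  by move=> zy; rewrite le_min !ge_min lexx zy orbT.
have m0 : 0 <= Num.min 1 `|y| by rewrite le_min ler01 normr_ge0.
have R1 (z : R) : `|z| <= `|y| ->
    `|logistic1 (x + z) - logistic1 x - z * logistic2 x| <= 2 * Num.min 1 `|y| * `|y|.
  move=> zy; have := @MVT_bound (fun z => logistic1 (x + z) - logistic1 x - z * logistic2 x)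
    (fun z => logistic2 (x + z) - logistic2 x) z (2 * Num.min 1 `|y|).
  rewrite addr0 mul0r subrr !subr0 => H; apply: (le_trans (H _ _)).
  - move=> t; have H1 := is_deriveB (is_deriveB (shift _ _ is_derive_logistic1 t) (is_derive_cst (logistic1 x) t 1))
      (is_deriveM (is_derive_id t 1) (is_derive_cst (logistic2 x) t 1)).
    apply: is_derive_eqfun H1 => //.
    by rewrite /GRing.scale /= subr0 mulr0 add0r mulr1.
  - move=> t tz; apply: le_trans (logistic2_lip _ _) _; rewrite ler_wpM2l// minle//.
    exact: le_trans zy.
  - by rewrite ler_wpM2l// mulr_ge0.
have := @MVT_bound (fun z => g (x + z) - g x - z * logistic1 x - z ^+ 2 * (logistic2 x / 2))
    (fun z => logistic1 (x + z) - logistic1 x - z * logistic2 x) y (2 * Num.min 1 `|y| * `|y|).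
rewrite addr0 expr0n/= !mul0r subrr !subr0 => H; apply: (le_trans (H _ R1)).
- move=> t; have H1 := is_deriveB (is_deriveB (is_deriveB (shift _ _ is_derive_logistic t) (is_derive_cst (g x) t 1))
    (is_deriveM (is_derive_id t 1) (is_derive_cst (logistic1 x) t 1)))
    (is_deriveM (is_deriveX 2 (is_derive_id t 1)) (is_derive_cst (logistic2 x / 2) t 1)).
  apply: is_derive_eqfun H1 => //.
  by rewrite /GRing.scale /= subr0 !mulr0 !add0r mulr1 expr1; field.
- rewrite [leLHS](_ : _ = 2 * (`|y| ^+ 2 * Num.min 1 `|y|)); last by ring.
  by rewrite real_normK ?num_real.
Qed.

Lemma logistic_le_expR x : g x <= expR x.
Proof.
rewrite /g -[leRHS]invrK -expRN lef_pV2 ?posrE ?expR_gt0 ?addr_gt0 ?expR_gt0//.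
by rewrite lerDr.
Qed.

Lemma logistic_ge_expR x : 1 - expR (- x) <= g x.
Proof.
have e0 := expR_gt0 (- x); have D0 : 0 < 1 + expR (- x) by rewrite addr_gt0.
rewrite /g -[leRHS]mul1r ler_pdivlMr//; nra.
Qed.

Lemma measurable_logistic : measurable_fun setT g.
Proof.
apply: continuous_measurable_fun => x.
by have [+ _] := is_derive_logistic x => /derivable1_diffP /differentiable_continuous.
Qed.

End logistic.

(** * The standard normal law *)

Section lebesgue_reflection.
Context (R : realType).
Local Notation mu := (@lebesgue_measure R).
Let phi : measurableTypeR R -> measurableTypeR R := fun x => - x.
Let mphi : measurable_fun setT phi. Proof. exact: measurableT_comp. Qed.
Let phi_pack := HB.pack_for {mfun measurableTypeR R >-> measurableTypeR R} phi (isMeasurableFun.Build _ _ _ _ _ mphi).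

Lemma ge0_integral_opp (f : R -> \bar R) : measurable_fun setT f -> (forall x, 0 <= f x)%E ->
  (\int[mu]_x f (- x)%R = \int[mu]_x f x)%E.
Proof.
move=> mf f0.
rewrite (_ : (\int[mu]_x f (- x)%R)%E = (\int[pushforward mu phi_pack]_x f x)%E); last first.
  by rewrite ge0_integral_pushforward.
by apply: eq_measure_integral => A mA _; exact: lebesgue_measureN.
Qed.

End lebesgue_reflection.

Section standard_normal.
Context (R : realType).
Local Notation mu := (@lebesgue_measure R).
Local Notation nu := (@normal_prob R 0 1).
Local Notation p := (@normal_pdf R 0 1).

Lemma normal_pdf01E (y : R) : p y = (Num.sqrt (2 * pi))^-1 * expR (- (2^-1 * y ^+ 2)).
Proof.
have -> : p y = (Num.sqrt (1 ^+ 2 * pi *+ 2))^-1 * expR (- (y - 0) ^+ 2 / (1 ^+ 2 *+ 2)).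
  by rewrite /normal_pdf oner_eq0.
by rewrite subr0 expr1n mul1r -mulr_natl mulNr [_ / _]mulrC.
Qed.

Lemma normal_pdf01_le1 (y : R) : p y <= 1.
Proof.
rewrite normal_pdf01E mulrC ler_pdivrMr ?sqrtr_gt0 ?mulr_gt0 ?pi_gt0// mul1r.
apply: (@le_trans _ _ 1); first by rewrite -expR0 ler_expR oppr_le0 mulr_ge0// sqr_ge0.
rewrite -[leLHS]sqrtr1 ler_sqrt; last by rewrite mulr_ge0// pi_ge0.
by have := pi_ge2 R; lra.
Qed.

(** Change of variables by the Radon-Nikodym derivative, which is almost everywhere the explicit
    density because both have the same integral over every measurable set. *)
Lemma ge0_integral_normal01 (f : R -> \bar R) : measurable_fun setT f -> (forall x, 0 <= f x)%E ->
  (\int[nu]_x f x = \int[mu]_x (f x * (p x)%:E))%E.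
Proof.
move=> mf f0; have dom := normal_prob_dominates (0 : R) 1.
rewrite -(Radon_Nikodym_SigmaFinite.change_of_variables dom f0 measurableT mf).
apply: ae_eq_integral => //.
- apply: emeasurable_funM => //; apply: (measurable_int mu).
  exact: Radon_Nikodym_SigmaFinite.f_integrable.
- apply: emeasurable_funM => //; apply/measurable_EFinP; exact: measurable_normal_pdf.
- apply: ae_eqe_mul2l; apply: integral_ae_eq => //.
  + exact: Radon_Nikodym_SigmaFinite.f_integrable.
  + by apply/measurable_EFinP; exact: measurable_normal_pdf.
  + by move=> E _ mE; rewrite -Radon_Nikodym_SigmaFinite.f_integral.
Qed.

(** Let M be the integral of z^2 exp (- z^2 / 2). By scaling, exp (- s z^2 / 2) instead gives s^(- 3
    / 2) M. Integration over s >= 1 yields 2 M and, in the other order, twice the integral of exp (-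
    z^2 / 2); hence M = sqrt (2 pi). *)
Lemma normal01_sqr : (\int[nu]_x (x ^+ 2)%:E = 1)%E.
Proof.
have msq (c : R) : measurable_fun setT (fun z : R => z ^+ 2 * expR (- (c * z ^+ 2))).
  apply: measurable_funM => //; apply: measurableT_comp => //; apply: measurableT_comp => //.
  by apply: measurable_funM => //.
pose M := (\int[mu]_z (z ^+ 2 * expR (- (2^-1 * z ^+ 2)))%:E)%E.
have pi0 := pi_gt0 R.
have MS (s : R) : 0 < s ->
    (\int[mu]_z (z ^+ 2 * expR (- (s / 2 * z ^+ 2)))%:E = (s `^ (- (2^-1) - 1))%:E * M)%E.
  move=> s0; have q0 : 0 < Num.sqrt s by rewrite sqrtr_gt0.
  rewrite /M -[in RHS](ge0_integral_scale q0); last 2 first.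
  - exact/measurable_EFinP.
  - by move=> x; rewrite lee_fin mulr_ge0 ?sqr_ge0 ?expR_ge0.
  rewrite muleA -EFinM -ge0_integralZl_EFin//; last 3 first.
  - by move=> x _; rewrite lee_fin mulr_ge0 ?sqr_ge0 ?expR_ge0.
  - apply/measurable_EFinP; apply: (measurableT_comp (msq _)); exact: measurable_funM.
  - by rewrite mulr_ge0 ?powR_ge0 ?sqrtr_ge0.
  apply: eq_integral => z _; rewrite -EFinM exprMn sqr_sqrtr ?(ltW s0)//; congr EFin.
  have E1 : s `^ (- 2^-1 - 1) * Num.sqrt s * s = 1.
    have -> : s `^ (- 2^-1 - 1) * Num.sqrt s * s = s `^ (- 2^-1 - 1) * s `^ (2^-1) * s `^ 1.
      by rewrite powR12_sqrt ?powRr1 ?(ltW s0).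
    by rewrite -!gt0_powRD// (_ : _ + 1 = 0) ?powRr0//; field.
  rewrite -[LHS]mul1r -[X in X * _ = _]E1.
  have -> : s / 2 * (z : R) ^+ 2 = 2^-1 * (s * z ^+ 2) by ring.
  by rewrite -!mulrA.
have sqrE (z s : R) : z ^+ 2 * expR (- (s / 2 * z ^+ 2)) = 2 * (z ^+ 2 / 2 * expR (- (z ^+ 2 / 2 * s))).
  by rewrite mulrA [2 * _]mulrC divfK//; congr (_ * expR (- _)); field.
have h20 : 0 < 2^-1 :> R by rewrite invr_gt0.
have H : (M * 2%:E = (2 * Num.sqrt (2 * pi))%:E)%E.
  (* The point z = 0 is removed because the inner integral over s has rate z^2 / 2, which must be
     positive. *)
  transitivity (\int[mu]_(s in `[1%R, +oo[) \int[mu]_(z in setT `\ 0%R) (z ^+ 2 * expR (- (s / 2 * z ^+ 2)))%:E)%E.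
    rewrite (_ : 2%:E = \int[mu]_(z in `[1%R, +oo[) (z `^ (- 2^-1 - 1))%:E)%E; last first.
      by rewrite integral_powR_pinfty// invrK.
    rewrite -ge0_integralZl//; last 3 first.
    - by apply/measurable_EFinP/measurable_funTS.
    - by move=> s _; rewrite lee_fin powR_ge0.
    - by apply: integral_ge0 => z _; rewrite lee_fin mulr_ge0 ?sqr_ge0 ?expR_ge0.
    apply: eq_integral => s; rewrite inE/= in_itv/= andbT => s1.
    rewrite muleC -MS ?(lt_le_trans ltr01)//.
    apply/esym; apply: integral_setD1; first exact: measurableD.
    by apply/measurable_EFinP/measurable_funTS; exact: msq.
  rewrite (@fubini_tonelli_set _ _ _ _ R mu mu `[1%R, +oo[ (setT `\ 0%R)
    (fun sz : R * R => (sz.2 ^+ 2 * expR (- (sz.1 / 2 * sz.2 ^+ 2)))%:E))//; last 3 first.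
  - exact: measurableD.
  - apply/measurable_EFinP; apply: measurable_funM; first exact: (measurableT_comp (exprn_measurable _)).
    apply: measurableT_comp => //; apply: measurableT_comp => //; apply: measurable_funM.
      exact: measurable_funM.
    exact: (measurableT_comp (exprn_measurable _)).
  - by move=> z; rewrite lee_fin mulr_ge0 ?sqr_ge0 ?expR_ge0.
  have mg : measurable_fun setT (fun z : R => expR (- (2^-1 * z ^+ 2))).
    apply: measurableT_comp => //; apply: measurableT_comp => //; exact: measurable_funM.
  transitivity (\int[mu]_(z in setT `\ 0%R) (2%:E * (expR (- (2^-1 * z ^+ 2)))%:E))%E.
    apply: eq_integral => z; rewrite inE/= => -[_ /eqP z0].
    have z2 : 0 < z ^+ 2 / 2 by rewrite divr_gt0// lt0r sqr_ge0 sqrf_eq0 z0.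
    transitivity (\int[mu]_(s in `[1%R, +oo[) (2%:E * (z ^+ 2 / 2 * expR (- (z ^+ 2 / 2 * s)))%:E))%E.
      by apply: eq_integral => s _; rewrite -EFinM sqrE.
    rewrite ge0_integralZl_EFin//; last 2 first.
    - by move=> s _; rewrite lee_fin mulr_ge0 ?expR_ge0 ?(ltW z2).
    - by apply/measurable_EFinP/measurable_funTS; exact: measurable_expRN.
    by rewrite integral_expRN_pinfty// mulr1 [z ^+ 2 / 2]mulrC.
  rewrite integral_setD1; last 2 first.
  - exact: measurableD.
  - by apply: measurable_funeM; apply/measurable_EFinP/measurable_funTS.
  rewrite ge0_integralZl_EFin//; last exact/measurable_EFinP.
  rewrite integral_gauss_scale// -EFinM; congr ((_ * _)%:E).
  by rewrite powRN powR12_sqrt// sqrtrV// invrK mulrC sqrtrM.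
have q0 : 0 < Num.sqrt (2 * pi) :> R by rewrite sqrtr_gt0 mulr_gt0.
rewrite ge0_integral_normal01//; last 2 first.
- exact/measurable_EFinP.
- by move=> x; rewrite lee_fin sqr_ge0.
transitivity (\int[mu]_x ((Num.sqrt (2 * pi))^-1%:E * (x ^+ 2 * expR (- (2^-1 * x ^+ 2)))%:E))%E.
  by apply: eq_integral => x _; rewrite normal_pdf01E -!EFinM mulrCA.
rewrite ge0_integralZl_EFin//; last 2 first.
- by move=> x _; rewrite lee_fin mulr_ge0 ?sqr_ge0 ?expR_ge0.
- by apply/measurable_EFinP; exact: msq.
rewrite -/M -[M]mule1 (_ : 1%E = (2%:E * 2^-1%:E)%E); last by rewrite -EFinM mulfV.
rewrite [(M * _)%E]muleA H -!EFinM; congr EFin.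
by move: (Num.sqrt _) q0 => q q0; field; rewrite gt_eqF.
Qed.

(** By reflection the positive and negative parts have the same integral. *)
Lemma normal01_mean : \int[nu]_x x = 0.
Proof.
rewrite /Rintegral integralE.
have H : (\int[nu]_x ((fun x : R => x%:E)^\- x) = \int[nu]_x ((fun x : R => x%:E)^\+ x))%E.
  rewrite !ge0_integral_normal01//; last 2 first.
  - exact/measurable_funepos/measurable_EFinP.
  - exact/measurable_funeneg/measurable_EFinP.
  rewrite -[RHS]ge0_integral_opp; last 2 first.
  - apply: emeasurable_funM; first exact/measurable_funepos/measurable_EFinP.
    by apply/measurable_EFinP; exact: measurable_normal_pdf.
  - by move=> x; rewrite mule_ge0// lee_fin normal_pdf_ge0.
  apply: eq_integral => x _; rewrite !normal_pdf01E sqrrN; congr (_ * _)%E.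
  by rewrite funenegE funeposE.
rewrite H; case: (\int[nu]_x _)%E => [r||]//=.
by rewrite subrr.
Qed.

(** The substitution w = (t u - a y) / b turns a y + b w into t u; the joint density then factors
    into the normal density of u and a normal density in y, which integrates to 1. *)
Lemma normal01_convolution (phi : R -> R) (a b : R) : 0 < a -> 0 < b ->
  measurable_fun setT phi -> (forall x, 0 <= phi x) ->
  (\int[nu]_y \int[nu]_w (phi (a * y + b * w))%:E =
   \int[nu]_u (phi (Num.sqrt (a ^+ 2 + b ^+ 2) * u))%:E)%E.
Proof.
move=> a0 b0 mphi phi0; set t := Num.sqrt _.
have ab0 : 0 < a ^+ 2 + b ^+ 2 by rewrite addr_gt0 ?exprn_gt0.
have t0 : 0 < t by rewrite sqrtr_gt0.
have t2 : t ^+ 2 = a ^+ 2 + b ^+ 2 by rewrite sqr_sqrtr// ltW.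
have tb0 : 0 < t / b by rewrite divr_gt0.
have p0 x : 0 <= p x by exact: normal_pdf_ge0.
have mp : measurable_fun setT p := measurable_normal_pdf _ _.
have mphil (c d : R) : measurable_fun setT (fun w => phi (c + d * w)).
  by apply: (measurableT_comp mphi); exact: measurable_affine.
(* completing the square: ((t u - a y) / b)^2 + y^2 = u^2 + ((t y - a u) / b)^2 *)
have square (u y : R) : p (- (a * y / b) + t / b * u) * p y = p u * p (- (a * u / b) + t / b * y).
  rewrite !normal_pdf01E; set k := (Num.sqrt _)^-1.
  rewrite mulrACA [RHS]mulrACA -!expRD; congr (_ * expR _).
  have -> : t / b * u = t * u / b by ring.
  have -> : t / b * y = t * y / b by ring.
  rewrite -!opprD -!mulrDr; congr (- (_ * _)).
  rewrite -!mulNr -!mulrDl !expr_div_n.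
  have b2 : b ^+ 2 != 0 by rewrite sqrf_eq0 gt_eqF.
  have bE : b ^+ 2 = t ^+ 2 - a ^+ 2 by rewrite t2; ring.
  by apply: (mulIf b2); rewrite !mulrDl !divfK// bE; ring.
transitivity (\int[mu]_y \int[mu]_u ((t / b) * phi (t * u) * (p u * p (- (a * u / b) + t / b * y)))%:E)%E.
  rewrite ge0_integral_normal01; last 2 first.
  - apply: (@measurable_fun_fubini_tonelli_F _ _ _ _ R nu (fun yw : R * R => (phi (a * yw.1 + b * yw.2))%:E)).
      apply/measurable_EFinP; apply: (measurableT_comp mphi).
      by apply: measurable_funD; apply: measurable_funM.
    by move=> z; rewrite lee_fin.
  - by move=> y; apply: integral_ge0 => w _; rewrite lee_fin.
  apply: eq_integral => y _.
  rewrite ge0_integral_normal01; last 2 first.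
  - exact/measurable_EFinP.
  - by move=> w; rewrite lee_fin.
  rewrite -(@ge0_integral_affine R (- (a * y / b)) _ tb0 (fun w => ((phi (a * y + b * w))%:E * (p w)%:E)%E)); last 2 first.
  - apply: emeasurable_funM; apply/measurable_EFinP => //; exact: mphil.
  - by move=> w; rewrite -EFinM lee_fin mulr_ge0.
  have mF : measurable_fun setT (fun u => phi (t * u) * p (- (a * y / b) + t / b * u)).
    apply: measurable_funM; first by apply: (measurableT_comp mphi); exact: measurable_funM.
    by apply: (measurableT_comp mp); exact: measurable_affine.
  transitivity (\int[mu]_u ((t / b * p y)%:E * (phi (t * u) * p (- (a * y / b) + t / b * u))%:E))%E; last first.
    apply: eq_integral => u _; rewrite -EFinM -square; congr EFin.
    by move: (p _) (p _) => P1 P2; ring.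
  rewrite ge0_integralZl_EFin//; last 3 first.
  - by move=> u _; rewrite lee_fin mulr_ge0.
  - exact/measurable_EFinP.
  - by rewrite mulr_ge0// ltW.
  rewrite muleAC -EFinM; congr (_ * _)%E; apply: eq_integral => u _; rewrite -EFinM.
  by rewrite (_ : a * y + b * (- (a * y / b) + t / b * u) = t * u)//; field; rewrite gt_eqF.
rewrite (@fubini_tonelli_set _ _ _ _ R mu mu setT setT
  (fun yu : R * R => ((t / b) * phi (t * yu.2) * (p yu.2 * p (- (a * yu.2 / b) + t / b * yu.1)))%:E))//; last 2 first.
- apply/measurable_EFinP; apply: measurable_funM.
    by apply: measurable_funM => //; apply: (measurableT_comp mphi); exact: measurable_funM.
  apply: measurable_funM; first exact: (measurableT_comp mp).
  apply: (measurableT_comp mp); apply: measurable_funD; last exact: measurable_funM.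
  by apply: measurableT_comp => //; apply: measurable_funM => //; exact: measurable_funM.
- by move=> z; rewrite lee_fin; apply: mulr_ge0; apply: mulr_ge0 => //; exact: ltW.
rewrite ge0_integral_normal01; last 2 first.
- by apply/measurable_EFinP; apply: (measurableT_comp mphi); exact: measurable_funM.
- by move=> w; rewrite lee_fin.
apply: eq_integral => u _ /=.
transitivity (\int[mu]_y ((phi (t * u) * p u)%:E * ((t / b)%:E * (p (- (a * u / b) + t / b * y))%:E)))%E.
  by apply: eq_integral => y _; rewrite -!EFinM; congr EFin; ring.
have mpl : measurable_fun setT (fun y => p (- (a * u / b) + t / b * y)).
  by apply: (measurableT_comp mp); exact: measurable_affine.
rewrite ge0_integralZl_EFin//; last 3 first.
- by move=> y _; rewrite -EFinM lee_fin mulr_ge0// ltW.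
- by apply: measurable_funeM; exact/measurable_EFinP.
- by rewrite mulr_ge0.
rewrite ge0_integralZl_EFin//; last 3 first.
- by move=> y _; rewrite lee_fin.
- exact/measurable_EFinP.
- exact: ltW.
rewrite (@ge0_integral_affine _ (- (a * u / b)) _ tb0 (fun y => (p y)%:E)); last 2 first.
- exact/measurable_EFinP.
- by move=> w; rewrite lee_fin.
by rewrite integral_normal_pdf mule1 EFinM.
Qed.

End standard_normal.

Lemma prob_Rintegral_cst d (T : measurableType d) (R : realType) (Q : probability T R) (k : R) :
  \int[Q]_w k = k.
Proof.
rewrite Rintegral_cst// [X in fine X](_ : _ = 1%E) ?mulr1//; exact: probability_setT.
Qed.

Lemma prob_integrable_cst d (T : measurableType d) (R : realType) (Q : probability T R) (k : R) :
  Q.-integrable setT (EFin \o (fun=> k)).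
Proof. by apply: (@bounded_integrable _ _ _ Q (cst k) `|k|). Qed.

Lemma integrable_EFinB d (T : measurableType d) (R : realType) (Q : {measure set T -> \bar R})
    (f g : T -> R) : Q.-integrable setT (EFin \o f) -> Q.-integrable setT (EFin \o g) ->
  Q.-integrable setT (EFin \o (fun w => f w - g w)).
Proof. by move=> fi gi; exact: (integrableB measurableT fi gi). Qed.

Lemma integrable_EFinZ d (T : measurableType d) (R : realType) (Q : {measure set T -> \bar R})
    (k : R) (f : T -> R) : Q.-integrable setT (EFin \o f) ->
  Q.-integrable setT (EFin \o (fun w => k * f w)).
Proof. by move=> fi; exact: (integrableZl measurableT k fi). Qed.

(** * Gaussian smoothing and Lindeberg replacement *)

Section gaussian_average.
Context (R : realType).
Local Notation nu := (@normal_prob R 0 1).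
Implicit Types (f : R -> R) (t x : R).

(** The heat semigroup, parametrized by the standard deviation t; scale 0 is the identity. *)
Definition gavg f t x : R := \int[nu]_y f (x + t * y).

Lemma gavgE f (K : R) t x : measurable_fun setT f -> (forall x, `|f x| <= K) ->
  (\int[nu]_y (f (x + t * y))%:E = (gavg f t x)%:E)%E.
Proof.
move=> mf fK; apply: (@bounded_integralE _ _ _ nu (fun y => f (x + t * y)) K) => //.
by apply: (measurableT_comp mf); exact: measurable_affine.
Qed.

Lemma gavg0 f x : gavg f 0 x = f x.
Proof.
rewrite /gavg; under eq_Rintegral do rewrite mul0r addr0.
exact: (@prob_Rintegral_cst _ _ _ nu).
Qed.

Lemma gavg_itv f t x : measurable_fun setT f -> (forall x, 0 <= f x <= 1) -> 0 <= gavg f t x <= 1.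
Proof.
move=> mf f01.
have fK x' : `|f x'| <= 1 by have /andP[f0 f1] := f01 x'; rewrite ger0_norm.
rewrite -!lee_fin -(gavgE _ _ mf fK) integral_ge0/=; last first.
  by move=> y _; rewrite lee_fin; have /andP[] := f01 (x + t * y).
apply: (@le_trans _ _ (\int[nu]_y (1 : \bar R))%E); last first.
  by rewrite integral_cst//= mul1e; have -> : nu setT = 1%E by exact: (@probability_setT _ _ _ nu).
apply: ge0_le_integral => //.
- by move=> y _; rewrite lee_fin; have /andP[] := f01 (x + t * y).
- by apply/measurable_EFinP; apply: (measurableT_comp mf); exact: measurable_affine.
- by move=> y _; rewrite lee_fin; have /andP[] := f01 (x + t * y).
Qed.

Lemma measurable_gavg f t : measurable_fun setT f -> (forall x, 0 <= f x) ->
  measurable_fun setT (gavg f t).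
Proof.
move=> mf f0.
apply: (@measurableT_comp _ _ _ _ _ _ (@fine R) _ (fun x => (\int[nu]_y (f (x + t * y))%:E)%E)) => //.
apply: (@measurable_fun_fubini_tonelli_F _ _ _ _ R nu (fun xy : R * R => (f (xy.1 + t * xy.2))%:E)).
- apply/measurable_EFinP; apply: (measurableT_comp mf).
  by apply: measurable_funD => //; exact: measurable_funM.
- by move=> z; rewrite lee_fin.
Qed.

Lemma gavg_semigroup f (a b : R) x : 0 <= a -> 0 <= b ->
  measurable_fun setT f -> (forall x, 0 <= f x <= 1) ->
  gavg (gavg f b) a x = gavg f (Num.sqrt (a ^+ 2 + b ^+ 2)) x.
Proof.
move=> a0 b0 mf f01.
have [->|an0] := eqVneq a 0; first by rewrite gavg0 expr0n/= add0r sqrtr_sqr ger0_norm.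
have [->|bn0] := eqVneq b 0.
  by rewrite expr0n/= addr0 sqrtr_sqr ger0_norm//; apply: eq_Rintegral => y _; rewrite gavg0.
have {}a0 : 0 < a by rewrite lt0r an0.
have {}b0 : 0 < b by rewrite lt0r bn0.
have f0 z : 0 <= f z by have /andP[] := f01 z.
have fK z : `|f z| <= 1 by have /andP[? ?] := f01 z; rewrite ger0_norm.
have gK z : `|gavg f b z| <= 1 by have /andP[? ?] := gavg_itv b z mf f01; rewrite ger0_norm.
apply: EFin_inj; rewrite -(gavgE _ _ mf fK) -(gavgE _ _ (measurable_gavg b mf f0) gK).
have mphi : measurable_fun setT (fun y => f (x + y)).
  by apply: (measurableT_comp mf); exact: measurable_funD.
rewrite -(@normal01_convolution _ (fun y => f (x + y)) a b)//.
by apply: eq_integral => y _; rewrite -(gavgE _ _ mf fK); under eq_integral do rewrite -addrA.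
Qed.

End gaussian_average.

Section lindeberg.
Context (R : realType).
Implicit Types (c z : R).

(* Truncating [|V|] at 1 controls the third-order Taylor error with two moments only. *)
Definition lind d (T : measurableType d) (Q : probability T R) (V : T -> R) c : R :=
  \int[Q]_w (V w ^+ 2 * Num.min 1 (c * `|V w|)).

Section step.
Context d (T : measurableType d) (Q : probability T R) (V : T -> R).
Hypothesis mV : measurable_fun setT V.
Hypothesis V2 : Q.-integrable setT (EFin \o (fun w => V w ^+ 2)).

Lemma integrable_of_sqr : Q.-integrable setT (EFin \o V).
Proof.
have H := integrableD measurableT (@bounded_integrable _ _ _ Q (cst 1) 1 (measurable_cst _) _) V2.
apply: (le_integrable _ _ _ (H _)) => //.
- exact/measurable_EFinP.
- move=> w _ /=; rewrite lee_fin [leRHS]ger0_norm ?addr_ge0 ?sqr_ge0//.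
  rewrite -[V w ^+ 2]real_normK ?num_real//; have := normr_ge0 (V w); nra.
- by move=> w; rewrite normr1.
Qed.

Lemma lind_integrable c : 0 <= c ->
  Q.-integrable setT (EFin \o (fun w => V w ^+ 2 * Num.min 1 (c * `|V w|))).
Proof.
move=> c0; apply: (le_integrable _ _ _ V2) => //.
- apply/measurable_EFinP; apply: measurable_funM; first exact: measurable_funX.
  by apply: measurable_minr => //; apply: measurable_funM => //; exact: measurableT_comp.
- move=> w _ /=; have m0 : 0 <= Num.min 1 (c * `|V w|) by rewrite le_min ler01 mulr_ge0.
  rewrite lee_fin (ger0_norm (sqr_ge0 _)) (ger0_norm (mulr_ge0 (sqr_ge0 _) m0)).
  by rewrite ler_piMr ?sqr_ge0// ge_min lexx.
Qed.

Lemma lind_cvg (c_ : nat -> R) : (forall n, 0 <= c_ n) -> c_ n @[n --> \oo] --> (0 : R) ->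
  lind Q V (c_ n) @[n --> \oo] --> (0 : R).
Proof.
move=> c0 cc.
have -> : (0 : R) = \int[Q]_w (cst 0 w) by rewrite Rintegral_cst// mul0r.
apply: (@dominated_cvg_Rintegral _ _ _ Q setT (fun n w => V w ^+ 2 * Num.min 1 (c_ n * `|V w|))
  (cst 0) (fun w => V w ^+ 2)) => //.
- move=> n; apply/measurable_EFinP; exact: measurable_int (lind_integrable (c0 n)).
- move=> w _ /=; rewrite -[X in _ --> X](mulr0 (V w ^+ 2)); apply: cvgMr.
  apply: (@squeeze_cvgr _ _ _ _ (fun=> 0) (fun n => c_ n * `|V w|)).
  + by near=> n; rewrite le_min ler01 mulr_ge0//= ge_min lexx orbT.
  + exact: cvg_cst.
  + by rewrite -[X in _ --> X](mul0r `|V w|); apply: cvgMl.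
- move=> n w _; have m0 : 0 <= Num.min 1 (c_ n * `|V w|) by rewrite le_min ler01 mulr_ge0.
  by rewrite (ger0_norm (mulr_ge0 (sqr_ge0 _) m0)) ler_piMr ?sqr_ge0// ge_min lexx.
Unshelve. all: by end_near. Qed.

(** The linear Taylor term has mean 0 and the quadratic one gives the explicit correction; the
    remainder at y = c V is at most M c^2 V^2 min (1, c |V|), whose integral is the quantity
    [lind]. *)
Lemma lindeberg_step (psi : R -> R) (A B M c z : R) : 0 <= c -> 0 <= M ->
  measurable_fun setT psi -> (forall x, 0 <= psi x <= 1) ->
  \int[Q]_w V w = 0 ->
  (forall y, `|psi (z + y) - psi z - y * A - y ^+ 2 * B| <= M * (y ^+ 2 * Num.min 1 `|y|)) ->
  `|\int[Q]_w psi (z + c * V w) - psi z - c ^+ 2 * B * \int[Q]_w (V w ^+ 2)| <= M * c ^+ 2 * lind Q V c.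
Proof.
move=> c0 M0 mpsi psi01 V1 HR.
have iV := integrable_of_sqr.
have ic := prob_integrable_cst Q.
have i1 : Q.-integrable setT (EFin \o (fun w => psi (z + c * V w))).
  apply: (@bounded_integrable _ _ _ Q _ 1).
    by apply: (measurableT_comp mpsi); apply: measurable_funD => //; exact: measurable_funM.
  by move=> w; have /andP[p0 p1] := psi01 (z + c * V w); rewrite ger0_norm.
have i2 : Q.-integrable setT (EFin \o (fun w => psi (z + c * V w) - psi z)) by exact: (integrable_EFinB i1 (ic _)).
have i3 : Q.-integrable setT (EFin \o (fun w => (c * A) * V w)) by exact: integrable_EFinZ.
have i4 : Q.-integrable setT (EFin \o (fun w => psi (z + c * V w) - psi z - (c * A) * V w)) by exact: integrable_EFinB.
have i5 : Q.-integrable setT (EFin \o (fun w => (c ^+ 2 * B) * V w ^+ 2)) by exact: integrable_EFinZ.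
have i6 : Q.-integrable setT (EFin \o (fun w => psi (z + c * V w) - psi z - (c * A) * V w - (c ^+ 2 * B) * V w ^+ 2)) by exact: integrable_EFinB.
have -> : \int[Q]_w psi (z + c * V w) - psi z - c ^+ 2 * B * \int[Q]_w (V w ^+ 2) =
   \int[Q]_w (psi (z + c * V w) - psi z - (c * A) * V w - (c ^+ 2 * B) * V w ^+ 2).
  rewrite RintegralB// RintegralB// RintegralB// !RintegralZl// V1 mulr0 subr0.
  by rewrite prob_Rintegral_cst.
apply: (le_trans (le_normr_Rintegral _ i6)) => //.
rewrite /lind -RintegralZl//; last exact: lind_integrable.
apply: le_Rintegral => //.
- exact: integrable_norm i6.
- exact/integrable_EFinZ/lind_integrable.
move=> w _; have := HR (c * V w); rewrite exprMn normrM (ger0_norm c0) => H.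
rewrite [leRHS](_ : _ = M * (c ^+ 2 * V w ^+ 2 * Num.min 1 (c * `|V w|))); last by ring.
rewrite [X in `|X| <= _](_ : _ = psi (z + c * V w) - psi z - c * V w * A - c ^+ 2 * V w ^+ 2 * B) //; ring.
Qed.

End step.

(** Taylor coefficients and remainder are averaged over translates, so smoothing keeps the constant
    [M] for every t. *)
Lemma gavg_taylor (phi A B : R -> R) (M K t : R) :
  measurable_fun setT phi -> measurable_fun setT A -> measurable_fun setT B ->
  (forall x, 0 <= phi x <= 1) -> (forall x, `|A x| <= K) -> (forall x, `|B x| <= K) ->
  (forall x y, `|phi (x + y) - phi x - y * A x - y ^+ 2 * B x| <= M * (y ^+ 2 * Num.min 1 `|y|)) ->
  forall z y, `|gavg phi t (z + y) - gavg phi t z - y * gavg A t z - y ^+ 2 * gavg B t z| <=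
     M * (y ^+ 2 * Num.min 1 `|y|).
Proof.
move=> mphi mA mB phi01 AK BK HR z y.
set nu := (@normal_prob R 0 1).
have ib (f : R -> R) (k x : R) : measurable_fun setT f -> (forall x, `|f x| <= k) ->
    nu.-integrable setT (EFin \o (fun w => f (x + t * w))).
  move=> mf fk; apply: (@bounded_integrable _ _ _ nu _ k) => //.
  by apply: (measurableT_comp mf); exact: measurable_affine.
have phik x : `|phi x| <= 1 by have /andP[? ?] := phi01 x; rewrite ger0_norm.
have i1 := ib phi 1 (z + y) mphi phik.
have i2 := ib phi 1 z mphi phik.
have i12 : nu.-integrable setT (EFin \o (fun w => phi (z + y + t * w) - phi (z + t * w))) by exact: integrable_EFinB.
have i3' : nu.-integrable setT (EFin \o (fun w => y * A (z + t * w))) by apply: integrable_EFinZ; exact: (ib A K).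
have i4' : nu.-integrable setT (EFin \o (fun w => y ^+ 2 * B (z + t * w))) by apply: integrable_EFinZ; exact: (ib B K).
have i123 : nu.-integrable setT (EFin \o (fun w => phi (z + y + t * w) - phi (z + t * w) - y * A (z + t * w))) by exact: integrable_EFinB.
have i1234 : nu.-integrable setT (EFin \o (fun w => phi (z + y + t * w) - phi (z + t * w) - y * A (z + t * w)
   - y ^+ 2 * B (z + t * w))) by exact: integrable_EFinB.
have -> : gavg phi t (z + y) - gavg phi t z - y * gavg A t z - y ^+ 2 * gavg B t z =
   \int[nu]_w (phi (z + y + t * w) - phi (z + t * w) - y * A (z + t * w) - y ^+ 2 * B (z + t * w)).
  rewrite RintegralB// RintegralB// RintegralB// RintegralZl//; last exact: (ib A K).
  by rewrite RintegralZl//; exact: (ib B K).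
apply: (le_trans (le_normr_Rintegral _ i1234)) => //.
have -> : M * (y ^+ 2 * Num.min 1 `|y|) = \int[nu]_w (cst (M * (y ^+ 2 * Num.min 1 `|y|)) w).
  by rewrite (@prob_Rintegral_cst _ _ _ nu).
apply: le_Rintegral => //.
- exact: integrable_norm i1234.
- exact: (@prob_integrable_cst _ _ _ nu).
by move=> w _; have := HR (z + t * w) y; rewrite [z + t * w + y]addrAC.
Qed.

End lindeberg.

Section central_limit.
Context d (Omega : measurableType d) (R : realType) (P : probability Omega R).
Context (X : nat -> Omega -> R) (s0 : R).
Hypothesis mX : forall i, measurable_fun setT (X i).
Hypothesis iX : iid P X.
Hypothesis s00 : 0 < s0.
Hypothesis X2 : P.-integrable setT (EFin \o (fun w => X 0%N w ^+ 2)).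
Hypothesis X1E : \int[P]_w X 0%N w = 0.
Hypothesis X2E : \int[P]_w (X 0%N w ^+ 2) = s0 ^+ 2.
Local Notation S := (partial_sum X).
Local Notation nu := (@normal_prob R 0 1).

Lemma measurable_partial_sum k : measurable_fun setT (S k).
Proof. by rewrite /partial_sum; apply: measurable_sum. Qed.

Lemma partial_sum_indep k (A B : set R) : measurable A -> measurable B ->
  P (S k @^-1` A `&` X k @^-1` B) = (P (S k @^-1` A) * P (X k @^-1` B))%E.
Proof.
have [mi _] := iX.
apply: (@block_indep_fun _ _ _ P _ _ _ X mX _ _ _ _ [set i | (i < k)%N] [set k] (S k) (X k)) => //.
- by apply/seteqP; split => // i /= [ik iE]; rewrite iE ltnn in ik.
- rewrite (_ : S k = fun w => \sum_(i <- iota 0 k) X i w).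
    apply: (block_measurable_sum (phi := fun _ x => x)) => //.
    by move=> i; rewrite mem_iota.
  by apply/funext => w; rewrite /partial_sum -(big_mkord xpredT (fun i => X i w)) /index_iota subn0.
- exact: block_measurable_var.
Qed.

(** Lindeberg errors of a summand scaled by c and of the centered normal variable of the same
    variance that replaces it. *)
Definition clt_err (c : R) : R := lind P (X 0%N) c + s0 ^+ 2 * lind nu id (c * s0).

Lemma normal01_sqr_integrable : nu.-integrable setT (EFin \o (fun y : R => y ^+ 2)).
Proof.
apply: ge0_integrable => //; first by move=> y; exact: sqr_ge0.
by rewrite normal01_sqr ltry.
Qed.

Section smooth.
Context (phi A B : R -> R) (M K : R).
Hypothesis mphi : measurable_fun setT phi.
Hypothesis mA : measurable_fun setT A.
Hypothesis mB : measurable_fun setT B.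
Hypothesis phi01 : forall x, 0 <= phi x <= 1.
Hypothesis AK : forall x, `|A x| <= K.
Hypothesis BK : forall x, `|B x| <= K.
Hypothesis M0 : 0 <= M.
Hypothesis HR : forall x y,
  `|phi (x + y) - phi x - y * A x - y ^+ 2 * B x| <= M * (y ^+ 2 * Num.min 1 `|y|).

(** The variances agree, so the quadratic terms of the two expansions cancel and only the remainders
    are left. *)
Lemma clt_step (c t z : R) j : 0 <= c ->
  `|\int[P]_w gavg phi t (z + c * X j w) - gavg (gavg phi t) (c * s0) z| <= M * c ^+ 2 * clt_err c.
Proof.
move=> c0; have psi01 x := gavg_itv t x mphi phi01.
have mpsi : measurable_fun setT (gavg phi t).
  by apply: measurable_gavg => // x; have /andP[] := phi01 x.
have HT := @gavg_taylor _ phi A B M K t mphi mA mB phi01 AK BK HR z.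
have cs0 : 0 <= c * s0 by rewrite mulr_ge0// ltW.
have -> : \int[P]_w gavg phi t (z + c * X j w) = \int[P]_w gavg phi t (z + c * X 0%N w).
  rewrite /Rintegral; congr fine; have [_ idX] := iX.
  apply: (integral_eq_law (P := P) (f := fun x => (gavg phi t (z + c * x))%:E) (mX j) (mX 0%N)) => //.
  - by move=> D mD; exact: idX.
  - by apply/measurable_EFinP; apply: (measurableT_comp mpsi); exact: measurable_affine.
  - by move=> x; rewrite lee_fin; have /andP[] := psi01 (z + c * x).
have H1 := lindeberg_step (mX 0%N) X2 c0 M0 mpsi psi01 X1E HT.
have mid : measurable_fun setT (id : measurableTypeR R -> R) by exact: measurable_id.
have n2 : \int[nu]_y (y ^+ 2) = 1 by rewrite /Rintegral normal01_sqr.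
have H2 := @lindeberg_step _ _ (measurableTypeR R) nu id mid normal01_sqr_integrable _ _ _ _ _ _ cs0 M0 mpsi psi01 (normal01_mean R) HT.
rewrite X2E in H1; rewrite n2 exprMn -/(gavg _ _ _) in H2.
have -> : \int[P]_w gavg phi t (z + c * X 0%N w) - gavg (gavg phi t) (c * s0) z =
  (\int[P]_w gavg phi t (z + c * X 0%N w) - gavg phi t z - c ^+ 2 * gavg B t z * s0 ^+ 2) -
  (gavg (gavg phi t) (c * s0) z - gavg phi t z - c ^+ 2 * s0 ^+ 2 * gavg B t z * 1) by ring.
apply: le_trans (ler_normB _ _) _; apply: le_trans (lerD H1 H2) _.
by rewrite le_eqVlt /clt_err; apply/orP; left; apply/eqP; ring.
Qed.

(** With S_j frozen by independence, the last summand is exchanged for a normal one, which the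
    semigroup property merges with the normal part already present. *)
Lemma clt_replace (c t x : R) j : 0 <= c -> 0 <= t ->
  `|\int[P]_w gavg phi t (x + c * S j.+1 w) - \int[P]_w gavg phi (Num.sqrt ((c * s0) ^+ 2 + t ^+ 2)) (x + c * S j w)|
   <= M * c ^+ 2 * clt_err c.
Proof.
move=> c0 t0; have psi01 y := gavg_itv t y mphi phi01.
have cs0 : 0 <= c * s0 by rewrite mulr_ge0// ltW.
have mpsi : measurable_fun setT (gavg phi t).
  by apply: measurable_gavg => // y; have /andP[] := phi01 y.
pose h z := \int[P]_w gavg phi t (z + c * X j w).
have mz (z : R) : measurable_fun setT (fun w => gavg phi t (z + c * X j w)).
  by apply: (measurableT_comp mpsi); apply: measurable_funD => //; exact: measurable_funM.
have hE z : (\int[P]_w (gavg phi t (z + c * X j w))%:E = (h z)%:E)%E.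
  apply: (@bounded_integralE _ _ _ P _ 1) => // w.
  by have /andP[p0 p1] := psi01 (z + c * X j w); rewrite ger0_norm.
have mh : measurable_fun setT h.
  have -> : h = (@fine R) \o (fun z => (\int[P]_w (gavg phi t (z + c * X j w))%:E)%E) by [].
  apply: measurableT_comp => //.
  apply: (@measurable_fun_fubini_tonelli_F _ _ _ _ R P (fun zw : R * Omega => (gavg phi t (zw.1 + c * X j zw.2))%:E)).
  - apply/measurable_EFinP; apply: (measurableT_comp mpsi).
    by apply: measurable_funD => //; apply: measurable_funM => //; exact: measurableT_comp.
  - by move=> z; rewrite lee_fin; have /andP[] := psi01 (z.1 + c * X j z.2).
have h01 z : 0 <= h z <= 1.
  rewrite -!lee_fin -hE integral_ge0/=; last first.
    by move=> w _; rewrite lee_fin; have /andP[] := psi01 (z + c * X j w).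
  apply: (@le_trans _ _ (\int[P]_w (1 : \bar R))%E); last first.
    by rewrite integral_cst//= probability_setT mule1.
  apply: ge0_le_integral => //.
  - by move=> w _; rewrite lee_fin; have /andP[] := psi01 (z + c * X j w).
  - exact/measurable_EFinP.
  - by move=> w _; rewrite lee_fin; have /andP[] := psi01 (z + c * X j w).
have mSj : measurable_fun setT (fun w => x + c * S j w).
  by apply: measurable_funD => //; apply: measurable_funM => //; exact: measurable_partial_sum.
have -> : \int[P]_w gavg phi t (x + c * S j.+1 w) = \int[P]_w h (x + c * S j w).
  rewrite /Rintegral; congr fine.
  transitivity (\int[P]_w (gavg phi t ((x + c * S j w) + c * X j w))%:E)%E.
    by apply: eq_integral => w _; rewrite /partial_sum big_ord_recr/= mulrDr addrA.
  rewrite (@integral_indep_pair _ _ _ P _ _ _ _ (S j) (X j) (measurable_partial_sum j) (mX j) (@partial_sum_indep j)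
    (fun z => (gavg phi t ((x + c * z.1) + c * z.2))%:E)); last 2 first.
  - apply/measurable_EFinP; apply: (measurableT_comp mpsi).
    by apply: measurable_funD; [apply: measurable_funD => //; exact: measurable_funM|exact: measurable_funM].
  - by move=> z; rewrite lee_fin; have /andP[] := psi01 (x + c * z.1 + c * z.2).
  by apply: eq_integral => w _; rewrite -hE.
have bint (f : R -> R) : measurable_fun setT f -> (forall z, 0 <= f z <= 1) ->
    P.-integrable setT (EFin \o (fun w => f (x + c * S j w))).
  move=> mf f01; apply: (@bounded_integrable _ _ _ P _ 1); first exact: (measurableT_comp mf).
  by move=> w; have /andP[p0 p1] := f01 (x + c * S j w); rewrite ger0_norm.
set t' := Num.sqrt _.
have mt' : measurable_fun setT (gavg phi t').
  by apply: measurable_gavg => // y; have /andP[] := phi01 y.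
have i1 := bint h mh h01.
have i2 := bint (gavg phi t') mt' (fun z => gavg_itv t' z mphi phi01).
rewrite -RintegralB//; apply: (le_trans (le_normr_Rintegral _ (integrable_EFinB i1 i2))) => //.
rewrite -[leRHS](prob_Rintegral_cst P); apply: le_Rintegral => //.
- exact: integrable_norm (integrable_EFinB i1 i2).
- exact: prob_integrable_cst.
by move=> w _; rewrite /t' -gavg_semigroup//; exact: clt_step.
Qed.

Lemma clt_smooth (c x : R) k : 0 <= c ->
  `|\int[P]_w phi (x + c * S k w) - gavg phi (c * s0 * Num.sqrt k%:R) x| <= k%:R * (M * c ^+ 2 * clt_err c).
Proof.
move=> c0; have cs0 : 0 <= c * s0 by rewrite mulr_ge0// ltW.
(* The hybrid after k - j replacements: j original summands remain, and the normal ones act as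
   smoothing at scale c s0 sqrt (k - j). *)
have H j : (j <= k)%N ->
    `|\int[P]_w gavg phi (c * s0 * Num.sqrt (k - j)%:R) (x + c * S j w) - gavg phi (c * s0 * Num.sqrt k%:R) x|
    <= j%:R * (M * c ^+ 2 * clt_err c).
  elim: j => [_|j IH jk].
    rewrite subn0 mul0r.
    under eq_Rintegral do rewrite /partial_sum big_ord0 mulr0 addr0.
    by rewrite prob_Rintegral_cst subrr normr0.
  have t0 : 0 <= c * s0 * Num.sqrt (k - j.+1)%:R by rewrite mulr_ge0 ?sqrtr_ge0.
  have H1 := clt_replace x j c0 t0.
  have E1 : Num.sqrt ((c * s0) ^+ 2 + (c * s0 * Num.sqrt (k - j.+1)%:R) ^+ 2) = c * s0 * Num.sqrt (k - j)%:R.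
    rewrite [X in _ + X]exprMn sqr_sqrtr// -{1}[(c * s0) ^+ 2]mulr1 -mulrDr sqrtrM ?sqr_ge0// sqrtr_sqr ger0_norm//.
    by rewrite nat1r -subSn// subSS.
  rewrite E1 in H1.
  rewrite -[j.+1%:R]natr1 mulrDl mul1r.
  apply: le_trans (lerD (IH (ltnW jk)) H1).
  rewrite [leRHS]addrC; apply: le_trans _ (ler_normD _ _).
  by rewrite addrA subrK.
have := H k (leqnn k); rewrite subnn sqrtr0 mulr0.
by under eq_Rintegral do rewrite gavg0.
Qed.

End smooth.

Lemma clt_err_cvg : clt_err (Num.sqrt k%:R)^-1 @[k --> \oo] --> (0 : R).
Proof.
have c0 k : 0 <= (Num.sqrt k%:R : R)^-1 by rewrite invr_ge0 sqrtr_ge0.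
have cc : (Num.sqrt k%:R : R)^-1 @[k --> \oo] --> (0 : R).
  apply: cvg_trans (@cvgn_powRN R 2^-1 _); last by rewrite invr_gt0.
  by apply: near_eq_cvg; near=> k; rewrite powRN powR12_sqrt.
rewrite -[X in _ --> X]addr0 -[X in _ --> _ + X](mulr0 (s0 ^+ 2)).
apply: cvgD; first exact: lind_cvg.
apply: cvgMr; apply: lind_cvg => //.
- exact: normal01_sqr_integrable.
- by move=> k; rewrite mulr_ge0// ltW.
- by rewrite -[X in _ --> X](mul0r s0); exact: cvgMl.
Unshelve. all: by end_near. Qed.

(** [l] is the steepness of the test function. The factor l^3 is l^2 from the second derivative
    times the l in min (1, l |y|) <= l min (1, |y|); with c = 1 / sqrt k the k replacements cost k
    c^2 = 1. The bound is free of the level x. *)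
Lemma clt_logistic (l : R) (x : R) k : 1 <= l -> (0 < k)%N ->
  `|\int[P]_w logistic (l * ((Num.sqrt k%:R)^-1 * S k w - x)) - \int[nu]_y logistic (l * (s0 * y - x))|
  <= 2 * l ^+ 3 * clt_err (Num.sqrt k%:R)^-1.
Proof.
move=> l1 k0; have l0 : 0 < l by exact: lt_le_trans l1.
set c := (Num.sqrt k%:R)^-1.
have q0 : 0 < Num.sqrt k%:R :> R by rewrite sqrtr_gt0 ltr0n.
have c0 : 0 <= c by rewrite invr_ge0 ltW.
have ml : measurable_fun setT (fun w => logistic (l * w)).
  by apply: (measurableT_comp (@measurable_logistic R)); exact: measurable_funM.
have m1 : measurable_fun setT (fun w => l * logistic1 (l * w)).
  apply: measurable_funM => //; rewrite /logistic1; apply: measurable_funM => //.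
  exact: measurable_funB.
have m2 : measurable_fun setT (fun w => l ^+ 2 * (logistic2 (l * w) / 2)).
  apply: measurable_funM => //; apply: measurable_funM => //; rewrite /logistic2 /logistic1.
  apply: measurable_funM; first by apply: measurable_funM => //; exact: measurable_funB.
  by apply: measurable_funB => //; exact: measurable_funM.
have k1 w : `|l * logistic1 (l * w)| <= l ^+ 2.
  have /andP[p0 p1] := logistic1_itv (l * w); rewrite (ger0_norm (mulr_ge0 (ltW l0) p0)).
  by rewrite expr2 ler_wpM2l ?(ltW l0)// (le_trans p1).
have k2 w : `|l ^+ 2 * (logistic2 (l * w) / 2)| <= l ^+ 2.
  rewrite normrM (ger0_norm (sqr_ge0 l)) ler_piMr ?sqr_ge0// ler_norml.
  have := logistic2_bound (l * w); rewrite ler_norml => /andP[b1 b2].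
  by apply/andP; split; lra.
have HR z y : `|logistic (l * (z + y)) - logistic (l * z) - y * (l * logistic1 (l * z)) -
    y ^+ 2 * (l ^+ 2 * (logistic2 (l * z) / 2))| <= 2 * l ^+ 3 * (y ^+ 2 * Num.min 1 `|y|).
  have := logistic_taylor (l * z) (l * y); rewrite -mulrDr => H.
  rewrite [X in `|X| <= _](_ : _ = logistic (l * (z + y)) - logistic (l * z) - l * y * logistic1 (l * z) -
     (l * y) ^+ 2 * (logistic2 (l * z) / 2)); last by ring.
  apply: (le_trans H); rewrite exprMn normrM (gtr0_norm l0).
  have Hm : Num.min 1 (l * `|y|) <= l * Num.min 1 `|y|.
    case: (leP 1 `|y|) => y1; first by rewrite mulr1 ge_min l1.
    by rewrite ge_min lexx orbT.
  rewrite [leRHS](_ : _ = 2 * (l ^+ 2 * y ^+ 2 * (l * Num.min 1 `|y|))); last by ring.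
  by rewrite ler_wpM2l// ler_wpM2l// mulr_ge0 ?sqr_ge0.
have l01 w : 0 <= logistic (l * w) <= 1 by have /andP[a b] := logistic_itv (l * w); rewrite !ltW.
have l3 : 0 <= 2 * l ^+ 3 by rewrite mulr_ge0// exprn_ge0// ltW.
have := clt_smooth ml m1 m2 l01 k1 k2 l3 HR (- x) k c0.
have -> : c * s0 * Num.sqrt k%:R = s0 by rewrite mulrAC mulVf ?mul1r// gt_eqF.
have -> : k%:R * (2 * l ^+ 3 * c ^+ 2 * clt_err c) = 2 * l ^+ 3 * clt_err c.
  have : k%:R * c ^+ 2 = 1.
    by rewrite exprVn sqr_sqrtr// mulfV// pnatr_eq0 -lt0n.
  move=> E; rewrite (_ : k%:R * _ = k%:R * c ^+ 2 * (2 * l ^+ 3 * clt_err c)); last by ring.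
  by rewrite E mul1r.
rewrite /gavg; under eq_Rintegral do rewrite [- x + _]addrC.
by under [X in `|_ - X|]eq_Rintegral do rewrite [- x + _]addrC.
Qed.

(** Holds because the normal density is at most 1. *)
Lemma gauss_tail_lip (x y : R) : x <= y -> gauss_tail x - gauss_tail y <= y - x.
Proof.
move=> xy; rewrite /gauss_tail -lee_fin EFinB !fineK ?fin_num_measure//.
rewrite leeBlDr ?fin_num_measure//.
rewrite (_ : `[x, +oo[%classic = `[x, y[ `|` `[y, +oo[)%classic; last first.
  by rewrite -itv_bndbnd_setU ?bnd_simp.
rewrite measureU//; last first.
  apply/seteqP; split => // z /= []; rewrite !in_itv/= andbT => /andP[_ zy] yz.
  by have := lt_le_trans zy yz; rewrite ltxx.
rewrite leeD2r// /normal_prob.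
apply: (@le_trans _ _ (\int[@lebesgue_measure R]_(z in `[x, y[) 1)%E).
  apply: ge0_le_integral => //.
  - by move=> z _; rewrite lee_fin normal_pdf_ge0.
  - by apply/measurable_EFinP/measurable_funTS; exact: measurable_normal_pdf.
  - by move=> z _; rewrite lee_fin normal_pdf01_le1.
rewrite integral_cst//= mul1e lebesgue_measure_itv/= lte_fin.
by case: ifP => _; rewrite -?EFinD// lee_fin subr_ge0.
Qed.

Lemma prob_le_Rintegral d' (T : measurableType d') (Q : probability T R) (A : set T) (f : T -> R) (e : R) :
  measurable A -> measurable_fun setT f -> (forall w, 0 <= f w <= 1) -> 0 <= e ->
  (forall w, A w -> 1 <= f w + e) -> fine (Q A) <= \int[Q]_w f w + e.
Proof.
move=> mA mf f01 e0 Af.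
have fi : Q.-integrable setT (EFin \o f).
  by apply: (@bounded_integrable _ _ _ Q _ 1) => // w; have /andP[? ?] := f01 w; rewrite ger0_norm.
have ii : Q.-integrable setT (EFin \o \1_A).
  apply: (@bounded_integrable _ _ _ Q _ 1) => // w.
  by rewrite indicE; case: (_ \in _); rewrite ?normr1 ?normr0.
have -> : fine (Q A) = \int[Q]_w (\1_A w) by rewrite /Rintegral integral_indic// setIT.
rewrite -[in leRHS](prob_Rintegral_cst Q e) -RintegralD//; last exact: prob_integrable_cst.
apply: le_Rintegral => //.
  exact: (integrableD measurableT fi (prob_integrable_cst Q e)).
move=> w _; rewrite indicE; have [wA|wA] := boolP (w \in A).
  by rewrite Af//; exact: set_mem.
by have /andP[f0 _] := f01 w; rewrite addr_ge0.
Qed.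

Lemma Rintegral_le_prob d' (T : measurableType d') (Q : probability T R) (A : set T) (f : T -> R) (e : R) :
  measurable A -> measurable_fun setT f -> (forall w, 0 <= f w <= 1) -> 0 <= e ->
  (forall w, ~ A w -> f w <= e) -> \int[Q]_w f w <= fine (Q A) + e.
Proof.
move=> mA mf f01 e0 Af.
have fi : Q.-integrable setT (EFin \o f).
  by apply: (@bounded_integrable _ _ _ Q _ 1) => // w; have /andP[? ?] := f01 w; rewrite ger0_norm.
have ii : Q.-integrable setT (EFin \o \1_A).
  apply: (@bounded_integrable _ _ _ Q _ 1) => // w.
  by rewrite indicE; case: (_ \in _); rewrite ?normr1 ?normr0.
have -> : fine (Q A) = \int[Q]_w (\1_A w) by rewrite /Rintegral integral_indic// setIT.
rewrite -[in leRHS](prob_Rintegral_cst Q e) -RintegralD//; last exact: prob_integrable_cst.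
apply: le_Rintegral => //.
  exact: (integrableD measurableT ii (prob_integrable_cst Q e)).
move=> w _; rewrite indicE; have [wA|wA] := boolP (w \in A).
  by have /andP[_ f1] := f01 w; rewrite (le_trans f1)// lerDl.
by rewrite add0r Af//; rewrite notin_setE in wA.
Qed.

(** A logistic step centered at x + dl or x - dl replaces the indicator up to eta / 6 outside a
    window of width 2 dl, over which the Gaussian tail varies by at most 2 dl / s0 = eta / 3.
    Uniformity in x is inherited from [clt_logistic]. *)
Lemma central_limit_uniform (eta : R) : 0 < eta -> \forall k \near \oo, forall x,
  `|fine (P [set w | x * Num.sqrt k%:R <= S k w]) - gauss_tail (x / s0)| <= eta.
Proof.
move=> e0.
have arith (IP IN pA g0 g1 er h : R) : IP <= pA + eta / 6 -> g1 <= IN + eta / 6 -> er <= eta / 6 ->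
    g0 - g1 <= h + eta / 3 - h -> IN - er <= IP -> - eta <= pA - g0.
  by lra.
have arith' (IP IN pA g0 g1 er h : R) : pA <= IP + eta / 6 -> IN <= g1 + eta / 6 -> er <= eta / 6 ->
    g1 - g0 <= h - (h - eta / 3) -> IP <= IN + er -> pA - g0 <= eta.
  by lra.
pose dl := eta * s0 / 6.
have dl0 : 0 < dl by rewrite divr_gt0 ?mulr_gt0.
(* This steepness gives exp (- l dl) <= 1 / (l dl) <= eta / 6. *)
pose l := Num.max 1 (dl^-1 * (6 / eta)).
have l1 : 1 <= l by rewrite le_max lexx.
have l0 : 0 < l by exact: lt_le_trans l1.
have el : expR (- (l * dl)) <= eta / 6.
  rewrite expRN -[leRHS]invrK lef_pV2 ?posrE ?expR_gt0 ?invr_gt0 ?divr_gt0// invf_div.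
  apply: le_trans (expR_ge1Dx _); apply: (@le_trans _ _ (l * dl)); last by rewrite lerDr.
  by rewrite -ler_pdivrMr// mulrC le_max lexx orbT.
have H : 2 * l ^+ 3 * clt_err (Num.sqrt k%:R)^-1 @[k --> \oo] --> (0 : R).
  by rewrite -[X in _ --> X](mulr0 (2 * l ^+ 3)); apply: cvgMr; exact: clt_err_cvg.
near=> k; move=> x.
have k0 : (0 < k)%N by near: k; exact: nbhs_infty_gt.
have q0 : 0 < Num.sqrt k%:R :> R by rewrite sqrtr_gt0 ltr0n.
have err : 2 * l ^+ 3 * clt_err (Num.sqrt k%:R)^-1 <= eta / 6.
  by near: k; apply: (cvgr_le _ H); rewrite divr_gt0.
set A := [set w | _].
have mS := measurable_partial_sum k.
pose W w := (Num.sqrt k%:R)^-1 * S k w.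
have mW : measurable_fun setT W by exact: measurable_funM.
have AE w : A w <-> x <= W w by rewrite /A/= mulrC /W ler_pdivlMl.
have mA : measurable A.
  rewrite (_ : A = W @^-1` `[x, +oo[%classic).
    by rewrite -[X in measurable X]setTI; exact: mW.
  by apply/seteqP; split => w; rewrite /= in_itv/= andbT => /AE.
have mF (V : Omega -> R) u : measurable_fun setT V -> measurable_fun setT (fun w => logistic (l * (V w - u))).
  move=> mV; apply: (measurableT_comp (@measurable_logistic R)); apply: measurable_funM => //.
  exact: measurable_funB.
have mG u : measurable_fun setT (fun y : measurableTypeR R => logistic (l * (s0 * y - u))).
  apply: (measurableT_comp (@measurable_logistic R)); apply: measurable_funM => //.
  by apply: measurable_funB => //; exact: measurable_funM.
have l01 (v : R) : 0 <= logistic v <= 1 by have /andP[a b] := logistic_itv v; rewrite !ltW.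
have e60 : 0 <= eta / 6 by rewrite divr_ge0// ltW.
have up (v : R) : dl <= v -> 1 <= logistic (l * v) + eta / 6.
  move=> dv; rewrite -lerBlDr; apply: le_trans (logistic_ge_expR _).
  rewrite lerD2l lerN2; apply: le_trans el.
  by rewrite ler_expR lerN2 ler_wpM2l// ltW.
have dn (v : R) : v <= - dl -> logistic (l * v) <= eta / 6.
  move=> dv; apply: le_trans (logistic_le_expR _) _; apply: le_trans el.
  by rewrite ler_expR -mulrN ler_wpM2l// ltW.
have mtail (u : R) : measurable [set y : measurableTypeR R | u <= s0 * y].
  rewrite (_ : [set y | _] = `[u / s0, +oo[%classic); first exact: measurable_itv.
  by apply/seteqP; split => y /=; rewrite in_itv/= andbT ler_pdivrMr// mulrC.
have tailE (u : R) : fine (nu [set y | u <= s0 * y]) = gauss_tail (u / s0).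
  rewrite /gauss_tail; congr (fine (nu _)).
  by apply/seteqP; split => y /=; rewrite in_itv/= andbT ler_pdivrMr// mulrC.
have d2 : 2 * dl / s0 = eta / 3 by rewrite /dl; field; rewrite gt_eqF.
rewrite ler_norml; apply/andP; split.
- have H1 : \int[P]_w logistic (l * (W w - (x + dl))) <= fine (P A) + eta / 6.
    apply: Rintegral_le_prob => //; first exact: mF.
    move=> w nA; apply: dn; rewrite opprD addrA gerDr subr_le0 leNgt; apply/negP => xW.
    by apply: nA; apply/AE; exact: ltW.
  have H2 : gauss_tail ((x + 2 * dl) / s0) <= \int[nu]_y logistic (l * (s0 * y - (x + dl))) + eta / 6.
    rewrite -tailE; apply: (@prob_le_Rintegral _ _ nu) => //.
    by move=> y /= xy; apply: up; lra.
  have H3 := clt_logistic (x + dl) l1 k0; rewrite ler_distl in H3; have /andP[H3a H3b] := H3.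
  have H4 := @gauss_tail_lip (x / s0) ((x + 2 * dl) / s0).
  rewrite ler_pM2r ?invr_gt0// lerDl mulr_ge0 ?(ltW dl0)// in H4; have {}H4 := H4 isT.
  rewrite [in leRHS]mulrDl d2 in H4.
  exact: arith H1 H2 err H4 H3a.
- have H1 : fine (P A) <= \int[P]_w logistic (l * (W w - (x - dl))) + eta / 6.
    apply: prob_le_Rintegral => //; first exact: mF.
    by move=> w /AE xW; apply: up; lra.
  have H2 : \int[nu]_y logistic (l * (s0 * y - (x - dl))) <= gauss_tail ((x - 2 * dl) / s0) + eta / 6.
    rewrite -tailE; apply: (@Rintegral_le_prob _ _ nu) => //.
    move=> y /= xy; apply: dn; have {}xy : s0 * y < x - 2 * dl by rewrite ltNge; apply/negP.
    lra.
  have H3 := clt_logistic (x - dl) l1 k0; rewrite ler_distl in H3; have /andP[H3a H3b] := H3.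
  have H4 := @gauss_tail_lip ((x - 2 * dl) / s0) (x / s0).
  rewrite ler_pM2r ?invr_gt0// gerDl oppr_le0 mulr_ge0 ?(ltW dl0)// in H4; have {}H4 := H4 isT.
  rewrite [X in _ <= _ - X]mulrDl mulNr d2 in H4.
  exact: arith' H1 H2 err H4 H3b.
Unshelve. all: by end_near. Qed.

End central_limit.

(** * Large deviations of partial sums *)

Section indicator_sums.
Context d (Omega : measurableType d) (R : realType) (P : probability Omega R).
Local Notation pr A := (fine (P A)).

Lemma integrable_indic_prob (A : set Omega) : measurable A -> P.-integrable setT (EFin \o (\1_A : Omega -> R)).
Proof.
move=> mA; apply: (@bounded_integrable _ _ _ P _ 1) => // w.
by rewrite indicE; case: (_ \in _); rewrite ?normr1 ?normr0.
Qed.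

Lemma Rintegral_sum_indic (As : seq (set Omega)) : (forall A, A \in As -> measurable A) ->
  P.-integrable setT (EFin \o (fun w => \sum_(A <- As) (\1_A w : R))) /\
  \int[P]_w (\sum_(A <- As) (\1_A w : R)) = \sum_(A <- As) pr A.
Proof.
elim: As => [_|A As IH mAs].
  have -> : (fun w : Omega => \sum_(A <- [::]) (\1_A w : R)) = (fun=> 0) by apply/funext => w; rewrite big_nil.
  by rewrite big_nil prob_Rintegral_cst; split => //; exact: prob_integrable_cst.
have mA : measurable A by apply: mAs; rewrite mem_head.
have [|i1 E1] := IH; first by move=> B BAs; apply: mAs; rewrite inE BAs orbT.
have -> : (fun w => \sum_(B <- A :: As) (\1_B w : R)) = (fun w => \1_A w + \sum_(B <- As) (\1_B w : R)).
  by apply/funext => w; rewrite big_cons.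
have iA := integrable_indic_prob mA.
split; first exact: (integrableD measurableT iA i1).
rewrite RintegralD// E1 big_cons; congr (_ + _).
by rewrite /Rintegral integral_indic// setIT.
Qed.

(** Union bounds and inclusion-exclusion are used in this form: an inequality between sums of
    indicators, integrated termwise. *)
Lemma sum_prob_le (As Bs : seq (set Omega)) :
  (forall A, A \in As -> measurable A) -> (forall B, B \in Bs -> measurable B) ->
  (forall w, \sum_(A <- As) (\1_A w : R) <= \sum_(B <- Bs) (\1_B w : R)) ->
  \sum_(A <- As) pr A <= \sum_(B <- Bs) pr B.
Proof.
move=> /Rintegral_sum_indic[iA <-] /Rintegral_sum_indic[iB <-] H.
by apply: le_Rintegral => // w _; exact: H.
Qed.

End indicator_sums.

(** For u >= 0, exp u - 1 <= u exp u is used twice; for u < 0, exp u <= 1 / (1 - u). *)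
Lemma expR_sqr_ub (R : realType) (u v : R) : u <= v -> 0 <= v -> expR u <= 1 + u + u ^+ 2 * expR v.
Proof.
move=> uv v0; have ev : 1 <= expR v by rewrite -expR0 ler_expR.
have [u0|u0] := leP 0 u.
  have euv : expR u <= expR v by rewrite ler_expR.
  have H := expR_ge1Dx (- u); have e0 := expR_gt0 u.
  have H1 : expR u * (1 - u) <= 1.
    by rewrite -[leRHS](divff (lt0r_neq0 e0)) -expRN ler_wpM2l// ltW.
  have : u * (expR u - 1) <= u * (u * expR u) by rewrite ler_wpM2l//; nra.
  have : u ^+ 2 * expR u <= u ^+ 2 * expR v by rewrite ler_wpM2l// sqr_ge0.
  rewrite !expr2; nra.
have u1 : 0 < 1 - u by rewrite subr_gt0 (lt_trans u0).
have H : expR u <= (1 - u)^-1.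
  by rewrite -[u]opprK expRN lef_pV2 ?posrE ?expR_gt0 ?opprK// expR_ge1Dx.
apply: (le_trans H); rewrite -[leLHS]mul1r ler_pdivrMr//.
have : u ^+ 2 <= u ^+ 2 * expR v by rewrite ler_peMr// sqr_ge0.
rewrite !expr2; nra.
Qed.

Section half_line_sets.
Context d (T : measurableType d) (R : realType).
Implicit Types (V : T -> R) (u : R).

Lemma measurable_ge_set V u : measurable_fun setT V -> measurable [set w | u <= V w].
Proof.
move=> mV; rewrite (_ : [set w | _] = V @^-1` `[u, +oo[%classic).
  by rewrite -[X in measurable X]setTI; exact: mV.
by apply/seteqP; split => w /=; rewrite in_itv/= andbT.
Qed.

Lemma measurable_lt_set V u : measurable_fun setT V -> measurable [set w | V w < u].
Proof.
move=> mV; rewrite (_ : [set w | _] = V @^-1` `]-oo, u[%classic).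
  by rewrite -[X in measurable X]setTI; exact: mV.
by apply/seteqP; split => w /=; rewrite in_itv.
Qed.

Lemma measurable_lt_indic V u : measurable_fun setT V -> measurable_fun setT (fun w => (V w < u)%R%:R : R).
Proof.
move=> mV; rewrite (_ : (fun w => _) = \1_[set w | V w < u]); first exact/measurable_indic/measurable_lt_set.
apply/funext => w; rewrite indicE; case: ltP => H; first by rewrite mem_set.
by rewrite memNset//=; apply/negP; rewrite -leNgt.
Qed.

End half_line_sets.

Section large_deviations.
Context d (Omega : measurableType d) (R : realType) (P : probability Omega R).
Context (X : nat -> Omega -> R) (s0 : R).
Hypothesis mX : forall i, measurable_fun setT (X i).
Hypothesis iX : iid P X.
Hypothesis s00 : 0 < s0.
Hypothesis X2 : P.-integrable setT (EFin \o (fun w => X 0%N w ^+ 2)).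
Hypothesis X1E : \int[P]_w X 0%N w = 0.
Hypothesis X2E : \int[P]_w (X 0%N w ^+ 2) = s0 ^+ 2.
Local Notation S := (partial_sum X).
Local Notation pr A := (fine (P A)).

Definition rtail (u : R) : R := pr [set w | u <= X 0%N w].

Lemma rtailE i u : pr [set w | u <= X i w] = rtail u.
Proof.
have [_ H] := iX; rewrite /rtail; congr fine.
have E j : [set w | u <= X j w] = X j @^-1` `[u, +oo[%classic.
  by apply/seteqP; split => w /=; rewrite in_itv/= andbT.
by rewrite !E; apply: H.
Qed.

Lemma rtail_itv u : 0 <= rtail u <= 1.
Proof.
rewrite /rtail fine_ge0//= -lee_fin fineK ?fin_num_measure ?probability_le1//; exact: measurable_ge_set.
Qed.

Let X1 := integrable_of_sqr (mX 0%N) X2.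

(** The quadratic majorant of the exponential is nonnegative also where X >= y and the truncated
    integrand vanishes, so the full moments E X = 0 and E X^2 = s0^2 may be used. *)
Lemma truncated_mgf_ub (h y : R) : 0 <= h -> 0 < y ->
  \int[P]_w (expR (h * X 0%N w) * (X 0%N w < y)%R%:R) <= 1 + s0 ^+ 2 * h ^+ 2 * expR (h * y).
Proof.
move=> h0 y0; have hy0 : 0 <= h * y by rewrite mulr_ge0// ltW.
have mind : measurable_fun setT (fun w => (X 0%N w < y)%R%:R : R).
  exact: measurable_lt_indic.
pose f w := 1 + h * X 0%N w + (h ^+ 2 * expR (h * y)) * X 0%N w ^+ 2.
have if1 : P.-integrable setT (EFin \o (fun w => 1 + h * X 0%N w)).
  exact: (integrableD measurableT (prob_integrable_cst P 1) (integrable_EFinZ h X1)).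
have if2 : P.-integrable setT (EFin \o (fun w => (h ^+ 2 * expR (h * y)) * X 0%N w ^+ 2)).
  exact: integrable_EFinZ.
have iF : P.-integrable setT (EFin \o f) by exact: (integrableD measurableT if1 if2).
have -> : 1 + s0 ^+ 2 * h ^+ 2 * expR (h * y) = \int[P]_w f w.
  rewrite /f RintegralD// RintegralD//; last 2 first.
  - exact: prob_integrable_cst.
  - exact: integrable_EFinZ.
  by rewrite prob_Rintegral_cst !RintegralZl// X1E X2E; ring.
apply: le_Rintegral => //.
  apply: (@bounded_integrable _ _ _ P _ (expR (h * y))).
    apply: measurable_funM => //; apply: measurableT_comp => //; exact: measurable_funM.
  move=> w; rewrite ger0_norm ?mulr_ge0 ?expR_ge0//.
  case: ltP => Xy; last by rewrite mulr0 expR_ge0.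
  by rewrite mulr1 ler_expR ler_wpM2l// ltW.
move=> w _; rewrite /f; case: ltP => Xy.
  rewrite mulr1; have := @expR_sqr_ub _ (h * X 0%N w) (h * y) _ hy0.
  rewrite ler_wpM2l ?(ltW Xy)// => /(_ isT) H; apply: (le_trans H); rewrite lerD2l.
  by rewrite exprMn mulrAC.
have X0 : 0 <= X 0%N w by rewrite (le_trans (ltW y0)).
by rewrite mulr0 !addr_ge0 ?mulr_ge0 ?sqr_ge0 ?expR_ge0.
Qed.

Lemma measurable_light_part (k : nat) (x y : R) :
  measurable [set w | x <= S k w /\ forall i, (i < k)%N -> X i w < y].
Proof.
rewrite (_ : [set w | _] = [set w | x <= S k w] `&` \bigcap_i [set w | (i < k)%N -> X i w < y]).
  apply: measurableI; first exact/measurable_ge_set/measurable_partial_sum.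
  apply: bigcapT_measurable => i; case: (ltnP i k) => ik.
    by rewrite (_ : [set w | _] = [set w | X i w < y]); [exact: measurable_lt_set|apply/seteqP; split => w /=; [exact|]].
  by rewrite (_ : [set w | _] = setT)//; apply/seteqP; split.
by apply/seteqP; split => w /= [H1 H2]; split => // i; [move=> _; exact: H2|exact: H2].
Qed.

(** Chernoff's bound restricted to the event that all jumps are below y: on it the product of the
    truncated exponentials is exp (h S_k). *)
Lemma light_part_exp (k : nat) (h x y : R) : 0 <= h -> 0 < y ->
  pr [set w | x <= S k w /\ forall i, (i < k)%N -> X i w < y] <=
  expR (- (h * x)) * (1 + s0 ^+ 2 * h ^+ 2 * expR (h * y)) ^+ k.
Proof.
move=> h0 y0; set A := [set w | _].
pose phi (i : nat) (u : R) := expR (h * u) * (u < y)%R%:R.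
have mphi i : measurable_fun setT (phi i).
  apply: measurable_funM; first by apply: measurableT_comp => //; exact: measurable_funM.
  exact: (@measurable_lt_indic _ _ _ id).
have phi0 i u : 0 <= phi i u by rewrite mulr_ge0 ?expR_ge0.
have mA : measurable A by exact: measurable_light_part.
have [mi idX] := iX.
have HI := @integral_indep_prod _ _ _ P _ _ _ X mX set0 setT (iota 0 k) phi mi mphi phi0.
have ST : <<s sigma_block X set0 >> [set: Omega] by exact: (@measurableT _ (g_sigma_algebraType (sigma_block X set0))).
have {}HI := HI ST (iota_uniq 0 k) (fun i _ H => H).
set m := \int[P]_w (expR (h * X 0%N w) * (X 0%N w < y)%R%:R).
have mE i : (\int[P]_w (phi i (X i w))%:E = m%:E)%E.
  rewrite (integral_eq_law (P := P) (f := fun u => (phi 0%N u)%:E) (mX i) (mX 0%N)); last 3 first.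
  - by move=> B mB; exact: idX.
  - exact/measurable_EFinP.
  - by move=> u; rewrite lee_fin.
  apply: (@bounded_integralE _ _ _ P _ (expR (h * y))); first exact: (measurableT_comp (mphi 0%N)).
  move=> w; rewrite ger0_norm ?phi0// /phi.
  case: ltP => Xy; last by rewrite mulr0 expR_ge0.
  by rewrite mulr1 ler_expR ler_wpM2l// ltW.
have m0 : 0 <= m by rewrite -lee_fin -(mE 0%N) integral_ge0// => w _; rewrite lee_fin.
have prodm (r : seq nat) : (\prod_(i <- r) \int[P]_w (phi i (X i w))%:E = (m ^+ size r)%:E)%E.
  elim: r => [|i r IH]; first by rewrite big_nil.
  by rewrite big_cons IH mE -EFinM exprS.
rewrite prodm size_iota probability_setT mul1e in HI.
apply: (@le_trans _ _ (expR (- (h * x)) * m ^+ k)); last first.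
  have b0 : 0 <= s0 ^+ 2 * h ^+ 2 * expR (h * y) by rewrite mulr_ge0 ?expR_ge0// -exprMn sqr_ge0.
  rewrite ler_wpM2l ?expR_ge0//; apply: lerXn2r; rewrite ?nnegrE ?addr_ge0//.
  exact: truncated_mgf_ub.
rewrite -lee_fin fineK ?fin_num_measure// EFinM -HI -ge0_integralZl_EFin ?expR_ge0//; last 2 first.
- by move=> w _; rewrite lee_fin prodr_ge0.
- apply/measurable_EFinP; apply: (@measurable_prod _ _ _ _ _ _ (fun i w => phi i (X i w))) => i _.
  exact: (measurableT_comp (mphi i)).
rewrite -(setIT A) -integral_indic//; apply: ge0_le_integral => //.
- exact/measurable_EFinP/measurable_indic.
- apply: measurable_funeM; apply/measurable_EFinP; apply: (@measurable_prod _ _ _ _ _ _ (fun i w => phi i (X i w))) => i _.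
  exact: (measurableT_comp (mphi i)).
move=> w _; rewrite indicE -EFinM lee_fin; case: (boolP (w \in A)) => [/set_mem[/= xS XA]|_]; last first.
  by rewrite mulr_ge0 ?expR_ge0 ?prodr_ge0.
have -> : \prod_(i <- iota 0 k) phi i (X i w) = expR (h * S k w).
  rewrite /partial_sum -(big_mkord xpredT (fun i => X i w)) /index_iota subn0 mulr_sumr expR_sum.
  rewrite [LHS]big_seq [RHS]big_seq; apply: eq_bigr => i; rewrite mem_iota add0n => /andP[_ ik].
  by rewrite /phi XA// mulr1.
by rewrite -expRD -expR0 ler_expR addrC subr_ge0 ler_wpM2l.
Qed.

(* Chernoff bound with exponent [h = ln T / (2 y)], where [y] is the truncation level and [T] is
   proportional to [k e^2]: then [k s0^2 h^2 exp (h y) = (ln T)^2 / (4 sqrt T)] is bounded. *)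
Lemma light_part_ub (p : R) : 0 < p -> exists2 C : R, 0 < C &
  forall k (e : R), (0 < k)%N -> 0 < e ->
  pr [set w | e * k%:R <= S k w /\ forall i, (i < k)%N -> X i w < (2 * p)^-1 * (e * k%:R)] <=
  C * (k%:R * e ^+ 2) `^ (- p).
Proof.
move=> p0; pose c := (2 * p)^-1; have c0 : 0 < c by rewrite invr_gt0 mulr_gt0.
pose b := c ^+ 2 / s0 ^+ 2; have b0 : 0 < b by rewrite divr_gt0 ?exprn_gt0.
exists (expR 4 * b `^ (- p)); first by rewrite mulr_gt0 ?expR_gt0 ?powR_gt0.
move=> k e k0 e0; have k0R : 0 < k%:R :> R by rewrite ltr0n.
set A := [set w | _].
pose T := b * (k%:R * e ^+ 2); have T0 : 0 < T by apply: mulr_gt0 => //; rewrite mulr_gt0 ?exprn_gt0.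
have x0 : 0 <= k%:R * e ^+ 2 by rewrite mulr_ge0 ?sqr_ge0.
rewrite -mulrA -(powRM _ (ltW b0) x0) -/T.
have mA : measurable A by exact: measurable_light_part.
have [T1|T1] := leP T 1.
  apply: (@le_trans _ _ 1); first by rewrite -lee_fin fineK ?fin_num_measure ?probability_le1.
  apply: (@le_trans _ _ (expR 4 * 1)); first by rewrite mulr1 -expR0 ler_expR.
  rewrite ler_wpM2l ?expR_ge0//.
  by have := powRN_le (ltW p0) T0 T1; rewrite powR1.
pose y := c * (e * k%:R); have y0 : 0 < y by rewrite !mulr_gt0.
pose L := ln T / 2; have L0 : 0 <= L by rewrite divr_ge0// ln_ge0 ?ltW.
have h0 : 0 <= L / y by apply: divr_ge0 => //; exact: ltW.
apply: (le_trans (light_part_exp k (e * k%:R) h0 y0)).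
have hx : L / y * (e * k%:R) = L / c.
  by rewrite /y; field; rewrite !gt_eqF.
have hy : L / y * y = L by rewrite divfK ?gt_eqF.
have b1 : 0 <= s0 ^+ 2 * (L / y) ^+ 2 * expR L by rewrite mulr_ge0 ?expR_ge0// -exprMn sqr_ge0.
rewrite hx hy mulrC; apply: ler_pM; rewrite ?expR_ge0//.
- by rewrite exprn_ge0// addr_ge0.
- apply: (@le_trans _ _ (expR (s0 ^+ 2 * (L / y) ^+ 2 * expR L) ^+ k)).
    by rewrite lerXn2r ?nnegrE ?expR_ge0 ?expR_ge1Dx// addr_ge0.
  rewrite -expRM_natl ler_expR.
  have eL : expR L = Num.sqrt T.
    rewrite -powR12_sqrt ?(ltW T0)// /powR gt_eqF// /L mulrC; congr expR.
  have q0 : 0 < Num.sqrt T by rewrite sqrtr_gt0.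
  have q2 : Num.sqrt T ^+ 2 = T by rewrite sqr_sqrtr// ltW.
  have lnT : ln T <= 4 * Num.sqrt (Num.sqrt T).
    have qq0 : 0 < Num.sqrt (Num.sqrt T) by rewrite sqrtr_gt0.
    have -> : ln T = 4 * ln (Num.sqrt (Num.sqrt T)).
      move: qq0 (sqr_sqrtr (ltW q0)); move: (Num.sqrt (Num.sqrt T)) => q qq0 qE.
      have -> : T = q ^+ 4 by rewrite -q2 -qE -exprM.
      by rewrite lnXn// mulr_natl.
    rewrite ler_wpM2l//; have := @le_ln1Dx _ (Num.sqrt (Num.sqrt T) - 1).
    rewrite (addrC 1) subrK => H; apply: (le_trans (H _)); last by rewrite gerBl.
    by rewrite ltrBrDr addNr.
  have lnT2 : ln T ^+ 2 <= 16 * Num.sqrt T.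
    rewrite (_ : 16 * Num.sqrt T = (4 * Num.sqrt (Num.sqrt T)) ^+ 2).
      by rewrite lerXn2r ?nnegrE// ?mulr_ge0 ?sqrtr_ge0// ln_ge0// ltW.
    by rewrite exprMn sqr_sqrtr ?(ltW q0)//; ring.
  have E : k%:R * (s0 ^+ 2 * (L / y) ^+ 2 * expR L) = ln T ^+ 2 / (4 * Num.sqrt T).
    have -> : s0 ^+ 2 * (L / y) ^+ 2 = ln T ^+ 2 / (4 * (k%:R * T)).
      by rewrite /L /y /T /b; field; rewrite !gt_eqF.
    by rewrite eL -{2}q2; field; rewrite !gt_eqF.
  rewrite E ler_pdivrMr ?mulr_gt0//; apply: (le_trans lnT2).
  by rewrite mulrA -natrM.
- rewrite le_eqVlt; apply/orP; left; apply/eqP.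
  by rewrite /powR gt_eqF//; congr expR; rewrite /L /c invrK; field.
Qed.

(** Sums over a list of indices, so that one index can be removed: [others i k] below is S_k without
    its term of index i. *)
Definition seq_sum (r : seq nat) (w : Omega) : R := \sum_(i <- r) X i w.

Lemma measurable_seq_sum r : measurable_fun setT (seq_sum r).
Proof. by rewrite /seq_sum; apply: measurable_sum. Qed.

Lemma seq_sum_indep r i (A B : set R) : i \notin r -> measurable A -> measurable B ->
  P (seq_sum r @^-1` A `&` X i @^-1` B) = (P (seq_sum r @^-1` A) * P (X i @^-1` B))%E.
Proof.
move=> ir; have [mi _] := iX.
apply: (@block_indep_fun _ _ _ P _ _ _ X mX _ _ _ _ [set j | j \in r] [set i] (seq_sum r) (X i)) => //.
- by apply/seteqP; split => // j /= [jr jE]; rewrite -jE jr in ir.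
- by apply: (block_measurable_sum (phi := fun _ x => x)).
- exact: block_measurable_var.
Qed.

(** The cross term disappears on integrating (u + X_i)^2 over X_i with u frozen; independence is
    thus used only for a nonnegative integrand. *)
Lemma seq_sum_sqr r : uniq r -> (\int[P]_w (seq_sum r w ^+ 2)%:E = ((size r)%:R * s0 ^+ 2)%:E)%E.
Proof.
elim: r => [_|i r IH /= /andP[ir ur]].
  by under eq_integral do rewrite /seq_sum big_nil expr0n; rewrite integral0 mul0r.
transitivity (\int[P]_w ((seq_sum r w + X i w) ^+ 2)%:E)%E.
  by apply: eq_integral => w _; rewrite /seq_sum big_cons addrC.
rewrite (@integral_indep_pair _ _ _ P _ _ _ _ (seq_sum r) (X i) (measurable_seq_sum r) (mX i)
  (fun A B => @seq_sum_indep r i A B ir) (fun z => ((z.1 + z.2) ^+ 2)%:E)); last 2 first.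
- by apply/measurable_EFinP; apply: measurable_funX; exact: measurable_funD.
- by move=> z; rewrite lee_fin sqr_ge0.
have inner (u : R) : (\int[P]_w' ((u + X i w') ^+ 2)%:E = (u ^+ 2 + s0 ^+ 2)%:E)%E.
  have [_ idX] := iX.
  rewrite (integral_eq_law (P := P) (f := fun v => ((u + v) ^+ 2)%:E) (mX i) (mX 0%N)); last 3 first.
  - by move=> B mB; exact: idX.
  - by apply/measurable_EFinP; apply: measurable_funX; exact: measurable_funD.
  - by move=> v; rewrite lee_fin sqr_ge0.
  have i1 : P.-integrable setT (EFin \o (fun w => u ^+ 2 + (2 * u) * X 0%N w)).
    exact: (integrableD measurableT (prob_integrable_cst P _) (integrable_EFinZ _ X1)).
  have i2 : P.-integrable setT (EFin \o (fun w => u ^+ 2 + (2 * u) * X 0%N w + X 0%N w ^+ 2)).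
    exact: (integrableD measurableT i1 X2).
  transitivity (\int[P]_w (u ^+ 2 + (2 * u) * X 0%N w + X 0%N w ^+ 2)%:E)%E.
    by apply: eq_integral => w _; congr EFin; ring.
  rewrite -[LHS]fineK; last exact: (integrable_fin_num measurableT i2).
  rewrite -[X in X%:E = _]/(\int[P]_w (u ^+ 2 + (2 * u) * X 0%N w + X 0%N w ^+ 2)).
  rewrite RintegralD// RintegralD//; last 2 first.
  - exact: prob_integrable_cst.
  - exact: integrable_EFinZ.
  by rewrite prob_Rintegral_cst RintegralZl// X1E X2E mulr0 addr0.
under eq_integral do rewrite /= inner EFinD.
rewrite ge0_integralD//; last 3 first.
- by move=> w _; rewrite lee_fin sqr_ge0.
- by apply/measurable_EFinP; apply: measurable_funX; exact: measurable_seq_sum.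
- by move=> w _; rewrite lee_fin sqr_ge0.
rewrite IH// integral_cst//= probability_setT mule1 -EFinD; congr EFin.
by rewrite -natr1 mulrDl mul1r.
Qed.

Lemma seq_sum_chebyshev r v : uniq r -> 0 < v ->
  pr [set w | v <= `|seq_sum r w|] <= (size r)%:R * s0 ^+ 2 / v ^+ 2.
Proof.
move=> ur v0; have v20 : 0 < v ^+ 2 by rewrite exprn_gt0.
have mA : measurable [set w | v <= `|seq_sum r w|].
  by apply: (@measurable_ge_set _ _ _ (fun w => `|seq_sum r w|)); apply: measurableT_comp => //; exact: measurable_seq_sum.
rewrite ler_pdivlMr// -lee_fin EFinM fineK ?fin_num_measure// -seq_sum_sqr//.
rewrite muleC -(setIT [set w | _]) -integral_indic// -ge0_integralZl_EFin ?(ltW v20)//; last first.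
  exact/measurable_EFinP/measurable_indic.
apply: ge0_le_integral => //.
- by move=> w _; rewrite mule_ge0// lee_fin ltW.
- by apply: measurable_funeM; exact/measurable_EFinP/measurable_indic.
- by apply/measurable_EFinP; apply: measurable_funX; exact: measurable_seq_sum.
move=> w _; rewrite indicE -EFinM lee_fin; case: (boolP (w \in _)) => [/set_mem/= vw|_]; last by rewrite mulr0 sqr_ge0.
by rewrite mulr1 -[leRHS]real_normK ?num_real// lerXn2r ?nnegrE ?(ltW v0).
Qed.

Lemma indic_set (b : Omega -> bool) w : \1_[set w | b w] w = (b w)%:R :> R.
Proof.
by rewrite indicE; case: (boolP (b w)) => bw; [rewrite mem_set|rewrite memNset//; exact/negP].
Qed.

Let others i k := seq_sum (rem i (iota 0 k)).

Let partial_sumE i k w : (i < k)%N -> S k w = X i w + others i k w.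
Proof.
move=> ik; rewrite /partial_sum -(big_mkord xpredT (fun i => X i w)) /index_iota subn0.
by rewrite (big_rem i)//= mem_iota add0n.
Qed.

Let others_chebyshev i k v : (i < k)%N -> 0 < v ->
  pr [set w | v <= `|others i k w|] <= k%:R * s0 ^+ 2 / v ^+ 2.
Proof.
move=> ik v0; apply: le_trans (seq_sum_chebyshev (rem_uniq i (iota_uniq 0 k)) v0) _.
rewrite size_rem ?mem_iota// size_iota ler_wpM2r ?invr_ge0 ?sqr_ge0// ler_wpM2r ?sqr_ge0// ler_nat.
exact: leq_pred.
Qed.

(** The rest of the sum omits the term of index i, so the two events are independent, and
    Chebyshev's inequality bounds the second. *)
Let jump_indep i k u v : (i < k)%N -> 0 < v ->
  pr [set w | (u <= X i w) && (v <= `|others i k w|)] <= rtail u * (k%:R * s0 ^+ 2 / v ^+ 2).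
Proof.
move=> ik v0; have mabs : measurable_fun setT (fun x : R => `|x|) by exact: measurableT_comp.
have [mi _] := iX.
have mV : measurable [set x : R | v <= `|x|] by exact: measurable_ge_set.
have -> : [set w | (u <= X i w) && (v <= `|others i k w|)] =
    others i k @^-1` [set x | v <= `|x|] `&` X i @^-1` `[u, +oo[%classic.
  apply/seteqP; split => w /=; rewrite in_itv/= andbT; first by move=> /andP[? ?]; split.
  by move=> [? ?]; apply/andP; split.
rewrite seq_sum_indep//; last by rewrite mem_rem_uniq ?iota_uniq// inE eqxx.
rewrite fineM ?fin_num_measure//; last 2 first.
- by rewrite -[X in measurable X]setTI; exact: measurable_seq_sum.
- by rewrite -[X in measurable X]setTI; exact: mX.
rewrite mulrC; have -> : fine (P (X i @^-1` `[u, +oo[)) = rtail u.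
  by rewrite -(rtailE i); congr (fine (P _)); apply/seteqP; split => w /=; rewrite in_itv/= andbT.
have /andP[r0 _] := rtail_itv u.
by rewrite ler_wpM2l//; exact: others_chebyshev.
Qed.

Let sum_ge_term (r : seq nat) (F : nat -> R) i : (forall j, 0 <= F j) -> i \in r -> F i <= \sum_(j <- r) F j.
Proof. by move=> F0 ir; rewrite (big_rem i)//= lerDl sumr_ge0. Qed.

Let measurable_bool_and (b1 b2 : Omega -> bool) :
  measurable [set w | b1 w] -> measurable [set w | b2 w] -> measurable [set w | b1 w && b2 w].
Proof.
move=> m1 m2; rewrite (_ : [set w | _] = [set w | b1 w] `&` [set w | b2 w]); first exact: measurableI.
by apply/seteqP; split => w /=; [move=> /andP[]|move=> [-> ->]].
Qed.

Let lightE k (x y : R) : [set w | (x <= S k w) && all (fun i => X i w < y) (iota 0 k)] =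
  [set w | x <= S k w /\ forall i, (i < k)%N -> X i w < y].
Proof.
apply/seteqP; split => w /=.
  move=> /andP[-> /allP H]; split => // i ik; apply: H; by rewrite mem_iota.
by move=> [-> H]; apply/allP => i; rewrite mem_iota add0n => /andP[_]; exact: H.
Qed.

(** Either some jump reaches the truncation level or [light_part_ub] applies. *)
Lemma light_jump_ub (p : R) : 0 < p -> exists2 C : R, 0 < C &
  forall k (e : R), (0 < k)%N -> 0 < e ->
  pr [set w | e * k%:R <= S k w] <=
  k%:R * rtail ((2 * p)^-1 * (e * k%:R)) + C * (k%:R * e ^+ 2) `^ (- p).
Proof.
move=> p0; have [C C0 H] := light_part_ub p0; exists C => // k e k0 e0.
apply: le_trans (lerD (lexx _) (H k e k0 e0)); rewrite -lightE.
set x := e * k%:R; set y := _ * x.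
have mS := measurable_partial_sum mX k.
have := @sum_prob_le _ _ _ P [:: [set w | x <= S k w]]
  (rcons [seq [set w | y <= X i w] | i <- iota 0 k] [set w | (x <= S k w) && all (fun i => X i w < y) (iota 0 k)]).
rewrite big_seq1 -cats1 big_cat big_seq1 big_map/= => HH; apply: (le_trans (HH _ _ _)).
- by move=> A; rewrite inE => /eqP ->; exact: measurable_ge_set.
- move=> A; rewrite mem_cat inE => /orP[/mapP[i _ ->]|/eqP ->]; first exact: measurable_ge_set.
  by rewrite lightE; exact: measurable_light_part.
- move=> w; rewrite big_seq1 big_cat big_seq1 big_map/=.
  rewrite (indic_set (fun w => x <= S k w)) (indic_set (fun w => (x <= S k w) && all (fun i => X i w < y) (iota 0 k))).
  under eq_bigr do rewrite (indic_set (fun w => y <= X _ w)).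
  have s1 : 0 <= \sum_(i <- iota 0 k) (y <= X i w)%R%:R :> R by rewrite sumr_ge0.
  case: (x <= S k w) => /=; last by rewrite addr0.
  case: (boolP (all _ _)) => [_|/allPn[i ik nX]]; first by rewrite lerDr.
  rewrite addr0; apply: le_trans (sum_ge_term (F := fun i => (y <= X i w)%R%:R) _ ik) => //.
  by move: nX; rewrite -leNgt => ->.
- rewrite lerD2r big_seq (eq_bigr (fun=> rtail y)); last by move=> i _; exact: rtailE.
  by rewrite -big_seq big_const_seq count_predT size_iota iter_addr_0 mulr_natl.
Qed.

(** Three ways to reach x = e k: a jump of at least (1 - t) x; a jump of at least x / (2 p) with the
    rest of the sum at least t x; or no jump reaching x / (2 p). The second combines independent
    events and gains a factor O(1 / (t^2 k e^2)). *)
Lemma single_jump_ub (p : R) : 0 < p -> exists2 C : R, 0 < C &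
  forall k (e t : R), (0 < k)%N -> 0 < e -> 0 < t ->
  pr [set w | e * k%:R <= S k w] <=
  k%:R * rtail ((1 - t) * (e * k%:R)) + C * (k%:R * e ^+ 2) `^ (- p) +
  k%:R * rtail ((2 * p)^-1 * (e * k%:R)) * (s0 ^+ 2 / (t ^+ 2 * (k%:R * e ^+ 2))).
Proof.
move=> p0; have [C C0 H] := light_part_ub p0; exists C => // k e t k0 e0 t0.
rewrite addrAC; apply: le_trans (lerD (lexx _) (H k e k0 e0)); rewrite -lightE.
set x := e * k%:R; set y := (2 * p)^-1 * x; set L := [set w | _ && _].
have k0R : 0 < k%:R :> R by rewrite ltr0n.
have x0 : 0 < x by rewrite mulr_gt0.
have tx0 : 0 < t * x by rewrite mulr_gt0.
have mS := measurable_partial_sum mX k.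
have mD i : measurable [set w | (y <= X i w) && (t * x <= `|others i k w|)].
  apply: measurable_bool_and; first exact: measurable_ge_set.
  by apply: (@measurable_ge_set _ _ _ (fun w => `|others i k w|)); apply: measurableT_comp => //; exact: measurable_seq_sum.
have := @sum_prob_le _ _ _ P [:: [set w | x <= S k w]]
  ([seq [set w | (1 - t) * x <= X i w] | i <- iota 0 k] ++
   [seq [set w | (y <= X i w) && (t * x <= `|others i k w|)] | i <- iota 0 k] ++ [:: L]).
rewrite big_seq1 !big_cat big_seq1 !big_map/= => HH; apply: (le_trans (HH _ _ _)).
- by move=> A; rewrite inE => /eqP ->; exact: measurable_ge_set.
- move=> A; rewrite !mem_cat inE => /orP[/mapP[i _ ->]|/orP[/mapP[i _ ->]|/eqP ->]] //.
    exact: measurable_ge_set.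
  by rewrite /L lightE; exact: measurable_light_part.
- move=> w; rewrite big_seq1 !big_cat big_seq1 !big_map/=.
  rewrite /L (indic_set (fun w => x <= S k w)) (indic_set (fun w => (x <= S k w) && all (fun i => X i w < y) (iota 0 k))).
  under eq_bigr do rewrite (indic_set (fun w => (1 - t) * x <= X _ w)).
  under [X in _ + (X + _)]eq_bigr do rewrite (indic_set (fun w => (y <= X _ w) && (t * x <= `|others _ k w|))).
  have s1 : 0 <= \sum_(i <- iota 0 k) ((1 - t) * x <= X i w)%R%:R :> R by rewrite sumr_ge0.
  have s2 : 0 <= \sum_(i <- iota 0 k) ((y <= X i w) && (t * x <= `|others i k w|))%:R :> R by rewrite sumr_ge0.
  have [xS|_] /= := boolP (x <= S k w); last by rewrite addr0 addr_ge0.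
  case: (boolP (all _ _)) => [_|/allPn[i ik]]; first by rewrite addrA lerDr addr_ge0.
  rewrite -leNgt => yX; rewrite addr0.
  have ik' : (i < k)%N by move: ik; rewrite mem_iota.
  have [X1'|X1'] := leP ((1 - t) * x) (X i w).
    apply: ler_wpDr => //.
    apply: le_trans (sum_ge_term (F := fun i => ((1 - t) * x <= X i w)%R%:R) _ ik) => //.
    by rewrite X1'.
  apply: ler_wpDl => //.
  apply: le_trans (sum_ge_term (F := fun i => ((y <= X i w) && (t * x <= `|others i k w|))%:R) _ ik) => //.
  rewrite yX /= (_ : t * x <= _)//; apply: le_trans (ler_norm _).
  by move: xS; rewrite (partial_sumE w ik'); lra.
- rewrite addrA lerD2r lerD//.
    rewrite big_seq (eq_bigr (fun=> rtail ((1 - t) * x))); last by move=> i _; exact: rtailE.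
    by rewrite -big_seq big_const_seq count_predT size_iota iter_addr_0 mulr_natl.
  apply: (@le_trans _ _ (\sum_(i <- iota 0 k) rtail y * (k%:R * s0 ^+ 2 / (t * x) ^+ 2))).
    rewrite big_seq [leRHS]big_seq; apply: ler_sum => i; rewrite mem_iota add0n => /andP[_ ik].
    exact: jump_indep.
  rewrite big_const_seq count_predT size_iota iter_addr_0 -[leLHS]mulr_natl.
  rewrite le_eqVlt; apply/orP; left; apply/eqP; rewrite -!mulrA; congr (_ * (_ * _)).
  by rewrite /x; field; rewrite !gt_eqF.
Qed.

(* With [M] the number of jumps, [2 M - M^2 <= 1], so one jump not compensated by the rest is enough. *)
Lemma single_jump_lb k (e t : R) : (0 < k)%N -> 0 < e -> 0 < t ->
  k%:R * rtail ((1 + t) * (e * k%:R)) <=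
  pr [set w | e * k%:R <= S k w] +
  k%:R * rtail ((1 + t) * (e * k%:R)) * (s0 ^+ 2 / (t ^+ 2 * (k%:R * e ^+ 2))) +
  (k%:R * rtail ((1 + t) * (e * k%:R))) ^+ 2.
Proof.
move=> k0 e0 t0; set x := e * k%:R; set y := (1 + t) * x.
have k0R : 0 < k%:R :> R by rewrite ltr0n.
have x0 : 0 < x by rewrite mulr_gt0.
have tx0 : 0 < t * x by rewrite mulr_gt0.
have mS := measurable_partial_sum mX k.
have mD i : measurable [set w | (y <= X i w) && (t * x <= `|others i k w|)].
  apply: measurable_bool_and; first exact: measurable_ge_set.
  by apply: (@measurable_ge_set _ _ _ (fun w => `|others i k w|)); apply: measurableT_comp => //; exact: measurable_seq_sum.
pose E (ij : nat * nat) : set Omega := [set w | (ij.1 != ij.2) && ((y <= X ij.1 w) && (y <= X ij.2 w))].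
have mE ij : measurable (E ij).
  rewrite /E; case: (ij.1 != ij.2) => /=; first by apply: measurable_bool_and; exact: measurable_ge_set.
  by rewrite (_ : [set w | _] = set0)//; apply/seteqP; split.
have := @sum_prob_le _ _ _ P [seq [set w | y <= X i w] | i <- iota 0 k]
  ([:: [set w | x <= S k w]] ++
   [seq [set w | (y <= X i w) && (t * x <= `|others i k w|)] | i <- iota 0 k] ++
   [seq E (i, j) | i <- iota 0 k, j <- iota 0 k]).
rewrite !big_cat big_seq1 !big_map/= big_allpairs_dep/= => HH.
have -> : k%:R * rtail y = \sum_(i <- iota 0 k) fine (P [set w | y <= X i w]).
  rewrite big_seq (eq_bigr (fun=> rtail y)); last by move=> i _; exact: rtailE.
  by rewrite -big_seq big_const_seq count_predT size_iota iter_addr_0 mulr_natl.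
apply: (le_trans (HH _ _ _)).
- by move=> A /mapP[i _ ->]; exact: measurable_ge_set.
- move=> A; rewrite inE mem_cat => /orP[/eqP ->|/orP[/mapP[i _ ->]|/allpairsP[[i j] [_ _ ->]]]] //.
  exact: measurable_ge_set.
- move=> w; rewrite big_cons !big_cat !big_map/= big_allpairs_dep/=.
  rewrite (indic_set (fun w => x <= S k w)).
  under eq_bigr do rewrite (indic_set (fun w => y <= X _ w)).
  under [X in _ + (X + _)]eq_bigr do rewrite (indic_set (fun w => (y <= X _ w) && (t * x <= `|others _ k w|))).
  have s2 : 0 <= \sum_(i <- iota 0 k) ((y <= X i w) && (t * x <= `|others i k w|))%:R :> R by rewrite sumr_ge0.
  have s3 : 0 <= \sum_(i <- iota 0 k) \sum_(j <- iota 0 k) \1_(E (i, j)) w :> R by rewrite sumr_ge0// => i _; rewrite sumr_ge0.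
  set M := \sum_(i <- iota 0 k) (y <= X i w)%R%:R.
  have [xS|xS] := leP x (S k w); last first.
    rewrite add0r; apply: ler_wpDr => //; rewrite /M big_seq [leRHS]big_seq; apply: ler_sum => i.
    rewrite mem_iota add0n => /andP[_ ik].
    have [yX|//] := leP y (X i w); rewrite /= (_ : t * x <= _)//.
    rewrite -normrN; apply: le_trans (ler_norm _).
    by move: xS; rewrite (partial_sumE w ik) /y in yX *; lra.
  (* There are M^2 - M ordered pairs of distinct jumps. *)
  have -> : \sum_(i <- iota 0 k) \sum_(j <- iota 0 k) \1_(E (i, j)) w = M ^+ 2 - M :> R.
    rewrite expr2 {1}/M big_distrl/= -sumrB big_seq [RHS]big_seq; apply: eq_bigr => i ik.
    have -> : \sum_(j <- iota 0 k) \1_(E (i, j)) w = \sum_(j <- iota 0 k | j != i) (y <= X i w)%R%:R * (y <= X j w)%R%:R :> R.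
      rewrite [RHS]big_mkcond/=; apply: eq_bigr => j _.
      rewrite /E (indic_set (fun w => ((i, j).1 != (i, j).2) && ((y <= X (i, j).1 w) && (y <= X (i, j).2 w))))/=.
      by rewrite eq_sym; case: (j != i) => //=; case: (y <= X i w) => //=; rewrite ?mul1r ?mul0r.
    rewrite -big_distrr/= /M (bigD1_seq i)//= ?iota_uniq// mulrDr.
    by case: (y <= X i w); rewrite ?mulr1 ?mul1r ?mul0r ?subr0 ?addr0// addrAC subrr add0r.
  have := sqr_ge0 (M - 1); rewrite sqrrB1 /= => HM.
  by move: s2; set W := \sum_(i <- _) _ => W0; lra.
- rewrite -addrA lerD2l lerD//.
    apply: (@le_trans _ _ (\sum_(i <- iota 0 k) rtail y * (k%:R * s0 ^+ 2 / (t * x) ^+ 2))).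
      rewrite big_seq [leRHS]big_seq; apply: ler_sum => i; rewrite mem_iota add0n => /andP[_ ik].
      exact: jump_indep.
    rewrite -mulr_suml; have -> : \sum_(i <- iota 0 k) rtail y = \sum_(i <- iota 0 k) fine (P [set w | y <= X i w]).
      by apply: eq_bigr => i _; rewrite rtailE.
    rewrite le_eqVlt; apply/orP; left; apply/eqP; congr (_ * _).
    by rewrite /x; field; rewrite !gt_eqF.
  rewrite expr2 big_distrl/=; apply: ler_sum => i _; rewrite big_distrr/=; apply: ler_sum => j _.
  have [ij|ij] := eqVneq i j.
    rewrite (_ : E (i, j) = set0) ?measure0 ?mulr_ge0 ?fine_ge0//.
    by apply/seteqP; split => w //; rewrite /E/= ij eqxx.
  rewrite (_ : E (i, j) = X i @^-1` `[y, +oo[%classic `&` X j @^-1` `[y, +oo[%classic); last first.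
    by apply/seteqP; split => w /=; rewrite /E/= ?ij/= !in_itv/= !andbT; [move=> /andP[]|move=> [-> ->]].
  have mXi l : measurable (X l @^-1` `[y, +oo[%classic).
    by rewrite -[X in measurable X]setTI; exact: mX.
  have [mi _] := iX.
  rewrite (@block_indep_fun _ _ _ P _ _ _ X mX _ _ _ _ [set i] [set j] (X i) (X j))//; last 3 first.
  - by apply/seteqP; split => // l /= [li lj]; move/eqP: ij; rewrite -li -lj.
  - exact: block_measurable_var.
  - exact: block_measurable_var.
  have E1 l : X l @^-1` `[y, +oo[%classic = [set w | y <= X l w].
    by apply/seteqP; split => w /=; rewrite in_itv/= andbT.
  by rewrite fineM ?fin_num_measure// !E1.
Qed.

End large_deviations.

(** * Averaging over the cluster size *)

Lemma random_index_prob d (Omega : measurableType d) (R : realType) (P : probability Omega R)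
    (N : Omega -> nat) (A : nat -> set Omega) :
  measurable_fun setT N -> (forall k, measurable (A k)) ->
  (forall k, P (A k `&` N @^-1` [set k]) = (P (A k) * P (N @^-1` [set k]))%E) ->
  fine (P [set w | A (N w) w]) = nat_expect P N (fun k => fine (P (A k))).
Proof.
move=> mN mA indA; rewrite /nat_expect /Rintegral; congr fine.
have mNk k : measurable (N @^-1` [set k]) by rewrite -[X in measurable X]setTI; exact: mN.
have mB : measurable [set w | A (N w) w].
  rewrite (_ : [set w | _] = \bigcup_k (A k `&` N @^-1` [set k])).
    by apply: bigcupT_measurable => k; exact: measurableI.
  apply/seteqP; split => w /=; first by move=> Aw; exists (N w).
  by move=> [k _ [Akw Nw]]; move: Akw; rewrite -Nw.
rewrite -(setIT [set w | _]) -integral_indic//.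
rewrite (@ge0_integral_partition_nat _ _ _ P N)//; last exact/measurable_EFinP/measurable_indic.
rewrite (@ge0_integral_partition_nat _ _ _ P N (fun w => (fine (P (A (N w))))%:E))//; last 2 first.
- by apply/measurable_EFinP; exact: (@measurable_nat_comp _ _ _ N mN (fun k => fine (P (A k)))).
- by move=> w; rewrite lee_fin fine_ge0.
apply: eq_eseriesr => k _; rewrite integral_indic//.
transitivity (P (A k `&` N @^-1` [set k])).
  by congr (P _); apply/seteqP; split => w /= [Aw Nw]; split => //; move: Aw; rewrite Nw.
rewrite indA; transitivity (\int[P]_(w in N @^-1` [set k]) (fine (P (A k)))%:E)%E; last first.
  by apply: eq_integral => w /set_mem/= ->.
by rewrite integral_cst//= fineK ?fin_num_measure.
Qed.

(** Each exponential of the mixture is replaced by a negative power, and the remaining integral of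
    (1 + z^2)^(- (1 + a)) is known. The power of x^2 matches the variable k e^2 of the averages. *)
Lemma gauss_tail_powR (R : realType) (a : R) : 2^-1 <= a ->
  exists2 C : R, 0 < C & forall x, 0 < x -> gauss_tail x <= C * (x ^+ 2) `^ (- a).
Proof.
move=> a2; have pi0 := pi_gt0 R; pose mu := @lebesgue_measure R.
have a0 : 0 < a by apply: lt_le_trans a2; rewrite invr_gt0.
have p32 : 3 / 2 <= 1 + a by lra.
have p1 : 1 <= 1 + a by rewrite lerDl ltW.
have pp1 : 1 <= 1 + a - 2^-1 by lra.
pose D : R := (2 * pi)^-1 * (2 * (a + 1)) `^ a * 2 `^ a.
pose I : R := Num.sqrt pi * Gamma (1 + a - 2^-1) / Gamma (1 + a).
have D0 : 0 < D.
  apply: mulr_gt0; last exact: powR_gt0.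
  by apply: mulr_gt0; [rewrite invr_gt0 mulr_gt0|apply: powR_gt0; rewrite mulr_gt0// addr_gt0].
have I0 : 0 < I by rewrite !mulr_gt0 ?invr_gt0 ?sqrtr_gt0 ?Gamma_gt0.
exists (D * I) => [|x x0]; first exact: mulr_gt0.
have x20 : 0 < x ^+ 2 by rewrite exprn_gt0.
have z10 (z : R) : 0 < 1 + z ^+ 2 by rewrite ltr_pwDl// sqr_ge0.
rewrite /gauss_tail -lee_fin fineK ?fin_num_measure// gauss_tail_mixture//.
have idE (v : R) : 0 < v -> (2 * pi)^-1 * (v^-1 * ((2 * (a + 1)) `^ a * (x ^+ 2 / 2 * v) `^ (- a))) =
    D * (x ^+ 2) `^ (- a) * v `^ (- (1 + a)).
  move=> v0; have x22 : 0 <= x ^+ 2 / 2 by rewrite divr_ge0// ltW.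
  rewrite (powRM _ x22 (ltW v0)) (@powRM _ (x ^+ 2) 2^-1) ?invr_ge0 ?(ltW x20)//.
  have -> : v `^ (- (1 + a)) = v^-1 * v `^ (- a) by rewrite opprD gt0_powRD// powR_inv1// ltW.
  have -> : (2^-1 : R) `^ (- a) = 2 `^ a by rewrite -powR_inv1// -powRrM mulN1r opprK.
  by rewrite /D; ring.
have cp : 0 <= D * (x ^+ 2) `^ (- a) by rewrite mulr_ge0 ?powR_ge0// ltW.
rewrite [D * I * _]mulrAC [(_ * I)%:E]EFinM /I -(integral_inv1Dsqr_powR p32) -ge0_integralZl_EFin//; last 2 first.
- by move=> z _; rewrite lee_fin powR_ge0.
- by apply/measurable_EFinP; exact: measurable_1Dsqr_powR.
apply: ge0_le_integral => //.
- by move=> z _; rewrite lee_fin mulr_ge0 ?expR_ge0// invr_ge0 !mulr_ge0 ?(ltW pi0) ?(ltW (z10 z)).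
- apply/measurable_EFinP; apply: measurable_funM; first exact: measurable_gauss_weight.
  apply: measurableT_comp => //; apply: measurableT_comp => //; apply: measurable_funM => //.
  exact: measurable_funD.
- by apply: measurable_funeM; apply/measurable_EFinP; exact: measurable_1Dsqr_powR.
move=> z _; rewrite -EFinM lee_fin invfM -[leLHS]mulrA.
have s0 : 0 < x ^+ 2 / 2 * (1 + z ^+ 2) by rewrite !mulr_gt0 ?invr_gt0.
apply: (@le_trans _ _ ((2 * pi)^-1 * ((1 + z ^+ 2)^-1 * ((2 * (a + 1)) `^ a * (x ^+ 2 / 2 * (1 + z ^+ 2)) `^ (- a))))).
  by rewrite ler_wpM2l ?invr_ge0 ?mulr_ge0 ?(ltW pi0)// ler_wpM2l ?invr_ge0 ?(ltW (z10 z))// expRN_powR_ub// ltW.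
by rewrite idE.
Qed.

Lemma cvg0_powR (R : realType) (x : nat -> R) (b : R) : 0 < b -> (forall n, 0 <= x n) ->
  x n @[n --> \oo] --> (0 : R) -> x n `^ b @[n --> \oo] --> (0 : R).
Proof.
move=> b0 x0 x_0; apply/cvgr0Pnorm_le => e e0; have e'0 : 0 < e `^ b^-1 by exact: powR_gt0.
near=> n; have H : x n <= e `^ b^-1 by near: n; exact: (cvgr_le _ x_0).
rewrite ger0_norm ?powR_ge0//.
apply: (@le_trans _ _ ((e `^ b^-1) `^ b)); last by rewrite -powRrM mulVf ?gt_eqF// powRr1// ltW.
by rewrite ge0_ler_powR ?nnegrE ?(ltW b0) ?x0 ?(ltW e'0).
Unshelve. all: by end_near. Qed.

Section large_cluster.
Context d (Omega : measurableType d) (R : realType) (P : probability Omega R).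
Context (Z : nat -> Omega -> nat) (mZ : forall n, measurable_fun setT (Z n)).
Context (gamma sigma : R).
Hypothesis gamma0 : 0 < gamma.
Hypothesis sigma1 : 1 < sigma.
Hypothesis Zub : exists2 C : R, 0 < C & forall n (u : R), 0 < u <= 1 ->
  \int[P]_w ((1 - u) ^+ Z n w) <= C * (1 + n%:R * u) `^ (- sigma).
Hypothesis Zcvg : forall u_ : nat -> R, (forall n, 0 < u_ n <= 1) ->
  u_ n @[n --> \oo] --> (0 : R) ->
  (1 + gamma * n%:R * u_ n) `^ sigma * \int[P]_w ((1 - u_ n) ^+ Z n w)
    @[n --> \oo] --> (1 : R).
Local Notation E n := (nat_expect P (Z n)).
Implicit Types (k n : nat) (K e : R).

(** Cut at k e^2 = K between the central limit range and the large deviation range; k = 0 belongs to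
    neither. *)
Definition upto K e k : R := ((0 < k)%N && (k%:R <= K / e ^+ 2))%:R.
Definition above K e k : R := ((0 < k)%N && (K / e ^+ 2 < k%:R))%:R.

Lemma upto_above K e k : upto K e k + above K e k = (0 < k)%N%:R.
Proof. by rewrite /upto /above ltNge; case: (0 < k)%N; case: (_ <= _) => //=; rewrite ?addr0 ?add0r. Qed.

Lemma upto_itv K e k : 0 <= upto K e k <= 1.
Proof. by rewrite ler0n lern1 leq_b1. Qed.

Lemma above_itv K e k : 0 <= above K e k <= 1.
Proof. by rewrite ler0n lern1 leq_b1. Qed.

Lemma aboveP K e k : 0 < e -> above K e k = 0 \/ [/\ above K e k = 1, (0 < k)%N & K < k%:R * e ^+ 2].
Proof.
move=> e0; rewrite /above ltr_pdivrMr ?exprn_gt0//.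
by case: (0 < k)%N; [case: ltP => // Kk; [right|left]|left].
Qed.

Lemma nat_integrable01 n (f : nat -> R) : (forall k, 0 <= f k <= 1) -> nat_integrable P (Z n) f.
Proof.
move=> f01; apply: (@nat_integrable_bounded _ _ _ _ _ (mZ n) 1) => k.
by have /andP[f0 f1] := f01 k; rewrite ger0_norm.
Qed.

Lemma upto_expect_ub : exists2 C : R, 0 < C & forall n K e, (0 < n)%N -> 0 < K -> 0 < e ->
  E n (upto K e) <= C * K `^ sigma * (n%:R * e ^+ 2) `^ (- sigma).
Proof.
have [C C0 H] := small_ub mZ sigma1 Zub; exists C => // n K e n0 K0 e0.
have e20 : 0 < e ^+ 2 by rewrite exprn_gt0.
have n0R : 0 < n%:R :> R by rewrite ltr0n.
apply: le_trans (H n (K / e ^+ 2) n0 (divr_gt0 K0 e20)) _.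
rewrite -[leRHS]mulrA ler_wpM2l ?(ltW C0)// -mulrA -invfM powRM ?(ltW K0)//; last by rewrite invr_ge0 mulr_ge0// ltW.
have ne0 : 0 <= n%:R * e ^+ 2 by rewrite mulr_ge0// ltW.
have -> : (e ^+ 2 * n%:R)^-1 = (n%:R * e ^+ 2) `^ (- 1) by rewrite powR_inv1// mulrC.
by rewrite -powRrM mulN1r.
Qed.

Lemma above_powR_itv (q K e : R) k : 0 <= q -> 1 <= K -> 0 < e ->
  0 <= above K e k * (k%:R * e ^+ 2) `^ (- q) <= 1.
Proof.
move=> q0 K1 e0; have [->|[-> k0 kK]] := aboveP K k e0; first by rewrite mul0r lexx ler01.
rewrite mul1r powR_ge0/= -[leRHS](powRr0 (k%:R * e ^+ 2)) ler_powR ?oppr_le0//.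
by rewrite (le_trans K1)// ltW.
Qed.

(** One power of the exponent sigma + 2 is spent on k e^2 > K and yields 1 / K; for the others, k
    e^2 >= 1 gives k e^2 >= (1 + k e^2) / 2, and [inv1D_moment_ub] applies. *)
Lemma above_expect_ub : exists2 C : R, 0 < C & forall n K e, (0 < n)%N -> 1 <= K -> 0 < e ->
  E n (fun k => above K e k * (k%:R * e ^+ 2) `^ (- (sigma + 2))) <=
  C / K * (n%:R * e ^+ 2) `^ (- sigma).
Proof.
have [C C0 H] := inv1D_moment_ub mZ sigma1 Zub.
exists (2 `^ (sigma + 1) * C) => [|n K e n0 K1 e0]; first by rewrite mulr_gt0 ?powR_gt0.
have s10 : 0 < sigma + 1 by move: sigma1; lra.
have e20 : 0 < e ^+ 2 by rewrite exprn_gt0.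
have K0 : 0 < K by apply: lt_le_trans K1.
have := H n (e ^+ 2) n0 e20; set W := E n _ => HW.
apply: (@le_trans _ _ (2 `^ (sigma + 1) / K * W)); last first.
  rewrite -!(mulrA (2 `^ _)) ler_wpM2l ?powR_ge0// (mulrC K^-1) mulrAC.
  by rewrite ler_wpM2r ?invr_ge0 ?(ltW K0).
have c0 : 0 <= 2 `^ (sigma + 1) / K by rewrite divr_ge0 ?powR_ge0// ltW.
rewrite /W -nat_expectZ; last first.
  apply: nat_integrable01 => k; rewrite mulr_ge0 ?powR_ge0//= mulr_ile1 ?powR_ge0 ?lern1 ?leq_b1//.
  rewrite -[leRHS](powRr0 (1 + k%:R * e ^+ 2)) ler_powR ?lerDl ?(mulr_ge0 _ (ltW e20))//.
  by rewrite oppr_le0 ltW.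
have x1 k : K < k%:R * e ^+ 2 -> 1 <= k%:R * e ^+ 2 by move=> /ltW; exact: le_trans.
apply: nat_expect_le.
- by apply: nat_integrable01 => k; apply: above_powR_itv => //; move: sigma1; lra.
- apply: nat_integrableZ; apply: nat_integrable01 => k; rewrite mulr_ge0 ?powR_ge0//= mulr_ile1 ?powR_ge0 ?lern1 ?leq_b1//.
  rewrite -[leRHS](powRr0 (1 + k%:R * e ^+ 2)) ler_powR ?lerDl ?(mulr_ge0 _ (ltW e20))//.
  by rewrite oppr_le0 ltW.
move=> k; have [->|[-> k0 kK]] := aboveP K k e0.
  by rewrite mul0r; apply: mulr_ge0 => //; exact: mulr_ge0 (powR_ge0 _ _).
rewrite k0 !mul1r; move: kK (x1 _ kK); set x := k%:R * _ => Kx x1'.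
have x0 : 0 < x by apply: lt_le_trans x1'.
have -> : x `^ (- (sigma + 2)) = x^-1 * x `^ (- (sigma + 1)).
  rewrite -[in RHS]powR_inv1 ?(ltW x0)// -gt0_powRD//; congr (_ `^ _); ring.
rewrite [2 `^ _ / K]mulrC -mulrA.
apply: ler_pM; rewrite ?invr_ge0 ?powR_ge0 ?(ltW x0)//.
  by rewrite lef_pV2 ?posrE// ltW.
rewrite -[2]invrK -powR_inv1 ?invr_ge0// -powRrM mulN1r -powRM ?invr_ge0 ?addr_ge0 ?(ltW x0)//.
apply: powRN_le => //; first exact: ltW.
  by rewrite mulr_gt0 ?invr_gt0// addr_gt0.
by rewrite mulrC ler_pdivrMr//; lra.
Qed.


Context (X : nat -> Omega -> R) (s0 : R).
Hypothesis mX : forall i, measurable_fun setT (X i).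
Hypothesis iX : iid P X.
Hypothesis s00 : 0 < s0.
Hypothesis X2 : P.-integrable setT (EFin \o (fun w => X 0%N w ^+ 2)).
Hypothesis X1E : \int[P]_w X 0%N w = 0.
Hypothesis X2E : \int[P]_w (X 0%N w ^+ 2) = s0 ^+ 2.

Definition mean_tail e k : R := fine (P [set w | e * k%:R <= partial_sum X k w]).

Lemma mean_tail_itv e k : 0 <= mean_tail e k <= 1.
Proof.
rewrite /mean_tail fine_ge0//= -lee_fin fineK ?fin_num_measure ?probability_le1//;
  exact/measurable_ge_set/measurable_partial_sum.
Qed.

Lemma gauss_tail_itv (x : R) : 0 <= gauss_tail x <= 1.
Proof. by rewrite /gauss_tail fine_ge0//= -lee_fin fineK ?fin_num_measure ?probability_le1. Qed.

Let le01M (a b : R) : 0 <= a <= 1 -> 0 <= b <= 1 -> 0 <= a * b <= 1.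
Proof. by move=> /andP[a0 a1] /andP[b0 b1]; rewrite mulr_ge0//= mulr_ile1. Qed.

Let intUM K e n f : (forall k, 0 <= f k <= 1) -> nat_integrable P (Z n) (fun k => upto K e k * f k).
Proof. by move=> f01; apply: nat_integrable01 => k; apply: le01M => //; exact: upto_itv. Qed.

Let intAM K e n f : (forall k, 0 <= f k <= 1) -> nat_integrable P (Z n) (fun k => above K e k * f k).
Proof. by move=> f01; apply: nat_integrable01 => k; apply: le01M => //; exact: above_itv. Qed.

Context (eps : nat -> R).
Hypothesis eps_gt0 : forall n, 0 < eps n.
Hypothesis eps_cvg0 : eps n @[n --> \oo] --> (0 : R).
Hypothesis neps_cvgy : n%:R * eps n ^+ 2 @[n --> \oo] --> +oo.
Local Notation N n := (n%:R * eps n ^+ 2).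

Let N_gt0 n : (0 < n)%N -> 0 < N n.
Proof. by move=> n0; rewrite mulr_gt0 ?ltr0n ?exprn_gt0. Qed.

Let near_gt0 : \forall n \near \oo, (0 < n)%N.
Proof. exact: nbhs_infty_gt. Qed.

Lemma nat_expect_dist n (f g h : nat -> R) : nat_integrable P (Z n) f -> nat_integrable P (Z n) g ->
  nat_integrable P (Z n) h -> (forall k, `|f k - g k| <= h k) -> `|E n f - E n g| <= E n h.
Proof.
move=> If Ig Ih fgh; rewrite -nat_expectB// ler_norml; apply/andP; split.
  rewrite -mulN1r -nat_expectZ//; apply: nat_expect_le; [exact: nat_integrableZ|exact: nat_integrableB|].
  by move=> k; have := fgh k; rewrite ler_norml mulN1r => /andP[].
apply: nat_expect_le => //; first exact: nat_integrableB.
by move=> k; have := fgh k; rewrite ler_norml => /andP[].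
Qed.

Lemma near_eps_le (c : R) : 0 < c -> \forall n \near \oo, eps n <= c.
Proof. by move=> c0; apply: (cvgr_le _ eps_cvg0). Qed.

Lemma near_eps_powR_le (b c : R) : 0 < b -> 0 < c -> \forall n \near \oo, eps n `^ b <= c.
Proof. by move=> b0 c0; apply: (cvgr_le _ (cvg0_powR b0 (fun n => ltW (eps_gt0 n)) eps_cvg0)). Qed.

Lemma gauss_above_ub : exists2 C : R, 0 < C & forall n K, (0 < n)%N -> 1 <= K ->
  E n (fun k => above K (eps n) k * gauss_tail (eps n * Num.sqrt k%:R / s0)) <= C / K * N n `^ (- sigma).
Proof.
have [C1 C10 H1] := above_expect_ub.
have p2 : 2^-1 <= sigma + 2 by move: sigma1; lra.
have p0 : 0 <= sigma + 2 by move: sigma1; lra.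
have [C2 C20 H2] := gauss_tail_powR p2.
pose c := (s0 ^- 2) `^ (- (sigma + 2)); have c0 : 0 < c by rewrite powR_gt0// invr_gt0 exprn_gt0.
exists (C2 * c * C1) => [|n K n0 K1]; first by rewrite !mulr_gt0.
have e20 : 0 < eps n ^+ 2 by rewrite exprn_gt0.
have c20 : 0 <= C2 * c by rewrite mulr_ge0// ltW.
have iA : nat_integrable P (Z n) (fun k => above K (eps n) k * (k%:R * eps n ^+ 2) `^ (- (sigma + 2))).
  by apply: nat_integrable01 => k; exact: above_powR_itv.
apply: (@le_trans _ _ (C2 * c * E n (fun k => above K (eps n) k * (k%:R * eps n ^+ 2) `^ (- (sigma + 2))))); last first.
  by rewrite -!(mulrA (C2 * c)) ler_wpM2l// H1.
rewrite -nat_expectZ//; apply: nat_expect_le.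
- by apply: intAM => k; exact: gauss_tail_itv.
- exact: nat_integrableZ.
move=> k; have [->|[-> k0 kK]] := aboveP K k (eps_gt0 n); first by rewrite !mul0r mulr0.
have k0R : 0 < k%:R :> R by rewrite ltr0n.
have x0 : 0 < eps n * Num.sqrt k%:R / s0 by rewrite !mulr_gt0 ?invr_gt0 ?sqrtr_gt0.
rewrite !mul1r; apply: (le_trans (H2 _ x0)).
have -> : (eps n * Num.sqrt k%:R / s0) ^+ 2 = k%:R * eps n ^+ 2 * s0 ^- 2.
  by rewrite !exprMn sqr_sqrtr// exprVn; ring.
have h1 : 0 <= k%:R * eps n ^+ 2 by rewrite mulr_ge0// ltW.
have h2 : 0 <= s0 ^- 2 by rewrite invr_ge0 sqr_ge0.
by rewrite (powRM _ h1 h2) -/c -mulrA (mulrC c).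
Qed.

(** Beyond some k0 the central limit theorem has absolute error eta, chosen so that eta P(0 < Z_n <=
    K / eps^2) takes half of the allowance. The smaller sizes weigh O(n^(- sigma)), that is eps^(2
    sigma) times (n eps^2)^(- sigma). *)
Lemma clt_upto_ub (K dl : R) : 0 < K -> 0 < dl -> \forall n \near \oo,
  `|E n (fun k => upto K (eps n) k * mean_tail (eps n) k) -
    E n (fun k => upto K (eps n) k * gauss_tail (eps n * Num.sqrt k%:R / s0))| <= dl * N n `^ (- sigma).
Proof.
move=> K0 dl0; have [C1 C10 H1] := upto_expect_ub.
have [C2 C20 H2] := small_ub mZ sigma1 Zub.
have Ks0 : 0 < C1 * K `^ sigma by rewrite mulr_gt0// powR_gt0.
pose eta := dl / (2 * (C1 * K `^ sigma)); have eta0 : 0 < eta by rewrite divr_gt0// mulr_gt0.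
have [k0 _ Hk0] := central_limit_uniform mX iX s00 X2 X1E X2E eta0.
have m0 : 0 < k0.+1%:R :> R by [].
have D0 : 0 < C2 * k0.+1%:R `^ sigma by rewrite mulr_gt0// powR_gt0.
have dD : 0 < dl / (2 * (C2 * k0.+1%:R `^ sigma)) by rewrite divr_gt0// mulr_gt0.
have s20 : 0 < 2 * sigma by move: sigma1; lra.
near=> n; have n0 : (0 < n)%N by near: n.
have n0R : 0 < n%:R :> R by rewrite ltr0n.
have e20 : 0 < eps n ^+ 2 by rewrite exprn_gt0.
pose h k : R := eta * upto K (eps n) k + ((0 < k)%N && (k%:R <= k0.+1%:R :> R))%:R.
have Iu : nat_integrable P (Z n) (upto K (eps n)) by apply: nat_integrable01 => k; exact: upto_itv.
have Ib : nat_integrable P (Z n) (fun k => ((0 < k)%N && (k%:R <= k0.+1%:R :> R))%:R).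
  by apply: nat_integrable01 => k; rewrite ler0n lern1 leq_b1.
have Ih : nat_integrable P (Z n) h by apply: nat_integrableD => //; exact: nat_integrableZ.
apply: (@le_trans _ _ (E n h)).
  apply: nat_expect_dist => //.
  - by apply: intUM => k; exact: mean_tail_itv.
  - by apply: intUM => k; exact: gauss_tail_itv.
  move=> k; rewrite -mulrBr normrM ger0_norm; last by have /andP[] := upto_itv K (eps n) k.
  have /andP[u0 u1] := upto_itv K (eps n) k.
  have [kk0|kk0] := leqP k k0.
    apply: (@le_trans _ _ (upto K (eps n) k * 1)).
      rewrite ler_wpM2l// ler_norml.
      have /andP[] := mean_tail_itv (eps n) k; have /andP[] := gauss_tail_itv (eps n * Num.sqrt k%:R / s0).
      by move=> ? ? ? ?; apply/andP; split; lra.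
    rewrite mulr1 /h; apply: ler_wpDl; first by rewrite mulr_ge0// ltW.
    rewrite /upto; case: (0 < k)%N => //=.
    by rewrite (ler_nat R k) (leq_trans kk0 (leqnSn k0)) ler_nat leq_b1.
  apply: ler_wpDr => //; rewrite mulrC ler_wpM2r//.
  have := Hk0 k (ltnW kk0) (eps n * Num.sqrt k%:R).
  have -> : eps n * Num.sqrt k%:R * Num.sqrt k%:R = eps n * k%:R by rewrite -mulrA -expr2 sqr_sqrtr.
  exact.
have NE : (k0.+1%:R / n%:R) `^ sigma = k0.+1%:R `^ sigma * eps n `^ (2 * sigma) * N n `^ (- sigma).
  have -> : k0.+1%:R / n%:R = k0.+1%:R * (eps n ^+ 2 * (N n)^-1) :> R by field; rewrite !gt_eqF.
  have NV : 0 <= (N n)^-1 by rewrite invr_ge0 mulr_ge0// ltW.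
  rewrite powRM ?(mulr_ge0 (ltW e20) NV)// powRM ?(ltW e20)// mulrA.
  have -> : (N n)^-1 = N n `^ (- 1) by rewrite powR_inv1// mulr_ge0// ltW.
  have -> : (eps n ^+ 2) `^ sigma = eps n `^ (2 * sigma) by rewrite -powR_mulrn ?(ltW (eps_gt0 n))// -powRrM.
  by rewrite -powRrM mulN1r.
rewrite /h nat_expectD ?nat_expectZ//; last exact: nat_integrableZ.
have e2s : eps n `^ (2 * sigma) <= dl / (2 * (C2 * k0.+1%:R `^ sigma)) by near: n; exact: near_eps_powR_le.
have Ns0 := powR_ge0 (N n) (- sigma).
have A1 : eta * E n (upto K (eps n)) <= dl / 2 * N n `^ (- sigma).
  apply: (@le_trans _ _ (eta * (C1 * K `^ sigma * N n `^ (- sigma)))).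
    by rewrite ler_wpM2l ?(ltW eta0)// H1.
  rewrite le_eqVlt; apply/orP; left; apply/eqP; rewrite mulrA; congr (_ * _).
  by rewrite /eta; field; rewrite !gt_eqF ?powR_gt0.
have A2 : E n (fun k => ((0 < k)%N && (k%:R <= k0.+1%:R :> R))%:R) <= dl / 2 * N n `^ (- sigma).
  apply: (le_trans (H2 _ _ n0 m0)); rewrite NE mulrA ler_wpM2r//.
  rewrite mulrA -ler_pdivlMl// (le_trans e2s)// le_eqVlt; apply/orP; left; apply/eqP.
  by field; rewrite !gt_eqF ?powR_gt0.
by rewrite (splitr dl) mulrDl lerD.
Unshelve. all: by end_near. Qed.

(** The Gaussian functional over all k > 0 has the limit [Upsilon], and its part above the cut is at
    most C / K after normalization. Hence [K0] depends on [dl] only, and n is taken large after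
    K. *)
Lemma gauss_part_cvg (dl : R) : 0 < dl -> exists2 K0 : R, 1 <= K0 & forall K, K0 <= K ->
  \forall n \near \oo, `|E n (fun k => upto K (eps n) k * mean_tail (eps n) k) -
    N n `^ (- sigma) * Upsilon gamma sigma s0| <= dl * N n `^ (- sigma).
Proof.
move=> dl0; have [C C0 H] := gauss_above_ub; pose d3 := dl / 3.
have d30 : 0 < d3 by rewrite divr_gt0.
have Hc := gauss_functional_cvg mZ gamma0 sigma1 Zub Zcvg s00 eps_gt0 eps_cvg0 neps_cvgy.
exists (Num.max 1 (C / d3)) => [|K]; first by rewrite le_max lexx.
rewrite ge_max => /andP[K1 KC]; have K0 : 0 < K by apply: lt_le_trans K1.
near=> n; have n0 : (0 < n)%N by near: n.
have Ns0 : 0 < N n `^ (- sigma) by rewrite powR_gt0 ?N_gt0.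
have : `|E n (fun k => upto K (eps n) k * mean_tail (eps n) k) -
    E n (fun k => upto K (eps n) k * gauss_tail (eps n * Num.sqrt k%:R / s0))| <= d3 * N n `^ (- sigma).
  by near: n; exact: clt_upto_ub.
have HU : `|Upsilon gamma sigma s0 - N n `^ sigma *
    E n (fun k => (0 < k)%N%:R * gauss_tail (eps n * Num.sqrt k%:R / s0))| <= d3.
  by near: n; exact: cvgr_dist_le.
set a := E n _; set b := E n _ => ab.
pose c := E n (fun k => above K (eps n) k * gauss_tail (eps n * Num.sqrt k%:R / s0)).
have c0 : 0 <= c by apply: nat_expect_ge0 => k; rewrite mulr_ge0//; have /andP[] := gauss_tail_itv (eps n * Num.sqrt k%:R / s0).
have cub : c <= d3 * N n `^ (- sigma).
  apply: (le_trans (H n K n0 K1)); rewrite ler_wpM2r ?(ltW Ns0)//.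
  by rewrite ler_pdivrMr// mulrC -ler_pdivrMr.
have bc : b + c = E n (fun k => (0 < k)%N%:R * gauss_tail (eps n * Num.sqrt k%:R / s0)).
  rewrite -nat_expectD; last 2 first.
  - by apply: intUM => k; exact: gauss_tail_itv.
  - by apply: intAM => k; exact: gauss_tail_itv.
  by congr nat_expect; apply/funext => k; rewrite -mulrDl upto_above.
have bcU : `|b + c - N n `^ (- sigma) * Upsilon gamma sigma s0| <= d3 * N n `^ (- sigma).
  rewrite bc; move: HU; set w := E n _ => HU.
  have -> : w = N n `^ (- sigma) * (N n `^ sigma * w).
    by rewrite mulrA powRN mulVf ?mul1r// gt_eqF// powR_gt0 ?N_gt0.
  rewrite -mulrBr normrM gtr0_norm// mulrC ler_wpM2r ?(ltW Ns0)//.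
  by rewrite distrC.
move: ab bcU; rewrite !ler_norml => /andP[h1 h2] /andP[h3 h4].
have -> : dl = d3 + d3 + d3 by rewrite /d3; field.
move: h1 h2 h3 h4 c0 cub; rewrite !mulrDl.
move: (d3 * _) (_ * Upsilon _ _ _) => u v.
by move=> *; apply/andP; split; lra.
Unshelve. all: by end_near. Qed.


(** The probability of the theorem averaged over the cluster size; the factor 0 < k encodes the
    value 0 of L_n on {Z_n = 0}. *)
Definition sample_tail n : R := E n (fun k => (0 < k)%N%:R * mean_tail (eps n) k).

Lemma sample_tail_split n K : sample_tail n =
  E n (fun k => upto K (eps n) k * mean_tail (eps n) k) +
  E n (fun k => above K (eps n) k * mean_tail (eps n) k).
Proof.
rewrite -nat_expectD; last 2 first.
- by apply: intUM => k; exact: mean_tail_itv.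
- by apply: intAM => k; exact: mean_tail_itv.
by congr nat_expect; apply/funext => k; rewrite -mulrDl upto_above.
Qed.

(** * Jumps under a moment of order 1 + sigma *)

Section finite_moment.
Hypothesis XM : (\int[P]_w ((X 0%N)^\+ w `^ (1 + sigma))%:E < +oo)%E.
Local Notation rt := (rtail P X).

(* The expectation over [Z n] is taken first: applying Markov's inequality to [rtail] instead would
   lose a logarithm. *)
Lemma jump_expect_ub (c : R) : 0 < c -> exists2 C : R, 0 < C & forall n e, (0 < n)%N -> 0 < e ->
  nat_integrable P (Z n) (fun k => k%:R * rt (c * (e * k%:R))) /\
  E n (fun k => k%:R * rt (c * (e * k%:R))) <= C * (n%:R `^ (- sigma) * e `^ (- (1 + sigma))).
Proof.
move=> c0; have [C C0 H] := small_ub mZ sigma1 Zub.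
pose q := 1 + sigma; have q0 : 0 < q by rewrite /q; move: sigma1; lra.
pose M := fine (\int[P]_w ((X 0%N)^\+ w `^ q)%:E).
have mX' : measurable_fun setT (fun w => (X 0%N)^\+ w `^ q).
  by apply: (measurableT_comp (measurable_powR _)); exact: measurable_funrpos.
have MI0 : (0 <= \int[P]_w ((X 0%N)^\+ w `^ q)%:E)%E by apply: integral_ge0 => w _; rewrite lee_fin powR_ge0.
have ME : (\int[P]_w ((X 0%N)^\+ w `^ q)%:E = M%:E)%E by rewrite fineK// ge0_fin_numE.
have M0 : 0 <= M by rewrite fine_ge0.
(* M is only known to be nonnegative; M + 1 keeps the constant positive. *)
exists (C * c `^ (- q) * (M + 1)) => [|n e n0 e0]; first by rewrite !mulr_gt0 ?powR_gt0 ?ltr_wpDl.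
have n0R : 0 < n%:R :> R by rewrite ltr0n.
have ce0 : 0 < c * e by rewrite mulr_gt0.
pose B := C * (c * e) `^ (- q) * n%:R `^ (- sigma).
have B0 : 0 <= B by rewrite !mulr_ge0 ?powR_ge0// ltW.
pose phi (k : nat) (w : Omega) : R := k%:R * \1_[set w' | c * (e * k%:R) <= X 0%N w'] w.
have mphi k : measurable_fun setT (phi k).
  by apply: measurable_funM => //; apply/measurable_indic/measurable_ge_set.
have phi0 k w : 0 <= phi k w by rewrite mulr_ge0.
have key : (\int[P]_w ((Z n w)%:R * rt (c * (e * (Z n w)%:R)))%:E <= (B * M)%:E)%E.
  have -> : (\int[P]_w ((Z n w)%:R * rt (c * (e * (Z n w)%:R)))%:E =
      \int[P]_w \int[P]_w' (phi (Z n w) w')%:E)%E.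
    apply: eq_integral => w _; rewrite /phi.
    under eq_integral do rewrite EFinM.
    rewrite ge0_integralZl_EFin//; last by apply/measurable_EFinP/measurable_indic/measurable_ge_set.
    rewrite integral_indic//; last exact: measurable_ge_set.
    by rewrite setIT EFinM /rtail fineK// fin_num_measure//; exact: measurable_ge_set.
  rewrite (@fubini_tonelli_set _ _ _ _ R P P setT setT (fun ww : Omega * Omega => (phi (Z n ww.1) ww.2)%:E))//; last 2 first.
  - apply/measurable_EFinP; have := @measurable_nat_fun2 _ _ _ _ _ _ phi (mZ n) mphi.
    by move=> H'; exact: (measurableT_comp H' (@measurable_swap _ _ _ _)).
  - by move=> z; rewrite lee_fin.
  rewrite EFinM -ME -ge0_integralZl_EFin//; last 2 first.
  - by move=> w _; rewrite lee_fin powR_ge0.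
  - exact/measurable_EFinP.
  apply: ge0_le_integral => //.
  - by move=> w _; apply: integral_ge0 => w' _; rewrite lee_fin.
  - apply: (@measurable_fun_fubini_tonelli_G _ _ _ _ R P (fun ww : Omega * Omega => (phi (Z n ww.1) ww.2)%:E)) => //.
      apply/measurable_EFinP; have := @measurable_nat_fun2 _ _ _ _ _ _ phi (mZ n) mphi.
      by move=> H'; exact: (measurableT_comp H' (@measurable_swap _ _ _ _)).
    by move=> z; rewrite lee_fin.
  - by apply: measurable_funeM; exact/measurable_EFinP.
  move=> w _; have [x0|x0] := leP (X 0%N w) 0.
    rewrite integral0_eq ?mule_ge0 ?lee_fin ?powR_ge0// => w' _; congr EFin.
    rewrite /phi indicE; case: (Z n w') => [|k]; first by rewrite mul0r.
    rewrite memNset ?mulr0//= => H1; have : 0 < c * (e * k.+1%:R) by rewrite !mulr_gt0.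
    by move: H1 x0; lra.
  (* With m = X / (c e), the weight k on the event c e k <= X is at most m on k <= m; [small_ub]
     then produces m^(1 + sigma) n^(- sigma), whose expectation is the moment at hand. *)
  pose m := X 0%N w / (c * e); have m0 : 0 < m by rewrite divr_gt0.
  have phiE k : phi k w <= m * ((0 < k)%N && (k%:R <= m))%:R.
    rewrite /phi indicE; case: k => [|k]; first by rewrite mul0r mulr0.
    have -> : (w \in [set w' | c * (e * k.+1%:R) <= X 0%N w']) = (k.+1%:R <= m).
      have E1 : k.+1%:R * (c * e) = c * (e * k.+1%:R) by ring.
      by rewrite /m ler_pdivlMr// E1; apply/idP/idP => [/set_mem//|?]; exact: mem_set.
    by have [km|km] := leP (k.+1%:R : R) m; rewrite /= ?mulr0 ?mulr1.
  have Im : nat_integrable P (Z n) (fun k => m * ((0 < k)%N && (k%:R <= m))%:R).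
    by apply: nat_integrableZ; apply: nat_integrable01 => k; rewrite ler0n lern1 leq_b1.
  apply: (@le_trans _ _ (\int[P]_w' (m * ((0 < Z n w')%N && ((Z n w')%:R <= m))%:R)%:E)%E).
    apply: ge0_le_integral => //.
    - by move=> w' _; rewrite lee_fin.
    - by apply/measurable_EFinP; exact: (@measurable_nat_comp _ _ _ (Z n) (mZ n) (fun k => phi k w)).
    - by apply/measurable_EFinP; exact: (@measurable_nat_comp _ _ _ (Z n) (mZ n) (fun k => m * ((0 < k)%N && (k%:R <= m))%:R)).
    by move=> w' _; rewrite lee_fin.
  rewrite (nat_expectE Im) -EFinM lee_fin nat_expectZ; last first.
    by apply: nat_integrable01 => k; rewrite ler0n lern1 leq_b1.
  apply: (@le_trans _ _ (m * (C * (m / n%:R) `^ sigma))).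
    by rewrite ler_wpM2l ?(ltW m0)// H.
  have -> : (X 0%N)^\+ w = X 0%N w by rewrite /funrpos max_l// ltW.
  rewrite le_eqVlt; apply/orP; left; apply/eqP.
  have nV0 : 0 <= n%:R^-1 :> R by rewrite invr_ge0.
  have ceV0 : 0 <= (c * e)^-1 by rewrite invr_ge0 ltW.
  have -> : m * (C * (m / n%:R) `^ sigma) = C * (m `^ q * n%:R `^ (- sigma)).
    rewrite (powRM _ (ltW m0) nV0) /q gt0_powRD// powRr1 ?(ltW m0)//.
    by rewrite -[n%:R^-1]powR_inv1// -powRrM mulN1r; ring.
  rewrite /m (powRM _ (ltW x0) ceV0) -[(c * e)^-1]powR_inv1 ?(ltW ce0)// -powRrM mulN1r /B; ring.
have mg : measurable_fun setT (fun w => (Z n w)%:R * rt (c * (e * (Z n w)%:R)) : R).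
  exact: (@measurable_nat_comp _ _ _ (Z n) (mZ n) (fun k => k%:R * rt (c * (e * k%:R)))).
have g0 w : 0 <= (Z n w)%:R * rt (c * (e * (Z n w)%:R)) :> R.
  by rewrite mulr_ge0//; have /andP[] := rtail_itv P mX (c * (e * (Z n w)%:R)).
have Ig : nat_integrable P (Z n) (fun k => k%:R * rt (c * (e * k%:R))).
  by apply: ge0_integrable => //; apply: le_lt_trans key _; rewrite ltry.
split=> //; move: key; rewrite (nat_expectE Ig) lee_fin => key; apply: (le_trans key).
have -> : B = C * c `^ (- q) * (n%:R `^ (- sigma) * e `^ (- q)).
  by rewrite /B (powRM _ (ltW c0) (ltW e0)); ring.
rewrite -!(mulrA (C * _)) ler_wpM2l ?mulr_ge0 ?powR_ge0 ?(ltW C0)//.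
by rewrite mulrC ler_wpM2r ?mulr_ge0 ?powR_ge0// lerDl.
Qed.

(** Above the cut the jumps contribute at most a multiple of n^(- sigma) eps^(- (1 + sigma)) =
    eps^(sigma - 1) (n eps^2)^(- sigma), negligible since sigma > 1, and the light part is O(1 / K)
    after normalization. *)
Lemma sample_tail_light (dl : R) : 0 < dl -> \forall n \near \oo,
  `|sample_tail n - N n `^ (- sigma) * Upsilon gamma sigma s0| <= dl * N n `^ (- sigma).
Proof.
move=> dl0; pose d3 := dl / 3; have d30 : 0 < d3 by rewrite divr_gt0.
have p0 : 0 < sigma + 2 by move: sigma1; lra.
have s10 : 0 < sigma - 1 by move: sigma1; lra.
have [C1 C10 H1] := light_jump_ub mX iX s00 X2 X1E X2E p0.
have [C2 C20 H2] := above_expect_ub.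
pose c := (2 * (sigma + 2))^-1; have c0 : 0 < c by rewrite invr_gt0 mulr_gt0.
have [C3 C30 H3] := jump_expect_ub c0.
have [K1 K11 HG] := gauss_part_cvg d30.
pose K := Num.max K1 (C1 * C2 / d3).
have KK1 : K1 <= K by rewrite le_max lexx.
have Kge1 : 1 <= K by apply: le_trans KK1.
have K0 : 0 < K by apply: lt_le_trans Kge1.
have dC : 0 < d3 / C3 by rewrite divr_gt0.
near=> n; have n0 : (0 < n)%N by near: n.
have n0R : 0 < n%:R :> R by rewrite ltr0n.
have Ns0 : 0 < N n `^ (- sigma) by rewrite powR_gt0 ?N_gt0.
have e2 : eps n `^ (sigma - 1) <= d3 / C3 by near: n; exact: near_eps_powR_le.
have HU : `|E n (fun k => upto K (eps n) k * mean_tail (eps n) k) -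
    N n `^ (- sigma) * Upsilon gamma sigma s0| <= d3 * N n `^ (- sigma) by near: n; exact: HG.
have [I3 H3'] := H3 n (eps n) n0 (eps_gt0 n).
have I2 : nat_integrable P (Z n) (fun k => above K (eps n) k * (k%:R * eps n ^+ 2) `^ (- (sigma + 2))).
  by apply: nat_integrable01 => k; apply: above_powR_itv => //; exact: ltW.
have IA : nat_integrable P (Z n) (fun k => above K (eps n) k * mean_tail (eps n) k).
  by apply: intAM => k; exact: mean_tail_itv.
have HA : E n (fun k => above K (eps n) k * mean_tail (eps n) k) <= d3 * N n `^ (- sigma) + d3 * N n `^ (- sigma).
  apply: (@le_trans _ _ (E n (fun k => k%:R * rt (c * (eps n * k%:R)) +
      C1 * (above K (eps n) k * (k%:R * eps n ^+ 2) `^ (- (sigma + 2)))))).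
    apply: nat_expect_le => //; first by apply: nat_integrableD => //; exact: nat_integrableZ.
    move=> k; have /andP[rt0 _] := rtail_itv P mX (c * (eps n * k%:R)).
    have [->|[-> k0 kK]] := aboveP K k (eps_gt0 n).
      by rewrite !mul0r mulr0 addr0 mulr_ge0.
    by rewrite !mul1r; exact: H1.
  rewrite nat_expectD ?nat_expectZ//; last exact: nat_integrableZ.
  apply: lerD.
    apply: (le_trans H3').
    have -> : n%:R `^ (- sigma) * eps n `^ (- (1 + sigma)) = eps n `^ (sigma - 1) * N n `^ (- sigma).
      rewrite powRM ?sqr_ge0// -[eps n ^+ 2]powR_mulrn ?(ltW (eps_gt0 n))// -powRrM mulrCA -gt0_powRD//.
      by congr (_ * _ `^ _); ring.
    by rewrite mulrA ler_wpM2r ?(ltW Ns0)// mulrC -ler_pdivlMr.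
  apply: (@le_trans _ _ (C1 * (C2 / K * N n `^ (- sigma)))).
    by rewrite ler_wpM2l ?(ltW C10)// H2.
  rewrite mulrA ler_wpM2r ?(ltW Ns0)// mulrA ler_pdivrMr// (mulrC d3) -ler_pdivrMr//.
  by rewrite le_max lexx orbT.
have HA0 : 0 <= E n (fun k => above K (eps n) k * mean_tail (eps n) k).
  by apply: nat_expect_ge0 => k; rewrite mulr_ge0//; have /andP[] := mean_tail_itv (eps n) k.
rewrite (sample_tail_split n K); move: HU HA HA0.
have -> : dl = d3 + d3 + d3 by rewrite /d3; field.
rewrite !ler_norml !mulrDl; move: (d3 * _) (E n _) (E n _) (_ * Upsilon _ _ _) => u a b v.
by move=> /andP[h1 h2] h3 h4; apply/andP; split; lra.
Unshelve. all: by end_near. Qed.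

End finite_moment.


(** * Jumps under a power tail *)

Section regular_tail.
Context (alpha a : R).
Hypothesis alpha_itv : 2 < alpha < 1 + sigma.
Hypothesis a0 : 0 < a.
Local Notation rt := (rtail P X).
Hypothesis tailE : rt u / (a * u `^ (- alpha)) @[u --> +oo] --> (1 : R).

Let alpha2 : 2 < alpha. Proof. by case/andP: alpha_itv. Qed.
Let alpha0 : 0 < alpha. Proof. by move: alpha2; lra. Qed.

(** Leading term of the expected number of summands above e k, namely k a (e k)^(- alpha); the
    powers of e and k are kept apart so that averaging over k leaves a harmonic moment. *)
Definition jump e k : R := a * (e `^ (- alpha) * k%:R `^ (- (alpha - 1))).

Lemma jump_gt0 e k : 0 < e -> (0 < k)%N -> 0 < jump e k.
Proof. by move=> e0 k0; rewrite !mulr_gt0 ?powR_gt0 ?ltr0n. Qed.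

Lemma jumpE e k : 0 < e -> (0 < k)%N -> jump e k = k%:R * (a * (e * k%:R) `^ (- alpha)).
Proof.
move=> e0 k0; have k0R : 0 < k%:R :> R by rewrite ltr0n.
rewrite /jump (powRM _ (ltW e0) (ltW k0R)) (_ : - (alpha - 1) = 1 - alpha); last by ring.
by rewrite gt0_powRD// powRr1 ?(ltW k0R)//; ring.
Qed.

(** As alpha > 2, the expected number of jumps is small with e once k e^2 >= 1; this controls the
    event of two jumps. *)
Lemma jump_small e k : 0 < e -> 1 <= k%:R * e ^+ 2 -> jump e k <= a * e `^ (alpha - 2).
Proof.
move=> e0 ke; have e20 : 0 < e ^+ 2 by rewrite exprn_gt0.
have k0R : 0 < k%:R :> R by rewrite -(pmulr_lgt0 _ e20) (lt_le_trans ltr01).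
have -> : jump e k = a * ((k%:R * e ^+ 2) `^ (- (alpha - 1)) * e `^ (alpha - 2)).
  rewrite /jump (powRM _ (ltW k0R) (ltW e20)) -[e ^+ 2]powR_mulrn ?(ltW e0)// -powRrM -mulrA -gt0_powRD//.
  by rewrite (mulrC (k%:R `^ _)); congr (_ * (_ `^ _ * _)); ring.
rewrite ler_wpM2l ?(ltW a0)// -[leRHS]mul1r ler_wpM2r ?powR_ge0//.
by rewrite -[leRHS](powRr0 (k%:R * e ^+ 2)) ler_powR// oppr_le0; move: alpha2; lra.
Qed.

Lemma rtail_asymp (t : R) : 0 < t -> exists2 U : R, 0 < U & forall u, U <= u ->
  `|rt u - a * u `^ (- alpha)| <= t * (a * u `^ (- alpha)).
Proof.
move=> t0; have [V [_ HV]] : \forall u \near +oo, `|1 - rt u / (a * u `^ (- alpha))| <= t.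
  exact: cvgr_dist_le.
exists (Num.max 1 (V + 1)) => [|u]; first by rewrite lt_max ltr01.
rewrite ge_max => /andP[u1 uV]; have u0 : 0 < u by apply: lt_le_trans u1.
have A0 : 0 < a * u `^ (- alpha) by rewrite mulr_gt0 ?powR_gt0.
have := HV u; rewrite (lt_le_trans _ uV) ?ltrDl// => /(_ isT) H.
have -> : rt u - a * u `^ (- alpha) = (rt u / (a * u `^ (- alpha)) - 1) * (a * u `^ (- alpha)).
  by rewrite mulrBl divfK ?gt_eqF// mul1r.
by rewrite normrM (gtr0_norm A0) ler_wpM2r ?(ltW A0)// distrC.
Qed.

(** The order of the constants matters: [C] comes from the light part and is independent of the
    precision [th], while [K1] and [e1] depend on it. *)
Lemma mean_tail_jump : exists2 C : R, 0 < C & forall th : R, 0 < th ->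
  exists K1 e1 : R, [/\ 1 <= K1, 0 < e1 & forall e k, 0 < e -> e <= e1 -> (0 < k)%N -> K1 <= k%:R * e ^+ 2 ->
  `|mean_tail e k - jump e k| <= th * jump e k + C * (k%:R * e ^+ 2) `^ (- (sigma + 2))].
Proof.
have arith_ub (A m1 m2 D g eta th : R) : 0 <= A -> 0 < eta <= 1 -> 8 * eta <= th ->
    m1 <= (1 + eta) * ((1 + eta) * A) -> m2 <= eta * A -> g <= m1 + D + m2 -> g - A <= th * A + D.
  move=> A0 /andP[e0 e1] eth H1 H2 H3.
  have h1 : eta * (eta * A) <= eta * A by rewrite ler_piMl// mulr_ge0// ltW.
  have h2 : 8 * (eta * A) <= th * A by rewrite mulrA ler_wpM2r.
  have h3 : 0 <= eta * A by rewrite mulr_ge0// ltW.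
  have E : (1 + eta) * ((1 + eta) * A) = A + 2 * (eta * A) + eta * (eta * A) by ring.
  move: (eta * (eta * A)) (eta * A) (th * A) E h1 h2 h3 H1 H2 => x y z E; rewrite E; lra.
have arith_lb (A m1 m2 m3 D g eta th : R) : 0 <= A -> 0 <= D -> 0 < eta <= 1 -> 8 * eta <= th ->
    (1 - eta) * ((1 - eta) * A) <= m1 -> m2 <= eta * A -> m3 <= eta * A -> m1 <= g + m2 + m3 ->
    - (th * A + D) <= g - A.
  move=> A0 D0 /andP[e0 e1] eth H1 H2 H3 H4.
  have h1 : 0 <= eta * (eta * A) by rewrite !mulr_ge0// ltW.
  have h2 : 8 * (eta * A) <= th * A by rewrite mulrA ler_wpM2r.
  have h3 : 0 <= eta * A by rewrite mulr_ge0// ltW.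
  have E : (1 - eta) * ((1 - eta) * A) = A - 2 * (eta * A) + eta * (eta * A) by ring.
  move: (eta * (eta * A)) (eta * A) (th * A) E h1 h2 h3 H1 H2 H3 => x y z E; rewrite E; lra.
have p0 : 0 < sigma + 2 by move: sigma1; lra.
have [C C0 H] := single_jump_ub mX iX s00 X2 X1E X2E p0; exists C => // th th0.
pose c := (2 * (sigma + 2))^-1; have c0 : 0 < c by rewrite invr_gt0 mulr_gt0.
have c2 : c <= 2^-1 by rewrite lef_pV2 ?posrE ?mulr_gt0//; move: sigma1; lra.
(* The errors add up to at most 4 eta, as (1 + eta)^2 + eta <= 1 + 4 eta and (1 - eta)^2 - 2 eta >=
   1 - 4 eta; the factor 8 leaves room. *)
pose eta := Num.min 1 th / 8; have eta0 : 0 < eta by rewrite divr_gt0// lt_min ltr01.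
have eta1 : eta <= 1 by rewrite ler_pdivrMr// mul1r ge_min; apply/orP; left; lra.
have eta_itv : 0 < eta <= 1 by rewrite eta0.
have etath : 8 * eta <= th by rewrite /eta mulrC divfK// ge_min lexx orbT.
(* Continuity of x^(- alpha) at 1 turns the thresholds (1 - t) e k and (1 + t) e k into factors
   close to 1. *)
have [t /andP[t0 t2] [t3 t4]] : exists2 t : R, 0 < t <= 2^-1 &
    (1 - t) `^ (- alpha) <= 1 + eta /\ 1 - eta <= (1 + t) `^ (- alpha).
  have /cvgr_dist_le/(_ _ eta0) : x `^ (- alpha) @[x --> (1 : R)] --> (1 : R) `^ (- alpha).
    by apply: cvg_powR => //; exact: cvg_id.
  have -> : (1 : R) `^ (- alpha) = 1 by rewrite powR1.
  move=> [r /= r0 Hr]; pose t := Num.min 2^-1 (r / 2).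
  have t0 : 0 < t by rewrite lt_min invr_gt0 ltr0n divr_gt0.
  have tr : t < r by rewrite (@le_lt_trans _ _ (r / 2))// ?ge_min ?lexx ?orbT//; lra.
  exists t; first by rewrite t0 ge_min lexx.
  have := Hr (1 - t); have := Hr (1 + t).
  rewrite /ball_/= !opprD !addrA subrr !sub0r opprK normrN gtr0_norm// => /(_ tr) + /(_ tr).
  by rewrite !ler_norml => /andP[h1 h2] /andP[h3 h4]; split; lra.
have [U U0 HU] := rtail_asymp eta0.
(* k e^2 >= B / eta makes each Chebyshev correction at most eta * jump. [e2] makes jump at most eta
   / 16, hence the squared term, at most (4 * jump)^2, is below eta * jump. *)
pose B := 4 * (1 + c `^ (- alpha)) * s0 ^+ 2 / t ^+ 2.
have B0 : 0 <= B.
  apply: divr_ge0; last exact: sqr_ge0.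
  by apply: mulr_ge0; [rewrite mulr_ge0// addr_ge0// powR_ge0|exact: sqr_ge0].
pose e2 := (eta / (16 * a)) `^ (alpha - 2)^-1.
have e20 : 0 < e2 by rewrite powR_gt0// divr_gt0// mulr_gt0.
exists (Num.max 1 (B / eta)), (Num.min (c / U) e2); split.
- by rewrite le_max lexx.
- by rewrite lt_min e20 divr_gt0.
move=> e k e0; rewrite le_min ge_max => /andP[eU ee2] k0 /andP[x1 xB].
have k0R : 0 < k%:R :> R by rewrite ltr0n.
pose x := k%:R * e ^+ 2; have x0 : 0 < x by apply: lt_le_trans x1.
pose u := e * k%:R; have u0 : 0 < u by rewrite mulr_gt0.
have xu : x = u * e by rewrite /x /u; ring.
(* Here u = x / e with x >= 1 and e <= c / U, so even the lowest threshold c u lies where the tail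
   asymptotics hold. *)
have cU : U <= c * u.
  rewrite ler_pdivlMr// in eU; apply: (@le_trans _ _ (U * x)); first by rewrite ler_peMr ?(ltW U0).
  by rewrite xu mulrCA (mulrC c) ler_wpM2l ?(ltW u0)// mulrC.
pose A := jump e k; have A0 : 0 < A by exact: jump_gt0.
have AE (v : R) : 0 < v -> k%:R * (a * (v * u) `^ (- alpha)) = v `^ (- alpha) * A.
  by move=> v0; rewrite /A jumpE// (powRM _ (ltW v0) (ltW u0)); ring.
have rtb (v : R) : c <= v -> (1 - eta) * (v `^ (- alpha) * A) <= k%:R * rt (v * u) /\
    k%:R * rt (v * u) <= (1 + eta) * (v `^ (- alpha) * A).
  move=> cv; have v0 : 0 < v by apply: lt_le_trans cv.
  have vU : U <= v * u by apply: (le_trans cU); rewrite ler_wpM2r// ltW.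
  rewrite -AE// !(mulrCA _ k%:R) !ler_pM2l//; have := HU _ vU.
  by rewrite ler_norml => /andP[h1 h2]; split; lra.
have [_ M1] := rtb (1 - t) ltac:(lra); have [_ M2] := rtb c (lexx c).
have [M3 M4] := rtb (1 + t) ltac:(lra).
have jA : A <= eta / 16.
  apply: (le_trans (jump_small e0 x1)); rewrite -ler_pdivlMl//.
  apply: (@le_trans _ _ (e2 `^ (alpha - 2))).
    by rewrite ge0_ler_powR ?nnegrE ?(ltW e0) ?(ltW e20)// subr_ge0 ltW.
  rewrite -powRrM mulVf ?gt_eqF ?subr_gt0// powRr1; last by apply: divr_ge0 (ltW eta0) _; rewrite mulr_ge0 ?(ltW a0).
  by rewrite le_eqVlt; apply/orP; left; apply/eqP; field; rewrite gt_eqF.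
have t20 : 0 < t ^+ 2 by rewrite exprn_gt0.
have sx (b m : R) : 0 <= m <= 4 * b * A -> 0 <= b <= 1 + c `^ (- alpha) -> m * (s0 ^+ 2 / (t ^+ 2 * x)) <= eta * A.
  move=> /andP[m0 mb] /andP[b0 bc].
  have s2 : 0 <= s0 ^+ 2 / t ^+ 2 by rewrite divr_ge0 ?sqr_ge0.
  have -> : m * (s0 ^+ 2 / (t ^+ 2 * x)) = m * (s0 ^+ 2 / t ^+ 2) / x by field; rewrite !gt_eqF.
  rewrite ler_pdivrMr//; apply: (@le_trans _ _ (B * A)).
    have -> : B * A = 4 * (1 + c `^ (- alpha)) * A * (s0 ^+ 2 / t ^+ 2) by rewrite /B; ring.
    rewrite ler_wpM2r//; apply: (le_trans mb).
    by rewrite -!mulrA ler_wpM2l// ler_wpM2r ?(ltW A0).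
  by rewrite [leRHS]mulrAC ler_wpM2r ?(ltW A0)// (mulrC eta) -ler_pdivrMr.
have k_rt0 v : 0 <= k%:R * rt v by rewrite mulr_ge0//; have /andP[] := rtail_itv P mX v.
have ca0 : 0 <= c `^ (- alpha) by exact: powR_ge0.
have M1' : k%:R * rt ((1 - t) * u) <= (1 + eta) * ((1 + eta) * A).
  apply: (le_trans M1); rewrite ler_wpM2l ?addr_ge0 ?(ltW eta0)//.
  by rewrite ler_wpM2r ?(ltW A0).
have M3' : (1 - eta) * ((1 - eta) * A) <= k%:R * rt ((1 + t) * u).
  apply: le_trans M3; rewrite ler_wpM2l ?subr_ge0//.
  by rewrite ler_wpM2r ?(ltW A0).
have t1a : (1 + t) `^ (- alpha) <= 1.
  by rewrite -[leRHS](powRr0 (1 + t)) ler_powR ?lerDl ?(ltW t0)// oppr_le0 ltW.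
have M4' : k%:R * rt ((1 + t) * u) <= 4 * 1 * A.
  apply: (le_trans M4); rewrite -mulrA; apply: ler_pM => //.
  - by rewrite addr_ge0 ?(ltW eta0).
  - by rewrite mulr_ge0 ?powR_ge0 ?(ltW A0).
  - by move: eta1; lra.
  - by rewrite ler_wpM2r ?(ltW A0).
rewrite ler_norml; apply/andP; split; last first.
  apply: (arith_ub A _ _ _ _ eta th (ltW A0) eta_itv etath M1' _ (H k e t k0 e0 t0)).
  apply: (sx (c `^ (- alpha))); rewrite ?k_rt0 ?ca0 ?lerDr//=.
  apply: (le_trans M2); rewrite -mulrA ler_wpM2r ?(mulr_ge0 ca0) ?(ltW A0)//.
  by move: eta1; lra.
apply: (arith_lb A _ _ _ _ _ eta th (ltW A0) _ eta_itv etath M3' _ _ (single_jump_lb mX iX X2 X1E X2E k0 e0 t0)).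
- by rewrite mulr_ge0 ?powR_ge0 ?(ltW C0).
- by apply: (sx 1); rewrite ?k_rt0 ?ler01 ?lerDl.
rewrite expr2; apply: (@le_trans _ _ (4 * 1 * A * (4 * 1 * A))).
  exact: ler_pM.
rewrite mulr1 mulrACA -natrM mulrA ler_wpM2r ?(ltW A0)//.
by rewrite -ler_pdivlMl// mulrC.
Qed.

(** Below the cut this is [gauss_part_cvg]. Above it the tail is [jump] up to a relative error, and
    the average of [jump] there is the full harmonic moment minus a part of relative order (K / (n
    eps^2))^b, which vanishes for fixed K. The error is relative to the sum of both orders, so they
    need not be compared. *)
Lemma sample_tail_heavy (dl : R) : 0 < dl -> \forall n \near \oo,
  `|sample_tail n - (N n `^ (- sigma) * Upsilon gamma sigma s0 +
     eps n `^ (- alpha) * n%:R `^ (- (alpha - 1)) * (a * I_const gamma (alpha - 1) sigma))| <=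
  dl * (N n `^ (- sigma) + eps n `^ (- alpha) * n%:R `^ (- (alpha - 1))).
Proof.
move=> dl0; pose d4 := dl / 4; have d40 : 0 < d4 by rewrite divr_gt0.
set r := alpha - 1; have r_itv : 1 <= r < sigma by rewrite /r; move: alpha_itv => /andP[*]; lra.
have p0 : 0 < sigma + 2 by move: sigma1; lra.
have Hh := harmonic_cvg mZ gamma0 sigma1 Zub Zcvg r_itv.
have [b [C3 [b0 C30 H3]]] := harmonic_small_ub mZ gamma0 sigma1 Zub Zcvg r_itv.
set I := I_const _ _ _ in Hh *; pose D := 1 + `|I|; have D0 : 0 < D by rewrite ltr_pwDl.
have [C1 C10 H1] := mean_tail_jump.
have [C2 C20 H2] := above_expect_ub.
(* D bounds n^r times the harmonic moment, so a relative error th on the jumps costs at most d4 in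
   units of the second order of magnitude. *)
pose th := d4 / (a * D); have th0 : 0 < th by rewrite divr_gt0// mulr_gt0.
have [K1 [e1 [K11 e10 HJ]]] := H1 th th0.
have [K2 K21 HG] := gauss_part_cvg d40.
pose K := Num.max (Num.max K1 K2) (C1 * C2 / d4).
have KK1 : K1 <= K by rewrite /K !le_max lexx.
have KK2 : K2 <= K by rewrite /K !le_max lexx orbT.
have KC : C1 * C2 / d4 <= K by rewrite /K le_max lexx orbT.
have Kge1 : 1 <= K by apply: le_trans KK1.
have K0 : 0 < K by apply: lt_le_trans Kge1.
pose y := d4 / (a * C3); have y0 : 0 < y by rewrite divr_gt0// mulr_gt0.
have yb0 : 0 < y `^ b^-1 by rewrite powR_gt0.
have da0 : 0 < d4 / a by rewrite divr_gt0.
near=> n; have n0 : (0 < n)%N by near: n.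
have n0R : 0 < n%:R :> R by rewrite ltr0n.
have e0 := eps_gt0 n; have e20 : 0 < eps n ^+ 2 by rewrite exprn_gt0.
have Ns0 : 0 < N n `^ (- sigma) by rewrite powR_gt0 ?N_gt0.
pose h k : R := (0 < k)%N%:R * k%:R `^ (- r).
have h01 k : 0 <= h k <= 1.
  rewrite /h mulr_ge0 ?powR_ge0//=; case: k => [|k]; rewrite ?mul0r// mul1r.
  rewrite -[leRHS](powRr0 k.+1%:R) ler_powR ?ler1n// oppr_le0.
  by have /andP[r1 _] := r_itv; apply: le_trans r1.
have near_e : eps n <= e1 by near: n; exact: near_eps_le.
have HU : `|E n (fun k => upto K (eps n) k * mean_tail (eps n) k) -
    N n `^ (- sigma) * Upsilon gamma sigma s0| <= d4 * N n `^ (- sigma) by near: n; exact: HG.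
have HI : `|I - n%:R `^ r * E n h| <= d4 / a by near: n; exact: cvgr_dist_le.
have HD : n%:R `^ r * E n h <= D.
  near: n; apply: (cvgr_le _ Hh); rewrite /D (le_lt_trans (ler_norm _))// ltrDr//.
have HN : K / y `^ b^-1 <= N n by near: n; move/cvgryPge: neps_cvgy; exact.
have HS : forall m, 0 < m -> E n (fun k => ((0 < k)%N && (k%:R <= m))%:R * k%:R `^ (- r)) <=
    C3 * n%:R `^ (- r) * (m / n%:R) `^ b by near: n.
pose Q := eps n `^ (- alpha) * n%:R `^ (- r).
have Q0 : 0 < Q by rewrite mulr_gt0 ?powR_gt0.
pose A0 := a * eps n `^ (- alpha); have A00 : 0 < A0 by rewrite mulr_gt0 ?powR_gt0.
have Ih : nat_integrable P (Z n) h by exact: nat_integrable01.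
have Iah : nat_integrable P (Z n) (fun k => above K (eps n) k * h k) by exact: intAM.
have Iuh : nat_integrable P (Z n) (fun k => upto K (eps n) k * h k) by exact: intUM.
have EhE : E n h = n%:R `^ (- r) * (n%:R `^ r * E n h).
  by rewrite mulrA powRN mulVf ?mul1r// gt_eqF// powR_gt0.
have Eh_ub : A0 * E n h <= a * D * Q.
  rewrite EhE /A0 /Q; apply: (@le_trans _ _ (a * eps n `^ (- alpha) * (n%:R `^ (- r) * D))).
    by rewrite ler_wpM2l ?(ltW A00)// ler_wpM2l ?powR_ge0.
  by rewrite le_eqVlt; apply/orP; left; apply/eqP; ring.
have Eh_I : `|A0 * E n h - Q * (a * I)| <= d4 * Q.
  have -> : A0 * E n h - Q * (a * I) = - (a * Q) * (I - n%:R `^ r * E n h).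
    by rewrite {1}EhE /A0 /Q; ring.
  rewrite normrM normrN (gtr0_norm (mulr_gt0 a0 Q0)) mulrAC ler_wpM2r ?(ltW Q0)//.
  by rewrite mulrC -ler_pdivlMr.
have I2 : nat_integrable P (Z n) (fun k => above K (eps n) k * (k%:R * eps n ^+ 2) `^ (- (sigma + 2))).
  by apply: nat_integrable01 => k; apply: above_powR_itv => //; exact: ltW.
have IA : nat_integrable P (Z n) (fun k => above K (eps n) k * mean_tail (eps n) k).
  by apply: intAM => k; exact: mean_tail_itv.
have HA : `|E n (fun k => above K (eps n) k * mean_tail (eps n) k) - A0 * E n (fun k => above K (eps n) k * h k)| <=
    d4 * Q + d4 * N n `^ (- sigma).
  rewrite -nat_expectZ//; apply: (@le_trans _ _ (E n (fun k => th * A0 * h k +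
      C1 * (above K (eps n) k * (k%:R * eps n ^+ 2) `^ (- (sigma + 2)))))).
    apply: nat_expect_dist => //; first exact: nat_integrableZ.
      by apply: nat_integrableD; exact: nat_integrableZ.
    move=> k; have /andP[h0 _] := h01 k.
    have [->|[-> k0 kK]] := aboveP K k e0.
      rewrite !mul0r !mulr0 subr0 normr0 addr0 mulr_ge0//; apply: mulr_ge0; exact: ltW.
    have jE : A0 * h k = jump (eps n) k by rewrite /A0 /h k0 mul1r /jump -mulrA.
    rewrite !mul1r -mulrA jE; apply: HJ => //.
    by apply: (le_trans KK1); exact: ltW.
  rewrite nat_expectD ?nat_expectZ//; last 2 first.
  - exact: nat_integrableZ.
  - exact: nat_integrableZ.
  apply: lerD.
    rewrite -mulrA -ler_pdivlMl//; apply: (le_trans Eh_ub).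
    rewrite le_eqVlt; apply/orP; left; apply/eqP; rewrite /th; field.
    by rewrite !gt_eqF.
  apply: (@le_trans _ _ (C1 * (C2 / K * N n `^ (- sigma)))).
    by rewrite ler_wpM2l ?(ltW C10)// H2.
  by rewrite mulrA ler_wpM2r ?(ltW Ns0)// mulrA ler_pdivrMr// (mulrC d4) -ler_pdivrMr.
have HB : E n (fun k => upto K (eps n) k * h k) + E n (fun k => above K (eps n) k * h k) = E n h.
  rewrite -nat_expectD//; congr nat_expect; apply/funext => k.
  by rewrite -mulrDl upto_above /h mulrA -natrM mulnb andbb.
have HB0 : 0 <= A0 * E n (fun k => upto K (eps n) k * h k).
  rewrite mulr_ge0 ?(ltW A00)//; apply: nat_expect_ge0 => k; rewrite mulr_ge0//.
  by have /andP[] := h01 k.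
have HB1 : A0 * E n (fun k => upto K (eps n) k * h k) <= d4 * Q.
  have -> : (fun k => upto K (eps n) k * h k) =
      (fun k => ((0 < k)%N && (k%:R <= K / eps n ^+ 2))%:R * k%:R `^ (- r)).
    apply/funext => k; rewrite /upto /h; case: (0 < k)%N => /=; rewrite ?mul0r ?mul1r//.
  have m0 : 0 < K / eps n ^+ 2 by rewrite divr_gt0.
  have := HS _ m0; set W := E n _ => HW.
  have yb : (K / eps n ^+ 2 / n%:R) `^ b <= y.
    have -> : K / eps n ^+ 2 / n%:R = K / N n by field; rewrite !gt_eqF.
    apply: (@le_trans _ _ ((y `^ b^-1) `^ b)).
      rewrite ge0_ler_powR ?nnegrE ?(ltW b0) ?(ltW yb0)//.
        by rewrite divr_ge0 ?(ltW K0)// ltW// N_gt0.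
      by rewrite ler_pdivrMr ?N_gt0// mulrC -ler_pdivrMr.
    by rewrite -powRrM mulVf ?gt_eqF// powRr1// ltW.
  apply: (@le_trans _ _ (A0 * (C3 * n%:R `^ (- r) * y))).
    rewrite ler_wpM2l ?(ltW A00)//; apply: (le_trans HW).
    by rewrite ler_wpM2l ?mulr_ge0 ?powR_ge0 ?(ltW C30).
  rewrite le_eqVlt; apply/orP; left; apply/eqP; rewrite /A0 /Q /y; field.
  by rewrite !gt_eqF.
rewrite (sample_tail_split n K) -/Q; move: HU HA HB HB0 HB1 Eh_I.
have -> : dl = d4 + d4 + d4 + d4 by rewrite /d4; field.
move=> HU HA HB HB0 HB1 Eh_I; rewrite -HB mulrDr in Eh_I.
have d4N : 0 <= d4 * N n `^ (- sigma) by rewrite mulr_ge0 ?ltW.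
have d4Q : 0 <= d4 * Q by rewrite mulr_ge0 ?ltW.
move: HU HA HB0 HB1 Eh_I d4N d4Q; rewrite !ler_norml !mulrDl !mulrDr.
move: (d4 * _) (d4 * _) (E n _) (E n _) (A0 * _) (A0 * _) (_ * Upsilon _ _ _) (Q * (a * I)) => u v p q f g U V.
by move=> /andP[? ?] /andP[? ?] ? ? /andP[? ?] ? ?; apply/andP; split; lra.
Unshelve. all: by end_near. Qed.

End regular_tail.

End large_cluster.

(** * The three regimes *)

Lemma cvgy_powRN (R : realType) (x : nat -> R) (b : R) : 0 < b ->
  x n @[n --> \oo] --> +oo -> x n `^ (- b) @[n --> \oo] --> (0 : R).
Proof. by move=> b0 xy; apply: (@cvg_comp _ _ _ x (fun z : R => z `^ (- b)) _ _ _ xy); exact: cvgr_powRN. Qed.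

(** [A] and [B] are the two orders of magnitude and [c] is the normalization of a regime; the
    regimes differ only in the limits u and v of c A and c B. *)
Lemma scaled_cvg (R : realType) (S A B c : nat -> R) (U V u v : R) :
  (forall dl : R, 0 < dl -> \forall n \near \oo, `|S n - (A n * U + B n * V)| <= dl * (A n + B n)) ->
  (forall n, 0 <= A n) -> (forall n, 0 <= B n) -> (forall n, 0 <= c n) ->
  c n * A n @[n --> \oo] --> u -> c n * B n @[n --> \oo] --> v ->
  c n * S n @[n --> \oo] --> u * U + v * V.
Proof.
move=> H A0 B0 c0 cA cB; pose D := `|u + v| + 1; have D0 : 0 < D by rewrite ltr_wpDl.
have cAB : c n * A n + c n * B n @[n --> \oo] --> u + v by exact: cvgD.
have H0 : c n * S n - (c n * A n * U + c n * B n * V) @[n --> \oo] --> (0 : R).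
  apply/cvgr0Pnorm_le => e e0; near=> n.
  have cD : c n * A n + c n * B n <= D.
    near: n; apply: (cvgr_le _ cAB); rewrite /D (le_lt_trans (ler_norm _))// ltrDl//.
  have HS : `|S n - (A n * U + B n * V)| <= e / D * (A n + B n) by near: n; apply: H; exact: divr_gt0.
  have -> : c n * S n - (c n * A n * U + c n * B n * V) = c n * (S n - (A n * U + B n * V)) by ring.
  rewrite normrM ger0_norm//; apply: (le_trans (ler_wpM2l (c0 n) HS)).
  rewrite mulrCA mulrDr; apply: (@le_trans _ _ (e / D * D)); last by rewrite divfK ?gt_eqF.
  by rewrite ler_wpM2l// divr_ge0// ltW.
rewrite -[X in _ --> X]add0r.
have -> : (fun n => c n * S n) = (fun n => (c n * S n - (c n * A n * U + c n * B n * V)) + (c n * A n * U + c n * B n * V)).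
  by apply/funext => n; rewrite subrK.
apply: cvgD => //; apply: cvgD; apply: cvgMl => //.
Unshelve. all: by end_near. Qed.

(** As eps > 0, the event forces Z_n > 0 and reads eps k <= S_k on {Z_n = k}; independence of X and
    Z then averages over k. *)
Lemma sample_mean_tailE d (Omega : measurableType d) (R : realType) (P : probability Omega R)
    (X : nat -> Omega -> R) (Z : nat -> Omega -> nat) (eps : nat -> R) n :
  (forall i, measurable_fun setT (X i)) -> (forall n, measurable_fun setT (Z n)) ->
  independent_families P X Z -> (forall n, 0 < eps n) ->
  fine (P [set w | eps n <= sample_mean X Z n w]) = sample_tail P Z X eps n.
Proof.
move=> mX mZ XZ e0; pose A k := [set w | eps n * k%:R <= partial_sum X k w /\ (0 < k)%N].
have mS (k : nat) : block_measurable X setT (partial_sum X k).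
  rewrite (_ : partial_sum X k = (fun w => \sum_(i <- iota 0 k) id (X i w))); last first.
    by apply/funext => w; rewrite /partial_sum -(big_mkord xpredT (fun i => X i w)) /index_iota subn0.
  by apply: (block_measurable_sum (phi := fun=> id)).
have AE k : A k = if (0 < k)%N then partial_sum X k @^-1` `[eps n * k%:R, +oo[%classic else set0.
  apply/seteqP; split => w; rewrite /A/=; case: (0 < k)%N => //=; rewrite ?in_itv/= ?andbT => //; by case.
have sA k : sigma_of_family X (A k).
  rewrite AE; case: (0 < k)%N; first exact: mS.
  exact: (@measurable0 _ (g_sigma_algebraType (sigma_block X setT))).
have mA k : measurable (A k) by exact: (g_sigma_block_measurable mX (sA k)).
have -> : [set w | eps n <= sample_mean X Z n w] = [set w | A (Z n w) w].
  apply/seteqP; split => w; rewrite /A/= /sample_mean; have [->|Z0] := posnP (Z n w).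
  - by rewrite mulr0 => /(lt_le_trans (e0 n)); rewrite ltxx.
  - by rewrite mulr1 ler_pdivlMr ?ltr0n.
  - by case.
  - by rewrite mulr1 ler_pdivlMr ?ltr0n// => -[].
rewrite (random_index_prob (mZ n) mA) => [|k]; last first.
  apply: XZ => //; apply: sub_sigma_algebra; exists n => //.
  by exists [set k] => //; rewrite setTI.
rewrite /sample_tail; congr nat_expect; apply/funext => k; rewrite /mean_tail.
case: k => [|k]; first by rewrite mul0r (_ : A 0%N = set0) ?measure0//; apply/seteqP; split => w // [].
rewrite mul1r; congr (fine (P _)); apply/seteqP; split => w; rewrite /A/=; first by case.
by [].
Qed.
(** For u > 0 the events u <= X and u <= X^+ coincide. *)
Lemma has_tail_rtail d (Omega : measurableType d) (R : realType) (P : probability Omega R)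
    (X : nat -> Omega -> R) (alpha a : R) :
  has_tail P (X 0%N)^\+ alpha a -> rtail P X u / (a * u `^ (- alpha)) @[u --> +oo] --> (1 : R).
Proof.
move=> [_ H]; apply: cvg_trans H; apply: near_eq_cvg; near=> u.
have u0 : 0 < u by near: u; exact: nbhs_pinfty_gt.
congr (fine (P _) / _); apply/seteqP; split => w /=; by rewrite /funrpos le_max (leNgt u 0) u0 orbF.
Unshelve. all: by end_near. Qed.

Theorem theorem1p2 (R : realType) (d : measure_display)
    (Omega : measurableType d) (P : probability Omega R)
    (xi : nat -> nat -> {RV P >-> nat}) (Y : nat -> {RV P >-> nat})
    (X : nat -> {RV P >-> R}) (beta gamma sigma sigma0 : R) (eps : nat -> R) :
  offspring_immigration xi Y ->
  condition_A (xi 0%N 0%N) (Y 0%N) ->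
  beta = fine (gen_fun_derive_at1 1 (nat_pmf P (Y 0%N))) ->
  gamma = 2^-1 * fine (gen_fun_derive_at1 2 (nat_pmf P (xi 0%N 0%N))) ->
  sigma = beta / gamma ->
  1 < sigma ->
  iid P (fun i => X i : Omega -> R) ->
  independent_families P (fun i => X i : Omega -> R)
    (GWI (fun n i => xi n i : Omega -> nat) (fun n => Y n : Omega -> nat)) ->
  ('E_P[X 0%N] = 0)%E ->
  0 < sigma0 ->
  ('E_P[fun w => (X 0%N w ^+ 2)%R] = (sigma0 ^+ 2)%:E)%E ->
  (forall n, 0 < eps n) ->
  eps @ \oo --> (0 : R) ->
  (fun n => n%:R * eps n ^+ 2) @ \oo --> +oo ->
  let Z := GWI (fun n i => xi n i : Omega -> nat)
               (fun n => Y n : Omega -> nat) in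
  let L := sample_mean (fun i => X i : Omega -> R) Z in
  let prob n := fine (P [set w | eps n <= L n w]) in
  let Xp : Omega -> R := (X 0%N : Omega -> R)^\+ in
  let rho alpha := (1 + sigma - alpha) / (2 * sigma - alpha) in
  [/\ ('E_P[fun w => (Xp w `^ (1 + sigma))%R] < +oo)%E \/
      (exists alpha a : R, [/\ 2 < alpha < 1 + sigma, has_tail P Xp alpha a &
         (fun n => eps n * n%:R `^ rho alpha) @ \oo --> (0 : R)]) ->
      (fun n => eps n `^ (2 * sigma) * n%:R `^ sigma * prob n) @ \oo -->
        Upsilon gamma sigma sigma0,
      forall alpha a : R, 2 < alpha < 1 + sigma -> has_tail P Xp alpha a ->
      (fun n => eps n * n%:R `^ rho alpha) @ \oo --> +oo ->
      (fun n => eps n `^ alpha * n%:R `^ (alpha - 1) * prob n) @ \oo -->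
        a * I_const gamma (alpha - 1) sigma
    & forall alpha a tau : R, 2 < alpha < 1 + sigma -> has_tail P Xp alpha a ->
      0 < tau -> (fun n => eps n * n%:R `^ rho alpha) @ \oo --> tau ->
      (fun n => n%:R `^ (sigma * (alpha - 2) / (2 * sigma - alpha)) * prob n)
        @ \oo -->
        tau `^ (- (2 * sigma)) * Upsilon gamma sigma sigma0 +
        tau `^ (- alpha) * a * I_const gamma (alpha - 1) sigma].

Proof.
move=> oi cA betaE gammaE sigmaE sigma1 iX XZ EX1 s00 EX2 e0 e_0 Ny Z L prob Xp rho.
have gamma0 : 0 < gamma := gwi_gamma_gt0 cA gammaE.
have Zub := gwi_laplace_ub oi cA betaE gammaE sigmaE.
have Zcvg := gwi_laplace_cvg oi cA betaE gammaE sigmaE.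
have mX i : measurable_fun setT (X i : Omega -> R) by exact: measurable_funP.
have mZ n : measurable_fun setT (Z n) by exact: measurable_GWI.
have X1E : \int[P]_w X 0%N w = 0 by move: EX1; rewrite unlock /Rintegral => ->.
have EX2' : (\int[P]_w (X 0%N w ^+ 2)%:E = (sigma0 ^+ 2)%:E)%E by move: EX2; rewrite unlock.
have X2E : \int[P]_w (X 0%N w ^+ 2) = sigma0 ^+ 2 by rewrite /Rintegral EX2'.
have X2 : P.-integrable setT (EFin \o (fun w => X 0%N w ^+ 2)).
  apply: ge0_integrable => //; first exact: measurable_funX.
    by move=> w; exact: sqr_ge0.
  by rewrite EX2' ltry.
pose S := sample_tail P Z (fun i => X i : Omega -> R) eps.
have probE n : prob n = S n by exact: sample_mean_tailE.
pose A n : R := (n%:R * eps n ^+ 2) `^ (- sigma).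
have A0 n : 0 <= A n by exact: powR_ge0.
have sigma0' : 0 < sigma by apply: lt_trans sigma1.
have NsE n : eps n `^ (2 * sigma) * n%:R `^ sigma = (n%:R * eps n ^+ 2) `^ sigma.
  by rewrite powRM ?sqr_ge0// -[eps n ^+ 2]powR_mulrn ?(ltW (e0 n))// -powRrM mulrC.
have near0 : \forall n \near \oo, (0 : R) < n%:R by near=> n; rewrite ltr0n; near: n; exact: nbhs_infty_gt.
have cA1 : eps n `^ (2 * sigma) * n%:R `^ sigma * A n @[n --> \oo] --> (1 : R).
  apply: (@cvg_trans _ (@cst nat R 1 n @[n --> \oo])); last exact: cvg_cst.
  apply: near_eq_cvg; near=> n; have n0 : (0 : R) < n%:R by near: n.
  by rewrite NsE /A powRN mulfV// gt_eqF// powR_gt0 ?mulr_gt0 ?exprn_gt0.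
have probS (c : nat -> R) : (fun n => c n * prob n) = (fun n => c n * S n).
  by apply/funext => n; rewrite probE.
pose B alpha n : R := eps n `^ (- alpha) * n%:R `^ (- (alpha - 1)).
have B0 alpha n : 0 <= B alpha n by rewrite mulr_ge0 ?powR_ge0.
(* The identity behind the three cases is B / A = x^(2 sigma - alpha), because rho (2 sigma - alpha)
   = 1 + sigma - alpha; the exponent is positive since alpha < 1 + sigma < 2 sigma. *)
pose x alpha n : R := eps n * n%:R `^ rho alpha.
have x0 alpha n : 0 <= x alpha n by rewrite mulr_ge0 ?powR_ge0 ?(ltW (e0 n)).
have HS alpha a : 2 < alpha < 1 + sigma -> has_tail P Xp alpha a -> forall dl : R, 0 < dl ->
    \forall n \near \oo, `|S n - (A n * Upsilon gamma sigma sigma0 +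
      B alpha n * (a * I_const gamma (alpha - 1) sigma))| <= dl * (A n + B alpha n).
  move=> al_itv tl dl dl0; have [a0 _] := tl.
  exact: (sample_tail_heavy mZ gamma0 sigma1 Zub Zcvg mX iX s00 X2 X1E X2E e0 e_0 Ny al_itv a0
    (@has_tail_rtail _ _ _ P (fun i => X i : Omega -> R) _ _ tl) dl0).
have xE alpha b n : 0 < n%:R :> R -> x alpha n `^ b = eps n `^ b * n%:R `^ (rho alpha * b).
  by move=> n0; rewrite /x (powRM _ (ltW (e0 n)) (powR_ge0 _ _)) -powRrM.
have AE n : 0 < n%:R :> R -> A n = eps n `^ (- (2 * sigma)) * n%:R `^ (- sigma).
  move=> n0; rewrite /A powRM ?sqr_ge0 ?(ltW n0)// -[eps n ^+ 2]powR_mulrn ?(ltW (e0 n))// -powRrM mulrC.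
  by rewrite mulrN.
have pE n (b1 b2 c1 c2 : R) : 0 < n%:R :> R -> eps n `^ b1 * n%:R `^ c1 * (eps n `^ b2 * n%:R `^ c2) =
    eps n `^ (b1 + b2) * n%:R `^ (c1 + c2).
  by move=> n0; rewrite mulrACA -!gt0_powRD.
have d0 alpha : 2 < alpha < 1 + sigma -> 2 * sigma - alpha != 0.
  by move=> /andP[? ?]; rewrite gt_eqF//; lra.
have near_cvg (f g : nat -> R) (l : R) : (forall n, 0 < n%:R :> R -> f n = g n) ->
    g n @[n --> \oo] --> l -> f n @[n --> \oo] --> l.
  move=> fg; apply: cvg_trans; apply: near_eq_cvg; near=> n; rewrite fg//; near: n; exact: near0.
split.
- rewrite probS => -[XM|[alpha [a [al_itv tl x_0]]]].
    have XM' : (\int[P]_w ((X 0%N : Omega -> R)^\+ w `^ (1 + sigma))%:E < +oo)%E by move: XM; rewrite unlock.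
    rewrite -[X in _ --> X]mul1r -[X in _ --> X]addr0 -(mulr0 0).
    (* Under the finite moment there is no second order of magnitude, so B = 0. *)
    apply: (@scaled_cvg _ S A (fun=> 0)) => //.
    - move=> dl dl0; near=> n; rewrite mul0r !addr0; near: n.
      exact: (sample_tail_light mZ gamma0 sigma1 Zub Zcvg mX iX s00 X2 X1E X2E e0 e_0 Ny XM' dl0).
    - by move=> n; rewrite mulr_ge0 ?powR_ge0.
    - by under eq_fun do rewrite mulr0; exact: cvg_cst.
  rewrite -[X in _ --> X]mul1r -[X in _ --> X]addr0 -(mul0r (a * I_const gamma (alpha - 1) sigma)).
  apply: (@scaled_cvg _ S A (B alpha)) => //.
  - exact: HS.
  - by move=> n; rewrite mulr_ge0 ?powR_ge0.
  have b0 : 0 < 2 * sigma - alpha by move: al_itv => /andP[? ?]; lra.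
  apply: near_cvg (cvg0_powR b0 (x0 alpha) x_0) => n n0.
  rewrite pE// xE//; congr (_ `^ _ * _ `^ _); rewrite /rho.
  by rewrite divfK ?d0//; ring.
- move=> alpha a al_itv tl x_y; rewrite probS.
  rewrite -[X in _ --> X]mul1r -[X in _ --> X]add0r -(mul0r (Upsilon gamma sigma sigma0)).
  apply: (@scaled_cvg _ S A (B alpha)) => //.
  - exact: HS.
  - by move=> n; rewrite mulr_ge0 ?powR_ge0.
  - have b0 : 0 < 2 * sigma - alpha by move: al_itv => /andP[? ?]; lra.
    apply: near_cvg (cvgy_powRN b0 x_y) => n n0.
    rewrite AE// pE// xE//; congr (_ `^ _ * _ `^ _); first by ring.
    by rewrite mulrN /rho divfK ?d0//; ring.
  apply: near_cvg (cvg_cst (1 : R)) => n n0.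
  by rewrite pE// !subrr !powRr0 mulr1.
- move=> alpha a tau al_itv tl tau0 x_t; rewrite probS -(mulrA (tau `^ (- alpha))).
  (* The factor eps^0 lets the exponents of eps and of n be added by [pE]. *)
  have cE (c1 : R) n : 0 < n%:R :> R -> n%:R `^ c1 = eps n `^ 0 * n%:R `^ c1.
    by rewrite powRr0 mul1r.
  apply: (@scaled_cvg _ S A (B alpha)) => //.
  - exact: HS.
  - apply: near_cvg (@cvg_powR R nat _ _ (x alpha) (- (2 * sigma)) _ tau0 x_t) => n n0.
    rewrite AE// cE// pE// xE// add0r; congr (_ * _ `^ _).
    by rewrite /rho; field; exact: d0.
  apply: near_cvg (@cvg_powR R nat _ _ (x alpha) (- alpha) _ tau0 x_t) => n n0.
  rewrite cE// pE// xE// add0r; congr (_ * _ `^ _).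
  by rewrite /rho; field; exact: d0.
Unshelve. all: by end_near. Qed.
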